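(* Suppose that there exist $\alpha\in(0,1)$, a constant $C>0$ and positive integers $k_n<n$ ($n\ge2$) with $k_n\to\infty$ having the following property: for all $n$, for all isotropic log-concave probability measures $\mu$ on $\mathbb R^n$, for all $\varepsilon\in(0,1)$ and for every $E\in G_{n,k_n}$ there exists $F\in G_{n,k_n}$ with $d(E,F)<\varepsilon$ and $L_{\pi_F\mu}<C/\varepsilon^{\alpha}$. Then there exists a constant $C'>0$ (independent of $n$ and $\mu$) such that for every $n$ every isotropic log-concave probability measure $\mu$ on $\mathbb R^n$ satisfies $L_\mu<C'$.
   Context: $G_{n,k}$ is the Grassmannian of $k$-dimensional linear subspaces of $\mathbb R^n$, with the distance $d(E,F)=\inf\{\|I-U\|_{\rm op}: U\in O(n),\ U(E)=F\}$. A Borel probability measure $\mu$ on $\mathbb R^n$ is log-concave if $\mu((1-\lambda)A+\lambda B)\ge \mu(A)^{1-\lambda}\mu(B)^\lambda$ for all compact $A,B\subset\mathbb R^n$ and $\lambda\in(0,1)$. It is isotropic if moreover $\int\langle x,y\rangle\,d\mu(x)=0$ for all $y$ and $\int x_ix_j\,d\mu(x)=\delta_{ij}$. For a subspace $F$, $\pi_F\mu$ is the marginal of $\mu$ on $F$ (push-forward under the orthogonal projection onto $F$), viewed as a measure on $F\cong\mathbb R^{\dim F}$. For $q\ge1$, the $L_q$-centroid body $Z_q(\nu)$ of a log-concave probability measure $\nu$ on $\mathbb R^m$ is the convex body with support function $h_{Z_q(\nu)}(y)=\left(\int_{\mathbb R^m}|\langle x,y\rangle|^q\,d\nu(x)\right)^{1/q}$.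 In this statement the isotropic constant of an isotropic log-concave probability measure $\nu$ on $\mathbb R^m$ is defined as $L_\nu:=|Z_m(\nu)|^{-1/m}$, where $|\cdot|$ is volume (this agrees with the usual $\|f_\nu\|_\infty^{1/m}$, $f_\nu$ the density of $\nu$, up to absolute multiplicative constants). *)

(* Defs.v *)
From HB Require Import structures.
From mathcomp Require Import all_boot all_order all_algebra.
From mathcomp Require Import all_classical all_reals all_analysis.

Set Implicit Arguments.
Unset Strict Implicit.
Unset Printing Implicit Defensive.

Import Order.TTheory GRing.Theory Num.Theory.
Import numFieldNormedType.Exports.

Local Open Scope classical_set_scope.
Local Open Scope ring_scope.

Definition borel (R : realType) (n : nat) :=
  g_sigma_algebraType [set A : set 'rV[R]_n | open A].

(* The library's norm on ['rV[R]_n] is the sup norm; it is used here only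
   through its topology. *)
Definition dotp (R : realType) (n : nat) (x y : 'rV[R]_n) : R :=
  \sum_(i < n) x 0 i * y 0 i.

Definition enorm (R : realType) (n : nat) (x : 'rV[R]_n) : R :=
  Num.sqrt (dotp x x).

(* Square matrices act on row vectors from the right, [x |-> x *m A]. *)
Definition op_norm (R : realType) (n : nat) (A : 'M[R]_n) : R :=
  sup [set enorm (x *m A) | x in [set x : 'rV[R]_n | enorm x <= 1]].

Definition orthogonal_group (R : realType) (n : nat) : set 'M[R]_n :=
  [set U | U *m U^T = 1%:M].

Definition grassmannian (R : realType) (n k : nat) : set {vspace 'rV[R]_n} :=
  [set E | \dim E = k].

Definition grass_dist (R : realType) (n : nat) (E F : {vspace 'rV[R]_n}) : R :=
  inf [set op_norm (1%:M - U) | U in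
        [set U | orthogonal_group U /\ (linfun (mulmxr U) @: E)%VS = F]].

Definition log_concave (R : realType) (n : nat)
    (mu : probability (borel R n) R) : Prop :=
  forall (A B : set 'rV[R]_n) (l : R), compact A -> compact B -> 0 < l < 1 ->
    (mu A `^ (1 - l) * mu B `^ l <=
     mu [set ((1 - l) *: a + l *: b)%R | a in A & b in B])%E.

(* An extended real integral that equals a real number has finite positive and
   negative parts, so integrability is part of the two integral identities. *)
Definition isotropic_log_concave (R : realType) (n : nat)
    (mu : probability (borel R n) R) : Prop :=
  [/\ log_concave mu,
      forall y : 'rV[R]_n, (\int[mu]_x (dotp x y)%:E = 0)%E &
      forall i j : 'I_n,
        (\int[mu]_x ((x : 'rV[R]_n) 0 i * (x : 'rV[R]_n) 0 j)%:E
         = (i == j)%:R%:E)%E].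

Definition orthonormal_basis_of (R : realType) (n : nat)
    (F : {vspace 'rV[R]_n}) (b : (\dim F).-tuple 'rV[R]_n) : Prop :=
  basis_of F b /\
  forall i j : 'I_(\dim F), dotp (tnth b i) (tnth b j) = (i == j)%:R.

(* A choice of orthonormal basis identifies [F] with ['rV[R]_(\dim F)]; two
   choices differ by an orthogonal map of ['rV[R]_(\dim F)]. *)
Definition orthonormal_basis (R : realType) (n : nat)
    (F : {vspace 'rV[R]_n}) : (\dim F).-tuple 'rV[R]_n :=
  get (@orthonormal_basis_of R n F).

Definition orth_proj (R : realType) (n : nat) (F : {vspace 'rV[R]_n})
    (x : 'rV[R]_n) : 'rV[R]_n :=
  \sum_(i < \dim F)
    dotp x (tnth (orthonormal_basis F) i) *: tnth (orthonormal_basis F) i.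

Definition coords (R : realType) (n : nat) (F : {vspace 'rV[R]_n})
    (y : 'rV[R]_n) : 'rV[R]_(\dim F) :=
  \row_i dotp y (tnth (orthonormal_basis F) i).

Definition proj_coords (R : realType) (n : nat) (F : {vspace 'rV[R]_n}) :
  borel R n -> borel R (\dim F) := fun x => coords F (orth_proj F x).

Lemma continuous_rowP (R : realType) (m n : nat) (f : 'rV[R]_m -> 'rV[R]_n) :
  (forall i, continuous (fun x => f x 0 i)) -> continuous f.
Proof.
move=> fc x A /nbhs_ballP[e /= e0 eA].
have : \forall y \near x, forall i, ball (f x 0 i) e (f y 0 i).
  have Fx : Filter (nbhs x) by exact: nbhs_filter.
  apply: (@filter_forall _ _ (fun i y => ball (f x 0 i) e (f y 0 i)) (nbhs x)).
  by move=> i; apply: (fc i x); exact: nbhsx_ballx.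
apply: filterS => y xy; apply: eA.
by split => // i j; rewrite ord1; exact: xy.
Qed.

Lemma continuous_sum_ord (R : realType) (m n : nat) (f : 'I_n -> 'rV[R]_m -> R) :
  (forall i, continuous (f i)) -> continuous (fun x => \sum_(i < n) f i x).
Proof.
by move=> fc; apply: continuous_big => //; exact: add_continuous.
Qed.

Lemma continuous_scale (R : realType) (m : nat) (f : 'rV[R]_m -> R) (c : R) :
  continuous f -> continuous (fun x => f x * c).
Proof.
by move=> fc x; apply: (@continuous_comp _ _ _ f ( *%R^~ c));
  [exact: fc|exact: mulrr_continuous].
Qed.

Lemma continuous_dotp (R : realType) (n : nat) (y : 'rV[R]_n) :
  continuous (fun x : 'rV[R]_n => dotp x y).
Proof.
by apply: continuous_sum_ord => i; apply: continuous_scale;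
  exact: coord_continuous.
Qed.

Lemma continuous_proj_coords (R : realType) (n : nat) (F : {vspace 'rV[R]_n}) :
  continuous (fun x : 'rV[R]_n => coords F (orth_proj F x)).
Proof.
have projC : continuous (orth_proj F).
  apply: continuous_rowP => i.
  rewrite (_ : (fun x => _) = (fun x => \sum_(j < \dim F)
    dotp x (tnth (orthonormal_basis F) j)
    * tnth (orthonormal_basis F) j 0 i)); last first.
    by apply/funext => x; rewrite summxE; apply: eq_bigr => j _; rewrite mxE.
  by apply: continuous_sum_ord => j; apply: continuous_scale;
    exact: continuous_dotp.
apply: continuous_rowP => i.
rewrite (_ : (fun x => _) =
  (fun x => dotp (orth_proj F x) (tnth (orthonormal_basis F) i))); last first.
  by apply/funext => x; rewrite mxE.
move=> x; apply: (@continuous_comp _ _ _ (orth_proj F)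
  (fun z => dotp z (tnth (orthonormal_basis F) i))); first exact: projC.
exact: continuous_dotp.
Qed.

Lemma measurable_proj_coords (R : realType) (n : nat)
    (F : {vspace 'rV[R]_n}) : measurable_fun [set: borel R n] (proj_coords F).
Proof.
apply: measurability => //.
move=> _ [B oB <-]; rewrite setTI; apply: sub_sigma_algebra => /=.
by move/continuousP : (@continuous_proj_coords R n F); exact.
Qed.

HB.instance Definition _ (R : realType) (n : nat) (F : {vspace 'rV[R]_n}) :=
  @isMeasurableFun.Build _ _ (borel R n) (borel R (\dim F))
    (proj_coords F) (@measurable_proj_coords R n F).

Definition marginal (R : realType) (n : nat) (F : {vspace 'rV[R]_n})
    (mu : probability (borel R n) R) : probability (borel R (\dim F)) R :=
  distribution mu (proj_coords F).

(* The n-fold product of the one-dimensional Lebesgue measure, by the same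
   integral over sections as the library's product of two measures. *)
Fixpoint volume (R : realType) (n : nat) : set 'rV[R]_n -> \bar R :=
  match n with
  | 0 => fun A => (\1_A 0)%:E
  | m.+1 => fun A =>
      (\int[lebesgue_measure]_(t in [set: R])
         volume [set y : 'rV[R]_m | A (row_mx t%:M y : 'rV[R]_(1 + m))])%E
  end.

Definition support_function (R : realType) (n : nat) (K : set 'rV[R]_n)
    (y : 'rV[R]_n) : R :=
  sup [set dotp x y | x in K].

Definition convex_body (R : realType) (n : nat) (K : set 'rV[R]_n) : Prop :=
  [/\ K !=set0, compact K & convex_set K].

(* A convex body is determined by its support function, so at most one set [K]
   satisfies the predicate below. Nonempty interior is not required in
   [convex_body]; for isotropic [nu] it follows from the support function. *)
Definition centroid_body (R : realType) (n : nat) (q : R)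
    (nu : probability (borel R n) R) : set 'rV[R]_n :=
  get [set K : set 'rV[R]_n | convex_body K /\ forall y,
    ((support_function K y)%:E = 'N[nu]_q%:E [(fun x => (dotp x y)%:E)])%E].

Definition isotropic_constant (R : realType) (n : nat)
    (nu : probability (borel R n) R) : R :=
  fine (volume (centroid_body n%:R nu)) `^ (- n%:R^-1).

(* Main.v *)
(** For an even isotropic log-concave law [P] on [R^m] put [Z(a) = E exp(- a |X|^2)].
    The isotropic constants are bounded as soon as [Z(m/2) <= (C / sqrt m)^m] for all [P]:
    the smoothed density [g(x) = E exp(- (m/2) |X - x|^2)] is then at most [(C / sqrt m)^m],
    so its level set [g >= exp(- 4 m) g(0)] has volume at least [c^m], and that level set
    lies in a multiple of the centroid body.

    The hypothesis on marginals gives a weaker decay. Let [X] consist of many independent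
    copies of [P] completed by a Gaussian vector to dimension [k], and add an independent
    Gaussian vector in the remaining coordinates. A subspace at distance less than
    [eps = (2 a)^(-1/2)] from the first [k] coordinates sees [X] up to a linear map and a
    noise of size [eps], which is the scale of the smoothing by [exp(- a |x|^2)]. Hence the
    centroid body of that marginal has at most the volume of the level set of the smoothed
    density, and [L < C / eps^alpha] becomes [Z(a) <= (C' a^(- (1 - alpha) / 2))^k]; taking
    more and more copies gives the same bound for [P] itself.

    The exponent [(1 - alpha) / 2] improves itself to [1/2]. If [(2 a)^(m/2) Z(a)] were close
    to a large [lambda^m], put the smoothed density in a regular position, obtained by
    maximising its Gaussian mass times a small power of the determinant; a covering argument
    bounds its value at [0] there. The eigendirections of the position that exceed [lambda]
    must be the majority by this volume bound, but on them the weak decay makes the Gaussian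
    mass too small for a maximiser. So [lambda] can be halved until it is a constant. *)

From HB Require Import structures.
From mathcomp Require Import all_boot all_order all_algebra.
From mathcomp Require Import all_classical all_reals all_analysis.
From mathcomp Require Import measurable_realfun ring lra.
Require Import Defs.

Set Implicit Arguments.
Unset Strict Implicit.
Unset Printing Implicit Defensive.

Import Order.TTheory GRing.Theory Num.Theory.
Import numFieldNormedType.Exports.

Local Open Scope classical_set_scope.
Local Open Scope ring_scope.

(** * Borel sets of row vectors and Lebesgue measure *)

(** Smoothing at scale [eps = (2 a)^(-1/2)] costs the volume factor [(pi / a)^(1/2)] per dimension,
    and the hypothesis gives [eps^(-alpha)] of it away. The lost power of [a] is regained by playing
    the class of all even isotropic log-concave laws, in all dimensions, against itself. Bounds on
    [Z] are therefore improved for the whole class at once, which is stable under products,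
    rotations and coordinate marginals.

    The regular position serves two ends that pull the exponent [theta] of the determinant in
    opposite directions. Testing near-maximality with the inverse square root of a covariance bounds
    from below the covariance determinants of all exponential tilts in a ball, as the covering
    argument requires; the price is a factor [e^(12 m / theta)], so [theta] has to be a constant.
    Testing with the identity has to contradict a Gaussian mass that is too small, so [theta] has to
    be small against [1 - alpha]. The value [(1 - alpha) / 16] meets both demands. The supremum is
    approached only up to a factor [e], which these estimates absorb. *)

Section borel_rV.
Variable R : realType.
Implicit Types n : nat.

Lemma measurable_open_rV n (A : set 'rV[R]_n) : open A ->
  measurable (A : set (borel R n)).
Proof. by move=> oA; apply: sub_sigma_algebra. Qed.

Lemma measurable_closed_rV n (A : set 'rV[R]_n) : closed A ->
  measurable (A : set (borel R n)).
Proof.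
move=> cA; rewrite -(setCK A); apply: measurableC.
by apply: measurable_open_rV; rewrite openC.
Qed.

Lemma measurable_compact_rV n (A : set 'rV[R]_n) : compact A ->
  measurable (A : set (borel R n)).
Proof.
move=> cA; apply: measurable_closed_rV; exact: compact_closed.
Qed.

Lemma measurable_fun_continuous_rV n (f : 'rV[R]_n -> R) : continuous f ->
  measurable_fun setT (f : borel R n -> R).
Proof.
move=> /continuousP cf; apply: (measurability _ (RGenOpens.measurableE R)).
by move=> _ [_ [a [b ->]] <-]; rewrite setTI; apply: measurable_open_rV;
  apply: cf; exact: interval_open.
Qed.

Lemma measurable_fun_coord n (i : 'I_n) :
  measurable_fun setT (fun x : borel R n => (x : 'rV[R]_n) 0 i).
Proof. apply: measurable_fun_continuous_rV; exact: coord_continuous. Qed.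

(** An open set is the union of the rational cubes it contains, and there are only countably many of
    those; hence the coordinates generate the Borel sets. *)
Lemma measurable_fun_rV d (T : measurableType d) n (f : T -> borel R n) :
  (forall i, measurable_fun setT (fun x => (f x : 'rV[R]_n) 0 i)) ->
  measurable_fun setT f.
Proof.
move=> mf; apply: measurability => //.
move=> _ [B oB <-]; rewrite setTI.
have -> : f @^-1` B = \bigcup_(q in [set q : 'rV[rat]_n * rat |
    forall y : 'rV[R]_n, (forall i, `|y 0 i - ratr (q.1 0 i)| < ratr q.2) -> B y])
    \bigcap_(i in [set: 'I_n]) [set x | `|(f x : 'rV[R]_n) 0 i - ratr (q.1 0 i)| < ratr q.2].
  apply/seteqP; split=> [x Bfx|x [q qB] /= xq].
    have /nbhs_ballP[e /= e0 eB] := oB _ Bfx.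
    have e20 : 0 < e / 2 by rewrite divr_gt0.
    have [r /andP[r0 re]] : exists r : rat, 0 < (ratr r : R) < e / 2.
      have [r] := @rat_in_itvoo R 0 (e / 2) e20.
      by rewrite in_itv /= => re; exists r.
    have qP i : exists q : rat, `|(f x : 'rV[R]_n) 0 i - ratr q| < ratr r.
      have ab : (f x : 'rV[R]_n) 0 i - ratr r < (f x : 'rV[R]_n) 0 i + ratr r.
        by rewrite ltrD2l gtrN.
      have [q] := @rat_in_itvoo R _ _ ab.
      rewrite in_itv /= => qr; exists q; rewrite distrC ltr_distl; exact: qr.
    pose q := (\row_i projT1 (cid (qP i)), r).
    exists q => /= [y yq|i _ /=].
      apply: eB; split => // i j; rewrite (ord1 i) /ball /= distrC.
      have := yq j; rewrite mxE; case: cid => q0 /= hq hy.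
      rewrite (le_lt_trans (ler_distD (ratr q0) _ _))//.
      rewrite [ltRHS](splitr e) ltrD//; last by rewrite distrC (lt_trans hq).
      exact: lt_trans hy _.
    by rewrite mxE; case: cid.
  by apply: qB => i; exact: xq.
rewrite bigcup_mkcond; apply: countable_bigcupT_measurable.
  exact: countableP.
move=> q; case: ifPn => // _; apply: fin_bigcap_measurable => //.
move=> i _.
have mi : measurable_fun setT (fun x => `|(f x : 'rV[R]_n) 0 i - ratr (q.1 0 i)|).
  by apply: measurableT_comp => //; exact: measurable_funB.
rewrite -[X in measurable X]setTI.
have := mi measurableT `]-oo, (ratr q.2)[%classic (measurable_itv _).
by congr (measurable (setT `&` _)); apply/seteqP; split => x /=; rewrite in_itv.
Qed.

Lemma measurable_continuous_rV n p (f : 'rV[R]_n -> 'rV[R]_p) :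
  (forall i, continuous (fun x => f x 0 i)) ->
  measurable_fun setT (f : borel R n -> borel R p).
Proof. by move=> cf; apply: measurable_fun_rV => i; exact: measurable_fun_continuous_rV. Qed.

End borel_rV.

Section as_probability.
Context d (T : measurableType d) (R : realType) (m : {measure set T -> \bar R}).
Hypothesis m1 : m setT = 1%E.

(** A separate name for the function, to which the probability structure can be attached once the
    total mass is known to be one. *)
Definition as_prob_fun : set T -> \bar R := m.
HB.instance Definition _ := Measure.on as_prob_fun.
HB.instance Definition _ := Measure_isProbability.Build _ _ _ as_prob_fun m1.

Definition as_probability : probability T R := as_prob_fun.

End as_probability.

Section as_sigma_finite.
Context d (T : measurableType d) (R : realType) (m : {measure set T -> \bar R}).
Hypothesis sf : sigma_finite setT m.

Definition as_sf_fun : set T -> \bar R := m.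
HB.instance Definition _ := Measure.on as_sf_fun.
HB.instance Definition _ := Measure_isSigmaFinite.Build _ _ _ as_sf_fun sf.

Definition as_sigma_finite : {sigma_finite_measure set T -> \bar R} := as_sf_fun.

End as_sigma_finite.

Section products.
Variable R : realType.
Implicit Types n : nat.

Lemma measure_pushforwardP d1 d2 (T1 : measurableType d1) (T2 : measurableType d2)
    (m : {measure set T1 -> \bar R}) (f : T1 -> T2) : measurable_fun setT f ->
  exists m' : {measure set T2 -> \bar R}, forall A, m' A = m (f @^-1` A).
Proof.
move=> mf.
pose p : {measure set T2 -> \bar R} :=
  measure_function_pushforward__canonical__measure_function_Measure m mf.
by exists p.
Qed.

Lemma ge0_integral_image d1 d2 (T1 : measurableType d1) (T2 : measurableType d2)
    (m : {measure set T1 -> \bar R}) (m' : {measure set T2 -> \bar R})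
    (f : T1 -> T2) (g : T2 -> \bar R) :
  measurable_fun setT f -> measurable_fun setT g -> (forall x, 0 <= g x)%E ->
  (forall A, measurable A -> m' A = m (f @^-1` A)) ->
  (\int[m']_x g x = \int[m]_x g (f x))%E.
Proof.
move=> mf mg g0 m'E.
rewrite (@eq_measure_integral _ _ _ setT (pushforward m f) m'); last first.
  by move=> A mA _; rewrite m'E.
by rewrite ge0_integral_pushforward// preimage_setT.
Qed.

Lemma probabilityP d (T : measurableType d) (m : {measure set T -> \bar R}) :
  m setT = 1%E -> exists P : probability T R, forall A, P A = m A.
Proof. by move=> m1; exists (as_probability m1). Qed.

(** An image measure can lose sigma-finiteness; a measurable left inverse saves it, because an
    exhaustion of the source can be pulled back along it. *)
Lemma sigma_finite_pushforwardP d1 d2 (T1 : measurableType d1) (T2 : measurableType d2)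
    (m : {sigma_finite_measure set T1 -> \bar R}) (f : T1 -> T2) (g : T2 -> T1) :
  measurable_fun setT f -> measurable_fun setT g -> cancel f g ->
  exists m' : {sigma_finite_measure set T2 -> \bar R}, forall A, m' A = m (f @^-1` A).
Proof.
move=> mf mg fg; have [m' m'E] := measure_pushforwardP m mf.
have sf : sigma_finite setT m'.
  have [F TF Foo] := sigma_finiteT m.
  exists (fun i => g @^-1` F i).
    by rewrite -preimage_bigcup -TF preimage_setT.
  move=> i; have [mF Fi] := Foo i; split.
    by rewrite -[X in measurable X]setTI; exact: mg.
  rewrite m'E -comp_preimage (_ : g \o f = idfun)//.
  by apply/funext => x /=; rewrite fg.
by exists (as_sigma_finite sf).
Qed.

Lemma sigma_finite_prod d1 d2 (T1 : measurableType d1) (T2 : measurableType d2)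
    (m1 : {sigma_finite_measure set T1 -> \bar R})
    (m2 : {sigma_finite_measure set T2 -> \bar R}) : sigma_finite setT (m1 \x m2)%E.
Proof.
have /sigma_finiteP[F [TF ndF Foo]] := sigma_finiteT m1.
have /sigma_finiteP[G [TG ndG Goo]] := sigma_finiteT m2.
exists (fun n => F n `*` G n).
  rewrite -setXTT TF TG predeqE => -[x y]; split => [[/= [n _ Fnx] [k _ Gky]]|].
    exists (maxn n k) => //; split.
    - by move: x Fnx; exact/subsetPset/ndF/leq_maxl.
    - by move: y Gky; exact/subsetPset/ndG/leq_maxr.
  by move=> [n _ []/= ? ?]; split; exists n.
move=> k; have [? ?] := Foo k; have [? ?] := Goo k.
split; first exact: measurableX.
by rewrite product_measure1E// lte_mul_pinfty// ge0_fin_numE.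
Qed.

Definition rowp a b (z : borel R a * borel R b) : borel R (a + b) := row_mx z.1 z.2.
Definition lrow a b (z : borel R (a + b)) : borel R a := lsubmx (z : 'rV[R]_(a + b)).
Definition rrow a b (z : borel R (a + b)) : borel R b := rsubmx (z : 'rV[R]_(a + b)).

Lemma measurable_rowp a b : measurable_fun setT (@rowp a b).
Proof.
apply: measurable_fun_rV => i.
rewrite (_ : (fun x => _) = (fun x : borel R a * borel R b =>
  match fintype.split i with inl j => (x.1 : 'rV_a) 0 j | inr j => (x.2 : 'rV_b) 0 j end)); last first.
  by apply/funext => x; rewrite /rowp [LHS]mxE.
case: (fintype.split i) => j.
  by apply: (measurableT_comp (measurable_fun_coord j)).
by apply: (measurableT_comp (measurable_fun_coord j)).
Qed.

Lemma measurable_lrow a b : measurable_fun setT (@lrow a b).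
Proof.
apply: measurable_fun_rV => i.
rewrite (_ : (fun x => _) = (fun x : borel R (a + b) => (x : 'rV_(a + b)) 0 (lshift b i))).
  exact: measurable_fun_coord.
by apply/funext => x; rewrite [LHS]mxE.
Qed.

Lemma measurable_rrow a b : measurable_fun setT (@rrow a b).
Proof.
apply: measurable_fun_rV => i.
rewrite (_ : (fun x => _) = (fun x : borel R (a + b) => (x : 'rV_(a + b)) 0 (rshift a i))).
  exact: measurable_fun_coord.
by apply/funext => x; rewrite [LHS]mxE.
Qed.

Definition rowp1 b (z : R * borel R b) : borel R b.+1 := row_mx (z.1%:M : 'rV_1) z.2.

Lemma measurable_scalar1 : measurable_fun setT (fun t : R => (t%:M : 'rV_1) : borel R 1).
Proof.
apply: measurable_fun_rV => i.
rewrite (_ : (fun x => _) = id)//; apply/funext => x.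
by rewrite (ord1 i) [LHS]mxE eqxx mulr1n.
Qed.

Lemma measurable_rowp1 b : measurable_fun setT (@rowp1 b).
Proof.
rewrite (_ : @rowp1 b = @rowp 1 b \o
  (fun z : R * borel R b => ((z.1%:M : 'rV_1) : borel R 1, z.2)))//.
apply: measurableT_comp; first exact: measurable_rowp.
by apply: measurable_fun_pair => //; apply: measurableT_comp => //; exact: measurable_scalar1.
Qed.

Lemma leb_step n (m : {sigma_finite_measure set (borel R n) -> \bar R}) :
  exists m' : {sigma_finite_measure set (borel R n.+1) -> \bar R},
    forall A, m' A = (lebesgue_measure \x m)%E (@rowp1 n @^-1` A).
Proof.
pose g (z : borel R (1 + n)) : measurableTypeR R * borel R n :=
  ((lrow z : 'rV_1) 0 0, rrow z).
pose m0 := as_sigma_finite (sigma_finite_prod (@lebesgue_measure R) m).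
have K : cancel (@rowp1 n) g.
  by move=> [t y]; rewrite /g /rowp1 /lrow /rrow /= row_mxKl row_mxKr mxE eqxx.
apply: (@sigma_finite_pushforwardP _ _ _ _ m0 (@rowp1 n) g _ _ K).
- exact: measurable_rowp1.
- apply: measurable_fun_pair; last exact: (@measurable_rrow 1 n).
  exact: measurableT_comp (measurable_fun_coord (0 : 'I_1)) (@measurable_lrow 1 n).
Qed.

Lemma dirac0P : exists m' : {sigma_finite_measure set (borel R 0) -> \bar R},
  forall A, m' A = (\1_A 0)%:E.
Proof. by exists (@dirac _ (borel R 0) (0 : 'rV[R]_0) R) => A. Qed.

(** The recursion of [volume], carried out among sigma-finite measures so that Tonelli applies at
    each dimension. [volumeE] identifies the two. *)
Fixpoint leb n : {sigma_finite_measure set (borel R n) -> \bar R} :=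
  match n with
  | 0 => projT1 (cid dirac0P)
  | m.+1 => projT1 (cid (leb_step (leb m)))
  end.

Lemma leb0E (A : set (borel R 0)) : leb 0 A = (\1_A (0 : 'rV[R]_0))%:E.
Proof. by rewrite /leb; case: cid. Qed.

Lemma lebSE n (A : set (borel R n.+1)) :
  leb n.+1 A = (lebesgue_measure \x leb n)%E (@rowp1 n @^-1` A).
Proof. by rewrite /=; case: cid. Qed.

Local Opaque leb.

(** Holds for every set, since the product measure is by definition the integral of the measures of
    the sections, on arbitrary sets too. *)
Lemma volumeE n (A : set 'rV[R]_n) : volume A = leb n A.
Proof.
elim: n A => [|n ih] A; first by rewrite leb0E.
rewrite lebSE /product_measure1 /=; apply: eq_integral => t _ /=.
rewrite ih; congr (leb n _); apply/seteqP; split => y /=.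
  by rewrite /xsection /= inE.
by rewrite /xsection /= inE.
Qed.

Lemma ge0_integral_lebS n (f : 'rV[R]_n.+1 -> \bar R) :
  measurable_fun setT (f : borel R n.+1 -> \bar R) -> (forall x, 0 <= f x)%E ->
  (\int[leb n.+1]_x f x =
   \int[lebesgue_measure]_t \int[leb n]_y f (rowp1 (t, y)))%E.
Proof.
move=> mf f0.
have mfr : measurable_fun setT (f \o @rowp1 n).
  exact: measurableT_comp mf (@measurable_rowp1 n).
transitivity (\int[lebesgue_measure \x leb n]_z (f \o @rowp1 n) z)%E; last first.
  by rewrite fubini_tonelli1 // => x; exact: f0.
by apply: ge0_integral_image => // [|A mA]; [exact: measurable_rowp1|exact: lebSE].
Qed.

Lemma ge0_integral_leb0 (f : 'rV[R]_0 -> \bar R) : (forall x, 0 <= f x)%E ->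
  (\int[leb 0]_x f x = f (0%R : 'rV[R]_0))%E.
Proof.
move=> f0.
have mf : measurable_fun setT (f : borel R 0 -> \bar R).
  by rewrite (_ : f = cst (f 0%R))//; apply/funext => x; rewrite [x]thinmx0.
rewrite (_ : \int[leb 0]_x f x = \int[@dirac _ (borel R 0) (0%R : 'rV[R]_0) R]_x f x)%E.
  by rewrite integral_dirac// diracT mul1e.
by apply: eq_measure_integral => A _ _; exact: leb0E.
Qed.

End products.

(** * The Prekopa-Leindler inequality *)

Section exp_integral.
Variable R : realType.

Let is_derive_NexpRN (x : R) :
  is_derive (x : R) 1 (fun x : R => - expR (- x)) (expR (- x)).
Proof.
have h1 := @is_derive1_comp R expR (fun x => - x) x (expR (- x)) (-1).
have h2 := @is_deriveN R R R (fun x : R => expR (- x)) x 1 (expR (- x) * -1).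
rewrite mulrN1 opprK in h2; apply: h2; rewrite -mulrN1; exact: h1.
Qed.

Lemma integral_expR_Nyc (c : R) :
  (\int[lebesgue_measure]_(s in `]-oo, c]) (expR s)%:E = (expR c)%:E)%E.
Proof.
rewrite -[c]opprK ge0_integration_by_substitutionNy; last 2 first.
  by apply: continuous_subspaceT => x; exact: continuous_expR.
  by move=> x _; rewrite expR_ge0.
rewrite (@ge0_continuous_FTC2y _ _ (fun x => - expR (- x)) (- c) 0).
- by rewrite -EFinB sub0r !opprK.
- by move=> x _; rewrite expR_ge0.
- apply: continuous_subspaceT => x; apply: continuous_comp; first exact: opp_continuous.
  exact: continuous_expR.
- by rewrite -[X in _ --> X]oppr0; apply: cvgN; exact: cvgr_expR.
- by move=> x _; have [] := is_derive_NexpRN x.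
- apply: cvg_at_right_filter; apply: cvgN.
  apply: (@cvg_comp _ _ _ (fun x : R => - x) expR _ (nbhs (- (- c)))).
    exact: opp_continuous.
  exact: continuous_expR.
- by move=> x _; rewrite derive1E; have [_ ->] := is_derive_NexpRN x.
Qed.

End exp_integral.

Section layer.
Variable R : realType.
Context d (T : measurableType d).

Lemma measurable_set_le (f g : T -> R) : measurable_fun setT f ->
  measurable_fun setT g -> measurable [set x | f x <= g x].
Proof.
move=> mf mg.
have := measurable_funB mg mf measurableT (measurable_itv `[0, +oo[).
rewrite setTI; congr measurable.
by apply/seteqP; split => x /=; rewrite in_itv /= andbT subr_ge0.
Qed.

Lemma measurable_set_lt (f g : T -> R) : measurable_fun setT f ->
  measurable_fun setT g -> measurable [set x | f x < g x].
Proof.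
move=> mf mg.
have := measurable_funB mg mf measurableT (measurable_itv `]0, +oo[).
rewrite setTI; congr measurable.
by apply/seteqP; split => x /=; rewrite in_itv /= andbT subr_gt0.
Qed.

End layer.

Section layer_cake.
Variable R : realType.
Context d (T : measurableType d).
Variable m : {sigma_finite_measure set T -> \bar R}.

Lemma layer_cake (f : T -> R) : measurable_fun setT f -> (forall x, 0 <= f x) ->
  (\int[m]_x (f x)%:E =
   \int[lebesgue_measure]_(u in `[0%R, +oo[) m [set x | (u < f x)%R])%E.
Proof.
move=> mf f0.
pose S := [set z : T * measurableTypeR R | 0 <= z.2 /\ z.2 < f z.1].
have mS : measurable S.
  rewrite (_ : S = [set z | 0 <= z.2] `&` [set z | z.2 < f z.1])//.
  apply: measurableI.
    by apply: measurable_set_le => //; exact: measurable_snd.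
  apply: measurable_set_lt; first exact: measurable_snd.
  exact: measurableT_comp measurable_fst.
pose F z : \bar R := (\1_S z)%:E.
have mF : measurable_fun setT F by apply/measurable_EFinP; exact: measurable_indic.
have F0 z : (0 <= F z)%E by rewrite lee_fin.
have H := @fubini_tonelli _ _ _ _ _ m lebesgue_measure F mF F0.
transitivity (\int[m]_x \int[lebesgue_measure]_y F (x, y))%E.
  apply: eq_integral => x _.
  have E y : F (x, y) = (\1_(`[0, f x[%classic : set R) y)%:E.
    rewrite /F !indicE (_ : ((x, y) \in S) = (y \in `[0, f x[%classic))//.
    by apply/idP/idP; rewrite !inE /S /= in_itv /=; [move=> [-> ->]|move=> /andP[]].
  under eq_integral do rewrite E.
  transitivity (@lebesgue_measure R `[0, f x[%classic); last first.
    by rewrite integral_indic// setIT.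
  rewrite lebesgue_measure_itv /= lte_fin.
  by case: ltP => [_|fx0]; rewrite ?sube0//; congr (_%:E); apply/eqP; rewrite eq_le f0 fx0.
rewrite H [RHS]integral_mkcond; apply: eq_integral => u _.
rewrite patchE; have [u0|u0] := leP 0 u.
  rewrite mem_set /= ?in_itv /= ?u0//.
  have E x : F (x, u) = (\1_[set x | u < f x] x)%:E.
    rewrite /F !indicE (_ : ((x, u) \in S) = (x \in [set x | u < f x]))//.
    by apply/idP/idP; rewrite !inE /S /=; [case|].
  under eq_integral do rewrite E.
  by rewrite integral_indic// ?setIT//; exact: measurable_set_lt.
rewrite memNset /= ?in_itv /= ?andbT; last by apply/negP; rewrite -ltNge.
by apply: integral0_eq => x _; rewrite /F /S indicE memNset//= => -[]; rewrite leNgt u0.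
Qed.

(** The layer cake formula with levels [u = e^s]. On this scale the multiplicative hypothesis
    [f^(1-l) g^l <= h] becomes a convex combination of the levels [s], which turns Prekopa-Leindler
    on [R^n] into a statement about functions of [s]. *)
Lemma exp_layer_cake (f : T -> R) : measurable_fun setT f -> (forall x, 0 <= f x) ->
  (\int[m]_x (f x)%:E =
   \int[lebesgue_measure]_s ((expR s)%:E * m [set x | (expR s <= f x)%R]))%E.
Proof.
move=> mf f0.
pose S := [set z : T * measurableTypeR R | expR z.2 <= f z.1].
have mS : measurable S.
  apply: measurable_set_le; last exact: measurableT_comp measurable_fst.
  exact: measurableT_comp measurable_snd.
pose F z : \bar R := (expR z.2 * \1_S z)%:E.
have mF : measurable_fun setT F.
  apply/measurable_EFinP; apply: measurable_funM; last exact: measurable_indic.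
  exact: measurableT_comp measurable_snd.
have F0 z : (0 <= F z)%E by rewrite lee_fin mulr_ge0 ?expR_ge0.
have H := @fubini_tonelli _ _ _ _ _ m lebesgue_measure F mF F0.
transitivity (\int[m]_x \int[lebesgue_measure]_y F (x, y))%E.
  apply: eq_integral => x _.
  (* A zero of [f] reaches no level [e^s]; it is set apart because [ln 0] is only a default
     value. *)
  have [fx0|] := eqVneq (f x) 0.
    rewrite fx0 integral0_eq// => y _; rewrite /F indicE memNset ?mulr0//.
    by rewrite /S /= fx0; apply/negP; rewrite -ltNge expR_gt0.
  rewrite neq_lt ltNge f0 /= => fx0.
  have E y : F (x, y) = ((fun s => (expR s)%:E) \_ `]-oo, ln (f x)]%classic) y.
    rewrite /F patchE indicE /=.
    have -> : ((x, y) \in S) = (y \in `]-oo, ln (f x)]%classic).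
      have e : (expR y <= f x) = (y <= ln (f x)).
        by rewrite -[in RHS](expRK y) ler_ln// posrE// expR_gt0.
      by apply/idP/idP; rewrite !inE /S /= in_itv /= e.
    by case: ifPn; rewrite ?mulr1 ?mulr0.
  under eq_integral do rewrite E.
  by rewrite -integral_mkcond integral_expR_Nyc lnK.
rewrite H; apply: eq_integral => u _.
rewrite /F /=; under eq_integral do rewrite EFinM.
rewrite ge0_integralZl//.
- congr (_ * _)%E.
  have E x : (\1_S (x, u))%:E = (\1_[set x | expR u <= f x] x)%:E :> \bar R.
    by rewrite !indicE (_ : ((x, u) \in S) = (x \in [set x | expR u <= f x])).
  under eq_integral do rewrite E.
  by rewrite integral_indic// ?setIT//; exact: measurable_set_le.
- apply/measurable_EFinP; apply: measurableT_comp; first exact: measurable_indic.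
  exact: measurable_pair2.
Qed.

End layer_cake.

Section aux_measure.
Context d (T : measurableType d) (R : realType) (mu : {measure set T -> \bar R}).

Lemma decreasing_eventually_lt (D : (set T)^nat) (e : R) :
  (forall i, measurable (D i)) -> (mu (D 0%N) < +oo)%E ->
  {homo D : n m / (n <= m)%N >-> m `<=` n} ->
  (mu (\bigcap_n D n) < e%:E)%E -> exists n, (mu (D n) < e%:E)%E.
Proof.
move=> mD D0 hD ce.
have cD : mu \o D @ \oo --> mu (\bigcap_n D n).
  apply: nonincreasing_cvg_mu => //; first exact: bigcapT_measurable.
  by move=> n m nm; apply/subsetPset; exact: hD.
have [N _ NP] := cD _ (open_ereal_lt' ce).
by exists N; apply: NP => /=.
Qed.

End aux_measure.

(** * Inner regularity of Borel measures *)

Section regular.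
Variables (R : realType) (n : nat).

Definition inner_regular (mu : set (borel R n) -> \bar R) :=
  forall A, measurable A -> (mu A < +oo)%E -> forall e : R, 0 < e ->
  exists K, [/\ compact (K : set 'rV[R]_n), K `<=` A & (mu (A `\` K) < e%:E)%E].

(** Inner parallel sets: closed even for arbitrary [A], and increasing to [A] when [A] is open. *)
Let opener (A : set 'rV[R]_n) (j : nat) : set 'rV[R]_n := [set x | ball x j.+1%:R^-1 `<=` A].

Let closed_opener A j : closed (opener A j).
Proof.
rewrite -openC openE => x.
move=> /= /existsNP[y /not_implyP[xy nAy]].
have : nbhs x (ball y j.+1%:R^-1).
  by apply: open_nbhs_nbhs; split; [exact: ball_open|exact/ball_sym].
apply: filterS => z yz /= zA; apply: nAy; apply: zA; exact/ball_sym.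
Qed.

Let cball (N : nat) : set 'rV[R]_n := [set x | forall i, `|x 0 i| <= N%:R].

Let compact_cball N : compact (cball N).
Proof.
have := @rV_compact R n (fun=> `[(- N%:R), N%:R]%classic) (fun=> @segment_compact R _ _).
by congr compact; apply/seteqP; split => x /= + i => /(_ i); rewrite in_itv /= ler_norml.
Qed.

(** The sets that can be squeezed between a closed and an open set of nearly the same measure form a
    sigma-algebra, and it contains the open sets by exhaustion with inner parallel sets. *)
Lemma closed_open_regular (mu : {finite_measure set (borel R n) -> \bar R})
  (A : set (borel R n)) : measurable A -> forall e : R, 0 < e -> exists F U : set 'rV[R]_n,
   [/\ closed F, open U, F `<=` A, A `<=` U & (mu (U `\` F) < e%:E)%E].
Proof.
pose P := [set A : set 'rV[R]_n | forall e : R, 0 < e -> exists F U : set 'rV[R]_n,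
   [/\ closed F, open U, F `<=` A, A `<=` U & (mu (U `\` F) < e%:E)%E]].
have muoo B : measurable B -> (mu B < +oo)%E.
  by move=> mB; rewrite -ge0_fin_numE// fin_num_measure.
suff : <<s [set A : set 'rV[R]_n | open A]>> `<=` P by apply.
apply: smallest_sub; last first.
  move=> B /= oB e e0.
  have mo j : measurable (opener B j : set (borel R n)).
    by apply: measurable_closed_rV; exact: closed_opener.
  have mB : measurable (B : set (borel R n)) by exact: measurable_open_rV.
  have cap0 : \bigcap_j (B `\` opener B j) = set0.
    apply/seteqP; split => // x /= H; have [Bx _] := H 0%N Logic.I.
    have /nbhs_ballP[r /= r0 rB] := oB _ Bx.
    have [k kr] : exists k : nat, k.+1%:R^-1 < r.
      have [k _ /(_ k (leqnn _)) kr] := near_infty_natSinv_lt (PosNum r0); exists k; exact: kr.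
    have [_] := H k Logic.I; apply => y xy; apply: rB.
    exact: le_ball (ltW kr) _ xy.
  have hd : {homo (fun j => B `\` opener B j) : i k / (i <= k)%N >-> k `<=` i}.
    move=> i k ik; apply: setDS => x /= H; apply: subset_trans H; apply: le_ball.
    by rewrite lef_pV2 ?posrE// ler_nat ltnS.
  have [|j je] := @decreasing_eventually_lt _ _ _ mu (fun j => B `\` opener B j) e
    (fun j => measurableD mB (mo j)) (muoo _ (measurableD mB (mo 0%N))) hd.
    by rewrite cap0 measure0 lte_fin.
  exists (opener B j), B; split => //.
    by move=> x; apply; exact: ballxx.
split.
- move=> e e0; exists set0, set0; split; [exact: closed0|exact: open0|exact: subset_refl|exact: subset_refl|].
  by rewrite setD0 measure0 lte_fin.
- move=> B PB e e0; have [F [U [cF oU FB BU muFU]]] := PB e e0.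
  exists (~` U), (~` F); split.
  + by rewrite closedC.
  + by rewrite openC.
  + by rewrite setTD; exact: subsetC.
  + by rewrite setTD; exact: subsetC.
  + by rewrite setDE setCK setIC -setDE.
- move=> B PB e e0.
  have ei i : 0 < e / 2 / 2 / (2 ^ i.+1)%:R by rewrite !divr_gt0// ltr0n expn_gt0.
  have /choice[F /choice[U H]] : forall i, exists F, exists U, [/\ closed F, open U, F `<=` B i, B i `<=` U &
      (mu (U `\` F) < (e / 2 / 2 / (2 ^ i.+1)%:R)%:E)%E].
    by move=> i; exact: PB (ei i).
  have mF i : measurable (F i : set (borel R n)).
    by have [cF _ _ _ _] := H i; exact: measurable_closed_rV.
  have mU i : measurable (U i : set (borel R n)).
    by have [_ oU _ _ _] := H i; exact: measurable_open_rV.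
  pose UU := \bigcup_i U i.
  have mUU : measurable (UU : set (borel R n)) by exact: bigcupT_measurable.
  (* An infinite union of closed sets need not be closed; continuity from above shows that a finite
     part [G N] already misses little of [UU]. *)
  pose G N := \bigcup_(i in `I_N) F i.
  have mG N : measurable (G N : set (borel R n)) by exact: bigcup_measurable.
  have cap : (mu (\bigcap_N (UU `\` G N)) < e%:E)%E.
    apply: (@le_lt_trans _ _ (e / 2)%:E); last first.
      by rewrite lte_fin ltr_pdivrMr// ltr_pMr// ltr1n.
    have sub : \bigcap_N (UU `\` G N) `<=` \bigcup_i (U i `\` F i).
      move=> x Hx; have [[i _ Uix] _] := Hx 0%N Logic.I.
      exists i => //; split => // Fix; have [_] := Hx i.+1 Logic.I; apply.
      by exists i => //=.
    have mcap : measurable (\bigcap_N (UU `\` G N) : set (borel R n)).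
      by apply: bigcapT_measurable => N; exact: measurableD.
    have := @measure_sigma_subadditive _ _ _ mu _ (fun i => U i `\` F i)
       (fun i => measurableD (mU i) (mF i)) mcap sub.
    move=> /le_trans; apply.
    apply: (@le_trans _ _ (\big[+%E/0]_(0 <= i <oo | xpredT i) (0 + (e / 2 / 2 / (2 ^ i.+1)%:R)%:E))%E).
      apply: lee_nneseries => // i _; rewrite add0e; apply: ltW.
      by have [_ _ _ _] := H i.
    apply: (le_trans (epsilon_trick _ _ _)) => //; first by rewrite !divr_ge0// ltW.
    rewrite eseries0// add0e lee_fin ler_pdivrMr// ler_peMr// ?divr_ge0 ?ltW//.
    by rewrite ltr1n.
  have hd : {homo (fun j => UU `\` G j) : i k / (i <= k)%N >-> k `<=` i}.
    by move=> i k ik; apply: setDS => x [j /= ji Fx]; exists j => //=; exact: leq_trans ik.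
  have [N Ne] := @decreasing_eventually_lt _ _ _ mu (fun N => UU `\` G N) e
    (fun j => measurableD mUU (mG j)) (muoo _ (measurableD mUU (mG 0%N))) hd cap.
  exists (G N), UU; split => //.
  + apply: closed_bigcup; first exact: finite_II.
    by move=> i _; have [] := H i.
  + by apply: bigcup_open => i _; have [] := H i.
  + by move=> x [i /= iN Fx]; exists i => //; have [_ _ + _ _] := H i; apply.
  + by move=> x [i /= iN Fx]; exists i => //; have [_ _ _ + _] := H i; apply.
Qed.

Lemma inner_regular_finite (mu : {finite_measure set (borel R n) -> \bar R}) :
  inner_regular mu.
Proof.
move=> A mA _ e e0.
have muoo B : measurable B -> (mu B < +oo)%E.
  by move=> mB; rewrite -ge0_fin_numE// fin_num_measure.
have e20 : 0 < e / 2 by rewrite divr_gt0.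
have [F [U [cF oU FA AU muFU]]] := closed_open_regular mu mA e20.
have mF : measurable (F : set (borel R n)) by exact: measurable_closed_rV.
have mU : measurable (U : set (borel R n)) by exact: measurable_open_rV.
have mc N : measurable (cball N : set (borel R n)).
  by apply: measurable_compact_rV; exact: compact_cball.
have cap : (mu (\bigcap_N (A `\` (F `&` cball N))) < e%:E)%E.
  apply: (@le_lt_trans _ _ (mu (U `\` F))); last first.
    by apply: (lt_trans muFU); rewrite lte_fin ltr_pdivrMr// ltr_pMr// ltr1n.
  apply: le_measure; rewrite ?inE//.
  - apply: bigcapT_measurable => N; apply: measurableD => //; exact: measurableI.
  - exact: measurableD.
  - move=> x Hx; have [Ax _] := Hx 0%N Logic.I; split; first exact: AU.
    move=> Fx; have [N xN] : exists N, cball N x.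
      exists (Num.trunc `|x|).+1 => i; apply: (@le_trans _ _ `|x|); last exact/ltW/truncnS_gt.
      by rewrite [leRHS]/Num.norm /= mx_normrE; apply: (le_bigmax _ _ (0, i)).
    by have [_] := Hx N Logic.I; apply.
have hd : {homo (fun N => A `\` (F `&` cball N)) : i k / (i <= k)%N >-> k `<=` i}.
  move=> i k ik; apply: setDS => x [Fx xk]; split => // j.
  by apply: le_trans (xk j) _; rewrite ler_nat.
have [N Ne] := @decreasing_eventually_lt _ _ _ mu (fun N => A `\` (F `&` cball N)) e
  (fun j => measurableD mA (measurableI _ _ mF (mc j)))
  (muoo _ (measurableD mA (measurableI _ _ mF (mc 0%N)))) hd cap.
exists (F `&` cball N); split => //.
  rewrite setIC; apply: (@subclosed_compact _ _ (cball N)) => //.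
  by apply: closedI => //; apply: compact_closed; [exact: norm_hausdorff|exact: compact_cball].
  by move=> x [] ? ?; exact: FA.
Qed.

(** A set of finite measure lies in a large cube up to [e / 2], and the restriction of [mu] to that
    cube is a finite measure. *)
Lemma inner_regular_loc (mu : {measure set (borel R n) -> \bar R}) :
  (forall K : set 'rV[R]_n, compact K -> (mu K < +oo)%E) -> inner_regular mu.
Proof.
move=> lf A mA Aoo e e0.
have mc N : measurable (cball N : set (borel R n)).
  by apply: measurable_compact_rV; exact: compact_cball.
have cap : (mu (\bigcap_N (A `\` cball N)) < (e / 2)%:E)%E.
  rewrite (_ : bigcap _ _ = set0) ?measure0 ?lte_fin ?divr_gt0//.
  apply/seteqP; split => // x Hx.
  have [N xN] : exists N, cball N x.
    exists (Num.trunc `|x|).+1 => i; apply: (@le_trans _ _ `|x|); last exact/ltW/truncnS_gt.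
    by rewrite [leRHS]/Num.norm /= mx_normrE; apply: (le_bigmax _ _ (0, i)).
  by have [_] := Hx N Logic.I; apply.
have A0oo : (mu (A `\` cball 0) < +oo)%E.
  by apply: (le_lt_trans _ Aoo); apply: le_measure; rewrite ?inE//; exact: measurableD.
have hd : {homo (fun N => A `\` cball N) : i k / (i <= k)%N >-> k `<=` i}.
  by move=> i k ik; apply: setDS => x xk j; apply: le_trans (xk j) _; rewrite ler_nat.
have [N Ne] := @decreasing_eventually_lt _ _ _ mu (fun N => A `\` cball N) (e / 2)
  (fun j => measurableD mA (mc j)) A0oo hd cap.
pose nu := mfrestr (mc N) (lf _ (@compact_cball N)).
have e20 : 0 < e / 2 by rewrite divr_gt0.
have nuA : (nu A < +oo)%E.
  by rewrite /nu /mfrestr /mrestr; apply: (le_lt_trans _ Aoo); apply: le_measure; rewrite ?inE//; exact: measurableI.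
have [K [cK KA nuK]] := inner_regular_finite (mu := nu) mA nuA e20.
have mK : measurable (K : set (borel R n)) by exact: measurable_compact_rV.
exists K; split => //; rewrite (splitr e) EFinD.
apply: (@le_lt_trans _ _ (mu (A `\` cball N) + mu ((A `\` K) `&` cball N))%E); last first.
  exact: lteD.
apply: (le_trans _ (measureU2 _ _ _)).
- apply: le_measure; rewrite ?inE.
  + exact: measurableD.
  + apply: measurableU; first exact: measurableD.
    by apply: measurableI => //; exact: measurableD.
  + by move=> x [Ax Kx]; have [|] := pselect (cball N x); [right|left].
- exact: measurableD.
- by apply: measurableI => //; exact: measurableD.
Qed.

End regular.

(** * Brunn-Minkowski and Prekopa-Leindler on the line *)

Section lebesgue_affine.
Variable R : realType.

(** By uniqueness it suffices to look at half-open intervals; for [a < 0] the preimage is half-open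
    on the other side, with the same length. *)
Lemma lebesgue_affine (a b : R) (A : set (measurableTypeR R)) : a != 0 -> measurable A ->
  (lebesgue_measure A = `|a|%:E * lebesgue_measure [set x | A (a * x + b)%R])%E.
Proof.
move=> a0 mA.
pose f (x : measurableTypeR R) : measurableTypeR R := a * x + b.
have mf : measurable_fun setT f.
  by apply: measurable_funD => //; apply: measurable_funM.
have [m mE] := measure_pushforwardP (@lebesgue_measure R) mf.
pose m' := mscale (NngNum (normr_ge0 a)) m.
have -> : lebesgue_measure A = m' A; last by rewrite /m' /mscale /= mE.
apply: (@lebesgue_measure_unique _ m') mA.
move=> _ [[x y] _ <-] /=; rewrite /m' /mscale /= mE.
  have [ap|an|] := ltgtP 0 a; last by move/eqP; rewrite eq_sym (negbTE a0).
    have -> : f @^-1` `]x, y]%classic = `](x - b) / a, (y - b) / a]%classic.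
      apply/seteqP; split => z /=; rewrite !in_itv /= /f.
        by move=> /andP[? ?]; rewrite ltr_pdivrMr// ler_pdivlMr// mulrC ltrBlDr lerBrDr; apply/andP.
      by move=> /andP[]; rewrite ltr_pdivrMr// ler_pdivlMr// mulrC ltrBlDr lerBrDr => -> ->.
    have h : ((x - b) / a < (y - b) / a) = (x < y) by rewrite ltr_pM2r ?invr_gt0// ltrD2r.
    rewrite [X in (_ * X)%E]lebesgue_measure_itv lebesgue_measure_itv /= !lte_fin h.
    case: ifPn => _; last by rewrite mule0.
    rewrite -!EFinB -EFinM gtr0_norm//; congr (_%:E); field; exact: a0.
  have -> : f @^-1` `]x, y]%classic = `[(y - b) / a, (x - b) / a[%classic.
    apply/seteqP; split => z /=; rewrite !in_itv /= /f.
      by move=> /andP[? ?]; rewrite ler_ndivrMr// ltr_ndivlMr// mulrC ltrBlDr lerBrDr; apply/andP.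
    by move=> /andP[]; rewrite ler_ndivrMr// ltr_ndivlMr// mulrC ltrBlDr lerBrDr => -> ->.
  have h : ((y - b) / a < (x - b) / a) = (x < y) by rewrite ltr_nM2r ?invr_lt0// ltrD2r.
  rewrite [X in (_ * X)%E]lebesgue_measure_itv lebesgue_measure_itv /= !lte_fin h.
  case: ifPn => _; last by rewrite mule0.
  rewrite -!EFinB -EFinM ltr0_norm//; congr (_%:E); field; exact: a0.
Qed.

Lemma lebesgue_affine_image (a b : R) (A : set R) : 0 < a -> measurable (A : set (measurableTypeR R)) ->
  (lebesgue_measure [set (a * x + b)%R | x in A] = a%:E * lebesgue_measure A)%E.
Proof.
move=> a0 mA.
have -> : [set a * x + b | x in A] = [set x | A (a^-1 * x + - (a^-1 * b))].
  apply/seteqP; split => [_ [x Ax <-]|x Ax] /=.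
    by have -> : a^-1 * (a * x + b) - a^-1 * b = x by field; rewrite gt_eqF.
  by exists (a^-1 * x - a^-1 * b) => //; field; rewrite gt_eqF.
rewrite [in RHS](@lebesgue_affine (a^-1) (- (a^-1 * b)))// ?invr_eq0 ?gt_eqF//.
by rewrite muleA -EFinM gtr0_norm ?invr_gt0// mulfV ?gt_eqF// mul1e.
Qed.

(** With [a] the largest point of [A] and [b] the smallest point of [B], the translates
    [(1-l) A + l b] and [(1-l) a + l B] both lie in [C] and can meet only at the point [c]. *)
Lemma brunn_minkowski1_compact (A B : set R) (l : R) (C : set R) : 0 < l < 1 ->
  compact A -> compact B -> A !=set0 -> B !=set0 ->
  measurable (C : set (measurableTypeR R)) ->
  (forall a b, A a -> B b -> C ((1 - l) * a + l * b)) ->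
  ((1 - l)%:E * lebesgue_measure A + l%:E * lebesgue_measure B <= lebesgue_measure C)%E.
Proof.
move=> /andP[l0 l1] cA cB A0 B0 mC ABC.
have mA : measurable (A : set (measurableTypeR R)) by exact: compact_measurable.
have mB : measurable (B : set (measurableTypeR R)) by exact: compact_measurable.
have idc (D : set R) : {within D, continuous (id : R -> R)}.
  by apply: continuous_subspaceT => x; exact: cvg_id.
have [a Aa aP] : exists2 a, A a & forall x, A x -> x <= a.
  have [a Aa aP] := compact_EVT_max (f := id) A0 cA (idc A).
  by exists a; rewrite inE in Aa => // x Ax; apply: aP; rewrite inE.
have [b Bb bP] : exists2 b, B b & forall x, B x -> b <= x.
  have [b Bb bP] := compact_EVT_min (f := id) B0 cB (idc B).
  by exists b; rewrite inE in Bb => // x Bx; apply: bP; rewrite inE.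
have l'0 : 0 < 1 - l by rewrite subr_gt0.
pose c := (1 - l) * a + l * b.
pose A' := [set (1 - l) * x + l * b | x in A].
pose B' := [set l * x + (1 - l) * a | x in B].
have mA' : measurable (A' : set (measurableTypeR R)).
  apply: compact_measurable; apply: (continuous_compact _ cA).
  apply: continuous_subspaceT => x; apply: cvgD; last exact: cvg_cst.
  by apply: cvgM; [exact: cvg_cst|exact: cvg_id].
have mB' : measurable (B' : set (measurableTypeR R)).
  apply: compact_measurable; apply: (continuous_compact _ cB).
  apply: continuous_subspaceT => x; apply: cvgD; last exact: cvg_cst.
  by apply: cvgM; [exact: cvg_cst|exact: cvg_id].
rewrite -(@lebesgue_affine_image (1 - l) (l * b))// -(@lebesgue_affine_image l ((1 - l) * a))//.
rewrite -/A' -/B'.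
have cB' : compact B'.
  apply: (continuous_compact _ cB).
  apply: continuous_subspaceT => x; apply: cvgD; last exact: cvg_cst.
  by apply: cvgM; [exact: cvg_cst|exact: cvg_id].
(* Removing the common point [c] makes the two sets disjoint without changing the measure. *)
have -> : lebesgue_measure B' = lebesgue_measure (B' `\` [set c]).
  have cap0 : (lebesgue_measure (B' `&` [set c]) = 0)%E.
    apply/eqP; rewrite -measure_le0 -(lebesgue_measure_set1 c).
    by apply: le_measure; rewrite ?inE//; exact: measurableI.
  have Boo : (lebesgue_measure B' < +oo)%E by exact: compact_finite_measure.
  have E := @measureD _ _ _ (@lebesgue_measure R) B' [set c] mB' (measurable_set1 c) Boo.
  by rewrite [RHS]E [X in (_ - X)%E]cap0 sube0.
rewrite -measureU //; last first.
- apply/seteqP; split => // x [[y Ay <-] [[z Bz e] nc]]; apply: nc.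
  have := aP _ Ay; have := bP _ Bz => bz ya; rewrite /= /c; nra.
- exact: measurableD.
apply: le_measure; rewrite ?inE//.
  by apply: measurableU => //; exact: measurableD.
move=> x [[y Ay <-]|[[y By <-] _]]; first exact: ABC.
by rewrite addrC; exact: ABC.
Qed.

Lemma brunn_minkowski1 (A B C : set R) (l : R) : 0 < l < 1 ->
  measurable (A : set (measurableTypeR R)) -> measurable (B : set (measurableTypeR R)) ->
  measurable (C : set (measurableTypeR R)) ->
  A !=set0 -> B !=set0 ->
  (forall a b, A a -> B b -> C ((1 - l) * a + l * b)) ->
  ((1 - l)%:E * lebesgue_measure A + l%:E * lebesgue_measure B <= lebesgue_measure C)%E.
Proof.
move=> l01 mA mB mC [a Aa] [b Bb] ABC; have /andP[l0 l1] := l01.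
have l'0 : 0 < 1 - l by rewrite subr_gt0.
have key K K' : compact K -> K `<=` A -> compact K' -> K' `<=` B ->
  ((1 - l)%:E * lebesgue_measure K + l%:E * lebesgue_measure K' <= lebesgue_measure C)%E.
  move=> cK KA cK' KB.
  have cKa : compact (K `|` [set a]) by apply: compactU => //; exact: compact_set1.
  have cKb : compact (K' `|` [set b]) by apply: compactU => //; exact: compact_set1.
  apply: le_trans (brunn_minkowski1_compact l01 cKa cKb _ _ mC _); last first.
  - by move=> x y [/KA Ax|->] [/KB By|->]; exact: ABC.
  - by exists b; right.
  - by exists a; right.
  have mK := compact_measurable cK; have mK' := compact_measurable cK'.
  have ma : measurable (K `|` [set a] : set (measurableTypeR R)) by exact: compact_measurable.
  have mb : measurable (K' `|` [set b] : set (measurableTypeR R)) by exact: compact_measurable.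
  apply: leeD; apply: lee_wpmul2l; rewrite ?lee_fin; [exact: ltW| |exact: ltW|].
    by apply: le_measure; rewrite ?inE//; left.
  by apply: le_measure; rewrite ?inE//; left.
have step K : compact K -> K `<=` A ->
  ((1 - l)%:E * lebesgue_measure K + l%:E * lebesgue_measure B <= lebesgue_measure C)%E.
  move=> cK KA.
  have Koo : lebesgue_measure K \is a fin_num.
    by rewrite ge0_fin_numE//; exact: compact_finite_measure.
  rewrite -(fineK Koo) -EFinM addeC -leeBrDr//.
  rewrite [lebesgue_measure B](@lebesgue_regularity_inner_sup R)// muleC -lee_pdivlMr//.
  apply: ge_ereal_sup => _ [K' [cK' KB] <-]; rewrite lee_pdivlMr// muleC leeBrDr// EFinM fineK// addeC.
  exact: key.
have [->|Coo] := eqVneq (lebesgue_measure C) +oo%E; first by rewrite leey.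
have Boo : lebesgue_measure B \is a fin_num.
  rewrite ge0_fin_numE// ltey; apply: contra_neq Coo => Boo.
  have := step set0 (@compact0 _) (@sub0set _ _).
  rewrite measure0 mule0 add0e Boo gt0_muley ?lte_fin//.
  by rewrite leye_eq => /eqP.
rewrite -(fineK Boo) -EFinM -leeBrDr//.
rewrite [lebesgue_measure A](@lebesgue_regularity_inner_sup R)// muleC -lee_pdivlMr//.
apply: ge_ereal_sup => _ [K [cK KA] <-]; rewrite lee_pdivlMr// muleC leeBrDr// EFinM fineK//.
exact: step.
Qed.

End lebesgue_affine.

Section prekopa1.
Variable R : realType.

Lemma weighted_am_gm (a b l : R) : 0 <= a -> 0 <= b -> 0 < l < 1 ->
  a `^ (1 - l) * b `^ l <= (1 - l) * a + l * b.
Proof.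
move=> a0 b0 /andP[l0 l1].
have l'0 : 0 < 1 - l by rewrite subr_gt0.
have [->|a1] := eqVneq a 0.
  by rewrite powR0 ?gt_eqF// mul0r mulr0 add0r mulr_ge0// ltW.
have [->|b1] := eqVneq b 0.
  by rewrite [X in _ * X]powR0 ?gt_eqF// !mulr0 addr0 mulr_ge0// ltW.
have ap : 0 < a by rewrite lt_neqAle eq_sym a1.
have bp : 0 < b by rewrite lt_neqAle eq_sym b1.
rewrite /powR (negbTE a1) (negbTE b1) -expRD.
pose t := Itv01 (ltW l'0) (ltac:(by rewrite lerBlDr lerDl ltW) : 1 - l <= 1).
have := @convex_expR R t (ln a) (ln b).
rewrite !convRE /= !lnK ?posrE// => H.
have {2 4}-> : l = 1 - (1 - l) by rewrite subKr.
exact: H.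
Qed.

Lemma powR_invr (a p : R) : 0 <= a -> (a^-1) `^ p = (a `^ p)^-1.
Proof. by move=> a0; rewrite -powR_inv1// -powRrM mulN1r powRN. Qed.

(** Below level one the level sets of [f] and [g] are both nonempty, and their convex combination
    lies in the level set of [h]; Brunn-Minkowski is integrated over the levels in [[0, 1[], where
    all the mass of [f] and [g] sits. The conclusion is an arithmetic mean, stronger than the
    geometric one. *)
Lemma prekopa_leindler1_norm (f g h : R -> R) (l : R) : 0 < l < 1 ->
  measurable_fun setT f -> measurable_fun setT g -> measurable_fun setT h ->
  (forall x, 0 <= f x <= 1) -> (forall x, 0 <= g x <= 1) -> (forall x, 0 <= h x) ->
  (forall c, c < 1 -> exists x, c < f x) -> (forall c, c < 1 -> exists x, c < g x) ->
  (forall x y, f x `^ (1 - l) * g y `^ l <= h ((1 - l) * x + l * y)) ->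
  ((1 - l)%:E * \int[lebesgue_measure]_x (f x)%:E + l%:E * \int[lebesgue_measure]_x (g x)%:E
     <= \int[lebesgue_measure]_x (h x)%:E)%E.
Proof.
move=> l01 mf mg mh f01 g01 h0 fs gs fgh; have /andP[l0 l1] := l01.
have l'0 : 0 < 1 - l by rewrite subr_gt0.
have f0 x : 0 <= f x by have /andP[] := f01 x.
have g0 x : 0 <= g x by have /andP[] := g01 x.
pose F (k : R -> R) (u : R) := lebesgue_measure [set x | u < k x].
have mF (k : R -> R) : measurable_fun setT k -> measurable_fun setT (F k).
  move=> mk; pose S := [set z : measurableTypeR R * measurableTypeR R | z.2 < k z.1].
  have mS : measurable S.
    apply: measurable_set_lt; first exact: measurable_snd.
    exact: measurableT_comp measurable_fst.
  have := measurable_fun_ysection (@lebesgue_measure R) mS.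
  congr (measurable_fun _ _); apply/funext => u /=; congr lebesgue_measure.
  by apply/seteqP; split => x; rewrite /ysection /= inE.
have red (k : R -> R) : (forall x, k x <= 1) ->
   (\int[lebesgue_measure]_(u in `[0%R, +oo[) F k u = \int[lebesgue_measure]_(u in `[0%R, 1%R[) F k u)%E.
  move=> k1; rewrite [LHS]integral_mkcond [RHS]integral_mkcond; apply: eq_integral => u _.
  rewrite !patchE; have [u0|u0] := leP 0 u; last first.
    by rewrite !memNset//= in_itv/= ?andbT => [/andP[]|]; rewrite leNgt u0.
  have [u1|u1] := ltP u 1.
    by rewrite !mem_set//= in_itv /= u0.
  rewrite mem_set/= ?in_itv/= ?u0// memNset/= ?in_itv/= ?u0 ?ltNge ?u1//.
  rewrite /F (_ : mkset _ = set0) ?measure0//.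
  apply/seteqP; split => // x /=; rewrite ltNge; move/negP; apply.
  exact: le_trans (k1 x) u1.
rewrite !layer_cake// red; last by move=> x; have /andP[] := f01 x.
rewrite red; last by move=> x; have /andP[] := g01 x.
have mFf k : measurable_fun setT k -> measurable_fun (`[0, 1[%classic : set (measurableTypeR R)) (F k).
  by move=> mk; apply: measurable_funS (mF _ mk).
rewrite -!ge0_integralZl//=; try exact: mFf; try by rewrite lee_fin ltW.
rewrite -ge0_integralD//=; last 4 first.
- by move=> x _; apply: mule_ge0 => //; rewrite lee_fin ltW.
- by apply: measurable_funeM; exact: mFf.
- by move=> x _; apply: mule_ge0 => //; rewrite lee_fin ltW.
- by apply: measurable_funeM; exact: mFf.
apply: (@le_trans _ _ (\int[lebesgue_measure]_(u in `[0%R, 1%R[) F h u)%E); last first.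
  apply: ge0_subset_integral => //.
    by apply: measurable_funS (mF _ mh).
  by apply: subset_itvl.
apply: ge0_le_integral => //=.
- move=> x _; apply: adde_ge0; apply: mule_ge0 => //; rewrite lee_fin ltW//.
- by apply: emeasurable_funD; apply: measurable_funeM; exact: mFf.
- exact: mFf.
move=> u; rewrite /= in_itv /= => /andP[u0 u1].
apply: brunn_minkowski1 => //.
- exact: measurable_set_lt.
- exact: measurable_set_lt.
- exact: measurable_set_lt.
- exact: fs.
- exact: gs.
move=> x y /= ux uy; apply: lt_le_trans (fgh x y).
have [->|un0] := eqVneq u 0.
  by apply: mulr_gt0; apply: powR_gt0; [exact: le_lt_trans ux|exact: le_lt_trans uy].
have up : 0 < u by rewrite lt_neqAle eq_sym un0.
have E : u = u `^ (1 - l) * u `^ l.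
  by rewrite -powRD ?subrK ?powRr1//; apply/implyP => _; rewrite un0.
rewrite [ltLHS]E.
by apply: ltr_pM; rewrite ?powR_ge0//; apply: gt0_ltr_powR => //; rewrite ?nnegrE// ltW.
Qed.

(* The two functions are normalised to have supremum one, so that the
   one-dimensional Brunn-Minkowski inequality applies level by level. *)
Lemma prekopa_leindler1 (f g h : R -> R) (l a b : R) : 0 < l < 1 ->
  measurable_fun setT f -> measurable_fun setT g -> measurable_fun setT h ->
  (forall x, 0 <= f x <= a) -> (forall x, 0 <= g x <= b) -> (forall x, 0 <= h x) ->
  (forall x y, f x `^ (1 - l) * g y `^ l <= h ((1 - l) * x + l * y)) ->
  (\int[lebesgue_measure]_x (f x)%:E < +oo)%E -> (\int[lebesgue_measure]_x (g x)%:E < +oo)%E ->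
  ((\int[lebesgue_measure]_x (f x)%:E) `^ (1 - l) * (\int[lebesgue_measure]_x (g x)%:E) `^ l
     <= \int[lebesgue_measure]_x (h x)%:E)%E.
Proof.
move=> l01 mf mg mh fa gb h0 fgh foo goo; have /andP[l0 l1] := l01.
have l'0 : 0 < 1 - l by rewrite subr_gt0.
have f0 x : 0 <= f x by have /andP[] := fa x.
have g0 x : 0 <= g x by have /andP[] := gb x.
have hI : (0 <= \int[lebesgue_measure]_x (h x)%:E)%E.
  by apply: integral_ge0 => x _; rewrite lee_fin.
have fI : (0 <= \int[lebesgue_measure]_x (f x)%:E)%E.
  by apply: integral_ge0 => x _; rewrite lee_fin.
have gI : (0 <= \int[lebesgue_measure]_x (g x)%:E)%E.
  by apply: integral_ge0 => x _; rewrite lee_fin.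
have [f00|/existsNP[x0 fx0]] := pselect (forall x, f x = 0).
  rewrite integral0_eq => [|x _]; last by rewrite f00.
  by rewrite poweR0r ?gt_eqF// mul0e.
have [g00|/existsNP[y0 gy0]] := pselect (forall x, g x = 0).
  rewrite [X in (_ * X `^ _)%E]integral0_eq => [|x _]; last by rewrite g00.
  by rewrite [X in (_ * X)%E]poweR0r ?gt_eqF// mule0.
pose Mf := sup (range f); pose Mg := sup (range g).
have sf : has_sup (range f).
  by split; [exists (f 0), 0|exists a => _ [x _ <-]; have /andP[] := fa x].
have sg : has_sup (range g).
  by split; [exists (g 0), 0|exists b => _ [x _ <-]; have /andP[] := gb x].
have fM x : f x <= Mf by apply: ub_le_sup; [case: sf|exists x].
have gM x : g x <= Mg by apply: ub_le_sup; [case: sg|exists x].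
have Mf0 : 0 < Mf.
  by apply: lt_le_trans (fM x0); rewrite lt_neqAle f0 andbT eq_sym; exact/eqP.
have Mg0 : 0 < Mg.
  by apply: lt_le_trans (gM y0); rewrite lt_neqAle g0 andbT eq_sym; exact/eqP.
pose M := Mf `^ (1 - l) * Mg `^ l.
have M0 : 0 < M by rewrite mulr_gt0// powR_gt0.
have sc (k : R -> R) (c : R) : measurable_fun setT k -> (forall x, 0 <= k x) -> 0 <= c ->
  (\int[lebesgue_measure]_x (c * k x)%:E = c%:E * \int[lebesgue_measure]_x (k x)%:E)%E.
  move=> mk k0 c0; under eq_integral do rewrite EFinM.
  apply: ge0_integralZl => //; [exact/measurable_EFinP|by move=> x _; rewrite lee_fin].
have := @prekopa_leindler1_norm (fun x => Mf^-1 * f x) (fun x => Mg^-1 * g x)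
  (fun x => M^-1 * h x) l l01 _ _ _ _ _ _ _ _ _.
rewrite !sc// ?invr_ge0 ?(ltW M0) ?(ltW Mf0) ?(ltW Mg0)//.
have Ff : (\int[lebesgue_measure]_x (f x)%:E)%E \is a fin_num.
  by rewrite ge0_fin_numE.
have Gf : (\int[lebesgue_measure]_x (g x)%:E)%E \is a fin_num.
  by rewrite ge0_fin_numE.
rewrite -(fineK Ff) -(fineK Gf).
set If := fine _; set Ig := fine _ => H.
have If0 : 0 <= If by rewrite fine_ge0.
have Ig0 : 0 <= Ig by rewrite fine_ge0.
rewrite !poweR_EFin -EFinM.
have HH : ((1 - l)%:E * (Mf^-1%:E * If%:E) + l%:E * (Mg^-1%:E * Ig%:E) <=
   M^-1%:E * \int[lebesgue_measure]_x (h x)%:E)%E.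
  apply: H.
  - exact: measurable_funM.
  - exact: measurable_funM.
  - exact: measurable_funM.
  - by move=> x; rewrite mulr_ge0 ?invr_ge0 ?(ltW Mf0)//= mulrC ler_pdivrMr// mul1r.
  - by move=> x; rewrite mulr_ge0 ?invr_ge0 ?(ltW Mg0)//= mulrC ler_pdivrMr// mul1r.
  - by move=> x; rewrite mulr_ge0 ?invr_ge0 ?(ltW M0).
  - move=> c c1; have e0 : 0 < Mf * (1 - c) by rewrite mulr_gt0// subr_gt0.
    have [_ [x _ <-] h1] := sup_adherent e0 sf.
    by exists x; rewrite mulrC ltr_pdivlMr//; apply: le_lt_trans h1; rewrite -/Mf; nra.
  - move=> c c1; have e0 : 0 < Mg * (1 - c) by rewrite mulr_gt0// subr_gt0.
    have [_ [x _ <-] h1] := sup_adherent e0 sg.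
    by exists x; rewrite mulrC ltr_pdivlMr//; apply: le_lt_trans h1; rewrite -/Mg; nra.
  - move=> x y /=; rewrite !powRM ?invr_ge0// ?(ltW Mf0) ?(ltW Mg0)// mulrACA.
    rewrite !powR_invr ?(ltW Mf0) ?(ltW Mg0)// -invfM.
    by rewrite ler_pM2l ?invr_gt0// fgh.
apply: (@le_trans _ _ (M * ((1 - l) * (Mf^-1 * If) + l * (Mg^-1 * Ig)))%:E).
  rewrite lee_fin; apply: (@le_trans _ _ (M * ((Mf^-1 * If) `^ (1 - l) * (Mg^-1 * Ig) `^ l))).
    rewrite !powRM ?invr_ge0// ?(ltW Mf0) ?(ltW Mg0)//.
    rewrite !powR_invr ?(ltW Mf0) ?(ltW Mg0)// /M.
    rewrite le_eqVlt; apply/orP; left; apply/eqP; field.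
    by rewrite !gt_eqF ?powR_gt0.
  by rewrite ler_pM2l//; apply: weighted_am_gm => //; rewrite mulr_ge0 ?invr_ge0 ?(ltW Mf0) ?(ltW Mg0).
move: HH; rewrite -!EFinM -EFinD muleC lee_pdivlMr//.
by rewrite -EFinM mulrC.
Qed.

End prekopa1.

(** * Log-concave measures *)

Section slc.
Variables (R : realType) (n : nat).

(** The inequality of [log_concave] for any set function, so that it applies to Lebesgue measure as
    well. *)
Definition slc (mu : set 'rV[R]_n -> \bar R) : Prop :=
  forall (A B : set 'rV[R]_n) (l : R), compact A -> compact B -> 0 < l < 1 ->
    (mu A `^ (1 - l) * mu B `^ l <=
     mu [set ((1 - l) *: a + l *: b)%R | a in A & b in B])%E.

(** The convex combination of two measurable sets may fail to be measurable, hence the measurable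
    superset [C]. The sets [A] and [B] are approximated from inside by compact sets, for which the
    combination is compact. *)
Lemma slc_measurable (mu : {measure set (borel R n) -> \bar R})
    (A B C : set (borel R n)) (l : R) :
  inner_regular mu -> slc mu -> 0 < l < 1 ->
  measurable A -> measurable B -> measurable C -> (mu A < +oo)%E -> (mu B < +oo)%E ->
  (forall a b : 'rV[R]_n, A a -> B b -> C ((1 - l) *: a + l *: b)) ->
  (mu A `^ (1 - l) * mu B `^ l <= mu C)%E.
Proof.
move=> ir lc l01 mA mB mC Aoo Boo ABC; have /andP[l0 l1] := l01.
have l'0 : 0 < 1 - l by rewrite subr_gt0.
have [->|Coo] := eqVneq (mu C) +oo%E; first by rewrite leey.
have Cf : mu C \is a fin_num by rewrite ge0_fin_numE// ltey.
have Af : mu A \is a fin_num by rewrite ge0_fin_numE.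
have Bf : mu B \is a fin_num by rewrite ge0_fin_numE.
rewrite -(fineK Cf) -(fineK Af) -(fineK Bf) !poweR_EFin -EFinM lee_fin.
set a := fine (mu A); set b := fine (mu B); set c := fine (mu C).
have a_ge0 : 0 <= a by rewrite fine_ge0.
have b_ge0 : 0 <= b by rewrite fine_ge0.
have c_ge0 : 0 <= c by rewrite fine_ge0.
have [->|a0] := eqVneq a 0; first by rewrite powR0 ?gt_eqF// mul0r.
have [->|b0] := eqVneq b 0; first by rewrite [X in _ * X]powR0 ?gt_eqF// mulr0.
have ap : 0 < a by rewrite lt_neqAle eq_sym a0.
have bp : 0 < b by rewrite lt_neqAle eq_sym b0.
have key d : 0 < d < 1 -> (1 - d) * (a `^ (1 - l) * b `^ l) <= c.
  move=> /andP[d0 d1]; have d'0 : 0 < 1 - d by rewrite subr_gt0.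
  have approx (D : set (borel R n)) : measurable D -> mu D \is a fin_num -> 0 < fine (mu D) ->
     exists K : set 'rV[R]_n, [/\ compact K, K `<=` D & ((1 - d) * fine (mu D))%:E <= mu K]%E.
    move=> mD Df D0; have Doo : (mu D < +oo)%E by rewrite -ge0_fin_numE.
    have [K [cK KD muK]] := ir D mD Doo (d * fine (mu D)) (mulr_gt0 d0 D0).
    have mK : measurable (K : set (borel R n)) by exact: measurable_compact_rV.
    exists K; split => //.
    have Kf : mu K \is a fin_num.
      by rewrite ge0_fin_numE//; apply: le_lt_trans Doo; apply: le_measure; rewrite ?inE.
    have := @measureU2 _ _ _ mu K (D `\` K) mK (measurableD mD mK).
    rewrite setDUK// => H.
    have DKf : mu (D `\` K) \is a fin_num.
      rewrite ge0_fin_numE//; apply: le_lt_trans Doo; apply: le_measure; rewrite ?inE//.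
      exact: measurableD.
    have h1 : fine (mu (D `\` K)) < d * fine (mu D) by rewrite -lte_fin fineK.
    have h2 : fine (mu D) <= fine (mu K) + fine (mu (D `\` K)) by rewrite -lee_fin EFinD !fineK.
    rewrite -(fineK Kf) lee_fin.
    by rewrite mulrBl mul1r lerBlDr; apply: le_trans h2 _; rewrite lerD2l ltW.
  have [K [cK KA muK]] := approx A mA Af ap.
  have [K' [cK' KB muK']] := approx B mB Bf bp.
  have mK : measurable (K : set (borel R n)) by exact: measurable_compact_rV.
  have mK' : measurable (K' : set (borel R n)) by exact: measurable_compact_rV.
  have := lc K K' l cK cK' l01.
  set K2 := (X in (_ <= mu X)%E) => H.
  have cK2 : compact K2.
    have -> : K2 = (fun z : 'rV[R]_n * 'rV[R]_n => (1 - l) *: z.1 + l *: z.2) @` (K `*` K').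
      apply/seteqP; split => [_ [x Kx] [y Ky] <-|_ [[x y] [/= Kx Ky] <-]].
        by exists (x, y).
      by exists x => //; exists y.
    apply: continuous_compact; last exact: compact_setX.
    apply: continuous_subspaceT => z; apply: cvgD; apply: cvgZr; [exact: cvg_fst|exact: cvg_snd].
  have mK2 : measurable (K2 : set (borel R n)) by exact: measurable_compact_rV.
  have K2C : (mu K2 <= mu C)%E.
    apply: le_measure; rewrite ?inE// => _ [x Kx] [y Ky] <-.
    by apply: ABC; [exact: KA|exact: KB].
  rewrite -lee_fin (fineK Cf); apply: le_trans K2C; apply: le_trans H.
  have Kf : mu K \is a fin_num.
    by rewrite ge0_fin_numE//; apply: le_lt_trans Aoo; apply: le_measure; rewrite ?inE.
  have Kf' : mu K' \is a fin_num.
    by rewrite ge0_fin_numE//; apply: le_lt_trans Boo; apply: le_measure; rewrite ?inE.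
  move: muK muK'; rewrite -(fineK Kf) -(fineK Kf') !poweR_EFin -EFinM !lee_fin -/a -/b => h1 h2.
  apply: (@le_trans _ _ (((1 - d) * a) `^ (1 - l) * ((1 - d) * b) `^ l)).
    have E : (1 - d) `^ (1 - l) * (1 - d) `^ l = 1 - d.
      by rewrite -powRD ?subrK ?powRr1 ?(ltW d'0)//; apply/implyP => _; rewrite gt_eqF.
    by rewrite !powRM ?(ltW d'0)// mulrACA E.
  by apply: ler_pM; rewrite ?powR_ge0//; apply: ge0_ler_powR; rewrite ?nnegrE ?(ltW l0) ?(ltW l'0) ?fine_ge0// mulr_ge0// ltW.
set p := _ * _ in key *.
rewrite leNgt; apply/negP => cp.
have p0 : 0 < p by exact: le_lt_trans cp.
(* With this loss [d] the approximate bound reads [(p + c) / 2 <= c], which is false when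
   [c < p]. *)
have /key : 0 < (p - c) / (2 * p) < 1.
  have p20 : 0 < 2 * p by rewrite mulr_gt0.
  apply/andP; split; first by rewrite divr_gt0// subr_gt0.
  rewrite ltr_pdivrMr// mul1r.
  by rewrite ltrBlDr mulr_natl mulr2n -addrA ltrDl ltr_wpDr.
have -> : (1 - (p - c) / (2 * p)) * p = (p + c) / 2 by field; rewrite gt_eqF.
by rewrite ler_pdivrMr// mulr_natr mulr2n lerD2r leNgt cp.
Qed.

(** For [L_f(s) = e^s mu(f >= e^s)], log-concavity of [mu] on the level sets is exactly the
    hypothesis of the one-dimensional inequality for [L_f], [L_g], [L_h], and [exp_layer_cake] gives
    the three integrals. Markov's inequality supplies the bounds on [L_f] and [L_g] that the
    one-dimensional statement asks for. *)
Lemma prekopa_leindler (mu : {sigma_finite_measure set (borel R n) -> \bar R})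
    (f g h : 'rV[R]_n -> R) (l : R) :
  inner_regular mu -> slc mu -> 0 < l < 1 ->
  measurable_fun setT (f : borel R n -> R) -> measurable_fun setT (g : borel R n -> R) ->
  measurable_fun setT (h : borel R n -> R) ->
  (forall x, 0 <= f x) -> (forall x, 0 <= g x) -> (forall x, 0 <= h x) ->
  (forall x y, f x `^ (1 - l) * g y `^ l <= h ((1 - l) *: x + l *: y)) ->
  (\int[mu]_x (f x)%:E < +oo)%E -> (\int[mu]_x (g x)%:E < +oo)%E ->
  ((\int[mu]_x (f x)%:E) `^ (1 - l) * (\int[mu]_x (g x)%:E) `^ l
     <= \int[mu]_x (h x)%:E)%E.
Proof.
move=> ir lc l01 mf mg mh f0 g0 h0 fgh foo goo; have /andP[l0 l1] := l01.
have l'0 : 0 < 1 - l by rewrite subr_gt0.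
have [->|] := eqVneq (\int[mu]_x (h x)%:E)%E +oo%E; first by rewrite leey.
rewrite -ltey => hoo.
pose S (k : borel R n -> R) s := [set x | expR s <= k x].
have mS k s : measurable_fun setT k -> measurable (S k s).
  by move=> mk; exact: measurable_set_le.
pose L (k : borel R n -> R) s := expR s * fine (mu (S k s)).
have markov (k : borel R n -> R) s : measurable_fun setT k -> (forall x, 0 <= k x) ->
    ((expR s)%:E * mu (S k s) <= \int[mu]_x (k x)%:E)%E.
  move=> mk k0; rewrite -[mu _]mul1e -(setIT (S k s)) -integral_indic//; last exact: mS.
  have mI : measurable_fun setT (fun x => (\1_(S k s) x)%:E : \bar R).
    by apply/measurable_EFinP; apply: measurable_indic; exact: mS.
  rewrite mul1e -ge0_integralZl//.
  apply: ge0_le_integral => //.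
  - apply: measurable_funeM; apply/measurable_EFinP; apply: measurable_indic; exact: mS.
  - exact/measurable_EFinP.
  - move=> x _; rewrite -EFinM lee_fin indicE.
    by case: (boolP (x \in S k s)) => [/set_mem|_]; rewrite ?mulr1 ?mulr0.
have Sf (k : borel R n -> R) s : measurable_fun setT k -> (forall x, 0 <= k x) ->
    (\int[mu]_x (k x)%:E < +oo)%E -> mu (S k s) \is a fin_num.
  move=> mk k0 koo; rewrite ge0_fin_numE//.
  have := le_lt_trans (markov k s mk k0) koo.
  rewrite ltey => H; apply/eqP => e.
  by move: H; rewrite e gt0_muley ?lte_fin ?expR_gt0// eqxx.
have LE (k : borel R n -> R) : measurable_fun setT k -> (forall x, 0 <= k x) ->
    (\int[mu]_x (k x)%:E < +oo)%E ->
    (\int[mu]_x (k x)%:E = \int[lebesgue_measure]_s (L k s)%:E)%E.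
  move=> mk k0 koo; rewrite exp_layer_cake//; apply: eq_integral => s _.
  by rewrite /L EFinM fineK//; exact: Sf.
have mL k : measurable_fun setT k -> measurable_fun setT (L k).
  move=> mk; apply: measurable_funM => //.
  apply: (measurableT_comp (@fine_measurable _ _ _)) => //.
  pose Z := [set z : borel R n * measurableTypeR R | expR z.2 <= k z.1].
  have mZ : measurable Z.
    apply: measurable_set_le; last exact: measurableT_comp measurable_fst.
    exact: measurableT_comp measurable_snd.
  have := measurable_fun_ysection mu mZ.
  congr (measurable_fun _ _); apply/funext => u /=; congr (mu _).
  by apply/seteqP; split => x; rewrite /ysection /= inE.
have Lb (k : borel R n -> R) : measurable_fun setT k -> (forall x, 0 <= k x) ->
    (\int[mu]_x (k x)%:E < +oo)%E -> forall s, 0 <= L k s <= fine (\int[mu]_x (k x)%:E)%E.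
  move=> mk k0 koo s; rewrite mulr_ge0 ?expR_ge0 ?fine_ge0//=.
  have k0' : (0 <= \int[mu]_x (k x)%:E)%E by apply: integral_ge0 => x _; rewrite lee_fin.
  rewrite -lee_fin fineK ?ge0_fin_numE// /L EFinM fineK; last exact: Sf.
  exact: markov.
rewrite (LE f)// (LE g)// (LE h)//.
apply: (@prekopa_leindler1 R _ _ _ l _ _ l01 (mL _ mf) (mL _ mg) (mL _ mh) (Lb _ mf f0 foo) (Lb _ mg g0 goo)).
- by move=> s; have /andP[] := Lb _ mh h0 hoo s.
- move=> s u; rewrite /L.
  have H : (mu (S f s) `^ (1 - l) * mu (S g u) `^ l <= mu (S h ((1 - l) * s + l * u)%R))%E.
    apply: slc_measurable => //; try exact: mS.
    - by rewrite -ge0_fin_numE//; exact: Sf.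
    - by rewrite -ge0_fin_numE//; exact: Sf.
    - move=> x y /= sx uy; apply: le_trans (fgh x y).
      rewrite expRD (mulrC (1 - l)) (mulrC l) !expRM.
      by apply: ler_pM; rewrite ?powR_ge0//; apply: ge0_ler_powR; rewrite ?nnegrE ?expR_ge0 ?(ltW l0) ?(ltW l'0).
  have H' : fine (mu (S f s)) `^ (1 - l) * fine (mu (S g u)) `^ l <= fine (mu (S h ((1 - l) * s + l * u))).
    by rewrite -lee_fin EFinM -!poweR_EFin !fineK//; exact: Sf.
  rewrite !powRM ?expR_ge0 ?fine_ge0// mulrACA -!expRM -expRD (mulrC s) (mulrC u).
  by rewrite ler_pM2l ?expR_gt0.
- by rewrite -LE.
- by rewrite -LE.
Qed.

End slc.

Section lcm.
Variable R : realType.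

(** Log-concave measure. Finiteness on compact sets gives inner regularity, hence access to
    [slc_measurable]. *)
Definition lcm n (mu : set (borel R n) -> \bar R) :=
  slc mu /\ forall K : set 'rV[R]_n, compact K -> (mu K < +oo)%E.

Lemma lcm_regular n (mu : {measure set (borel R n) -> \bar R}) : lcm mu -> inner_regular mu.
Proof. by case=> _ lf; exact: inner_regular_loc. Qed.

Lemma prob_lcm n (P : probability (borel R n) R) : log_concave P -> lcm P.
Proof.
move=> lc; split => // K cK.
apply: (@le_lt_trans _ _ 1%E); last by rewrite ltry.
by apply: probability_le1; exact: measurable_compact_rV.
Qed.

Lemma continuous_lin n p (M : 'M[R]_(n, p)) : continuous (fun x : 'rV[R]_n => x *m M).
Proof.
apply: continuous_rowP => i.
rewrite (_ : (fun x => _) = (fun x : 'rV[R]_n => \sum_j x 0 j * M j i)); last first.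
  by apply/funext => x; rewrite mxE.
by apply: continuous_sum_ord => j; apply: continuous_scale; exact: coord_continuous.
Qed.

Lemma measurable_lin n p (M : 'M[R]_(n, p)) :
  measurable_fun setT ((fun x => x *m M) : borel R n -> borel R p).
Proof.
apply: measurable_continuous_rV => i x.
apply: (@continuous_comp _ _ _ (fun x : 'rV[R]_n => x *m M) (fun y : 'rV[R]_p => y 0 i)).
  exact: continuous_lin.
exact: coord_continuous.
Qed.

(** The preimage of a compact set under a linear map is closed but usually not compact, so
    log-concavity is used on measurable sets. *)
Lemma slc_pushforward_lin n p (M : 'M[R]_(n, p)) (mu : {measure set (borel R n) -> \bar R})
    (nu : set (borel R p) -> \bar R) : lcm mu ->
  (mu setT < +oo)%E ->
  (forall A, measurable A -> nu A = mu [set x : 'rV[R]_n | A (x *m M)]) -> slc nu.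
Proof.
move=> mulc muoo nuE A B l cA cB l01.
have mA : measurable (A : set (borel R p)) by exact: measurable_compact_rV.
have mB : measurable (B : set (borel R p)) by exact: measurable_compact_rV.
set C := [set _ | a in A & b in B].
have cC : compact C.
  have -> : C = (fun z : 'rV[R]_p * 'rV[R]_p => (1 - l) *: z.1 + l *: z.2) @` (A `*` B).
    apply/seteqP; split => [_ [x Kx] [y Ky] <-|_ [[x y] [/= Kx Ky] <-]].
      by exists (x, y).
    by exists x => //; exists y.
  apply: continuous_compact; last exact: compact_setX.
  by apply: continuous_subspaceT => z; apply: cvgD; apply: cvgZr; [exact: cvg_fst|exact: cvg_snd].
have mC : measurable (C : set (borel R p)) by exact: measurable_compact_rV.
rewrite !nuE//.
have pre (D : set (borel R p)) : measurable D -> measurable ([set x | D (x *m M)] : set (borel R n)).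
  by move=> mD; rewrite -[X in measurable X]setTI; exact: (measurable_lin M measurableT mD).
have fin (D : set (borel R p)) : measurable D -> (mu [set x | D (x *m M)] < +oo)%E.
  move=> mD; apply: le_lt_trans muoo; apply: le_measure; rewrite ?inE//; exact: pre.
have [lc _] := mulc.
apply: (@slc_measurable _ _ mu _ _ _ l (lcm_regular mulc) lc l01); try exact: pre; try exact: fin.
move=> a b /= Aa Bb; exists (a *m M) => //; exists (b *m M) => //.
by rewrite mulmxDl -!scalemxAl.
Qed.

Lemma pl n (mu : {sigma_finite_measure set (borel R n) -> \bar R})
    (f g h : 'rV[R]_n -> R) (l : R) : lcm mu -> 0 < l < 1 ->
  measurable_fun setT (f : borel R n -> R) -> measurable_fun setT (g : borel R n -> R) ->
  measurable_fun setT (h : borel R n -> R) ->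
  (forall x, 0 <= f x) -> (forall x, 0 <= g x) -> (forall x, 0 <= h x) ->
  (forall x y, f x `^ (1 - l) * g y `^ l <= h ((1 - l) *: x + l *: y)) ->
  (\int[mu]_x (f x)%:E < +oo)%E -> (\int[mu]_x (g x)%:E < +oo)%E ->
  ((\int[mu]_x (f x)%:E) `^ (1 - l) * (\int[mu]_x (g x)%:E) `^ l
     <= \int[mu]_x (h x)%:E)%E.
Proof. by move=> mulc; have [lc _] := mulc; apply: prekopa_leindler => //; exact: lcm_regular. Qed.

Definition lcf n (p : 'rV[R]_n -> R) := forall x y l, 0 < l < 1 ->
  p x `^ (1 - l) * p y `^ l <= p ((1 - l) *: x + l *: y).

(** Prekopa-Leindler for the products of [p] with the indicators of [A], [B] and of their
    combination. *)
Lemma slc_density n (mu : {sigma_finite_measure set (borel R n) -> \bar R})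
    (p : 'rV[R]_n -> R) (nu : set (borel R n) -> \bar R) :
  lcm mu -> measurable_fun setT (p : borel R n -> R) -> (forall x, 0 <= p x) -> lcf p ->
  (\int[mu]_x (p x)%:E < +oo)%E ->
  (forall A, measurable A -> nu A = (\int[mu]_(x in A) (p x)%:E)%E) -> slc nu.
Proof.
move=> mulc mp p0 lp poo nuE A B l cA cB l01; have /andP[l0 l1] := l01.
have l'0 : 0 < 1 - l by rewrite subr_gt0.
have mA : measurable (A : set (borel R n)) by exact: measurable_compact_rV.
have mB : measurable (B : set (borel R n)) by exact: measurable_compact_rV.
set C := [set _ | a in A & b in B].
have cC : compact C.
  have -> : C = (fun z : 'rV[R]_n * 'rV[R]_n => (1 - l) *: z.1 + l *: z.2) @` (A `*` B).
    apply/seteqP; split => [_ [x Kx] [y Ky] <-|_ [[x y] [/= Kx Ky] <-]].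
      by exists (x, y).
    by exists x => //; exists y.
  apply: continuous_compact; last exact: compact_setX.
  by apply: continuous_subspaceT => z; apply: cvgD; apply: cvgZr; [exact: cvg_fst|exact: cvg_snd].
have mC : measurable (C : set (borel R n)) by exact: measurable_compact_rV.
have E (D : set (borel R n)) : measurable D ->
   (\int[mu]_(x in D) (p x)%:E = \int[mu]_x (p x * \1_D x)%:E)%E.
  move=> mD; rewrite integral_mkcond; apply: eq_integral => x _.
  by rewrite patchE indicE; case: ifPn; rewrite ?mulr1 ?mulr0.
have mD (D : set (borel R n)) : measurable D -> measurable_fun setT (fun x : borel R n => p x * \1_D x).
  by move=> mD; apply: measurable_funM => //; exact: measurable_indic.
have Doo (D : set (borel R n)) : measurable D -> (\int[mu]_x (p x * \1_D x)%:E < +oo)%E.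
  move=> mDD; apply: le_lt_trans poo; apply: ge0_le_integral => //.
  - by move=> x _; rewrite lee_fin mulr_ge0.
  - by apply/measurable_EFinP; exact: mD.
  - exact/measurable_EFinP.
  - by move=> x _; rewrite lee_fin ler_piMr// indicE; case: (_ \in _).
rewrite !nuE// !E//.
apply: (@pl _ mu (fun x => p x * \1_A x) (fun x => p x * \1_B x) (fun x => p x * \1_C x)) => //.
- exact: mD.
- exact: mD.
- exact: mD.
- by move=> x; rewrite mulr_ge0.
- by move=> x; rewrite mulr_ge0.
- by move=> x; rewrite mulr_ge0.
- move=> x y; rewrite !indicE.
  have [xA|xA] := boolP (x \in A); last first.
    by rewrite mulr0 powR0 ?gt_eqF// mul0r mulr_ge0.
  have [yB|yB] := boolP (y \in B); last first.
    by rewrite !mulr0 [X in _ * X]powR0 ?gt_eqF// mulr0 mulr_ge0.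
  rewrite (mem_set (_ : C _)) ?mulr1; first exact: lp.
  by exists x; [exact: set_mem|exists y => //; exact: set_mem].
- exact: Doo.
- exact: Doo.
Qed.

Lemma measurable_section a b (A : set (borel R (a + b))) (x : 'rV[R]_a) : measurable A ->
  measurable ([set y : 'rV[R]_b | A (row_mx x y)] : set (borel R b)).
Proof.
move=> mA.
have mr : measurable_fun setT (fun y : borel R b => rowp (x : borel R a, y)).
  by apply: measurableT_comp (@measurable_rowp R a b) _; exact: measurable_pair1.
by rewrite -[X in measurable X]setTI; exact: (mr measurableT _ mA).
Qed.

Lemma continuous_lsub a b : continuous (fun z : 'rV[R]_(a + b) => lsubmx z : 'rV[R]_a).
Proof.
apply: continuous_rowP => i; under eq_fun do rewrite mxE.
exact: coord_continuous.
Qed.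

Lemma continuous_rsub a b : continuous (fun z : 'rV[R]_(a + b) => rsubmx z : 'rV[R]_b).
Proof.
apply: continuous_rowP => i; under eq_fun do rewrite mxE.
exact: coord_continuous.
Qed.

Lemma compact_section a b (A : set 'rV[R]_(a + b)) (x : 'rV[R]_a) : compact A ->
  compact [set y : 'rV[R]_b | A (row_mx x y)].
Proof.
move=> cA.
have cx : closed [set z : 'rV[R]_(a + b) | lsubmx z = x].
  apply: (@preimage_closed _ _ (fun z : 'rV[R]_(a + b) => lsubmx z : 'rV[R]_a) [set x]).
    by move=> z _; exact: continuous_lsub.
  by apply: compact_closed; [exact: norm_hausdorff|exact: compact_set1].
have -> : [set y : 'rV[R]_b | A (row_mx x y)] =
  (fun z : 'rV[R]_(a + b) => rsubmx z : 'rV[R]_b) @` (A `&` [set z | lsubmx z = x]).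
  apply/seteqP; split => [y Axy|_ [z [Az <-] <-]] /=.
    by exists (row_mx x y); rewrite ?row_mxKr//=; split => //; rewrite row_mxKl.
  by rewrite hsubmxK.
apply: continuous_compact.
  by apply: continuous_subspaceT => z; exact: continuous_rsub.
have clA : closed A by apply: compact_closed; [exact: norm_hausdorff|exact: cA].
apply: subclosed_compact cA _; last exact: subIsetl.
by apply: closedI.
Qed.

(** Log-concavity of [m2] says that the measures of the sections of [A], [B] and [C] satisfy the
    Prekopa-Leindler hypothesis as functions of the first variable; the inequality for [m1]
    integrates it. *)
Lemma lcm_prod a b (m1 : {sigma_finite_measure set (borel R a) -> \bar R})
    (m2 : {sigma_finite_measure set (borel R b) -> \bar R})
    (m : {measure set (borel R (a + b)) -> \bar R}) : lcm m1 -> lcm m2 ->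
  (forall A, measurable A -> m A = (\int[m1]_x m2 [set y : 'rV[R]_b | A (row_mx x y)])%E) -> lcm m.
Proof.
move=> lc1 lc2 mE.
have lf : forall K : set 'rV[R]_(a + b), compact K -> (m K < +oo)%E.
  move=> K cK; have mK : measurable (K : set (borel R _)) by exact: measurable_compact_rV.
  pose K1 := (fun z : 'rV[R]_(a + b) => lsubmx z : 'rV[R]_a) @` K.
  pose K2 := (fun z : 'rV[R]_(a + b) => rsubmx z : 'rV[R]_b) @` K.
  have cK1 : compact K1.
    by apply: continuous_compact cK; apply: continuous_subspaceT => z; exact: continuous_lsub.
  have cK2 : compact K2.
    by apply: continuous_compact cK; apply: continuous_subspaceT => z; exact: continuous_rsub.
  have mK1 : measurable (K1 : set (borel R _)) by exact: measurable_compact_rV.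
  have mK2 : measurable (K2 : set (borel R _)) by exact: measurable_compact_rV.
  apply: (@le_lt_trans _ _ (m ([set z | K1 (lsubmx z) /\ K2 (rsubmx z)]))).
    apply: le_measure; rewrite ?inE//.
      apply: measurableI.
        by rewrite -[X in measurable X]setTI; exact: (@measurable_lrow R a b measurableT _ mK1).
      by rewrite -[X in measurable X]setTI; exact: (@measurable_rrow R a b measurableT _ mK2).
    by move=> z Kz; split; exists z.
  rewrite mE; last first.
    apply: measurableI.
      by rewrite -[X in measurable X]setTI; exact: (@measurable_lrow R a b measurableT _ mK1).
    by rewrite -[X in measurable X]setTI; exact: (@measurable_rrow R a b measurableT _ mK2).
  rewrite (_ : (fun x => _) = (fun x => m2 K2 * (\1_K1 x)%:E)%E); last first.
    apply/funext => x; rewrite indicE; have [xK|xK] := boolP (x \in K1).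
      rewrite mule1; congr (m2 _); apply/seteqP; split => y /=; rewrite row_mxKl row_mxKr; first by case.
      by split => //; exact: set_mem.
    rewrite mule0 -(measure0 m2); congr (m2 _).
    by apply/seteqP; split => // y /=; rewrite row_mxKl => -[/mem_set]; rewrite (negbTE xK).
  have [_ lf2] := lc2; have [_ lf1] := lc1.
  rewrite ge0_integralZl//; last by apply/measurable_EFinP; exact: measurable_indic.
  by rewrite integral_indic// setIT lte_mul_pinfty ?lf1// ge0_fin_numE ?lf2.
split => // A B l cA cB l01.
have mA : measurable (A : set (borel R _)) by exact: measurable_compact_rV.
have mB : measurable (B : set (borel R _)) by exact: measurable_compact_rV.
set C := [set _ | a in A & b in B].
have cC : compact C.
  have -> : C = (fun z : 'rV[R]_(a + b) * 'rV[R]_(a + b) => (1 - l) *: z.1 + l *: z.2) @` (A `*` B).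
    apply/seteqP; split => [_ [x Kx] [y Ky] <-|_ [[x y] [/= Kx Ky] <-]].
      by exists (x, y).
    by exists x => //; exists y.
  apply: continuous_compact; last exact: compact_setX.
  by apply: continuous_subspaceT => z; apply: cvgD; apply: cvgZr; [exact: cvg_fst|exact: cvg_snd].
have mC : measurable (C : set (borel R _)) by exact: measurable_compact_rV.
have [lc2' lf2] := lc2.
pose s (D : set 'rV[R]_(a + b)) (x : 'rV[R]_a) := [set y : 'rV[R]_b | D (row_mx x y)].
have sf (D : set 'rV[R]_(a + b)) x : compact D -> m2 (s D x) \is a fin_num.
  by move=> cD; rewrite ge0_fin_numE// lf2//; exact: compact_section.
pose f (D : set 'rV[R]_(a + b)) x := fine (m2 (s D x)).
have fE (D : set 'rV[R]_(a + b)) : compact D -> m D = (\int[m1]_x (f D x)%:E)%E.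
  move=> cD; rewrite mE; last exact: measurable_compact_rV.
  by apply: eq_integral => x _; rewrite fineK//; exact: sf.
have mf (D : set 'rV[R]_(a + b)) : compact D -> measurable_fun setT (f D : borel R a -> R).
  move=> cD; apply: (measurableT_comp (@fine_measurable _ _ _)) => //.
  have mD : measurable (D : set (borel R _)) by exact: measurable_compact_rV.
  have mD' : measurable (@rowp R a b @^-1` D).
    by rewrite -[X in measurable X]setTI; exact: (@measurable_rowp R a b measurableT _ mD).
  have := measurable_fun_xsection m2 mD'.
  congr (measurable_fun _ _); apply/funext => u /=; congr (m2 _).
  by apply/seteqP; split => x; rewrite /xsection /= inE.
rewrite !fE//; apply: (pl lc1 l01); try exact: mf; try by move=> x; rewrite fine_ge0.
- move=> x y; rewrite -lee_fin EFinM -!poweR_EFin !fineK; try exact: sf.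
  apply: slc_measurable => //; try (by apply: measurable_section);
    try (by rewrite -ge0_fin_numE//; exact: sf).
    exact: lcm_regular.
  move=> u v /= Axu Byv; exists (row_mx x u) => //; exists (row_mx y v) => //.
  by rewrite !scale_row_mx add_row_mx.
- by rewrite -fE// lf.
- by rewrite -fE// lf.
Qed.

End lcm.

(** * Linear changes of variables *)

Section leb_facts.
Variable R : realType.
Local Notation "'leb' n" := (@leb R n) (at level 9, n at level 9).

Lemma measurable_rV1 : measurable_fun setT ((fun t : R => t%:M) : measurableTypeR R -> borel R 1).
Proof. exact: measurable_scalar1. Qed.

Lemma ge0_integral_leb1 (f : 'rV[R]_1 -> \bar R) :
  measurable_fun setT (f : borel R 1 -> \bar R) -> (forall x, 0 <= f x)%E ->
  (\int[leb 1]_x f x = \int[lebesgue_measure]_t f t%:M)%E.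
Proof.
move=> mf f0; rewrite ge0_integral_lebS//; apply: eq_integral => t _.
rewrite ge0_integral_leb0//; congr f; rewrite /rowp1 /=.
by apply/rowP => i; rewrite (ord1 i) mxE; case: splitP => // j _; rewrite (ord1 j).
Qed.

Lemma leb1E (A : set (borel R 1)) : measurable A ->
  leb 1 A = lebesgue_measure [set t : R | A t%:M].
Proof.
move=> mA; transitivity (\int[leb 1]_x (\1_A x)%:E)%E.
  by rewrite integral_indic// setIT.
rewrite (ge0_integral_leb1 (f := fun x => (\1_A x)%:E))//; last first.
  by apply/measurable_EFinP; exact: measurable_indic.
have mt : measurable ([set t : R | A t%:M] : set (measurableTypeR R)).
  by rewrite -[X in measurable X]setTI; exact: measurable_rV1.
rewrite -[in RHS](setIT [set t : R | A t%:M]) -integral_indic//.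
Qed.

Lemma lebSE' n (A : set (borel R (1 + n))) : measurable A ->
  leb n.+1 A = (\int[leb 1]_x leb n [set y : 'rV[R]_n | A (row_mx x y)])%E.
Proof.
move=> mA; rewrite lebSE ge0_integral_leb1//.
- by apply: eq_integral => t _ /=; congr (leb n _); apply/seteqP; split => y; rewrite /xsection /= inE.
- have mA' : measurable (@rowp R 1 n @^-1` A).
    by rewrite -[X in measurable X]setTI; exact: (@measurable_rowp R 1 n measurableT _ mA).
  have := measurable_fun_xsection (leb n) mA'.
  congr (measurable_fun _ _); apply/funext => u /=; congr (leb n _).
  by apply/seteqP; split => x; rewrite /xsection /= inE.
Qed.

(** Brunn-Minkowski on the line followed by the inequality between weighted arithmetic and geometric
    means. *)
Lemma lcm_leb1 : lcm (leb 1).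
Proof.
have tK (A : set 'rV[R]_1) : [set t : R | A t%:M] = (fun x : 'rV[R]_1 => x 0 0) @` A.
  apply/seteqP; split => [t At|_ [x Ax <-]] /=.
    by exists t%:M => //; rewrite mxE eqxx.
  by rewrite (_ : (x 0 0)%:M = x)//; apply/rowP => i; rewrite (ord1 i) mxE eqxx.
have cK (A : set 'rV[R]_1) : compact A -> compact [set t : R | A t%:M].
  move=> cA; rewrite tK; apply: continuous_compact cA.
  by apply: continuous_subspaceT => z; exact: coord_continuous.
have mK (A : set 'rV[R]_1) : compact A -> measurable (A : set (borel R 1)).
  by move=> cA; exact: measurable_compact_rV.
split; last by move=> K cA; rewrite leb1E; [exact/compact_finite_measure/cK|exact: mK].
move=> A B l cA cB l01; have /andP[l0 l1] := l01.
have l'0 : 0 < 1 - l by rewrite subr_gt0.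
set C := [set _ | a in A & b in B].
have cC : compact C.
  have -> : C = (fun z : 'rV[R]_1 * 'rV[R]_1 => (1 - l) *: z.1 + l *: z.2) @` (A `*` B).
    apply/seteqP; split => [_ [x Kx] [y Ky] <-|_ [[x y] [/= Kx Ky] <-]].
      by exists (x, y).
    by exists x => //; exists y.
  apply: continuous_compact; last exact: compact_setX.
  by apply: continuous_subspaceT => z; apply: cvgD; apply: cvgZr; [exact: cvg_fst|exact: cvg_snd].
rewrite !leb1E; try exact: mK.
set A' := [set t : R | A t%:M]; set B' := [set t : R | B t%:M]; set C' := [set t : R | C t%:M].
have Af : lebesgue_measure A' \is a fin_num.
  by rewrite ge0_fin_numE//; exact/compact_finite_measure/cK.
have Bf : lebesgue_measure B' \is a fin_num.
  by rewrite ge0_fin_numE//; exact/compact_finite_measure/cK.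
have [A0|/set0P A0] := eqVneq A' set0.
  by rewrite A0 measure0 poweR0r ?gt_eqF// mul0e.
have [B0|/set0P B0] := eqVneq B' set0.
  by rewrite B0 measure0 [X in (_ * X)%E]poweR0r ?gt_eqF// mule0.
have mA' : measurable (A' : set (measurableTypeR R)) by apply: compact_measurable; exact: cK.
have mB' : measurable (B' : set (measurableTypeR R)) by apply: compact_measurable; exact: cK.
have mC' : measurable (C' : set (measurableTypeR R)) by apply: compact_measurable; exact: cK.
have BM := @brunn_minkowski1 R A' B' C' l l01 mA' mB' mC' A0 B0.
apply: (@le_trans _ _ ((1 - l)%:E * lebesgue_measure A' + l%:E * lebesgue_measure B')%E); last first.
- apply: BM => a b Aa Bb; exists a%:M => //; exists b%:M => //.
  by rewrite !scale_scalar_mx -raddfD.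
- rewrite -(fineK Af) -(fineK Bf) !poweR_EFin -!EFinM -EFinD lee_fin.
  by apply: weighted_am_gm; rewrite ?fine_ge0.
Qed.

Lemma lcm_leb n : lcm (leb n).
Proof.
elim: n => [|n ih]; last first.
  by apply: (@lcm_prod R 1 n (leb 1) (leb n) _ lcm_leb1 ih) => A mA; exact: lebSE'.
split=> [A B l cA cB /andP[l0 l1]|K cK]; rewrite !leb0E ?ltry//.
have l'0 : 0 < 1 - l by rewrite subr_gt0.
rewrite !poweR_EFin -EFinM lee_fin !indicE.
have [A0|A0] := boolP (0 \in A); last by rewrite powR0 ?gt_eqF// mul0r.
have [B0|B0] := boolP (0 \in B); last by rewrite [X in _ * X]powR0 ?gt_eqF// mulr0.
rewrite !powR1 mulr1 mem_set//; exists 0; first exact: set_mem.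
by exists 0; [exact: set_mem|rewrite !scaler0 addr0].
Qed.

Lemma ge0_integral_affine (a b : R) (f : R -> \bar R) : a != 0 ->
  measurable_fun setT (f : measurableTypeR R -> \bar R) -> (forall x, 0 <= f x)%E ->
  (`|a|%:E * \int[lebesgue_measure]_t f (a * t + b)%R = \int[lebesgue_measure]_t f t)%E.
Proof.
move=> a0 mf f0.
pose k (x : measurableTypeR R) : measurableTypeR R := a * x + b.
have mk : measurable_fun setT k.
  by apply: measurable_funD => //; apply: measurable_funM.
have [m mE] := measure_pushforwardP (@lebesgue_measure R) mk.
rewrite -(ge0_integral_image (m' := m) (f := k) mk mf f0); last by move=> A mA; exact: mE.
pose aa := NngNum (normr_ge0 a).
rewrite (_ : `|a|%:E = (aa%:num)%:E)// -(ge0_integral_mscale m measurableT aa)//.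
apply: eq_measure_integral => A mA _.
rewrite [RHS](lebesgue_affine b a0 mA) -[X in (_ * X)%E]mE//.
Qed.

Definition jacobian n (M : 'M[R]_n) := forall f : 'rV[R]_n -> \bar R,
  measurable_fun setT (f : borel R n -> \bar R) -> (forall x, 0 <= f x)%E ->
  (`|\det M|%:E * \int[leb n]_x f (x *m M) = \int[leb n]_x f x)%E.

Lemma measurable_add n (a : 'rV[R]_n) :
  measurable_fun setT ((fun x => x + a) : borel R n -> borel R n).
Proof.
apply: measurable_fun_rV => i.
rewrite (_ : (fun x => _) = (fun x : borel R n => (x : 'rV[R]_n) 0 i + a 0 i)); last first.
  by apply/funext => x; rewrite mxE.
by apply: measurable_funD => //; exact: measurable_fun_coord.
Qed.

Lemma measurable_rowp1r n (f : borel R n.+1 -> \bar R) (t : R) : measurable_fun setT f ->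
  measurable_fun setT (fun y : borel R n => f (rowp1 (t, y))).
Proof.
move=> mf; apply: (measurableT_comp mf).
exact: (measurableT_comp (@measurable_rowp1 R n) (@measurable_pair1 _ _ _ _ t)).
Qed.

Lemma measurable_rowp1l n (f : borel R n.+1 -> \bar R) (y : borel R n) : measurable_fun setT f ->
  measurable_fun setT (fun t : measurableTypeR R => f (rowp1 (t, y))).
Proof.
move=> mf; apply: (measurableT_comp mf).
exact: (measurableT_comp (@measurable_rowp1 R n) (@measurable_pair2 _ _ _ _ y)).
Qed.

Lemma ge0_integral_lebS' n (f : 'rV[R]_n.+1 -> \bar R) :
  measurable_fun setT (f : borel R n.+1 -> \bar R) -> (forall x, 0 <= f x)%E ->
  (\int[leb n.+1]_x f x =
   \int[leb n]_y \int[lebesgue_measure]_t f (rowp1 (t, y)))%E.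
Proof.
move=> mf f0; rewrite ge0_integral_lebS//.
have mfr : measurable_fun setT (f \o @rowp1 R n).
  exact: measurableT_comp mf (@measurable_rowp1 R n).
exact: (@fubini_tonelli _ _ _ _ _ lebesgue_measure (leb n) (f \o @rowp1 R n) mfr (fun x => f0 _)).
Qed.

Lemma ge0_integral_translation n (a : 'rV[R]_n) (f : 'rV[R]_n -> \bar R) :
  measurable_fun setT (f : borel R n -> \bar R) -> (forall x, 0 <= f x)%E ->
  (\int[leb n]_x f (x + a)%R = \int[leb n]_x f x)%E.
Proof.
elim: n a f => [|n ih] a f mf f0.
  by rewrite !ge0_integral_leb0// (thinmx0 a) addr0.
have mfa : measurable_fun setT ((fun x => f (x + a)%R) : borel R n.+1 -> \bar R).
  exact: measurableT_comp mf (measurable_add a).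
rewrite !ge0_integral_lebS//.
have E (t : R) (y : 'rV_n) : rowp1 (t, y) + a = rowp1 (t + (lsubmx (a : 'rV_(1 + n)) : 'rV_1) 0 0, y + rsubmx (a : 'rV_(1 + n))).
  have aE : a = row_mx (lsubmx (a : 'rV_(1 + n)) : 'rV_1) (rsubmx (a : 'rV_(1 + n))) by rewrite hsubmxK.
  rewrite /rowp1 /= {1}aE; etransitivity; first exact: (@add_row_mx R 1 1 n); congr (@row_mx R 1 1 n _ _).
  by apply/rowP => i; rewrite (ord1 i) !mxE eqxx !mulr1n.
under eq_integral do (under eq_integral do rewrite E).
under eq_integral => t _.
  rewrite (ih _ (fun y => f (rowp1 (t + (lsubmx (a : 'rV_(1 + n)) : 'rV_1) 0 0, y))%R)); [|exact: measurable_rowp1r|by []].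
  over.
pose F t := (\int[leb n]_y f (rowp1 (t, y)))%E.
have mF : measurable_fun setT (F : measurableTypeR R -> \bar R).
  apply: (@measurable_fun_fubini_tonelli_F _ _ _ _ _ (leb n) (f \o @rowp1 R n)) => //; last by move=> x; exact: f0.
  exact: measurableT_comp mf (@measurable_rowp1 R n).
have F0 t : (0 <= F t)%E by apply: integral_ge0.
have := @ge0_integral_affine 1 ((lsubmx (a : 'rV_(1 + n)) : 'rV_1) 0 0) F (oner_neq0 _) mF F0.
rewrite normr1 mul1e => <-.
by apply: eq_integral => t _; rewrite mul1r.
Qed.

Lemma jacobianM n (M N : 'M[R]_n) : jacobian M -> jacobian N -> jacobian (M *m N).
Proof.
move=> jM jN f mf f0; rewrite det_mulmx normrM EFinM.
have mfN : measurable_fun setT ((fun x => f (x *m N)) : borel R n -> \bar R).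
  exact: measurableT_comp mf (measurable_lin N).
under eq_integral do rewrite mulmxA.
by rewrite (muleC `|_|%:E) -muleA (jM (fun x => f (x *m N)))// jN.
Qed.

(** For a fixed first coordinate [t] the shear translates the remaining ones by [t u]. *)
Lemma jacobian_upper n (u : 'rV[R]_n) :
  jacobian (block_mx 1%:M u 0 1%:M : 'M[R]_(1 + n)).
Proof.
move=> f mf f0; rewrite det_ublock !det1 mulr1 normr1 mul1e.
set M := block_mx _ _ _ _.
have mfM : measurable_fun setT ((fun x => f (x *m M)) : borel R (1 + n) -> \bar R).
  exact: measurableT_comp mf (measurable_lin M).
rewrite !ge0_integral_lebS//; apply: eq_integral => t _.
have E (y : 'rV_n) : (rowp1 (t, y) : 'rV_(1 + n)) *m M = rowp1 (t, y + t *: u).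
  rewrite /rowp1 /M mul_row_block !mulmx1 mulmx0 addr0; congr row_mx.
  by rewrite addrC; congr (_ + _); apply/rowP => i; rewrite !mxE big_ord1 mxE eqxx.
under eq_integral do rewrite E.
by rewrite (ge0_integral_translation _ (f := fun y => f (rowp1 (t, y))))//; exact: measurable_rowp1r.
Qed.

Lemma jacobian_lower n (c : 'cV[R]_n) :
  jacobian (block_mx 1%:M 0 c 1%:M : 'M[R]_(1 + n)).
Proof.
move=> f mf f0; rewrite det_lblock !det1 mulr1 normr1 mul1e.
set M := block_mx _ _ _ _.
have mfM : measurable_fun setT ((fun x => f (x *m M)) : borel R (1 + n) -> \bar R).
  exact: measurableT_comp mf (measurable_lin M).
rewrite !ge0_integral_lebS'//; apply: eq_integral => y _.
have E (t : R) : (rowp1 (t, y) : 'rV_(1 + n)) *m M = rowp1 (1 * t + (y *m c) 0 0, y).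
  rewrite /rowp1 /M mul_row_block !mulmx1 mulmx0 add0r mul1r; congr row_mx.
  by apply/rowP => i; rewrite (ord1 i) !mxE eqxx !mulr1n.
under eq_integral do rewrite E.
have := @ge0_integral_affine 1 ((y *m c) 0 0) (fun t => f (rowp1 (t, y))) (oner_neq0 _).
by rewrite normr1 mul1e; apply => //; exact: measurable_rowp1l.
Qed.

Lemma jacobian_diag n (a : R) (D : 'M[R]_n) : a != 0 -> jacobian D ->
  jacobian (block_mx a%:M 0 0 D : 'M[R]_(1 + n)).
Proof.
move=> a0 jD f mf f0; rewrite det_lblock det_scalar1 normrM EFinM.
set M := block_mx _ _ _ _.
have mfM : measurable_fun setT ((fun x => f (x *m M)) : borel R (1 + n) -> \bar R).
  exact: measurableT_comp mf (measurable_lin M).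
rewrite !ge0_integral_lebS//.
have E (t : R) (y : 'rV_n) : (rowp1 (t, y) : 'rV_(1 + n)) *m M = rowp1 (a * t + 0, y *m D).
  rewrite /rowp1 /M mul_row_block !mulmx0 addr0 add0r addr0 -scalar_mxM mulrC.
  by [].
under eq_integral do (under eq_integral do rewrite E).
pose F t := (\int[leb n]_y f (rowp1 (t, y)))%E.
have mF : measurable_fun setT (F : measurableTypeR R -> \bar R).
  apply: (@measurable_fun_fubini_tonelli_F _ _ _ _ _ (leb n) (f \o @rowp1 R n)) => //; last by move=> x; exact: f0.
  exact: measurableT_comp mf (@measurable_rowp1 R n).
have F0 t : (0 <= F t)%E by apply: integral_ge0.
rewrite -[RHS](@ge0_integral_affine a 0 F a0 mF F0) -muleA; congr (_ * _)%E.
rewrite -ge0_integralZl//.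
- apply: eq_integral => t _; rewrite /F.
  by rewrite -(jD (fun y => f (rowp1 (a * t + 0, y)%R)))//; exact: measurable_rowp1r.
- have := @measurable_fun_fubini_tonelli_F _ _ _ _ _ (leb n) (f \o (fun x => x *m M) \o @rowp1 R n).
  move=> H; apply: (eq_measurable_fun _ _ (H _ _)) => //.
    by move=> t _; apply: eq_integral => y _ /=; rewrite E.
  exact: measurableT_comp mfM (@measurable_rowp1 R n).
  by move=> x; exact: f0.
- by move=> t _; exact: integral_ge0.
Qed.

(** Gaussian elimination: with a nonzero corner entry the matrix is a lower shear times a block
    diagonal matrix, made of the corner and its Schur complement, times an upper shear. A vanishing
    corner is first repaired by adding a row whose first entry is nonzero. *)
Lemma jacobian_unitmx n (M : 'M[R]_n) : M \in unitmx -> jacobian M.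
Proof.
elim: n M => [|n ih] M uM.
  by move=> f mf f0; rewrite det_mx00 normr1 mul1e !ge0_integral_leb0// (thinmx0 M) mulmx0.
have piv (N : 'M[R]_(1 + n)) : N \in unitmx -> ulsubmx N 0 0 != 0 -> jacobian N.
  move=> uN; set a := ulsubmx N 0 0 => a0.
  pose u := ursubmx N; pose c := dlsubmx N; pose D := drsubmx N - a^-1 *: (c *m u).
  have aE : ulsubmx N = a%:M by apply/matrixP => i j; rewrite (ord1 i) (ord1 j) [RHS]mxE eqxx.
  have NE : N = block_mx 1%:M 0 (a^-1 *: c) 1%:M *m block_mx a%:M 0 0 D *m block_mx 1%:M (a^-1 *: u) 0 1%:M.
    rewrite !mulmx_block !mul1mx !mul0mx !mulmx0 !addr0 !add0r !mulmx1 -[LHS]submxK aE.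
    congr block_mx.
    - by rewrite addr0 mul_scalar_mx scalerA mulfV// scale1r.
    - by rewrite -scalemxAl mul_mx_scalar scalerA mulVf// scale1r.
    - by rewrite -scalemxAl mul_mx_scalar scalerA mulVf// scale1r -scalemxAr /D addrC subrK.
  rewrite NE; apply: jacobianM; last exact: jacobian_upper.
  apply: jacobianM; first exact: jacobian_lower.
  apply: jacobian_diag => //; apply: ih.
  move: uN; rewrite NE !unitmxE !det_mulmx !det_lblock !det_ublock !det1 !mul1r !mulr1 det_scalar1.
  by rewrite unitrM => /andP[].
have [M0|M0] := eqVneq (ulsubmx (M : 'M[R]_(1 + n)) 0 0) 0; last exact: piv.
have [i Mi] : exists i, dlsubmx (M : 'M[R]_(1 + n)) i 0 != 0.
  apply/existsP; rewrite -[X in is_true X]negbK negb_exists; apply/negP => /forallP H.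
  have : col 0 M = 0.
    apply/colP => i; rewrite !mxE; case: (split_ordP (i : 'I_(1 + n))) => j ->.
      by have := M0; rewrite (ord1 j) !mxE => <-; congr (M _ _); apply/val_inj.
    have := H j; rewrite negbK => /eqP; rewrite !mxE => <-; congr (M _ _); exact/val_inj.
  rewrite colE => h; have : (delta_mx 0 0 : 'cV[R]_n.+1) = 0.
    by rewrite -[LHS]mul1mx -(mulVmx uM) -mulmxA h mulmx0.
  by move/matrixP/(_ 0 0); rewrite !mxE !eqxx => /eqP; rewrite oner_eq0.
pose U := block_mx 1%:M (delta_mx 0 i) 0 1%:M : 'M[R]_(1 + n).
pose V := block_mx 1%:M (- delta_mx 0 i) 0 1%:M : 'M[R]_(1 + n).
have VU : V *m U = 1%:M.
  rewrite /V /U mulmx_block !mul1mx !mul0mx !mulmx0 !mulmx1 !addr0 add0r subrr.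
  by rewrite -scalar_mx_block.
have -> : M = V *m (U *m M) by rewrite mulmxA VU mul1mx.
apply: jacobianM; first exact: jacobian_upper.
apply: piv.
  by rewrite unitmx_mul uM andbT; have /mulmx1_unit[] := VU.
have gen (N : 'M[R]_(1 + n)) : ulsubmx (U *m N) = ulsubmx N + delta_mx 0 i *m dlsubmx N.
  by rewrite -{1}(submxK N) /U mulmx_block block_mxKul mul1mx.
rewrite (gen M) mxE M0 add0r.
rewrite mxE (bigD1 i)//= big1 ?addr0; last by move=> j ji; rewrite mxE eqxx (negbTE ji) mul0r.
by rewrite mxE !eqxx mul1r.
Qed.

End leb_facts.

(** * Real-valued integrals *)

Section integrals.
Context d (T : measurableType d) (R : realType).
Variable m : {measure set T -> \bar R}.
Implicit Types f g : T -> R.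

Definition ig f := m.-integrable setT (EFin \o f).
Definition Int f : R := Rintegral m setT f.

Lemma ig_measurable f : ig f -> measurable_fun setT f.
Proof. by move=> /measurable_int /measurable_EFinP. Qed.

Lemma ig_ge0 f : measurable_fun setT f -> (forall x, 0 <= f x) ->
  (\int[m]_x (f x)%:E < +oo)%E -> ig f.
Proof.
move=> mf f0 foo; apply/integrableP; split; first exact/measurable_EFinP.
by under eq_integral do rewrite /= ger0_norm//.
Qed.

Lemma IntE f : ig f -> (\int[m]_x (f x)%:E)%E = (Int f)%:E.
Proof. by move=> fi; rewrite /Int /Rintegral fineK//; exact: integrable_fin_num fi. Qed.

Lemma ig_le f g : measurable_fun setT f -> (forall x, `|f x| <= g x) -> ig g -> ig f.
Proof.
move=> mf fg; apply: le_integrable => //; first exact/measurable_EFinP.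
by move=> x _ /=; rewrite lee_fin; apply: le_trans (fg x) (ler_norm _).
Qed.

Lemma ig_le0 f g : measurable_fun setT f -> (forall x, 0 <= f x <= g x) -> ig g -> ig f.
Proof.
by move=> mf fg; apply: ig_le => // x; have /andP[f0 h] := fg x; rewrite ger0_norm.
Qed.

Lemma eq_ig f g : f =1 g -> ig f -> ig g.
Proof. by move=> /funext ->. Qed.

Lemma eq_Int f g : f =1 g -> Int f = Int g.
Proof. by move=> /funext ->. Qed.

Lemma igD f g : ig f -> ig g -> ig (fun x => f x + g x).
Proof. by move=> fi gi; exact: (integrableD measurableT fi gi). Qed.

Lemma igB f g : ig f -> ig g -> ig (fun x => f x - g x).
Proof. by move=> fi gi; exact: (integrableB measurableT fi gi). Qed.

Lemma igZ k f : ig f -> ig (fun x => k * f x).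
Proof. by move=> fi; exact: (integrableZl measurableT k fi). Qed.

Lemma ig_norm f : ig f -> ig (fun x => `|f x|).
Proof. by move=> fi; exact: (integrable_norm fi). Qed.

Lemma IntD f g : ig f -> ig g -> Int (fun x => f x + g x) = Int f + Int g.
Proof. by move=> fi gi; exact: RintegralD. Qed.

Lemma IntB f g : ig f -> ig g -> Int (fun x => f x - g x) = Int f - Int g.
Proof. by move=> fi gi; exact: RintegralB. Qed.

Lemma IntZ k f : ig f -> Int (fun x => k * f x) = k * Int f.
Proof. by move=> fi; exact: RintegralZl. Qed.

Lemma Int_le f g : ig f -> ig g -> (forall x, f x <= g x) -> Int f <= Int g.
Proof. by move=> fi gi fg; apply: le_Rintegral. Qed.

Lemma Int_ge0 f : (forall x, 0 <= f x) -> 0 <= Int f.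
Proof. by move=> f0; apply: Rintegral_ge0. Qed.

Lemma ig0 : ig (fun=> 0).
Proof. exact: integrable0. Qed.

Lemma Int0 : Int (fun=> 0) = 0.
Proof. by rewrite /Int /Rintegral integral0. Qed.

Lemma ig_sum n (F : 'I_n -> T -> R) : (forall i, ig (F i)) -> ig (fun x => \sum_(i < n) F i x).
Proof.
move=> Fi; elim: n F Fi => [|n ih] F Fi.
  by apply: (eq_ig _ ig0) => x; rewrite big_ord0.
apply: (eq_ig (f := fun x => F ord0 x + \sum_(i < n) F (lift ord0 i) x)).
  by move=> x; rewrite big_ord_recl.
by apply: igD => //; apply: ih.
Qed.

Lemma Int_sum n (F : 'I_n -> T -> R) : (forall i, ig (F i)) ->
  Int (fun x => \sum_(i < n) F i x) = \sum_(i < n) Int (F i).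
Proof.
move=> Fi; elim: n F Fi => [|n ih] F Fi.
  by rewrite big_ord0 (eq_Int (g := fun=> 0)) ?Int0// => x; rewrite big_ord0.
rewrite big_ord_recl -ih// -IntD//; last exact: ig_sum.
by apply: eq_Int => x; rewrite big_ord_recl.
Qed.

Lemma Int_lee f c : measurable_fun setT f -> (forall x, 0 <= f x) ->
  (\int[m]_x (f x)%:E <= c%:E)%E -> ig f /\ Int f <= c.
Proof.
move=> mf f0 fc; have fi : ig f by apply: ig_ge0 => //; apply: le_lt_trans fc (ltry _).
by split => //; rewrite -lee_fin -IntE.
Qed.

Lemma Int_eqE f c : measurable_fun setT f -> (forall x, 0 <= f x) ->
  (\int[m]_x (f x)%:E = c%:E)%E -> ig f /\ Int f = c.
Proof.
move=> mf f0 fc; have fi : ig f by apply: ig_ge0 => //; rewrite fc ltry.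
by split => //; apply: EFin_inj; rewrite -IntE.
Qed.

Lemma Int_gt0 f A : measurable A -> (0 < m A)%E -> (forall x, 0 <= f x) -> (forall x, A x -> 0 < f x) ->
  ig f -> 0 < Int f.
Proof.
move=> mA A0 f0 fA fi; rewrite lt_neqAle Int_ge0// andbT eq_sym; apply/negP => /eqP If0.
have mf := ig_measurable fi.
have : (\int[m]_x `|(f x)%:E| = 0)%E.
  by under eq_integral do rewrite /= ger0_norm//; rewrite IntE// If0.
have mfE : measurable_fun setT (EFin \o f) by exact/measurable_EFinP.
move/(ae_eq_integral_abs _ measurableT mfE) => -[N [mN N0 fN]].
move: A0; rewrite lt_neqAle => /andP[/negP + _]; apply; rewrite eq_sym.
apply/eqP; apply: (@subset_measure0 _ _ _ m A N) => // x Ax; apply: fN => /= /(_ I).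
by move=> [] fx0; have := fA _ Ax; rewrite fx0 ltxx.
Qed.

End integrals.

Section probability_integrals.
Context d (T : measurableType d) (R : realType).
Variable P : probability T R.
Implicit Types f g : T -> R.

Lemma ig_cst c : ig P (fun=> c).
Proof. by apply: finite_measure_integrable_cst. Qed.

Lemma Int_cst c : Int P (fun=> c) = c.
Proof.
by apply: EFin_inj; rewrite -(IntE (ig_cst c)) integral_cst// [X in (_ * X)%E]probability_setT mule1.
Qed.

Lemma ig_bounded0 f c : measurable_fun setT f -> (forall x, 0 <= f x <= c) -> ig P f.
Proof. by move=> mf fc; apply: ig_le0 mf fc (ig_cst c). Qed.

End probability_integrals.

(** * Euclidean geometry *)

Section dot.
Variable R : realType.

Lemma dotpC n (x y : 'rV[R]_n) : dotp x y = dotp y x.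
Proof. by apply: eq_bigr => i _; rewrite mulrC. Qed.

Lemma dotpDl n (x y z : 'rV[R]_n) : dotp (x + y) z = dotp x z + dotp y z.
Proof. by rewrite -big_split; apply: eq_bigr => i _; rewrite mxE mulrDl. Qed.

Lemma dotpZl n a (x y : 'rV[R]_n) : dotp (a *: x) y = a * dotp x y.
Proof. by rewrite /dotp mulr_sumr; apply: eq_bigr => i _; rewrite mxE mulrA. Qed.

Lemma dotpDr n (x y z : 'rV[R]_n) : dotp z (x + y) = dotp z x + dotp z y.
Proof. by rewrite dotpC dotpDl !(dotpC z). Qed.

Lemma dotpZr n a (x y : 'rV[R]_n) : dotp x (a *: y) = a * dotp x y.
Proof. by rewrite dotpC dotpZl dotpC. Qed.

Lemma dotpNl n (x y : 'rV[R]_n) : dotp (- x) y = - dotp x y.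
Proof. by rewrite -scaleN1r dotpZl mulN1r. Qed.

Lemma dotpNr n (x y : 'rV[R]_n) : dotp x (- y) = - dotp x y.
Proof. by rewrite dotpC dotpNl dotpC. Qed.

Lemma dotp0l n (y : 'rV[R]_n) : dotp 0 y = 0.
Proof. by rewrite -(scale0r 0) dotpZl mul0r. Qed.

Lemma dotp0r n (y : 'rV[R]_n) : dotp y 0 = 0.
Proof. by rewrite dotpC dotp0l. Qed.

Lemma dotp_ge0 n (x : 'rV[R]_n) : 0 <= dotp x x.
Proof. by apply: sumr_ge0 => i _; rewrite -expr2 sqr_ge0. Qed.

Lemma dotp_gt0 n (x : 'rV[R]_n) : x != 0 -> 0 < dotp x x.
Proof.
move=> x0; rewrite lt_neqAle dotp_ge0 andbT eq_sym; apply: contra x0.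
rewrite /dotp psumr_eq0; last by move=> i _; rewrite -expr2 sqr_ge0.
move=> /allP h; apply/eqP/rowP => i; rewrite mxE.
by have := h i (mem_index_enum _); rewrite mulf_eq0 orbb => /eqP.
Qed.

Lemma dotp_mulmx n p (x : 'rV[R]_n) (M : 'M[R]_(n, p)) (y : 'rV[R]_p) :
  dotp (x *m M) y = dotp x (y *m M^T).
Proof.
rewrite /dotp; under eq_bigr do rewrite mxE mulr_suml.
rewrite exchange_big; apply: eq_bigr => j _; rewrite mxE mulr_sumr.
by apply: eq_bigr => k _; rewrite !mxE; rewrite mulrAC -mulrA.
Qed.

Lemma dotp_row_mx a b (x : 'rV[R]_a) (y : 'rV[R]_b) x' y' :
  dotp (row_mx x y) (row_mx x' y') = dotp x x' + dotp y y'.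
Proof.
by rewrite /dotp big_split_ord; congr (_ + _); apply: eq_bigr => i _; rewrite ?row_mxEl ?row_mxEr.
Qed.

Lemma CS n (x y : 'rV[R]_n) : dotp x y ^+ 2 <= dotp x x * dotp y y.
Proof.
have [->|y0] := eqVneq y 0; first by rewrite !dotp0r expr0n mulr0.
have yy := dotp_gt0 y0.
have := dotp_ge0 (dotp y y *: x - dotp x y *: y).
rewrite -scaleNr !(dotpDl, dotpDr, dotpZl, dotpZr) (dotpC y x) => h.
rewrite -subr_ge0 -(pmulr_rge0 _ yy).
by apply: le_trans h _; rewrite le_eqVlt; apply/orP; left; apply/eqP; ring.
Qed.

Lemma enorm_ge0 n (x : 'rV[R]_n) : 0 <= enorm x.
Proof. exact: sqrtr_ge0. Qed.

Lemma enorm2 n (x : 'rV[R]_n) : enorm x ^+ 2 = dotp x x.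
Proof. by rewrite /enorm sqr_sqrtr// dotp_ge0. Qed.

Lemma enormZ n a (x : 'rV[R]_n) : enorm (a *: x) = `|a| * enorm x.
Proof. by rewrite /enorm dotpZl dotpZr mulrA -expr2 sqrtrM ?sqr_ge0// sqrtr_sqr. Qed.

Lemma enormN n (x : 'rV[R]_n) : enorm (- x) = enorm x.
Proof. by rewrite /enorm dotpNl dotpNr opprK. Qed.

Lemma CSe n (x y : 'rV[R]_n) : `|dotp x y| <= enorm x * enorm y.
Proof.
rewrite -sqrtr_sqr /enorm -sqrtrM ?dotp_ge0// ler_wsqrtr//; exact: CS.
Qed.

Lemma enorm_sq_le n (x : 'rV[R]_n) a : 0 <= a -> (enorm x <= a) = (dotp x x <= a ^+ 2).
Proof. by move=> a0; rewrite -enorm2 ler_sqr// nnegrE enorm_ge0. Qed.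

Lemma enormD n (x y : 'rV[R]_n) : enorm (x + y) <= enorm x + enorm y.
Proof.
rewrite enorm_sq_le ?addr_ge0 ?enorm_ge0// sqrrD !enorm2 dotpDl !dotpDr (dotpC y x).
have := ler_norm (dotp x y); have := CSe x y; lra.
Qed.

Lemma enorm_eq0 n (x : 'rV[R]_n) : enorm x = 0 -> x = 0.
Proof.
move=> x0; apply/eqP; apply: contraT => /dotp_gt0.
by rewrite -enorm2 x0 expr0n ltxx.
Qed.

Lemma continuous_dotpp n : continuous (fun x : 'rV[R]_n => dotp x x).
Proof.
apply: continuous_sum_ord => i x; apply: (@continuousM _ _ (fun x : 'rV[R]_n => x 0 i) (fun x : 'rV[R]_n => x 0 i)); exact: coord_continuous.
Qed.

Lemma continuous_enorm n : continuous (@enorm R n).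
Proof.
move=> x; apply: (@continuous_comp _ _ _ (fun x : 'rV[R]_n => dotp x x) Num.sqrt).
  exact: continuous_dotpp.
exact: sqrt_continuous.
Qed.

Lemma coord_le_enorm n (x : 'rV[R]_n) i : `|x 0 i| <= enorm x.
Proof.
rewrite -sqrtr_sqr /enorm ler_wsqrtr// /dotp (bigD1 i)//= -expr2 lerDl.
by apply: sumr_ge0 => j _; rewrite -expr2 sqr_ge0.
Qed.

Lemma compact_enorm n (A : set 'rV[R]_n) c : closed A -> (forall x, A x -> enorm x <= c) -> compact A.
Proof.
move=> clA Ac; apply: bounded_closed_compact => //.
exists c; split; first exact: num_real.
move=> e ce x Ax; rewrite /= (le_trans _ (ltW ce))//.
rewrite [leLHS]mx_normrE; apply/bigmax_leP; split => [|[i j] _ /=].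
  exact: le_trans (enorm_ge0 x) (Ac _ Ax).
by rewrite (ord1 i); apply: le_trans (coord_le_enorm x j) (Ac _ Ax).
Qed.

Lemma compact_ball n c : compact [set x : 'rV[R]_n | enorm x <= c].
Proof.
apply: (@compact_enorm n _ c) => //.
by apply: (@preimage_closed _ _ (@enorm R n) [set r | r <= c]);
  [move=> x _; exact: continuous_enorm|exact: closed_le].
Qed.

Lemma compact_enorm_bounded n (A : set 'rV[R]_n) : compact A -> exists c, 0 <= c /\ forall x, A x -> enorm x <= c.
Proof.
move=> cA; have [->|/set0P A0] := eqVneq A set0; first by exists 0.
have [x [Ax xm]] : exists x, A x /\ forall y, A y -> enorm y <= enorm x.
  have [x Ax H] := @compact_EVT_max _ R (@enorm R n) A A0 cA (continuous_subspaceT (@continuous_enorm n)).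
  by exists x; split; [rewrite inE in Ax|move=> y Ay; apply: H; rewrite inE].
by exists (enorm x); split; [exact: enorm_ge0|].
Qed.

Definition convexs n (C : set 'rV[R]_n) :=
  forall x y l, C x -> C y -> 0 < l < 1 -> C ((1 - l) *: x + l *: y).

(** The functional is [x - w], where [w] is the point of [C] nearest to [x]; it exists because only
    a compact part of [C] competes. *)
Lemma separation n (C : set 'rV[R]_n) (x : 'rV[R]_n) : closed C -> convexs C -> C !=set0 -> ~ C x ->
  exists v a, (forall y, C y -> dotp y v <= a) /\ a < dotp x v.
Proof.
move=> clC cC [z Cz] nCx.
pose A := C `&` [set y | enorm (y - x) <= enorm (z - x)].
have cf : continuous (fun y : 'rV[R]_n => enorm (y - x)).
  move=> y; apply: (@continuous_comp _ _ _ (fun y : 'rV[R]_n => y - x) (@enorm R n)).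
    by apply: (@continuousB _ _ _ (fun y : 'rV[R]_n => y) (fun=> x)); [exact: cvg_id|exact: cst_continuous].
  exact: continuous_enorm.
have cA : compact A.
  apply: (@compact_enorm n _ (enorm (z - x) + enorm x)).
    apply: closedI => //.
    by apply: (@preimage_closed _ _ (fun y : 'rV[R]_n => enorm (y - x)) [set r | r <= enorm (z - x)]);
      [move=> y _; exact: cf|exact: closed_le].
  move=> y [_ yz]; rewrite -(subrK x y); apply: le_trans (enormD _ _) _.
  by rewrite lerD2r.
have A0 : A !=set0 by exists z; split => //=.
have [w Aw wm] := @compact_EVT_min _ R (fun y : 'rV[R]_n => enorm (y - x)) A A0 cA (continuous_subspaceT cf).
move: Aw; rewrite inE => -[Cw wz].
have wmin y : C y -> enorm (w - x) <= enorm (y - x).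
  move=> Cy; have [h|h] := leP (enorm (y - x)) (enorm (z - x)).
    by apply: wm; rewrite inE.
  exact: le_trans wz (ltW h).
have v0 : x - w != 0 by rewrite subr_eq0; apply/eqP => xw; apply: nCx; rewrite xw.
have vv := dotp_gt0 v0.
exists (x - w), (dotp w (x - w)); split; last by rewrite -subr_gt0 -dotpNl -dotpDl.
move=> y Cy; rewrite leNgt; apply/negP => h.
set v := x - w in vv h *.
pose u := y - w.
have uv : 0 < dotp u v by rewrite /u dotpDl dotpNl subr_gt0.
have uu := dotp_ge0 u.
(* A step towards [y] short enough that the linear gain [2 l <u,v>] exceeds the quadratic loss
   [l^2 |u|^2], and smaller than one. *)
pose l := dotp u v / (dotp u u + dotp u v + 1).
have den : 0 < dotp u u + dotp u v + 1 by lra.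
have l0 : 0 < l by rewrite /l divr_gt0.
have l1 : l < 1 by rewrite /l ltr_pdivrMr// mul1r; lra.
have l01 : 0 < l < 1 by rewrite l0 l1.
have := wmin _ (cC _ _ _ Cw Cy l01).
rewrite enorm_sq_le ?enorm_ge0// enorm2.
have -> : w - x = - v by rewrite /v opprB.
have -> : (1 - l) *: w + l *: y - x = l *: u - v.
  by apply/rowP => i; rewrite /u /v !mxE; ring.
have expand (a b : 'rV[R]_n) : dotp (l *: a - b) (l *: a - b) = l * (l * dotp a a) - l * (2 * dotp a b) + dotp b b.
  by rewrite !(dotpDl, dotpDr, dotpNl, dotpNr, dotpZl, dotpZr) (dotpC b a); ring.
rewrite expand dotpNl dotpNr opprK => H.
have H2 : l * (2 * dotp u v) <= l * (l * dotp u u) by lra.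
have H3 : 2 * dotp u v <= l * dotp u u by rewrite -(ler_pM2l l0).
have H4 : l * dotp u u <= dotp u v.
  rewrite /l mulrAC ler_pdivrMr// ler_wpM2l ?ltW//; lra.
lra.
Qed.

End dot.

(** * Log-concave functions and Gaussian integrals *)

Section lcf.
Variable R : realType.
Implicit Types n : nat.
Local Notation "'leb' n" := (@leb R n) (at level 9, n at level 9).

Lemma measurable_dotp n (y : 'rV[R]_n) : measurable_fun setT (fun x : borel R n => dotp (x : 'rV[R]_n) y).
Proof. by apply: measurable_fun_continuous_rV; exact: continuous_dotp. Qed.

Lemma measurable_dotpp n : measurable_fun setT (fun x : borel R n => dotp (x : 'rV[R]_n) x).
Proof. by apply: measurable_fun_continuous_rV; exact: continuous_dotpp. Qed.

Lemma measurable_expRT d (T : measurableType d) (f : T -> R) :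
  measurable_fun setT f -> measurable_fun setT (fun x => expR (f x)).
Proof. by move=> mf; exact: measurableT_comp mf. Qed.

Lemma measurable_aff n p (M : 'M[R]_(n, p)) (b : 'rV[R]_p) :
  measurable_fun setT ((fun x => x *m M + b) : borel R n -> borel R p).
Proof. exact: measurableT_comp (measurable_add b) (measurable_lin M). Qed.

Lemma measurable_expaff n p (M : 'M[R]_(n, p)) (b : 'rV[R]_p) (a : R) :
  measurable_fun setT (fun x : borel R n => expR (a * dotp (x *m M + b) (x *m M + b))).
Proof.
apply: measurable_expRT; apply: measurable_funM => //.
exact: measurableT_comp (@measurable_dotpp p) (measurable_aff M b).
Qed.

Lemma lcf_mul n (f g : 'rV[R]_n -> R) : (forall x, 0 <= f x) -> (forall x, 0 <= g x) ->
  lcf f -> lcf g -> lcf (fun x => f x * g x).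
Proof.
move=> f0 g0 lf lg x y l l01; rewrite !powRM// mulrACA.
by apply: ler_pM; rewrite ?mulr_ge0 ?powR_ge0//; [exact: lf|exact: lg].
Qed.

Lemma powR_expR (a l : R) : expR a `^ l = expR (l * a).
Proof. by rewrite /powR gt_eqF ?expR_gt0// expRK. Qed.

Lemma lcf_expR n (phi : 'rV[R]_n -> R) :
  (forall x y l, 0 < l < 1 -> (1 - l) * phi x + l * phi y <= phi ((1 - l) *: x + l *: y)) ->
  lcf (fun x => expR (phi x)).
Proof. by move=> cphi x y l l01; rewrite !powR_expR -expRD ler_expR; exact: cphi. Qed.

Lemma lcf_affine n p (M : 'M[R]_(n, p)) (b : 'rV[R]_p) (f : 'rV[R]_p -> R) :
  lcf f -> lcf (fun x => f (x *m M + b)).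
Proof.
move=> lf x y l l01; apply: le_trans (lf _ _ _ l01) _.
rewrite le_eqVlt; apply/orP; left; apply/eqP; congr f.
rewrite mulmxDl -!scalemxAl !scalerDr addrACA; congr (_ + _).
by apply/rowP => i; rewrite !mxE; ring.
Qed.

Lemma lcf_gauss n (a : R) : 0 <= a -> lcf (fun x : 'rV[R]_n => expR (- a * dotp x x)).
Proof.
move=> a0; apply: lcf_expR => x y l /andP[l0 l1].
rewrite !(dotpDl, dotpDr, dotpZl, dotpZr) (dotpC y x).
have h := dotp_ge0 (x - y); rewrite !(dotpDl, dotpDr, dotpNl, dotpNr) (dotpC y x) in h.
rewrite -subr_ge0.
have : 0 <= a * (l * (1 - l)) * (dotp x x - dotp x y + (- dotp x y - - dotp y y)).
  by rewrite mulr_ge0// mulr_ge0// mulr_ge0 ?ltW// subr_gt0.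
move=> H; apply: le_trans H _; rewrite le_eqVlt; apply/orP; left; apply/eqP; ring.
Qed.

Lemma lcf_explin n (y : 'rV[R]_n) : lcf (fun x : 'rV[R]_n => expR (dotp x y)).
Proof. by apply: lcf_expR => x z l _; rewrite dotpDl !dotpZl. Qed.

Lemma lcf_cst n (c : R) : 0 <= c -> lcf (fun x : 'rV[R]_n => c).
Proof.
move=> c0 x y l /andP[l0 l1]; have [->|c1] := eqVneq c 0.
  by rewrite [X in _ * X]powR0 ?gt_eqF// mulr0.
rewrite -powRD; last by apply/implyP => _; rewrite c1.
by rewrite subrK powRr1.
Qed.

Lemma lcf_mid n (f : 'rV[R]_n -> R) x y : (forall x, 0 <= f x) -> lcf f ->
  f x * f y <= f (2^-1 *: (x + y)) ^+ 2.
Proof.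
move=> f0 lf; have h : 0 < (2^-1 : R) < 1 by apply/andP; split; lra.
have := lf x y _ h.
rewrite (_ : 1 - 2^-1 = 2^-1 :> R); last by lra.
rewrite -scalerDr !powR12_sqrt// => H.
rewrite -[leLHS](@sqr_sqrtr R) ?mulr_ge0// sqrtrM//.
by rewrite ler_sqr// nnegrE ?mulr_ge0 ?sqrtr_ge0.
Qed.

Lemma lcf_even_max n (f : 'rV[R]_n -> R) x : (forall x, 0 <= f x) -> lcf f ->
  (forall x, f (- x) = f x) -> f x <= f 0.
Proof.
move=> f0 lf ef; have := lcf_mid x (- x) f0 lf.
by rewrite subrr scaler0 ef -expr2 ler_sqr// nnegrE.
Qed.

(** Prekopa's theorem on marginals of log-concave functions. *)
Lemma lcf_marginal a b (mu : {sigma_finite_measure set (borel R b) -> \bar R})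
    (F : 'rV[R]_a -> 'rV[R]_b -> R) : lcm mu ->
  (forall x y, 0 <= F x y) -> (forall x, ig mu (F x)) ->
  (forall x y x' y' l, 0 < l < 1 ->
    F x y `^ (1 - l) * F x' y' `^ l <= F ((1 - l) *: x + l *: x') ((1 - l) *: y + l *: y')) ->
  lcf (fun x => Int mu (F x)).
Proof.
move=> mulc F0 Fi lF x x' l l01.
have := pl mulc l01 (ig_measurable (Fi x)) (ig_measurable (Fi x')) (ig_measurable (Fi _)) (F0 x) (F0 x') (F0 _)
  (fun y y' => lF x y x' y' l l01).
by rewrite !IntE// ?ltry ?poweR_EFin -?EFinM ?lee_fin; apply.
Qed.

(** Shifting [k] by [b] or by [-b] gives the same integral, by symmetry, and the two shifted
    products have [f k] above their geometric mean at midpoints. Prekopa-Leindler with weight one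
    half concludes. *)
Lemma anderson n (mu : {sigma_finite_measure set (borel R n) -> \bar R})
    (f k : 'rV[R]_n -> R) (b : 'rV[R]_n) : lcm mu ->
  (forall h : 'rV[R]_n -> R, measurable_fun setT (h : borel R n -> R) -> (forall x, 0 <= h x) ->
     (\int[mu]_x (h (- x)%R)%:E = \int[mu]_x (h x)%:E)%E) ->
  (forall x, 0 <= f x) -> (forall x, 0 <= k x) -> lcf f -> lcf k ->
  (forall x, f (- x) = f x) -> (forall x, k (- x) = k x) ->
  measurable_fun setT (f : borel R n -> R) -> measurable_fun setT (k : borel R n -> R) ->
  ig mu (fun x => f x * k (x + b)) -> ig mu (fun x => f x * k x) ->
  Int mu (fun x => f x * k (x + b)) <= Int mu (fun x => f x * k x).
Proof.
move=> mulc muN f0 k0 lf lk ef ek mf mk i1 i0.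
have F0 c x : 0 <= f x * k (x + c) by rewrite mulr_ge0.
have mF : measurable_fun setT (fun x : borel R n => f x * k (x + b)) by exact: ig_measurable i1.
have mF' : measurable_fun setT (fun x : borel R n => f x * k (x - b)).
  by apply: measurable_funM => //; exact: measurableT_comp mk (measurable_add (- b)).
have e : (\int[mu]_x (f x * k (x - b))%:E = \int[mu]_x (f x * k (x + b))%:E)%E.
  rewrite -(muN _ mF (F0 b)); apply: eq_integral => x _; congr (_ %:E).
  by rewrite ef -[k (- x + b)]ek opprD opprK.
have h : 0 < (2^-1 : R) < 1 by apply/andP; split; lra.
have := pl mulc h mF mF' (ig_measurable i0) (F0 b) (F0 (- b)) (fun x => mulr_ge0 (f0 x) (k0 x)).
rewrite e !IntE// !poweR_EFin -EFinM lee_fin -powRD; last first.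
  by rewrite subrK oner_eq0.
rewrite subrK powRr1; last by apply: Int_ge0 => x; exact: F0.
apply; rewrite ?ltry// => x y; rewrite !powRM// mulrACA.
apply: ler_pM; rewrite ?mulr_ge0 ?powR_ge0//; first exact: lf.
apply: le_trans (lk _ _ _ h) _.
rewrite (_ : 1 - 2^-1 = 2^-1 :> R); last by lra.
rewrite le_eqVlt; apply/orP; left; apply/eqP; congr k.
by apply/rowP => i; rewrite !mxE; lra.
Qed.

Lemma lebN n (h : 'rV[R]_n -> R) : measurable_fun setT (h : borel R n -> R) -> (forall x, 0 <= h x) ->
     (\int[leb n]_x (h (- x)%R)%:E = \int[leb n]_x (h x)%:E)%E.
Proof.
move=> mh h0.
have u : (- 1)%:M \in @unitmx R n by rewrite unitmxE det_scalar unitrX// unitrN1.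
rewrite -(@jacobian_unitmx R n _ u (fun x => (h x)%:E)).
- rewrite det_scalar normrX normrN1 expr1n mul1e; apply: eq_integral => x _.
  by rewrite mul_mx_scalar scaleN1r.
- exact/measurable_EFinP.
- by move=> x; rewrite lee_fin.
Qed.

Lemma gauss1 (s : R) : 0 < s ->
  (\int[lebesgue_measure]_t (expR (- (s * t ^+ 2) / 2))%:E = (Num.sqrt (2 * pi / s))%:E)%E.
Proof.
move=> s0; have s2 : 0 < Num.sqrt (s / 2) by rewrite sqrtr_gt0 divr_gt0.
have := @ge0_integral_affine R (Num.sqrt (s / 2)) 0 (fun t => (gauss_fun t)%:E) (lt0r_neq0 s2).
rewrite integralT_gauss gtr0_norm// => H.
have {H} := H _ (fun x => gauss_fun_ge0 x).
have mg : measurable_fun setT (fun t : measurableTypeR R => (gauss_fun t)%:E).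
  by apply/measurable_EFinP; exact: measurable_gauss_fun.
move=> /(_ mg).
have E t : gauss_fun (Num.sqrt (s / 2) * t + 0) = expR (- (s * t ^+ 2) / 2).
  by rewrite /gauss_fun addr0 exprMn sqr_sqrtr ?divr_ge0 ?ltW//; congr expR; lra.
under eq_integral do rewrite E.
set J := integral _ _ _ => H.
have -> : J = ((Num.sqrt (s / 2))^-1%:E * ((Num.sqrt (s / 2))%:E * J))%E.
  by rewrite muleA -EFinM mulVf ?mul1e// lt0r_neq0.
rewrite H -EFinM; congr (_ %:E).
rewrite -sqrtrV ?divr_ge0 ?ltW// -sqrtrM ?invr_ge0 ?divr_ge0 ?ltW//.
by congr Num.sqrt; rewrite invf_div mulrAC.
Qed.

Lemma gauss_diag n (s : 'rV[R]_n) : (forall i, 0 < s 0 i) ->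
  (\int[leb n]_x (expR (- (\sum_i s 0 i * x 0 i ^+ 2) / 2))%:E =
   (\prod_i Num.sqrt (2 * pi / s 0 i))%:E)%E.
Proof.
elim: n s => [|n ih] s s0.
  rewrite ge0_integral_leb0; last by move=> x; rewrite lee_fin expR_ge0.
  by rewrite !big_ord0 oppr0 mul0r expR0.
have mf k (u : 'rV[R]_k) : measurable_fun setT (fun x : borel R k => (expR (- (\sum_i u 0 i * (x : 'rV_k) 0 i ^+ 2) / 2))%:E).
  apply/measurable_EFinP; apply: measurable_fun_continuous_rV.
  move=> x; apply: continuous_comp; last exact: continuous_expR.
  apply: (@continuousM _ _ (fun x : 'rV[R]_k => - (\sum_i u 0 i * x 0 i ^+ 2)) (fun=> 2^-1)); last exact: cst_continuous.
  apply: (@continuousN _ _ _ (fun x : 'rV[R]_k => (\sum_i u 0 i * x 0 i ^+ 2))).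
  apply: (@continuous_sum_ord _ _ _ (fun i x => u 0 i * x 0 i ^+ 2)) => i z.
  apply: (@continuousM _ _ (fun=> u 0 i) (fun x : 'rV[R]_k => x 0 i ^+ 2)); first exact: cst_continuous.
  apply: (@continuousM _ _ (fun x : 'rV[R]_k => x 0 i) (fun x : 'rV[R]_k => x 0 i)); exact: coord_continuous.
rewrite ge0_integral_lebS//.
pose u : 'rV[R]_n := \row_i s 0 (lift ord0 i).
have uE i : u 0 i = s 0 (lift ord0 i) by rewrite mxE.
have A1 t (y : 'rV[R]_n) : (rowp1 (t, y) : 'rV_n.+1) 0 ord0 = t.
  rewrite /rowp1 /= (_ : ord0 = lshift n (0 : 'I_1)); last exact/val_inj.
  by rewrite (@row_mxEl R 1 1 n) mxE eqxx.
have A2 t (y : 'rV[R]_n) i : (rowp1 (t, y) : 'rV_n.+1) 0 (lift ord0 i) = y 0 i.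
  rewrite /rowp1 /= (_ : lift ord0 i = rshift 1 i); last exact/val_inj.
  by rewrite (@row_mxEr R 1 1 n).
have E t (y : 'rV[R]_n) : (expR (- (\sum_i s 0 i * (rowp1 (t, y) : 'rV_n.+1) 0 i ^+ 2) / 2))%:E =
    ((expR (- (s 0 0 * t ^+ 2) / 2))%:E * (expR (- (\sum_i u 0 i * y 0 i ^+ 2) / 2))%:E)%E.
  rewrite -EFinM -expRD big_ord_recl A1 opprD mulrDl.
  by under eq_bigr do rewrite A2 -uE.
under eq_integral do (under eq_integral do rewrite E).
under eq_integral => t _.
  rewrite ge0_integralZl//.
  rewrite ih; last by move=> i; rewrite uE.
  over.
rewrite ge0_integralZr//.
- rewrite gauss1// -EFinM big_ord_recl; congr ((_ * _)%:E).
  by apply: eq_bigr => i _; rewrite uE.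
- apply/measurable_EFinP; apply: measurable_expRT; apply: measurable_funM => //.
  by apply: measurable_funN; apply: measurable_funM.
- by rewrite lee_fin prodr_ge0// => i _; rewrite sqrtr_ge0.
Qed.

Lemma ig_gauss_diag n (s : 'rV[R]_n) : (forall i, 0 < s 0 i) ->
  ig (leb n) (fun x => expR (- (\sum_i s 0 i * x 0 i ^+ 2) / 2)) /\
  Int (leb n) (fun x => expR (- (\sum_i s 0 i * x 0 i ^+ 2) / 2)) = \prod_i Num.sqrt (2 * pi / s 0 i).
Proof.
move=> s0; apply: Int_eqE; last exact: gauss_diag.
  apply: measurable_expRT; apply: measurable_funM => //; apply: measurable_funN.
  apply: measurable_sum => i; apply: measurable_funM => //.
  by apply: measurable_funX; exact: measurable_fun_coord.
by move=> x; exact: expR_ge0.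
Qed.

End lcf.

(** * Borell's lemma *)

Section borell.
Variable R : realType.
Local Notation mu1 := (@lebesgue_measure R).

Lemma expR_pow_le (z : R) k : 0 <= z -> z ^+ k <= k%:R ^+ k * expR z.
Proof.
move=> z0; case: k => [|k]; first by rewrite !expr0 mul1r -expR0 ler_expR.
have k0 : 0 < k.+1%:R :> R by [].
rewrite -[X in expR X](@divfK _ k.+1%:R) ?gt_eqF// [X in expR X]mulrC expRM_natl -exprMn.
apply: lerXn2r; rewrite ?nnegrE ?mulr_ge0 ?expR_ge0//.
rewrite -ler_pdivrMl// mulrC; apply: le_trans (expR_ge1Dx _).
by rewrite lerDr.
Qed.

(** The majorant used in [borell_exp]: [e^u] on the negative half-line and [2 e^(-u)] on the
    positive one, of masses 1 and 2. *)
Lemma integral_exp_tail : (\int[mu1]_u (((fun s => (expR s)%:E) \_ `]-oo, 0%R]%classic) u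
    + 2%:E * ((fun s => (expR s)%:E) \_ `]-oo, 0%R]%classic) (- u)%R) = 3%:E)%E.
Proof.
set g := (_ \_ _).
have g0 u : (0 <= g u)%E by rewrite /g patchE; case: ifP => // _; rewrite lee_fin expR_ge0.
have mg : measurable_fun setT (g : measurableTypeR R -> \bar R).
  apply/(measurable_restrictT _ _).1 => //; apply: measurable_funTS.
  by apply/measurable_EFinP; exact: measurable_expR.
have Ig : (\int[mu1]_u g u = 1)%E by rewrite -integral_mkcond integral_expR_Nyc expR0.
have mgN : measurable_fun setT ((fun u => g (- u)) : measurableTypeR R -> \bar R).
  by apply: measurableT_comp mg _; exact: measurable_funN.
have IgN : (\int[mu1]_u g (- u)%R = 1)%E.
  have m1 : (-1 : R) != 0 by rewrite oppr_eq0 oner_neq0.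
  have := @ge0_integral_affine R (-1) 0 g m1 mg g0.
  rewrite normrN1 mul1e Ig => <-.
  by apply: eq_integral => u _; rewrite mulN1r addr0.
rewrite ge0_integralD//.
- rewrite Ig ge0_integralZl// IgN mule1 -EFinD; congr (_%:E); lra.
- by move=> u _; rewrite mule_ge0.
- exact: measurable_funeM.
Qed.

Variables (n : nat) (P : probability (borel R n) R).
Hypothesis lcP : lcm P.
Variable v : 'rV[R]_n.
Let xi (x : 'rV[R]_n) := dotp x v.

Let mxi : measurable_fun setT (fun x : borel R n => `|xi x|).
Proof. by apply: measurableT_comp => //; exact: measurable_dotp. Qed.

Let mge (s : R) : measurable ([set x | s <= `|xi x|] : set (borel R n)).
Proof. by apply: measurable_set_le => //; exact: measurable_cst. Qed.

Let mle (s : R) : measurable ([set x | `|xi x| <= s] : set (borel R n)).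
Proof. by apply: measurable_set_le => //; exact: measurable_cst. Qed.

(** A combination of a point with [|xi| <= s] and one with [|xi| >= r s] still has [|xi| >= s].
    Since the first set has probability at least 3/4 and the target at most 1/4, log-concavity
    forces the far set to be exponentially small. *)
Lemma borell_tail (s r : R) : 0 < s -> (P [set x | (s <= `|xi x|)%R] <= (4^-1)%:E)%E -> 0 <= r ->
  (P [set x | (r * s <= `|xi x|)%R] <= (2 * expR (- r / 3))%:E)%E.
Proof.
move=> s0 Ps r0.
have fP A : measurable A -> P A \is a fin_num by move=> mA; exact: fin_num_measure.
have [r1|r1] := leP r 1.
  apply: le_trans (probability_le1 P (mge _)) _; rewrite lee_fin.
  have := expR_ge1Dx (- r / 3); lra.
set A : set (borel R n) := [set x | `|xi x| <= s]; set B : set (borel R n) := [set x | r * s <= `|xi x|].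
set C : set (borel R n) := [set x | s <= `|xi x|] in Ps.
have mA : measurable A by exact: mle.
have mB : measurable B by exact: mge.
have mC : measurable C by exact: mge.
(* Chosen so that [l r s - (1 - l) s = s]. Then [l r = 2 - l < 2], which keeps [1 - l r / 3] above
   1/3 at the end. *)
pose l := 2 / (r + 1).
have r1' : 0 < r + 1 by lra.
have l0 : 0 < l by rewrite divr_gt0.
have l1 : l < 1 by rewrite /l ltr_pdivrMr// mul1r; lra.
have lr : l * (r + 1) = 2 by rewrite /l divfK// gt_eqF.
have l01 : 0 < l < 1 by rewrite l0 l1.
have PA : 3 / 4 <= fine (P A).
  rewrite -lee_fin fineK ?fP//.
  have : (P (~` C) <= P A)%E.
    apply: le_measure; rewrite ?inE//; first exact: measurableC.
    by move=> x; rewrite /C /A /= => /negP; rewrite -ltNge => /ltW.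
  apply: le_trans; rewrite probability_setC// -(fineK (fP _ mC)) -EFinB lee_fin.
  by move: Ps; rewrite -(fineK (fP _ mC)) lee_fin; lra.
have [lc _] := lcP.
have {}H : fine (P A) `^ (1 - l) * fine (P B) `^ l <= 4^-1.
  have H : (P A `^ (1 - l) * P B `^ l <= P C)%E.
    apply: (slc_measurable (lcm_regular lcP) lc l01 mA mB mC); rewrite -?ge0_fin_numE ?fP//.
    move=> a b Aa Bb; rewrite /C /= /xi dotpDl !dotpZl.
    have h1 : `|l * dotp b v| = l * `|dotp b v| by rewrite normrM gtr0_norm.
    have h2 : `|(1 - l) * dotp a v| = (1 - l) * `|dotp a v| by rewrite normrM gtr0_norm// subr_gt0.
    have h3 : `|l * dotp b v| - `|(1 - l) * dotp a v| <= `|(1 - l) * dotp a v + l * dotp b v|.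
      by rewrite [X in _ <= `|X|]addrC; exact: lerB_normD.
    apply: le_trans h3; rewrite h1 h2.
    have h4 : l * (r * s) <= l * `|dotp b v| by rewrite ler_pM2l.
    have h5 : (1 - l) * `|dotp a v| <= (1 - l) * s by rewrite ler_pM2l// subr_gt0.
    have h6 : (l * (r + 1)) * s = 2 * s by rewrite lr.
    lra.
  have := le_trans H Ps; rewrite -(fineK (fP _ mA)) -(fineK (fP _ mB)).
  by rewrite !poweR_EFin -EFinM lee_fin.
rewrite -(fineK (fP _ mB)) lee_fin; rewrite leNgt; apply/negP => pB.
have pB' : expR (- r / 3) < fine (P B).
  by apply: le_lt_trans pB; rewrite ler_peMl ?expR_ge0//; lra.
have h7 : 3 / 4 <= fine (P A) `^ (1 - l).
  have A1 : fine (P A) <= 1 by rewrite -lee_fin fineK ?fP// probability_le1.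
  have [->|/eqP A1'] := eqVneq (fine (P A)) 1; first by rewrite powR1; lra.
  have a01 : 0 < fine (P A) <= 1 by rewrite A1 andbT; lra.
  apply: le_trans PA _; rewrite -[leLHS]powRr1 ?fine_ge0//.
  by apply: ger_powR => //; lra.
have h8 : 1 - l * r / 3 <= fine (P B) `^ l.
  apply: (@le_trans _ _ (expR (- r / 3) `^ l)).
    rewrite powR_expR; apply: le_trans (expR_ge1Dx _); lra.
  by apply: ge0_ler_powR; rewrite ?nnegrE ?expR_ge0 ?fine_ge0// ltW.
have h9 : 0 < 1 - l * r / 3 by lra.
have : 3 / 4 * (1 - l * r / 3) <= fine (P A) `^ (1 - l) * fine (P B) `^ l.
  by apply: ler_pM => //; lra.
lra.
Qed.

(** The scale [6 s] turns the level [e^u] into the tail at [6 u s], which is at most [2 e^(-2u)];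
    against the weight [e^u] this leaves [2 e^(-u)]. *)
Lemma borell_exp (s : R) : 0 < s -> (P [set x | (s <= `|xi x|)%R] <= (4^-1)%:E)%E ->
  ig P (fun x => expR (`|xi x| / (6 * s))) /\ Int P (fun x => expR (`|xi x| / (6 * s))) <= 3.
Proof.
move=> s0 Ps.
have mf : measurable_fun setT (fun x : borel R n => expR (`|xi x| / (6 * s))).
  by apply: measurable_expRT; exact: measurable_funM.
apply: Int_lee => //.
rewrite (exp_layer_cake P mf); last by move=> x; exact: expR_ge0.
rewrite -integral_exp_tail.
have mS : measurable [set z : measurableTypeR R * borel R n | expR z.1 <= expR (`|xi z.2| / (6 * s))].
  apply: measurable_set_le; first exact: measurableT_comp measurable_fst.
  exact: measurableT_comp mf measurable_snd.
have g0 (u : R) : (0 <= ((fun s => (expR s)%:E) \_ `]-oo, 0%R]%classic) u)%E.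
  by rewrite patchE; case: ifP => // _; rewrite lee_fin expR_ge0.
have mg : measurable_fun setT (((fun s => (expR s)%:E) \_ `]-oo, 0%R]%classic) : measurableTypeR R -> \bar R).
  apply/(measurable_restrictT _ _).1 => //; apply: measurable_funTS.
  by apply/measurable_EFinP; exact: measurable_expR.
apply: ge0_le_integral => //.
- by move=> u _; rewrite mule_ge0// lee_fin expR_ge0.
- apply: emeasurable_funM; first by apply/measurable_EFinP; exact: measurable_expR.
  have := measurable_fun_xsection P mS; congr (measurable_fun _ _); apply/funext => u.
  by congr (P _); apply/seteqP; split => x; rewrite /xsection /= inE.
- apply: emeasurable_funD => //; apply: measurable_funeM.
  by apply: measurableT_comp mg _; exact: measurable_funN.
move=> u _.
have -> : [set x : borel R n | expR u <= expR (`|xi x| / (6 * s))] = [set x | 6 * u * s <= `|xi x|].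
  apply/seteqP; split => x /=; rewrite ler_expR ler_pdivlMr ?mulr_gt0//.
    by rewrite mulrA (mulrC u).
  by rewrite mulrA (mulrC u).
have [u0|u0] := leP u 0.
  apply: (@le_trans _ _ (expR u)%:E).
    by rewrite -[leRHS]mule1 lee_wpmul2l ?lee_fin ?expR_ge0// probability_le1.
  by rewrite [X in (X + _)%E]patchE mem_set /= ?in_itv//=; rewrite leeDl// mule_ge0.
rewrite [X in (X + _)%E]patchE memNset /= ?in_itv /= ?add0e; last by apply/negP; rewrite -ltNge.
rewrite patchE mem_set /= ?in_itv /= ?oppr_le0 ?(ltW u0)//.
have := borell_tail s0 Ps (_ : 0 <= 6 * u); move=> /(_ (mulr_ge0 _ (ltW u0))) H.
apply: (@le_trans _ _ ((expR u)%:E * (2 * expR (- (6 * u) / 3))%:E)%E).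
  by rewrite lee_wpmul2l ?lee_fin ?expR_ge0// H.
rewrite -!EFinM lee_fin mulrCA -expRD le_eqVlt; apply/orP; left; apply/eqP.
by congr (_ * expR _); lra.
Qed.

Lemma tail_exists : exists2 s : R, 0 < s & (P [set x | (s <= `|xi x|)%R] <= (4^-1)%:E)%E.
Proof.
pose D N := [set x : borel R n | N.+1%:R <= `|xi x|].
have cap : \bigcap_N D N = set0.
  rewrite -subset0 => x Dx; have := Dx (Num.trunc `|xi x|) I; rewrite /D /=.
  by apply/negP; rewrite -ltNge truncnS_gt.
have hD : {homo D : i j / (i <= j)%N >-> j `<=` i}.
  by move=> i j ij x; apply: le_trans; rewrite ler_nat ltnS.
have D0 : (P (D 0%N) < +oo)%E by apply: le_lt_trans (probability_le1 P (mge _)) (ltry _).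
have Dc : (P (\bigcap_N D N) < (4^-1)%:E)%E by rewrite cap measure0 lte_fin; lra.
have [N /ltW Ne] := decreasing_eventually_lt (fun j => mge j.+1%:R) D0 hD Dc.
by exists N.+1%:R.
Qed.

Lemma ig_exp_lin : exists2 c : R, 0 < c & ig P (fun x => expR (c * `|xi x|)).
Proof.
have [s s0 Ps] := tail_exists; exists (6 * s)^-1; first by rewrite invr_gt0 mulr_gt0.
by have [+ _] := borell_exp s0 Ps; apply: eq_ig => x; rewrite mulrC.
Qed.

Lemma ig_pow k : ig P (fun x => `|xi x| ^+ k).
Proof.
have [c c0 ic] := ig_exp_lin.
apply: ig_le0 (igZ (c^-1 ^+ k * k%:R ^+ k) ic); first exact: measurable_funX.
move=> x; rewrite exprn_ge0//= -mulrA -ler_pdivrMl ?exprn_gt0 ?invr_gt0//.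
rewrite -exprVn invrK -exprMn; apply: expR_pow_le.
by rewrite mulr_ge0// ltW.
Qed.

(** The factor [256 = 4^4] comes from [t^4 <= 4^4 e^t], [6^4] from the scale [6 s], and
    [48 = 16 * 3] from [s = 2 sqrt V], the Chebyshev threshold for probability 1/4, and the
    exponential moment bound 3. *)
Definition borell_const : R := 256 * 6 ^+ 4 * 48.

Lemma fourth_moment : 0 < Int P (fun x => xi x ^+ 2) ->
  Int P (fun x => xi x ^+ 4) <= borell_const * Int P (fun x => xi x ^+ 2) ^+ 2.
Proof.
set V := Int _ _ => V0.
have mxi' : measurable_fun setT (fun x : borel R n => xi x) by exact: measurable_dotp.
have E2 x : `|xi x| ^+ 2 = xi x ^+ 2 by rewrite real_normK// num_real.
have E4 x : `|xi x| ^+ 4 = xi x ^+ 4 by rewrite (exprM _ 2 2) E2 -exprM.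
have i2 : ig P (fun x => xi x ^+ 2) by apply: eq_ig (ig_pow 2).
have i4 : ig P (fun x => xi x ^+ 4) by apply: eq_ig (ig_pow 4).
have sV : 0 < Num.sqrt V by rewrite sqrtr_gt0.
pose s := 2 * Num.sqrt V; have s0 : 0 < s by rewrite mulr_gt0.
have s2 : s ^+ 2 = 4 * V by rewrite /s exprMn sqr_sqrtr ?ltW//; congr (_ * _); lra.
have Ps : (P [set x | (s <= `|xi x|)%R] <= (4^-1)%:E)%E.
  have mS := mge s.
  have iI : ig P (fun x => s ^+ 2 * (\1_[set x | s <= `|xi x|] x : R)).
    apply: igZ; apply: (@ig_bounded0 _ _ _ P _ 1); first exact: measurable_indic.
    by move=> x; rewrite indicE; case: (_ \in _); rewrite ?lexx ?ler01.
  have : Int P (fun x => s ^+ 2 * (\1_[set x | s <= `|xi x|] x : R)) <= V.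
    apply: Int_le => // x; rewrite indicE; case: (boolP (x \in _)) => [/set_mem /= sx|_].
      by rewrite mulr1 -E2; apply: lerXn2r => //; rewrite nnegrE ltW.
    by rewrite mulr0 sqr_ge0.
  rewrite -lee_fin -IntE//; under eq_integral do rewrite EFinM.
  rewrite ge0_integralZl//; [|by apply/measurable_EFinP; exact: measurable_indic|by rewrite lee_fin sqr_ge0].
  have -> : (\int[P]_x (\1_[set x | (s <= `|xi x|)%R] x)%:E = P [set x | (s <= `|xi x|)%R])%E.
    by rewrite integral_indic// setIT.
  rewrite s2 -(fineK (fin_num_measure P _ mS)) -EFinM !lee_fin.
  by rewrite mulrAC ger_pMl//; lra.
have [iE IE] := borell_exp s0 Ps.
have : Int P (fun x => xi x ^+ 4) <= Int P (fun x => (256 * (6 * s) ^+ 4) * expR (`|xi x| / (6 * s))).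
  apply: Int_le => //; first exact: igZ.
  move=> x; rewrite -E4; have s6 : 0 < 6 * s by rewrite mulr_gt0.
  have := expR_pow_le 4 (divr_ge0 (normr_ge0 (xi x)) (ltW s6)).
  rewrite exprMn exprVn ler_pdivrMr ?exprn_gt0// => /le_trans; apply.
  rewrite le_eqVlt; apply/orP; left; apply/eqP.
  ring.
rewrite IntZ// => /le_trans; apply.
have s4 : s ^+ 4 = 16 * V ^+ 2 by rewrite (exprM _ 2 2) s2 exprMn; congr (_ * _); lra.
rewrite exprMn s4; have V2 : 0 <= V ^+ 2 by rewrite sqr_ge0.
apply: (@le_trans _ _ (256 * (6 ^+ 4 * (16 * V ^+ 2)) * 3)).
  by rewrite ler_wpM2l// mulr_ge0// mulr_ge0 ?exprn_ge0// mulr_ge0.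
by rewrite /borell_const le_eqVlt; apply/orP; left; apply/eqP; ring.
Qed.

End borell.

(** * Even isotropic log-concave laws *)

Section laws.
Variable R : realType.

Definition evenm n (mu : {measure set (borel R n) -> \bar R}) :=
  forall h : 'rV[R]_n -> R, measurable_fun setT (h : borel R n -> R) -> (forall x, 0 <= h x) ->
     (\int[mu]_x (h (- x)%R)%:E = \int[mu]_x (h x)%:E)%E.

Definition law_of d (T : measurableType d) n (P : probability T R) (f : T -> 'rV[R]_n)
    (Q : probability (borel R n) R) :=
  forall h : 'rV[R]_n -> R, measurable_fun setT (h : borel R n -> R) -> (forall x, 0 <= h x) ->
     (\int[Q]_x (h x)%:E = \int[P]_x (h (f x))%:E)%E.

Lemma law_ofP d (T : measurableType d) n (P : probability T R) (f : T -> 'rV[R]_n) :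
  measurable_fun setT (f : T -> borel R n) -> exists2 Q, law_of P f Q & forall A, Q A = P (f @^-1` A).
Proof.
move=> mf; have [m' mE] := measure_pushforwardP P mf.
have m1 : m' setT = 1%E by rewrite mE preimage_setT; exact: probability_setT.
have [Q QE] := probabilityP m1.
exists Q => [h mh h0|A]; last by rewrite QE mE.
apply: (@ge0_integral_image R _ _ T (borel R n) P Q f (fun x => (h x)%:E)) => //.
- exact/measurable_EFinP.
- by move=> A mA; transitivity (m' A); [exact: QE|exact: mE].
Qed.

Lemma law_of_Int d (T : measurableType d) n (P : probability T R) (f : T -> 'rV[R]_n) Q
    (h : 'rV[R]_n -> R) : measurable_fun setT (f : T -> borel R n) ->
  law_of P f Q -> measurable_fun setT (h : borel R n -> R) ->
  (forall x, 0 <= h x) -> Int Q h = Int P (fun x => h (f x)).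
Proof. by move=> mf fQ mh h0; rewrite /Int /Rintegral fQ. Qed.

Lemma law_of_ig d (T : measurableType d) n (P : probability T R) (f : T -> 'rV[R]_n) Q
    (h : 'rV[R]_n -> R) : measurable_fun setT (f : T -> borel R n) ->
  law_of P f Q -> measurable_fun setT (h : borel R n -> R) ->
  (forall x, 0 <= h x) -> ig P (fun x => h (f x)) <-> ig Q h.
Proof.
move=> mf fQ mh h0; split => [ih|ih]; apply: ig_ge0 => //.
- by rewrite fQ//; rewrite IntE// ltry.
- exact: measurableT_comp mh mf.
- by rewrite -fQ// IntE// ltry.
Qed.

Lemma law_lin n p (M : 'M[R]_(n, p)) (P : probability (borel R n) R) :
  exists2 Q, law_of P (fun x => x *m M) Q & (lcm P -> lcm Q).
Proof.
have [Q fQ QE] := law_ofP P (measurable_lin M); exists Q => // lcP.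
apply: prob_lcm; apply: (slc_pushforward_lin lcP) (fun A _ => QE A).
by apply: (@le_lt_trans _ _ 1%E); [exact: probability_le1|rewrite ltry].
Qed.

Lemma prod_law a b (P1 : probability (borel R a) R) (P2 : probability (borel R b) R) :
  exists Q : probability (borel R (a + b)) R,
  [/\ forall h : 'rV[R]_(a + b) -> \bar R, measurable_fun setT (h : borel R (a + b) -> \bar R) ->
       (forall x, 0 <= h x)%E ->
       (\int[Q]_x h x = \int[P1]_x \int[P2]_y h (row_mx x y))%E,
     forall h : 'rV[R]_(a + b) -> \bar R, measurable_fun setT (h : borel R (a + b) -> \bar R) ->
       (forall x, 0 <= h x)%E ->
       (\int[Q]_x h x = \int[P2]_y \int[P1]_x h (row_mx x y))%E &
     lcm P1 -> lcm P2 -> lcm Q].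
Proof.
have [m' mE] := measure_pushforwardP (P1 \x P2)%E (@measurable_rowp R a b).
have m1 : m' setT = 1%E.
  transitivity ((P1 \x P2)%E (setT `*` setT)); first by rewrite mE preimage_setT setXTT.
  rewrite product_measure1E//.
  by rewrite [X in (X * _)%E]probability_setT [X in (_ * X)%E]probability_setT mule1.
have [Q QE] := probabilityP m1; exists Q.
have QI (h : 'rV[R]_(a + b) -> \bar R) : measurable_fun setT (h : borel R (a + b) -> \bar R) ->
       (forall x, 0 <= h x)%E -> (\int[Q]_x h x = \int[P1 \x P2]_z h (@rowp R a b z))%E.
  move=> mh h0; apply: (ge0_integral_image (f := @rowp R a b)) => //; first exact: measurable_rowp.
  by move=> A mA; transitivity (m' A); [exact: QE|exact: mE].
have mr (h : 'rV[R]_(a + b) -> \bar R) : measurable_fun setT (h : borel R (a + b) -> \bar R) ->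
   measurable_fun setT (h \o @rowp R a b).
  by move=> mh; exact: measurableT_comp mh (@measurable_rowp R a b).
split.
- move=> h mh h0; rewrite QI//.
  exact: (@fubini_tonelli1 _ _ _ _ _ P1 P2 (h \o @rowp R a b) (mr _ mh) (fun=> h0 _)).
- move=> h mh h0; rewrite QI//.
  exact: (@fubini_tonelli2 _ _ _ _ _ P1 P2 (h \o @rowp R a b) (mr _ mh) (fun=> h0 _)).
- move=> lc1 lc2; apply: (lcm_prod lc1 lc2) => A mA; transitivity (m' A); first exact: QE.
  rewrite mE /product_measure1.
  by apply: eq_integral => x _ /=; congr (P2 _); apply/seteqP; split => y; rewrite /xsection /= inE.
Qed.

(** Even isotropic log-concave laws. Evenness implies centring, and the quadratic form determines
    the covariance by polarisation; in this form both conditions pass to products and to images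
    under matrices with orthonormal columns. *)
Definition Cm n (P : probability (borel R n) R) :=
  [/\ lcm P, evenm P & forall v, Int P (fun x => dotp x v ^+ 2) = dotp v v].

Definition Zf n (P : probability (borel R n) R) (a : R) := Int P (fun x => expR (- a * dotp x x)).

Lemma measurable_dotpX n (v : 'rV[R]_n) k : measurable_fun setT (fun x : borel R n => dotp (x : 'rV[R]_n) v ^+ k).
Proof. by apply: measurable_funX; exact: measurable_dotp. Qed.

Lemma measurable_expN n (a : R) : measurable_fun setT (fun x : borel R n => expR (- a * dotp (x : 'rV[R]_n) x)).
Proof. by apply: measurable_expRT; apply: measurable_funM => //; exact: measurable_dotpp. Qed.

Lemma ig_sq n (P : probability (borel R n) R) v : lcm P -> ig P (fun x => dotp x v ^+ 2).
Proof.
move=> lcP; apply: eq_ig (ig_pow lcP v 2) => x.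
by rewrite real_normK// num_real.
Qed.

Lemma ig_dotp n (P : probability (borel R n) R) v : lcm P -> ig P (fun x => dotp x v).
Proof.
move=> lcP; apply: ig_le (ig_pow lcP v 1); first exact: measurable_dotp.
by move=> x; rewrite expr1.
Qed.

Lemma ig_expN n (P : probability (borel R n) R) (a : R) : 0 <= a -> ig P (fun x => expR (- a * dotp x x)).
Proof.
move=> a0; apply: (@ig_bounded0 _ _ _ P _ 1); first exact: measurable_expN.
by move=> x; rewrite expR_ge0 -expR0 ler_expR mulNr oppr_le0 mulr_ge0// dotp_ge0.
Qed.

Lemma Zf_le1 n (P : probability (borel R n) R) (a : R) : 0 <= a -> Zf P a <= 1.
Proof.
move=> a0; rewrite -[leRHS](Int_cst P 1); apply: Int_le; [exact: ig_expN|exact: ig_cst|].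
by move=> x; rewrite -expR0 ler_expR mulNr oppr_le0 mulr_ge0// dotp_ge0.
Qed.

Lemma Zf_gt0 n (P : probability (borel R n) R) (a : R) : 0 <= a -> 0 < Zf P a.
Proof.
move=> a0; apply: (@Int_gt0 _ _ _ P _ setT) => //; last exact: ig_expN.
- by rewrite [X in (_ < X)%E]probability_setT.
- by move=> x _; rewrite expR_gt0.
Qed.

Lemma Zf_ge n (P : probability (borel R n) R) (a b : R) : 0 <= a <= b -> Zf P b <= Zf P a.
Proof.
move=> /andP[a0 ab]; apply: Int_le; [exact: ig_expN (le_trans a0 ab)|exact: ig_expN|].
by move=> x; rewrite ler_expR ler_wpM2r ?dotp_ge0// lerN2.
Qed.

Lemma measurable_oppr_rV n (h : 'rV[R]_n -> R) : measurable_fun setT (h : borel R n -> R) ->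
  measurable_fun setT (fun x : borel R n => h (- (x : 'rV[R]_n))).
Proof.
move=> mh; have := measurableT_comp mh (@measurable_lin R n n (-1)%:M).
by apply: eq_measurable_fun => x _ /=; rewrite mul_mx_scalar scaleN1r.
Qed.

Lemma evenm_mean0 n (P : probability (borel R n) R) v : lcm P -> evenm P -> Int P (fun x => dotp x v) = 0.
Proof.
move=> lcP eP; have i1 := ig_dotp v lcP; have i2 := ig_norm i1.
have m1 : measurable_fun setT (fun x : borel R n => `|dotp x v| + dotp x v).
  exact: ig_measurable (igD i2 i1).
have h0 x : 0 <= `|dotp x v| + dotp x v by have := ler_norm (- dotp x v); rewrite normrN; lra.
have := eP _ m1 h0.
under eq_integral do rewrite dotpNl normrN.
rewrite (IntE (igB i2 i1)) (IntE (igD i2 i1)) IntB// IntD// => -[]; lra.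
Qed.

Lemma Cm_lin n p (M : 'M[R]_(n, p)) P : M^T *m M = 1%:M -> @Cm n P ->
  exists2 Q, law_of P (fun x => x *m M) Q & @Cm p Q.
Proof.
move=> MM [lcP eP vP]; have [Q fQ lcQ] := law_lin M P; exists Q => //; split; first exact: lcQ.
- move=> h mh h0; rewrite fQ//; last exact: measurable_oppr_rV.
  under eq_integral do rewrite -mulNmx.
  rewrite (eP (fun x => h (x *m M)))//; last exact: measurableT_comp mh (measurable_lin M).
  by rewrite fQ.
- move=> v; rewrite (law_of_Int (measurable_lin M) fQ)//.
  + transitivity (Int P (fun x => dotp x (v *m M^T) ^+ 2)); first by apply: eq_Int => x; rewrite dotp_mulmx.
    by rewrite vP dotp_mulmx trmxK -mulmxA MM mulmx1.
  + exact: measurable_dotpX.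
  + by move=> x; rewrite sqr_ge0.
Qed.

Lemma Cm_prod a b (P1 : probability (borel R a) R) (P2 : probability (borel R b) R) : Cm P1 -> Cm P2 ->
  exists Q : probability (borel R (a + b)) R, [/\ Cm Q,
   (forall h : 'rV[R]_(a + b) -> \bar R, measurable_fun setT (h : borel R (a + b) -> \bar R) ->
       (forall x, 0 <= h x)%E ->
       (\int[Q]_x h x = \int[P1]_x \int[P2]_y h (row_mx x y))%E) &
   forall t, 0 <= t -> Zf Q t = Zf P1 t * Zf P2 t].
Proof.
move=> [lc1 e1 v1] [lc2 e2 v2]; have [Q [QE QE' lcQ]] := prod_law P1 P2.
have mrow (h : 'rV[R]_(a + b) -> R) (x : 'rV[R]_a) : measurable_fun setT (h : borel R (a + b) -> R) ->
    measurable_fun setT (fun y : borel R b => h (row_mx x y)).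
  move=> mh; apply: (measurableT_comp mh).
  exact: (measurableT_comp (@measurable_rowp R a b) (@measurable_pair1 _ _ _ _ (x : borel R a))).
have mcol (h : 'rV[R]_(a + b) -> R) (y : 'rV[R]_b) : measurable_fun setT (h : borel R (a + b) -> R) ->
    measurable_fun setT (fun x : borel R a => h (row_mx x y)).
  move=> mh; apply: (measurableT_comp mh).
  exact: (measurableT_comp (@measurable_rowp R a b) (@measurable_pair2 _ _ _ _ (y : borel R b))).
have QeE (h : 'rV[R]_(a + b) -> R) : measurable_fun setT (h : borel R (a + b) -> R) -> (forall x, 0 <= h x) ->
    (\int[Q]_x (h x)%:E = \int[P1]_x \int[P2]_y (h (row_mx x y))%:E)%E.
  by move=> mh h0; rewrite (QE (fun x => (h x)%:E))//; exact/measurable_EFinP.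
have QeE' (h : 'rV[R]_(a + b) -> R) : measurable_fun setT (h : borel R (a + b) -> R) -> (forall x, 0 <= h x) ->
    (\int[Q]_x (h x)%:E = \int[P2]_y \int[P1]_x (h (row_mx x y))%:E)%E.
  by move=> mh h0; rewrite (QE' (fun x => (h x)%:E))//; exact/measurable_EFinP.
exists Q; split => //.
- split; first exact: lcQ.
  + move=> h mh h0; rewrite QeE//; last exact: measurable_oppr_rV.
    (* The two factors are reflected one after the other, with the order of integration exchanged in
       between. *)
    under eq_integral => x _.
      under eq_integral do rewrite -[- row_mx _ _]/(- row_mx x _) opp_row_mx.
      rewrite (e2 (fun y => h (row_mx (- x) y)))//; last exact: mrow.
      over.
    have mhl : measurable_fun setT ((fun z => h (z *m block_mx (-1)%:M 0 0 1%:M)) : borel R (a + b) -> R).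
      exact: measurableT_comp mh (measurable_lin _).
    have hl (x : 'rV[R]_a) (y : 'rV[R]_b) : h (row_mx (- x) y) = h (row_mx x y *m block_mx (-1)%:M 0 0 1%:M).
      by rewrite mul_row_block !mulmx0 addr0 add0r mulmx1 mul_mx_scalar scaleN1r.
    under eq_integral do (under eq_integral do rewrite hl).
    rewrite -(QeE _ mhl)// QeE'//; under eq_integral do (under eq_integral do rewrite -hl).
    under eq_integral => y _.
      rewrite (e1 (fun x => h (row_mx x y)))//; last exact: mcol.
      over.
    by rewrite -QeE'.
  + move=> v; have [lQ] : lcm Q by exact: lcQ.
    rewrite -(hsubmxK v); set v1' := lsubmx v; set v2' := rsubmx v => _.
    apply: EFin_inj; rewrite -IntE; last by apply: ig_sq; exact: lcQ.
    rewrite QeE; [|exact: measurable_dotpX|by move=> x; exact: sqr_ge0].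
    have i2 : ig P2 (fun y => dotp y v2') by exact: ig_dotp.
    have i2s : ig P2 (fun y => dotp y v2' ^+ 2) by exact: ig_sq.
    have m2 : Int P2 (fun y => dotp y v2') = 0.
      exact: evenm_mean0.
    have E x : (\int[P2]_y (dotp (row_mx x y) (row_mx v1' v2') ^+ 2)%:E = (dotp x v1' ^+ 2 + dotp v2' v2')%:E)%E.
      have e y : dotp (row_mx x y) (row_mx v1' v2') ^+ 2 = (dotp x v1' ^+ 2 + 2 * dotp x v1' * dotp y v2') + dotp y v2' ^+ 2.
        by rewrite dotp_row_mx; ring.
      under eq_integral do rewrite e.
      have ie : ig P2 (fun y => dotp x v1' ^+ 2 + 2 * dotp x v1' * dotp y v2').
        by apply: igD; [exact: ig_cst|exact: igZ].
      rewrite IntE; last exact: igD.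
      rewrite IntD// IntD//; [|exact: ig_cst|exact: igZ].
      by rewrite Int_cst IntZ// m2 mulr0 addr0 v2.
    under eq_integral do rewrite E.
    rewrite IntE; last by apply: igD; [exact: ig_sq|exact: ig_cst].
    by rewrite IntD ?Int_cst ?v1 ?dotp_row_mx//; [exact: ig_sq|exact: ig_cst].
- move=> t t0; apply: EFin_inj; rewrite -IntE; last exact: ig_expN.
  rewrite QeE; [|exact: measurable_expN|by move=> x; exact: expR_ge0].
  have E (x : 'rV[R]_a) : (\int[P2]_y (expR (- t * dotp (row_mx x y) (row_mx x y)))%:E = (Zf P2 t * expR (- t * dotp x x))%:E)%E.
    have e (y : 'rV[R]_b) : expR (- t * dotp (row_mx x y) (row_mx x y)) = expR (- t * dotp x x) * expR (- t * dotp y y).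
      by rewrite dotp_row_mx mulrDr expRD.
    under eq_integral do rewrite e.
    by rewrite IntE; [rewrite IntZ 1?mulrC//; exact: ig_expN|apply: igZ; exact: ig_expN].
  under eq_integral do rewrite E.
  rewrite IntE; last by apply: igZ; exact: ig_expN.
  by rewrite IntZ 1?mulrC//; exact: ig_expN.
Qed.

End laws.

Section density_measure.
Context d (T : measurableType d) (R : realType).
Variable m : {measure set T -> \bar R}.
Variable f : T -> R.
Hypothesis f0 : forall x, 0 <= f x.
Hypothesis fi : ig m f.

Definition dens (A : set T) : \bar R := (\int[m]_(x in A) (f x)%:E)%E.

Let dens0 : dens set0 = 0%E. Proof. by rewrite /dens integral_set0. Qed.

Let dens_ge0 A : (0 <= dens A)%E.
Proof. by apply: integral_ge0 => x _; rewrite lee_fin. Qed.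

Let dens_sigma_additive : semi_sigma_additive dens.
Proof.
move=> A mA tA mUA; rewrite /dens integral_bigcup//=; last first.
  by apply: (integrableS _ _ (subsetT _)) => //; exact: fi.
by apply: is_cvg_ereal_nneg_natsum_cond => n _ _; exact: dens_ge0.
Qed.

HB.instance Definition _ := isMeasure.Build _ _ _ dens dens0 dens_ge0 dens_sigma_additive.

Lemma densP : exists m' : {measure set T -> \bar R}, forall A, m' A = (\int[m]_(x in A) (f x)%:E)%E.
Proof. by exists dens. Qed.

End density_measure.

Section density_law.
Variables (R : realType) (n : nat).
Variable m : {sigma_finite_measure set (borel R n) -> \bar R}.
Variable f : 'rV[R]_n -> R.
Hypothesis f0 : forall x, 0 <= f x.
Hypothesis fi : ig m f.
Hypothesis If0 : 0 < Int m f.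

(** The formula for integrals of functions is derived from the one for sets by the exponential layer
    cake and Tonelli. *)
Lemma density_law : exists P : probability (borel R n) R,
  (forall h : 'rV[R]_n -> R, measurable_fun setT (h : borel R n -> R) -> (forall x, 0 <= h x) ->
    (\int[P]_x (h x)%:E = (Int m f)^-1%:E * \int[m]_x (h x * f x)%:E)%E) /\
  (lcm m -> lcf f -> lcm P).
Proof.
set I := Int m f; pose f1 x := I^-1 * f x.
have I0 : 0 < I^-1 by rewrite invr_gt0.
have f10 x : 0 <= f1 x by rewrite mulr_ge0// ltW.
have f1i : ig m f1 by exact: igZ.
have mf1 := ig_measurable f1i.
have [m' mE] := @densP _ (borel R n) R m f1 f10 f1i.
have m1 : m' setT = 1%E.
  by rewrite mE IntE// /f1 IntZ// mulVf// gt_eqF.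
have [P PE] := probabilityP m1; exists P; split => [h mh h0|mlc lf]; last first.
  apply: prob_lcm; apply: (@slc_density _ _ m f1) => //.
  - by apply: lcf_mul => //; [move=> _; exact: ltW|apply: lcf_cst; exact: ltW].
  - by rewrite IntE// ltry.
  - by move=> A mA; rewrite PE mE.
pose S := [set z : borel R n * measurableTypeR R | expR z.2 <= h z.1].
have mS : measurable S.
  apply: measurable_set_le; first exact: measurableT_comp measurable_snd.
  exact: measurableT_comp measurable_fst.
pose F z : \bar R := (expR z.2 * \1_S z * f1 z.1)%:E.
have mF : measurable_fun setT F.
  apply/measurable_EFinP; apply: measurable_funM; last exact: measurableT_comp mf1 measurable_fst.
  apply: measurable_funM; last exact: measurable_indic.
  exact: measurableT_comp measurable_snd.
have F0 z : (0 <= F z)%E by rewrite lee_fin mulr_ge0// mulr_ge0 ?expR_ge0.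
rewrite exp_layer_cake//.
transitivity (\int[lebesgue_measure]_s \int[m]_x F (x, s))%E.
  apply: eq_integral => s _.
  have mSs : measurable ([set x | expR s <= h x] : set (borel R n)) by exact: measurable_set_le.
  have PS : (P [set x | (expR s <= h x)%R] = \int[m]_(x in [set x | (expR s <= h x)%R]) (f1 x)%:E)%E.
    by transitivity (m' [set x | expR s <= h x]); [exact: PE|exact: mE].
  transitivity ((expR s)%:E * \int[m]_(x in [set x | (expR s <= h x)%R]) (f1 x)%:E)%E.
    by congr (_ * _)%E; exact: PS.
  rewrite integral_mkcond.
  rewrite -ge0_integralZl//; last 2 first.
  - have mEf : measurable_fun setT (fun x : borel R n => (f1 x)%:E) by exact/measurable_EFinP.
    exact: (measurable_restrictT _ mSs).1 (measurable_funS measurableT (@subsetT _ _) mEf).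
  - by move=> x _; rewrite patchE; case: ifP => // _; rewrite lee_fin.
  apply: eq_integral => x _; rewrite patchE /F /= indicE.
  have -> : ((x, s) \in S) = (x \in [set x | expR s <= h x]) by [].
  by case: ifP => _; rewrite ?mulr1 ?mulr0 ?mul0r ?mule0// EFinM.
rewrite -(@fubini_tonelli _ _ _ _ _ m lebesgue_measure F mF F0).
have mhf : measurable_fun setT (fun x : borel R n => (h x * f x)%:E).
  by apply/measurable_EFinP; apply: measurable_funM => //; exact: ig_measurable fi.
rewrite -ge0_integralZl//; try (by move=> x _; rewrite lee_fin mulr_ge0); try (by rewrite lee_fin ltW).
apply: eq_integral => x _.
(* The layer cake for the Dirac mass at [x] recovers the value [h x] from the indicators of the
   level sets. *)
have := @exp_layer_cake R _ (borel R n) (@dirac _ (borel R n) (x : borel R n) R) h mh h0.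
rewrite integral_dirac//; last exact/measurable_EFinP.
rewrite diracT mul1e => hE.
transitivity (\int[lebesgue_measure]_s ((f1 x)%:E * ((expR s)%:E * dirac (x : borel R n) [set y | (expR s <= h y)%R])))%E.
  apply: eq_integral => s _; rewrite /F /= diracE indicE.
  have -> : ((x, s) \in S) = (x \in [set y | expR s <= h y]) by [].
  rewrite -!EFinM; congr (_%:E); ring.
have mes : measurable_fun setT (fun s : measurableTypeR R => ((expR s)%:E * dirac (x : borel R n) [set y | (expR s <= h y)%R])%E).
  apply: emeasurable_funM; first by apply/measurable_EFinP; exact: measurable_expR.
  have := measurable_fun_ysection (@dirac _ (borel R n) (x : borel R n) R) mS.
  congr (measurable_fun _ _); apply/funext => u; congr (dirac _ _).
  by apply/seteqP; split => y; rewrite /ysection /= inE.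
rewrite ge0_integralZl//; try (by move=> s _; rewrite mule_ge0 ?lee_fin ?expR_ge0); try (by rewrite lee_fin).
by rewrite -hE -!EFinM /f1; congr (_ %:E); ring.
Qed.

End density_law.

(** * Isotropy and symmetrisation *)

Section isotropic.
Variable R : realType.

Lemma dotp_delta n (x : 'rV[R]_n) i : dotp x (delta_mx 0 i) = x 0 i.
Proof.
rewrite /dotp (bigD1 i)//= mxE !eqxx mulr1 big1 ?addr0// => j ji.
by rewrite mxE (negbTE ji) andbF mulr0.
Qed.

Lemma Cm_isotropic n (P : probability (borel R n) R) : Cm P -> isotropic_log_concave P.
Proof.
move=> [lcP eP vP]; split; first by have [] := lcP.
  by move=> y; rewrite IntE; [rewrite evenm_mean0|exact: ig_dotp].
move=> i j.
have E x : (x : 'rV[R]_n) 0 i * x 0 j = 4^-1 * (dotp x (delta_mx 0 i + delta_mx 0 j) ^+ 2 - dotp x (delta_mx 0 i - delta_mx 0 j) ^+ 2).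
  by rewrite !dotpDr dotpNr !dotp_delta; field.
under eq_integral do rewrite E.
have i1 v := ig_sq v lcP.
rewrite IntE; last by apply: igZ; exact: igB.
rewrite IntZ; last exact: igB.
rewrite IntB// !vP; congr (_%:E).
rewrite !(dotpDl, dotpDr, dotpNl, dotpNr) !dotp_delta !mxE !eqxx /= (eq_sym j i).
case: (i == j) => /=; lra.
Qed.

Lemma isotropic_sq n (P : probability (borel R n) R) v : isotropic_log_concave P ->
  Int P (fun x => dotp x v ^+ 2) = dotp v v.
Proof.
move=> [lc mean cov]; have lcP := prob_lcm lc.
have ii i j : ig P (fun x => (x : 'rV[R]_n) 0 i * x 0 j).
  have i1 w := ig_sq w lcP.
  apply: (@eq_ig _ _ _ P (fun x : borel R n => 4^-1 * (dotp x (delta_mx 0 i + delta_mx 0 j) ^+ 2 - dotp x (delta_mx 0 i - delta_mx 0 j) ^+ 2))).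
    by move=> x; rewrite !dotpDr dotpNr !dotp_delta; field.
  by apply: igZ; exact: igB.
have Iij i j : Int P (fun x => (x : 'rV[R]_n) 0 i * x 0 j) = (i == j)%:R.
  by apply: EFin_inj; rewrite -IntE.
transitivity (Int P (fun x => \sum_i \sum_j (v 0 i * v 0 j) * ((x : 'rV[R]_n) 0 i * x 0 j))).
  apply: eq_Int => x; rewrite expr2 /dotp big_distrlr /=.
  by apply: eq_bigr => i _; apply: eq_bigr => j _; ring.
rewrite Int_sum; last by move=> i; apply: ig_sum => j; exact: igZ.
apply: eq_bigr => i _; rewrite Int_sum; last by move=> j; exact: igZ.
rewrite (bigD1 i)//= IntZ// Iij eqxx mulr1 big1 ?addr0// => j ji.
by rewrite IntZ// Iij eq_sym (negbTE ji) mulr0.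
Qed.

(** The law of [(X - Y) / sqrt 2] with [Y] an independent copy of [X]: it becomes even, while
    log-concavity and the covariance are preserved. The moment bound lets lower estimates for the
    symmetrised law pass back to the centroid body of [P]. *)
Lemma symmetrization n (P : probability (borel R n) R) : isotropic_log_concave P ->
  exists2 Q : probability (borel R n) R, Cm Q &
  forall v q, Int Q (fun x => `|dotp x v| ^+ q) <= 2 ^+ q.+1 * Int P (fun x => `|dotp x v| ^+ q).
Proof.
move=> iP; have [lc mean cov] := iP; have lcP := prob_lcm lc.
have [Q2 [QE QE' lcQ]] := prod_law P P.
have lcQ2 := lcQ lcP lcP.
pose r : R := Num.sqrt 2^-1.
have r2 : r ^+ 2 = 2^-1 by rewrite sqr_sqrtr// invr_ge0.
have r0 : 0 <= r by exact: sqrtr_ge0.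
pose M : 'M[R]_(n + n, n) := col_mx r%:M (- r)%:M.
have rM (x y : 'rV[R]_n) : row_mx x y *m M = r *: (x - y).
  by rewrite mul_row_col !mul_mx_scalar scalerBr scaleNr.
have [Q fQ lcQQ] := law_lin M Q2; have {}lcQQ := lcQQ lcQ2.
have mrow (h : 'rV[R]_(n + n) -> R) (x : 'rV[R]_n) : measurable_fun setT (h : borel R (n + n) -> R) ->
    measurable_fun setT (fun y : borel R n => h (row_mx x y)).
  move=> mh; apply: (measurableT_comp mh).
  exact: (measurableT_comp (@measurable_rowp R n n) (@measurable_pair1 _ _ _ _ (x : borel R n))).
have QeE (h : 'rV[R]_n -> R) : measurable_fun setT (h : borel R n -> R) -> (forall x, 0 <= h x) ->
    (\int[Q]_x (h x)%:E = \int[P]_x \int[P]_y (h (r *: (x - y)))%:E)%E.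
  move=> mh h0; rewrite fQ// (QE (fun x => (h (x *m M))%:E)) => [||x].
  - by apply: eq_integral => x _; apply: eq_integral => y _; rewrite rM.
  - by apply/measurable_EFinP; exact: measurableT_comp mh (measurable_lin M).
  - by rewrite lee_fin.
have QeE' (h : 'rV[R]_n -> R) : measurable_fun setT (h : borel R n -> R) -> (forall x, 0 <= h x) ->
    (\int[Q]_x (h x)%:E = \int[P]_y \int[P]_x (h (r *: (x - y)))%:E)%E.
  move=> mh h0; rewrite fQ// (QE' (fun x => (h (x *m M))%:E)) => [||x].
  - by apply: eq_integral => x _; apply: eq_integral => y _; rewrite rM.
  - by apply/measurable_EFinP; exact: measurableT_comp mh (measurable_lin M).
  - by rewrite lee_fin.
have iv w : ig P (fun x => dotp x w) by exact: ig_dotp.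
have iv2 w : ig P (fun x => dotp x w ^+ 2) by exact: ig_sq.
have mv w : Int P (fun x => dotp x w) = 0 by apply: EFin_inj; rewrite -IntE.
exists Q.
  split => //.
  - move=> h mh h0; rewrite QeE//; last exact: measurable_oppr_rV.
    rewrite QeE'//; apply: eq_integral => x _; apply: eq_integral => y _.
    by rewrite -scalerN opprB.
  - move=> v; apply: EFin_inj; rewrite -IntE; last exact: ig_sq.
    rewrite QeE; [|exact: measurable_dotpX|by move=> x; exact: sqr_ge0].
    have E x : (\int[P]_y (dotp (r *: (x - y)) v ^+ 2)%:E = (2^-1 * dotp x v ^+ 2 + 2^-1 * dotp v v)%:E)%E.
      have e y : dotp (r *: (x - y)) v ^+ 2 = (2^-1 * dotp x v ^+ 2 + (- dotp x v) * dotp y v) + 2^-1 * dotp y v ^+ 2.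
        by rewrite dotpZl exprMn r2 dotpDl dotpNl; field.
      under eq_integral do rewrite e.
      have ie : ig P (fun y => 2^-1 * dotp x v ^+ 2 + (- dotp x v) * dotp y v).
        by apply: igD; [exact: ig_cst|exact: igZ].
      rewrite IntE; last by apply: igD => //; exact: igZ.
      rewrite IntD//; last exact: igZ.
      rewrite IntD//; [|exact: ig_cst|exact: igZ].
      by rewrite Int_cst !IntZ// mv mulr0 addr0 isotropic_sq.
    under eq_integral do rewrite E.
    rewrite IntE; last by apply: igD; [exact: igZ|exact: ig_cst].
    rewrite IntD; [|exact: igZ|exact: ig_cst].
    by rewrite IntZ// Int_cst isotropic_sq//; congr (_%:E); field.
move=> v q.
have ip : ig P (fun x => `|dotp x v| ^+ q) by exact: ig_pow.
have mq : measurable_fun setT (fun x : borel R n => `|dotp x v| ^+ q) by exact: ig_measurable ip.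
rewrite -lee_fin -IntE; last exact: ig_pow.
rewrite QeE//.
set J := Int P _.
have r1 : r <= 1.
  by rewrite -(@ler_sqr R)// ?nnegrE// r2 expr1n; lra.
have key x y : `|r * (dotp x v - dotp y v)| ^+ q <= 2 ^+ q * (`|dotp x v| ^+ q + `|dotp y v| ^+ q).
  have pow2 (s t : R) : 0 <= s -> 0 <= t -> (s + t) ^+ q <= 2 ^+ q * (s ^+ q + t ^+ q).
    wlog st : s t / s <= t => [hw s0 t0|s0 t0].
      have [st|/ltW ts] := leP s t; first exact: hw.
      by rewrite addrC [X in _ * X]addrC; exact: hw.
    apply: (@le_trans _ _ ((2 * t) ^+ q)); first by apply: lerXn2r; rewrite ?nnegrE ?addr_ge0 ?mulr_ge0//; lra.
    by rewrite exprMn ler_pM2l ?exprn_gt0// lerDr exprn_ge0.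
  apply: le_trans (pow2 _ _ (normr_ge0 _) (normr_ge0 _)).
  apply: lerXn2r; rewrite ?nnegrE ?addr_ge0//.
  rewrite normrM (ger0_norm r0); apply: le_trans (ler_normB _ _).
  by rewrite ler_piMl.
have eD x y : dotp (r *: (x - y)) v = r * (dotp x v - dotp y v) by rewrite dotpZl dotpDl dotpNl.
under eq_integral do (under eq_integral do rewrite eD).
have mF : measurable_fun setT (fun z : borel R n * borel R n => (`|r * (dotp (z.1 : 'rV[R]_n) v - dotp (z.2 : 'rV[R]_n) v)| ^+ q)%:E).
  apply/measurable_EFinP; apply: measurable_funX; apply: measurableT_comp => //; apply: measurable_funM => //.
  by apply: measurable_funB; [exact: measurableT_comp (measurable_dotp v) measurable_fst|exact: measurableT_comp (measurable_dotp v) measurable_snd].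
have F0 (z : borel R n * borel R n) : (0 <= (`|r * (dotp (z.1 : 'rV[R]_n) v - dotp (z.2 : 'rV[R]_n) v)| ^+ q)%:E)%E.
  by rewrite lee_fin exprn_ge0.
have E x : (\int[P]_y (`|r * (dotp x v - dotp y v)| ^+ q)%:E <= (2 ^+ q * (`|dotp x v| ^+ q + J))%:E)%E.
  have ie : ig P (fun y => 2 ^+ q * (`|dotp x v| ^+ q + `|dotp y v| ^+ q)).
    by apply: igZ; apply: igD => //; exact: ig_cst.
  apply: (@le_trans _ _ (\int[P]_y (2 ^+ q * (`|dotp x v| ^+ q + `|dotp y v| ^+ q))%:E)%E).
    apply: ge0_le_integral => //.
    - exact: (measurableT_comp mF (@measurable_pair1 _ _ _ _ (x : borel R n))).
    - by apply/measurable_EFinP; exact: ig_measurable ie.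
    - by move=> y _; rewrite lee_fin.
  rewrite IntE// IntZ; last by apply: igD => //; exact: ig_cst.
  by rewrite IntD// ?Int_cst//; exact: ig_cst.
have ie0 : ig P (fun x => `|dotp x v| ^+ q + J) by apply: igD => //; exact: ig_cst.
have J0 : 0 <= J by apply: Int_ge0 => x; rewrite exprn_ge0.
apply: (@le_trans _ _ (\int[P]_x (2 ^+ q * (`|dotp x v| ^+ q + J))%:E)%E).
  apply: ge0_le_integral => //.
  - by move=> x _; apply: integral_ge0 => y _; exact: (F0 (x, y)).
  - exact: (@measurable_fun_fubini_tonelli_F _ _ _ _ _ P _ mF F0).
  - by apply/measurable_EFinP; exact: ig_measurable (igZ _ ie0).
rewrite IntE; last exact: igZ.
rewrite IntZ// IntD//; last exact: ig_cst.
by rewrite Int_cst lee_fin -/J exprSr -mulrA mulr_natl mulr2n.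
Qed.

End isotropic.

Opaque leb.

(** * Powers of a law and Gaussian laws *)

Section standard.
Variable R : realType.

Lemma Cm_point : exists2 P : probability (borel R 0) R, Cm P & forall h, Int P h = h 0.
Proof.
have l1 : leb R 0 setT = 1%E by rewrite leb0E indicT.
have [P PE] := probabilityP l1.
have Ih h : Int P h = h 0.
  have -> : h = cst (h 0) by apply/funext => x; rewrite [x]thinmx0.
  by rewrite Int_cst.
exists P => //; split.
- have [lc lf] := lcm_leb R 0; split=> [A B l cA cB l01|K cK].
    by rewrite !PE; exact: lc.
  by rewrite PE; exact: lf.
- by move=> h _ _; apply: eq_integral => x _; rewrite [- x]thinmx0 [x]thinmx0.
- by move=> v; rewrite Ih !(thinmx0 v) dotp0l expr0n.
Qed.

Lemma Cm_power m (P : probability (borel R m) R) N : Cm P ->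
  exists2 Q : probability (borel R (N * m)) R, Cm Q & forall t, 0 <= t -> Zf Q t = Zf P t ^+ N.
Proof.
move=> cP; elim: N => [|N [Q cQ ZQ]].
  have [Q cQ IQ] := Cm_point; exists Q => // t t0.
  by rewrite /Zf IQ dotp0l mulr0 expR0.
have [Q' [cQ' _ ZQ']] := Cm_prod cP cQ; exists Q' => // t t0.
by rewrite ZQ'// ZQ// exprS.
Qed.

Lemma density_evenm n (m : {sigma_finite_measure set (borel R n) -> \bar R}) (f : 'rV[R]_n -> R)
    (I : R) (P : probability (borel R n) R) :
  evenm m -> measurable_fun setT (f : borel R n -> R) -> (forall x, 0 <= f x) -> (forall x, f (- x) = f x) ->
  (forall h : 'rV[R]_n -> R, measurable_fun setT (h : borel R n -> R) -> (forall x, 0 <= h x) ->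
    (\int[P]_x (h x)%:E = I%:E * \int[m]_x (h x * f x)%:E)%E) -> evenm P.
Proof.
move=> em mf f0 ef PE h mh h0; rewrite !PE//; last exact: measurable_oppr_rV.
congr (_ * _)%E; rewrite -(em (fun x => h x * f x)); last 2 first.
- exact: measurable_funM.
- by move=> x; rewrite mulr_ge0.
by apply: eq_integral => x _; rewrite ef.
Qed.

Lemma ig_gauss n (a : R) : 0 < a -> ig (leb R n) (fun x => expR (- a * dotp x x)) /\
  Int (leb R n) (fun x => expR (- a * dotp x x)) = Num.sqrt (pi / a) ^+ n.
Proof.
move=> a0; have a20 : 0 < 2 * a by rewrite mulr_gt0.
have [] := @ig_gauss_diag R n (const_mx (2 * a)).
  by move=> i; rewrite mxE.
have e (x : 'rV[R]_n) : - (\sum_i (const_mx (2 * a) : 'rV[R]_n) 0 i * x 0 i ^+ 2) / 2 = - a * dotp x x.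
  rewrite /dotp mulNr mulNr mulr_suml mulr_sumr; congr (- _); apply: eq_bigr => i _.
  by rewrite mxE expr2; field.
move=> i1 I1; split; first by apply: eq_ig i1 => x; rewrite e.
have -> : Int (leb R n) (fun x => expR (- a * dotp x x)) =
  Int (leb R n) (fun x => expR (- (\sum_i (const_mx (2 * a) : 'rV[R]_n) 0 i * x 0 i ^+ 2) / 2)).
  by apply: eq_Int => x; rewrite e.
rewrite I1 (eq_bigr (fun=> Num.sqrt (pi / a))) ?prodr_const ?card_ord// => i _.
by rewrite mxE; congr Num.sqrt; field; rewrite gt_eqF.
Qed.

(** The density [e^(-x^2/2)] is rescaled by its own variance [V], so no second moment has to be
    computed; the Laplace transform then has the constant [1 / (2 V)]. *)
Lemma gauss1_law : exists c : R, 0 < c /\ exists2 Q : probability (borel R 1) R, Cm Q &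
  forall w, (\int[Q]_x (expR (dotp x w))%:E = (expR (c * dotp w w))%:E)%E.
Proof.
pose f (x : 'rV[R]_1) := expR (- 2^-1 * dotp x x).
have h2 : 0 < 2^-1 :> R by rewrite invr_gt0.
have [fi Ifp] := ig_gauss 1 h2.
have If0 : 0 < Int (leb R 1) f by rewrite Ifp exprn_gt0// sqrtr_gt0 divr_gt0// pi_gt0.
have f0 x : 0 <= f x by exact: expR_ge0.
have [P0 [PE lcP0]] := density_law f0 fi If0.
have lf : lcf f by apply: lcf_gauss; exact: ltW.
have {}lcP0 := lcP0 (lcm_leb R 1) lf.
have mf := ig_measurable fi.
have eP0 : evenm P0.
  apply: (density_evenm _ mf f0 _ PE); first exact: lebN.
  by move=> x; rewrite /f dotpNl dotpNr opprK.
pose e0 : 'rV[R]_1 := const_mx 1.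
pose V := Int P0 (fun x => dotp x e0 ^+ 2).
have i2 : ig P0 (fun x => dotp x e0 ^+ 2) by exact: ig_sq.
have V0 : 0 < V.
  rewrite lt_neqAle Int_ge0 ?andbT; last by move=> x; exact: sqr_ge0.
  apply/eqP => V0; have := PE _ (ig_measurable i2) (fun x => sqr_ge0 _).
  rewrite IntE// -/V -V0 => /esym/eqP; rewrite mule_eq0 eqe invr_eq0 gt_eqF//= => /eqP H.
  have m2 : measurable_fun setT (fun x : borel R 1 => dotp x e0 ^+ 2 * f x).
    by apply: measurable_funM => //; exact: measurable_dotpX.
  have [i3 I3] := Int_eqE m2 (fun x => mulr_ge0 (sqr_ge0 _) (f0 x)) H.
  have mp : measurable ([set x : 'rV[R]_1 | (1 <= x 0 0 <= 2)%R] : set (borel R 1)).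
    rewrite -[X in measurable X]setTI.
    have := @measurable_fun_coord R 1 0 measurableT _ (@measurable_itv R `[1, 2]).
    by congr (measurable (_ `&` _)); apply/seteqP; split => x /=; rewrite in_itv.
  have pos : (0 < leb R 1 [set x : 'rV[R]_1 | (1 <= x 0 0 <= 2)%R])%E.
    rewrite leb1E//.
    have -> : [set t : R | [set x : 'rV[R]_1 | (1 <= x 0 0 <= 2)%R] t%:M] = `[1, 2]%classic.
      by apply/seteqP; split => t /=; rewrite in_itv /= mxE eqxx.
    by rewrite lebesgue_measure_itv /= lte_fin ltr1n -EFinB lte_fin; lra.
  have : 0 < Int (leb R 1) (fun x => dotp x e0 ^+ 2 * f x).
    apply: (Int_gt0 mp pos) => // [x|x /= /andP[x1 _]]; first by rewrite mulr_ge0 ?sqr_ge0.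
    rewrite mulr_gt0 ?expR_gt0// exprn_gt0//.
    by rewrite /dotp big_ord1 mxE mulr1; lra.
  by rewrite I3 ltxx.
pose r := Num.sqrt V^-1.
have r2 : r ^+ 2 = V^-1 by rewrite sqr_sqrtr// invr_ge0 ltW.
have [Q fQ lcQ] := law_lin (r%:M : 'M[R]_1) P0; have {}lcQ := lcQ lcP0.
have d1 (x v : 'rV[R]_1) : dotp x v = v 0 0 * dotp x e0.
  by rewrite /dotp !big_ord1 mxE mulr1 mulrC.
exists (V^-1 / 2); split; first by rewrite divr_gt0// invr_gt0.
exists Q.
  split => //.
  - move=> h mh h0; rewrite !fQ//; last exact: measurable_oppr_rV.
    rewrite -(eP0 (fun x => h (x *m r%:M)))//; last exact: measurableT_comp mh (measurable_lin _).
    by apply: eq_integral => x _; rewrite mulNmx.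
  - move=> v; rewrite (law_of_Int (measurable_lin _) fQ); [|exact: measurable_dotpX|by move=> x; exact: sqr_ge0].
    transitivity (Int P0 (fun x => (r ^+ 2 * v 0 0 ^+ 2) * dotp x e0 ^+ 2)).
      apply: eq_Int => x; rewrite mul_mx_scalar dotpZl d1; ring.
    rewrite IntZ// -/V r2 mulrAC mulVf ?mul1r ?gt_eqF//.
    by rewrite /dotp big_ord1 expr2.
move=> w; rewrite fQ//; last by apply: measurable_expRT; exact: measurable_dotp.
rewrite PE//; last by apply: measurable_expRT; exact: measurableT_comp (measurable_dotp w) (measurable_lin _).
have E (x : 'rV[R]_1) : (expR (dotp (x *m r%:M) w) * f x)%:E = ((expR (V^-1 / 2 * dotp w w))%:E * (f (x + - (r *: w))%R)%:E)%E.
  rewrite -EFinM /f -!expRD; congr ((expR _)%:E).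
  rewrite mul_mx_scalar !(dotpDl, dotpDr, dotpNl, dotpNr, dotpZl, dotpZr) (dotpC w x) mulrA -expr2 r2.
  lra.
under eq_integral do rewrite E.
rewrite ge0_integralZl//.
- rewrite (@ge0_integral_translation R 1 (- (r *: w)) (fun x => (f x)%:E))//; last exact/measurable_EFinP.
  have I1 : Int (leb R 1) f != 0 by exact: lt0r_neq0.
  by rewrite IntE// -!EFinM mulrCA (mulVf I1) mulr1.
- by apply/measurable_EFinP; exact: measurableT_comp mf (measurable_add _).
- by move=> x _; rewrite lee_fin.
Qed.

Lemma gauss_law : exists c : R, 0 < c /\ forall j, exists2 Q : probability (borel R j) R, Cm Q &
  forall w, (\int[Q]_x (expR (dotp x w))%:E = (expR (c * dotp w w))%:E)%E.
Proof.
have [c [c0 [Q1 cQ1 Q1E]]] := gauss1_law.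
exists c; split => //; elim=> [|j [Q cQ QE]].
  have [Q cQ IQ] := Cm_point; exists Q => // w.
  have -> : (fun x : borel R 0 => (expR (dotp x w))%:E) = cst 1%E.
    by apply/funext => x; rewrite [x]thinmx0 dotp0l expR0.
  by rewrite integral_cst// mul1e [LHS]probability_setT [w]thinmx0 dotp0l mulr0 expR0.
have [Q' [cQ' IQ' _]] := Cm_prod cQ1 cQ; exists Q' => // w.
rewrite (IQ' (fun x => (expR (dotp x w))%:E)); last 2 first.
- by apply/measurable_EFinP; apply: measurable_expRT; exact: measurable_dotp.
- by move=> x; rewrite lee_fin expR_ge0.
have wE : w = row_mx (lsubmx (w : 'rV_(1 + j))) (rsubmx (w : 'rV_(1 + j))) by rewrite hsubmxK.
set w1 := lsubmx _ in wE; set w2 := rsubmx _ in wE.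
have E (x : 'rV[R]_1) : (\int[Q]_y (expR (dotp (row_mx x y) w))%:E = (expR (dotp x w1))%:E * (expR (c * dotp w2 w2))%:E)%E.
  rewrite -QE -ge0_integralZl//.
  - by apply: eq_integral => y _; rewrite wE dotp_row_mx expRD EFinM.
  - by apply/measurable_EFinP; apply: measurable_expRT; exact: measurable_dotp.
under eq_integral do rewrite E.
rewrite ge0_integralZr//.
- by rewrite Q1E -EFinM -expRD -mulrDr -dotp_row_mx -wE.
- by apply/measurable_EFinP; apply: measurable_expRT; exact: measurable_dotp.
Qed.

Lemma gauss_moment : exists C : R, 0 < C /\ forall j, exists2 Q : probability (borel R j) R, Cm Q &
  forall w k, (0 < k)%N -> Int Q (fun x => `|dotp x w| ^+ k) <= (C * Num.sqrt k%:R * enorm w) ^+ k.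
Proof.
have [c [c0 H]] := gauss_law; exists (2 * expR c); split; first by rewrite mulr_gt0// expR_gt0.
move=> j; have [Q cQ QE] := H j; exists Q => // w k k0.
have [->|w0] := eqVneq w 0.
  rewrite (_ : enorm 0 = 0) ?mulr0; last by rewrite /enorm dotp0l sqrtr0.
  rewrite (eq_Int Q (g := fun=> 0)); last by move=> x; rewrite dotp0r normr0 expr0n gt_eqF.
  by rewrite Int0 expr0n gt_eqF.
have k0' : 0 < k%:R :> R by rewrite ltr0n.
have sk : 0 < Num.sqrt k%:R :> R by rewrite sqrtr_gt0.
have sk2 : Num.sqrt k%:R ^+ 2 = k%:R :> R by rewrite sqr_sqrtr// ltW.
have ew : 0 < enorm w by rewrite sqrtr_gt0; exact: dotp_gt0.
(* The scale in [t^k <= k^k e^t], [t = l |<x,w>|], for which the Gaussian exponent [c l^2 |w|^2] is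
   exactly [c k]. *)
pose l := Num.sqrt k%:R / enorm w.
have l0 : 0 < l by rewrite divr_gt0.
have me (a : R) : measurable_fun setT (fun x : borel R j => expR (a * dotp x w)).
  by apply: measurable_expRT; apply: measurable_funM => //; exact: measurable_dotp.
have IE (a : R) : ig Q (fun x => expR (a * dotp x w)) /\ Int Q (fun x => expR (a * dotp x w)) = expR (c * (a * (a * dotp w w))).
  apply: Int_eqE => //; rewrite -dotpZr -dotpZl -QE.
  by apply: eq_integral => x _; rewrite dotpZr.
have [i1 I1] := IE l; have [i2 I2] := IE (- l).
have lw : l * (l * dotp w w) = k%:R.
  by rewrite mulrA -expr2 /l expr_div_n sk2 -enorm2 divfK// gt_eqF// exprn_gt0.
have [lcQ _ _] := cQ.
apply: (@le_trans _ _ (Int Q (fun x => (Num.sqrt k%:R * enorm w) ^+ k * (expR (l * dotp x w) + expR (- l * dotp x w))))).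
  apply: Int_le; [exact: ig_pow|by apply: igZ; exact: igD|move=> x].
  have := expR_pow_le k (mulr_ge0 (ltW l0) (normr_ge0 (dotp x w))).
  rewrite exprMn => H1.
  have lk : 0 < l ^+ k by rewrite exprn_gt0.
  rewrite -(ler_pM2l lk); apply: le_trans H1 _.
  rewrite mulrA -exprMn (_ : l * (Num.sqrt k%:R * enorm w) = k%:R); last first.
    by rewrite /l mulrCA divfK ?gt_eqF// -expr2.
  rewrite ler_pM2l ?exprn_gt0//.
  have [h|h] := leP 0 (dotp x w).
    by rewrite ger0_norm// lerDl expR_ge0.
  by rewrite ltr0_norm// mulrN -mulNr lerDr expR_ge0.
rewrite IntZ; last exact: igD.
rewrite IntD// I1 I2 !mulNr !mulrN opprK lw.
rewrite -[X in _ <= X ^+ k]mulrA [leRHS]exprMn [leRHS]mulrC ler_wpM2l//.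
  by rewrite exprn_ge0// mulr_ge0 ?ltW.
rewrite -mulr2n -[_ *+ 2]mulr_natl [leRHS]exprMn [c * _]mulrC expRM_natl ler_wpM2r ?exprn_ge0 ?expR_ge0//.
by rewrite -[leLHS]expr1 ler_weXn2l// ler1n.
Qed.

End standard.

(** * Spectral theorem and orthonormal bases *)

Section orthogonal.
Variable R : realType.

Lemma mulmx_tr_dotp n (x y : 'rV[R]_n) : x *m y^T = (dotp x y)%:M.
Proof.
apply/matrixP => i j; rewrite (ord1 i) (ord1 j) !mxE eqxx mulr1n.
by apply: eq_bigr => k _; rewrite mxE.
Qed.

Lemma orthogonal_tr n (U : 'M[R]_n) : U *m U^T = 1%:M -> U^T *m U = 1%:M.
Proof. by move/mulmx1C. Qed.

Lemma dotp_orth n p (U : 'M[R]_(n, p)) (x y : 'rV[R]_n) : U *m U^T = 1%:M ->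
  dotp (x *m U) (y *m U) = dotp x y.
Proof. by move=> UU; rewrite dotp_mulmx -mulmxA UU mulmx1. Qed.

(** The reflection in the hyperplane orthogonal to [e - v] exchanges these two unit vectors. *)
Lemma householder n (v : 'rV[R]_n.+1) : dotp v v = 1 ->
  exists2 U : 'M[R]_n.+1, U *m U^T = 1%:M & delta_mx 0 0 *m U = v.
Proof.
move=> vv; pose e := delta_mx 0 0 : 'rV[R]_n.+1.
have ee : dotp e e = 1 by rewrite dotp_delta mxE !eqxx.
have [ev|ev] := eqVneq e v.
  by exists 1%:M; rewrite ?trmx1 ?mulmx1.
pose w := e - v.
have w0 : 0 < dotp w w by apply: dotp_gt0; rewrite subr_eq0.
have ww : dotp w w = 2 - 2 * dotp e v.
  by rewrite /w !(dotpDl, dotpDr, dotpNl, dotpNr) (dotpC v e) ee vv; ring.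
have ew : dotp e w = 1 - dotp e v by rewrite /w dotpDr dotpNr ee.
pose c := 2 / dotp w w.
pose U : 'M[R]_n.+1 := 1%:M - c *: (w^T *m w).
have UT : U^T = U by rewrite /U linearB linearZ /= trmx1 trmx_mul trmxK.
have cw : c * dotp w w = 2 by rewrite /c divfK// gt_eqF.
have WW : (w^T *m w) *m (w^T *m w) = dotp w w *: (w^T *m w).
  by rewrite mulmxA -(mulmxA w^T) mulmx_tr_dotp mul_mx_scalar -scalemxAl.
exists U.
  rewrite UT /U mulmxBr mulmx1 mulmxBl mul1mx -scalemxAr -scalemxAl WW !scalerA.
  rewrite -mulrA cw; move: (w^T *m w) => W; apply/matrixP => i j; rewrite !mxE; ring.
rewrite /U mulmxBr mulmx1 -scalemxAr mulmxA mulmx_tr_dotp mul_scalar_mx scalerA -/e ew.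
have -> : c * (1 - dotp e v) = 1.
  have : c * (2 - 2 * dotp e v) = 2 by rewrite -ww.
  by rewrite (_ : c * (2 - 2 * dotp e v) = 2 * (c * (1 - dotp e v))); [move=> h; lra|ring].
by rewrite scale1r /w opprB addrCA subrr addr0.
Qed.

(** At a maximiser [v] of the Rayleigh quotient the form [B(x,y) = l <x,y> - <xA,y>] is positive
    semidefinite and vanishes at [v], so [v] lies in its kernel. *)
Lemma symmetric_eigen n (A : 'M[R]_n.+1) : A^T = A ->
  exists v l, dotp v v = 1 /\ v *m A = l *: v.
Proof.
move=> AT; pose q x := dotp (x *m A) x.
have cq : continuous q.
  apply: continuous_sum_ord => i x.
  apply: (@continuousM _ _ (fun x : 'rV[R]_n.+1 => (x *m A) 0 i) (fun x : 'rV[R]_n.+1 => x 0 i)); last exact: coord_continuous.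
  apply: (@continuous_comp _ _ _ (fun x : 'rV[R]_n.+1 => x *m A) (fun y : 'rV[R]_n.+1 => y 0 i)); first exact: continuous_lin.
  exact: coord_continuous.
pose S := [set x : 'rV[R]_n.+1 | dotp x x = 1].
have clS : closed S.
  apply: (@preimage_closed _ _ (fun x : 'rV[R]_n.+1 => dotp x x) [set 1]).
    by move=> x _; exact: continuous_dotpp.
  by apply: compact_closed; [exact: norm_hausdorff|exact: compact_set1].
have cS : compact S.
  by apply: (compact_enorm (c := 1) clS) => x; rewrite /S /= /enorm => ->; rewrite sqrtr1.
have S0 : S !=set0 by exists (delta_mx 0 0); rewrite /S /= dotp_delta mxE !eqxx.
have [v Sv vm] := @compact_EVT_max _ R q S S0 cS (continuous_subspaceT cq).
move: Sv; rewrite inE => vv; pose l := q v.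
have le_q x : q x <= l * dotp x x.
  have [->|x0] := eqVneq x 0; first by rewrite /q mul0mx !dotp0l mulr0.
  have xx := dotp_gt0 x0; pose r := Num.sqrt (dotp x x).
  have r0 : 0 < r by rewrite sqrtr_gt0.
  have r2 : r ^+ 2 = dotp x x by rewrite sqr_sqrtr// ltW.
  have : q (r^-1 *: x) <= l.
    by apply: vm; rewrite inE /S /= dotpZl dotpZr mulrA -expr2 exprVn r2 mulVf ?gt_eqF.
  rewrite /q -scalemxAl dotpZl dotpZr mulrA -expr2 exprVn r2.
  by rewrite ler_pdivrMl// mulrC.
pose B x y := l * dotp x y - dotp (x *m A) y.
exists v, l; split => //; apply/eqP; rewrite eq_sym -subr_eq0; apply/eqP.
set u := l *: v - v *m A.
have Bvu : dotp u u = B v u by rewrite {1}/u dotpDl dotpNl dotpZl.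
have Bvv : B v v = 0 by rewrite /B vv mulr1 subrr.
have Buu : 0 <= B u u by rewrite subr_ge0; exact: le_q.
have sym x y : dotp (x *m A) y = dotp (y *m A) x by rewrite dotp_mulmx AT dotpC.
have expand a b t : l * dotp (a + t *: b) (a + t *: b) - q (a + t *: b) = B a a + 2 * t * B a b + t ^+ 2 * B b b.
  by rewrite /q /B mulmxDl -scalemxAl !(dotpDl, dotpDr, dotpZl, dotpZr) (dotpC b a) (sym b a); ring.
have main t : 0 <= 2 * t * B v u + t ^+ 2 * B u u.
  by have := le_q (v + t *: u); rewrite -subr_ge0 expand Bvv add0r.
have uu := dotp_ge0 u.
have Bu1 : 0 < B u u + 1 by lra.
(* Nearly the minimiser of the quadratic in [t]; the added 1 keeps the denominator positive when
   [B u u] vanishes. *)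
have := main (- (B v u) / (B u u + 1)).
have -> : 2 * (- B v u / (B u u + 1)) * B v u + (- B v u / (B u u + 1)) ^+ 2 * B u u
   = - (B v u / (B u u + 1)) ^+ 2 * (B u u + 2).
  by field; rewrite gt_eqF.
have s0 := sqr_ge0 (B v u / (B u u + 1)).
move=> h; have : (B v u / (B u u + 1)) ^+ 2 <= 0.
  by rewrite -(ler_pM2r (_ : 0 < B u u + 2)); lra.
move=> h2; have : (B v u / (B u u + 1)) ^+ 2 = 0 by apply/eqP; rewrite eq_le h2 s0.
move/eqP; rewrite sqrf_eq0 mulf_eq0 invr_eq0 (gt_eqF Bu1) orbF -Bvu => /eqP u0.
by apply: enorm_eq0; rewrite /enorm u0 sqrtr0.
Qed.

(** A Householder map moves the first basis vector to an eigenvector; symmetry then clears both the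
    first row and the first column, and the remaining block goes to the induction. *)
Lemma spectral n (A : 'M[R]_n) : A^T = A ->
  exists U (d : 'rV[R]_n), U *m U^T = 1%:M /\ A = U^T *m diag_mx d *m U.
Proof.
elim: n A => [|n ih] A AT.
  by exists 0, 0; split; apply/matrixP => -[].
have [v [l [vv vA]]] := symmetric_eigen AT.
have [H HH Hv] := householder vv.
have [B BE0] : exists B : 'M[R]_(1 + n), B = H *m A *m H^T by exists (H *m A *m H^T).
have BT : B^T = B by rewrite BE0 !trmx_mul trmxK AT mulmxA.
have B0 : delta_mx 0 0 *m B = l *: (delta_mx 0 0 : 'rV[R]_n.+1).
  by rewrite BE0 !mulmxA Hv vA -scalemxAl -[v in v *m H^T]Hv -mulmxA HH mulmx1.
have Brow (j : 'I_(1 + n)) : B 0 j = l * (0 == j)%:R.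
  have /rowP/(_ j) := B0; rewrite -rowE !mxE => ->; by rewrite eqxx (eq_sym j).
have Bur : ursubmx B = 0.
  apply/matrixP => i j; rewrite (ord1 i) !mxE (_ : lshift n 0 = 0); last exact/val_inj.
  by rewrite Brow mulr0.
have Bul : ulsubmx B = l%:M.
  apply/matrixP => i j; rewrite (ord1 i) (ord1 j) !mxE (_ : lshift n 0 = 0); last exact/val_inj.
  by rewrite Brow eqxx mulr1.
have Bdl : dlsubmx B = 0 by rewrite -BT -trmx_ursub Bur trmx0.
have Bdr : (drsubmx B)^T = drsubmx B by rewrite trmx_drsub BT.
have BE : B = block_mx l%:M 0 0 (drsubmx B) by rewrite -[LHS]submxK Bul Bur Bdl.
have [U [d [UU dE]]] := ih _ Bdr.
pose W : 'M[R]_(1 + n) := block_mx 1%:M 0 0 U.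
have WT : W^T = block_mx 1%:M 0 0 U^T by rewrite /W tr_block_mx !trmx0 trmx1.
have WW : W *m W^T = 1%:M.
  by rewrite WT /W mulmx_block !mul1mx !mul0mx !mulmx0 !addr0 add0r UU -scalar_mx_block.
have HT := orthogonal_tr HH.
exists (W *m H), (row_mx l%:M d); split.
  by rewrite trmx_mul mulmxA -(mulmxA W) HH mulmx1.
have -> : A = H^T *m B *m H.
  by rewrite BE0 !mulmxA HT mul1mx -mulmxA HT mulmx1.
rewrite trmx_mul !mulmxA; congr (_ *m H); rewrite -!mulmxA; congr (H^T *m _).
have key : B = W^T *m (diag_mx (row_mx (l%:M : 'rV[R]_1) d) *m W).
  rewrite diag_mx_row {1}BE WT /W mulmx_block !mul0mx !mulmx0 !addr0 !add0r mulmx_block.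
  rewrite !mul1mx !mulmx1 !mul0mx !mulmx0 !addr0 !add0r mulmxA -dE.
  congr block_mx; apply/matrixP => i j; rewrite (ord1 i) (ord1 j) !mxE eqxx.
  by rewrite mulr1n.
exact: key.
Qed.

Lemma spectral_pos n (A : 'M[R]_n) : A^T = A -> (forall x, x != 0 -> 0 < dotp (x *m A) x) ->
  exists U (d : 'rV[R]_n), [/\ U *m U^T = 1%:M, A = U^T *m diag_mx d *m U & forall i, 0 < d 0 i].
Proof.
move=> AT Apos; have [U [d [UU AE]]] := spectral AT; exists U, d; split => // i.
have := Apos (delta_mx 0 i *m U).
rewrite AE !mulmxA -(mulmxA _ U U^T) UU mulmx1 dotp_orth// dotp_delta.
rewrite mul_mx_diag !mxE !eqxx mul1r; apply.
apply/eqP => h; have : (delta_mx 0 i : 'rV[R]_n) = 0 by rewrite -[LHS]mulmx1 -UU mulmxA h mul0mx.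
by move/rowP/(_ i); rewrite !mxE !eqxx => /eqP; rewrite oner_eq0.
Qed.

Lemma pos_sqrt n (A : 'M[R]_n) : A^T = A -> (forall x, x != 0 -> 0 < dotp (x *m A) x) ->
  exists2 P : 'M[R]_n, P \in unitmx & A = P *m P^T.
Proof.
move=> AT Apos; have [U [d [UU AE dpos]]] := spectral_pos AT Apos.
pose D : 'M[R]_n := diag_mx (\row_i Num.sqrt (d 0 i)).
have DD : D *m D^T = diag_mx d.
  rewrite tr_diag_mx mulmx_diag; congr diag_mx; apply/rowP => i.
  by rewrite !mxE -expr2 sqr_sqrtr// ltW.
exists (U^T *m D); last by rewrite trmx_mul trmxK mulmxA -(mulmxA _ D) DD.
rewrite unitmx_mul unitmx_tr; apply/andP; split; first by case/mulmx1_unit: UU.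
rewrite unitmxE det_diag unitfE; apply/prodf_neq0 => i _.
by rewrite mxE sqrtr_eq0 -ltNge.
Qed.

Lemma orthonormal_free n (Y : seq 'rV[R]_n) :
  (forall i j, (i < size Y)%N -> (j < size Y)%N -> dotp Y`_i Y`_j = (i == j)%:R) -> free Y.
Proof.
move=> oY; rewrite -[Y]/(tval (in_tuple Y)); apply/freeP => k sk i.
have := congr1 (fun z => dotp z Y`_i) sk; rewrite dotp0l.
have -> : dotp (\sum_(i < size Y) k i *: Y`_i) Y`_i = \sum_(j < size Y) k j * dotp Y`_j Y`_i.
  elim/big_ind2 : _ => [|x1 x2 y1 y2 h1 h2|j _]; first by rewrite dotp0l.
    by rewrite dotpDl h1 h2.
  by rewrite dotpZl.
rewrite (bigD1 i)//= oY// eqxx mulr1 big1 ?addr0// => j ji.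
by rewrite oY// (negbTE (_ : nat_of_ord j != i)) ?mulr0.
Qed.

(** Keeping the spans of all prefixes matters in [grass_transport], where a basis of a subspace is
    the beginning of a longer list. *)
Lemma gram_schmidt n (X : seq 'rV[R]_n) : free X ->
  exists Y, [/\ size Y = size X,
    forall i j, (i < size Y)%N -> (j < size Y)%N -> dotp Y`_i Y`_j = (i == j)%:R &
    forall i, (<<take i Y>> = <<take i X>>)%VS].
Proof.
elim/last_ind: X => [|X x ih] fX; first by exists [::].
have pr : perm_eq (rcons X x) (x :: X) by rewrite perm_rcons.
have : free (x :: X) by rewrite -(perm_free pr).
rewrite free_cons => /andP[xX fX'].
have [Y [sY oY spY]] := ih fX'.
have spYX : (<<Y>> = <<X>>)%VS by have := spY (size X); rewrite -{1}sY !take_size.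
pose p := \sum_(i < size Y) dotp x Y`_i *: Y`_i.
have pY : p \in <<Y>>%VS.
  by apply: rpred_sum => i _; apply: rpredZ; apply: memv_span; exact: mem_nth.
pose z := x - p.
have z0 : z != 0 by rewrite subr_eq0; apply: contra xX => /eqP ->; rewrite -spYX.
have zz := dotp_gt0 z0.
pose r := Num.sqrt (dotp z z).
have r0 : 0 < r by rewrite sqrtr_gt0.
have r2 : r ^+ 2 = dotp z z by rewrite sqr_sqrtr// ltW.
pose y := r^-1 *: z.
have yy : dotp y y = 1.
  by rewrite /y dotpZl dotpZr mulrA -expr2 exprVn r2 mulVf// gt_eqF.
have zY i : (i < size Y)%N -> dotp z Y`_i = 0.
  move=> iY; rewrite /z dotpDl dotpNl.
  have -> : dotp p Y`_i = \sum_(j < size Y) dotp x Y`_j * dotp Y`_j Y`_i.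
    rewrite /p; elim/big_ind2 : _ => [|x1 x2 y1 y2 h1 h2|j _]; first by rewrite dotp0l.
      by rewrite dotpDl h1 h2.
    by rewrite dotpZl.
  rewrite (bigD1 (Ordinal iY))//= oY// eqxx mulr1 big1 ?addr0 ?subrr// => j ji.
  by rewrite oY// (negbTE (_ : nat_of_ord j != i)) ?mulr0.
have yY i : (i < size Y)%N -> dotp y Y`_i = 0 by move=> iY; rewrite /y dotpZl zY// mulr0.
exists (rcons Y y); split.
- by rewrite !size_rcons sY.
- move=> i j; rewrite size_rcons !ltnS !nth_rcons => iY jY.
  case: ltngtP iY => // [iY|iY] _; case: ltngtP jY => // [jY|jY] _.
  + exact: oY.
  + by rewrite dotpC yY// jY (ltn_eqF iY).
  + by rewrite yY// iY eq_sym (ltn_eqF jY).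
  + by rewrite yy iY jY eqxx.
- move=> i; have [iX|iX] := leqP i (size X).
    by rewrite -!cats1 !takel_cat ?sY// spY.
  rewrite !take_oversize ?size_rcons ?sY// -!cats1 !span_cat spYX !span_seq1.
  have pX : p \in <<X>>%VS by rewrite -spYX.
  have ry : r *: y = x - p by rewrite /y scalerA mulfV ?gt_eqF// scale1r.
  apply/eqP; rewrite eqEsubv !subv_add !addvSl /= -!memvE; apply/andP; split.
    rewrite (_ : y = - (r^-1 *: p) + r^-1 *: x); last by rewrite /y /z scalerBr addrC.
    by apply: memv_add; rewrite ?rpredN rpredZ// memv_line.
  rewrite (_ : x = p + r *: y); last by rewrite ry addrCA subrr addr0.
  by apply: memv_add => //; rewrite rpredZ// memv_line.
Qed.

End orthogonal.

(** * Exponential tilts and regular positions *)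

Section superlevel.
Variable R : realType.

(** With [rho = <w,v> / s], the point [(2 / rho) w] has [<.,v> = 2 s] and lies outside the
    superlevel set, so log-concavity on the ray gives [p w <= p 0 e^(-2 k rho)]. Combined with the
    midpoint inequality [p w p 0 <= p(w/2)^2] this becomes a decay relative to [p(w/2)], whose
    integral is only [2^n] times that of [p]. *)
Lemma lcf_decay n (p : 'rV[R]_n -> R) (k s : R) (v w : 'rV[R]_n) :
  (forall x, 0 <= p x) -> lcf p -> 0 < p 0 -> 0 < s -> 0 <= k ->
  (forall x, p 0 * expR (- 4 * k) <= p x -> dotp x v <= s) ->
  2 * s < dotp w v -> p w <= p (2^-1 *: w) * expR (- k * (dotp w v / s)).
Proof.
move=> p0 lp p00 s0 k0 Ks wv.
pose rho := dotp w v / s; rewrite -/rho.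
have rho2 : 2 < rho by rewrite /rho ltr_pdivlMr.
have rho0 : 0 < rho by lra.
have [pw0|pw0] := eqVneq (p w) 0; first by rewrite pw0 mulr_ge0// expR_ge0.
have pw : 0 < p w by rewrite lt_neqAle eq_sym pw0 p0.
pose l := 2 / rho.
have l0 : 0 < l by rewrite divr_gt0.
have l1 : l < 1 by rewrite /l ltr_pdivrMr// mul1r.
have l01 : 0 < l < 1 by rewrite l0 l1.
have lr : l * rho = 2 by rewrite /l divfK// gt_eqF.
have zK : p (l *: w) < p 0 * expR (- 4 * k).
  rewrite ltNge; apply/negP => /Ks; rewrite dotpZl => h.
  have e : dotp w v = rho * s by rewrite /rho divfK// gt_eqF.
  by move: h; rewrite e mulrA lr; lra.
have := lp 0 w l l01; rewrite scaler0 add0r => /le_lt_trans/(_ zK) H.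
have h1 : p w `^ l < (p 0 * expR (- 2 * k * rho)) `^ l.
  rewrite powRM ?expR_ge0 ?(ltW p00)// powR_expR (_ : l * (- 2 * k * rho) = - 4 * k); last first.
    by rewrite mulrCA lr; ring.
  have p1 : 0 < p 0 `^ (1 - l) by rewrite powR_gt0.
  rewrite -(ltr_pM2l p1) mulrA -powRD ?subrK ?powRr1 ?(ltW p00)//.
  by rewrite oner_eq0.
have h2 : p w <= p 0 * expR (- 2 * k * rho).
  rewrite leNgt; apply/negP => h; have := h1; rewrite ltNge; apply/negP; rewrite negbK.
  apply: ge0_ler_powR; [exact: ltW| |by rewrite nnegrE|exact: ltW].
  by rewrite nnegrE mulr_ge0 ?expR_ge0 ?(ltW p00).
have h3 := lcf_mid w 0 p0 lp; rewrite addr0 in h3.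
have h4 : p w * expR (2 * k * rho) <= p 0.
  have := ler_wpM2r (expR_ge0 (2 * k * rho)) h2.
  by rewrite -(mulrA (p 0)) -expRD (_ : _ + _ = 0) ?expR0 ?mulr1//; ring.
have h5 : (p w * expR (k * rho)) ^+ 2 <= p (2^-1 *: w) ^+ 2.
  apply: le_trans h3; rewrite exprMn expr2 -mulrA ler_pM2l// expr2 -expRD.
  by rewrite (_ : k * rho + k * rho = 2 * k * rho)//; ring.
have h6 : p w * expR (k * rho) <= p (2^-1 *: w).
  by move: h5; rewrite ler_sqr// nnegrE ?mulr_ge0 ?expR_ge0.
have := ler_wpM2r (expR_ge0 (- k * rho)) h6.
by rewrite -(mulrA (p w)) -expRD (_ : _ + _ = 0) ?expR0 ?mulr1//; ring.
Qed.

Lemma int_scale n (a : R) (h : 'rV[R]_n -> R) : a != 0 ->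
  measurable_fun setT (h : borel R n -> R) -> (forall x, 0 <= h x) ->
  (\int[leb R n]_x (h x)%:E = (`|a| ^+ n)%:E * \int[leb R n]_x (h (a *: x))%:E)%E.
Proof.
move=> a0 mh h0.
have u : a%:M \in @unitmx R n by rewrite unitmxE det_scalar unitrX// unitfE.
rewrite -(@jacobian_unitmx R n _ u (fun x => (h x)%:E)).
- rewrite det_scalar normrX; congr (_ * _)%E; apply: eq_integral => x _.
  by rewrite mul_mx_scalar.
- exact/measurable_EFinP.
- by move=> x; rewrite lee_fin.
Qed.

Lemma Int_half n (p : 'rV[R]_n -> R) : (forall x, 0 <= p x) -> ig (leb R n) p ->
  ig (leb R n) (fun x => p (2^-1 *: x)) /\ Int (leb R n) (fun x => p (2^-1 *: x)) = 2 ^+ n * Int (leb R n) p.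
Proof.
move=> p0 ip; have mp := ig_measurable ip.
have mp2 : measurable_fun setT (fun x : borel R n => p (2^-1 *: (x : 'rV[R]_n))).
  have := measurableT_comp mp (@measurable_lin R n n (2^-1)%:M).
  by apply: eq_measurable_fun => x _ /=; rewrite mul_mx_scalar.
apply: Int_eqE => //.
rewrite (int_scale (a := 2)) => [|||x]; [|by rewrite gt_eqF|exact: mp2|exact: p0].
under eq_integral do rewrite scalerA mulVf ?scale1r ?gt_eqF//.
by rewrite IntE// -EFinM ger0_norm.
Qed.

Lemma superlevel_volume n (p : 'rV[R]_n -> R) (t : R) : 0 < t -> (forall x, 0 <= p x) -> ig (leb R n) p ->
  (leb R n [set x | (t <= p x)%R] <= (t^-1 * Int (leb R n) p)%:E)%E.
Proof.
move=> t0 p0 ip; have mp := ig_measurable ip.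
have mA : measurable ([set x | t <= p x] : set (borel R n)) by exact: measurable_set_le.
have -> : leb R n [set x | (t <= p x)%R] = (\int[leb R n]_x (\1_[set x | (t <= p x)%R] x)%:E)%E.
  by rewrite integral_indic// setIT.
rewrite EFinM -IntE// -ge0_integralZl//; try (by move=> x _; rewrite lee_fin); try (by rewrite lee_fin invr_ge0 ltW); try exact/measurable_EFinP.
apply: ge0_le_integral => //.
- by apply/measurable_EFinP; exact: measurable_indic.
- by apply/measurable_EFinP; exact: measurable_funM.
- move=> x _; rewrite -EFinM lee_fin indicE; case: (boolP (x \in _)) => [/set_mem /= h|_].
    by rewrite ler_pdivlMl// mulr1.
  by rewrite mulr_ge0// invr_ge0 ltW.
Qed.

(** Outside the ball [e^(-|x|^2/2)] is at most [e^(-2n)] times [e^(-|x|^2/4)], and inside it is at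
    most 1. Comparing the total Gaussian integrals leaves volume at least one for the ball. *)
Lemma leb_gauss_ball n : (0 < n)%N ->
  (1 <= leb R n [set x : 'rV[R]_n | (dotp x x <= 8 * n%:R)%R])%E.
Proof.
move=> n0; set A := [set x : 'rV[R]_n | _].
have mA : measurable (A : set (borel R n)).
  by apply: measurable_set_le => //; exact: measurable_dotpp.
have [->|] := eqVneq (leb R n A) +oo%E; first by rewrite leey.
rewrite -ltey => Aoo.
have h2 : 0 < 2^-1 :> R by rewrite invr_gt0.
have h4 : 0 < 4^-1 :> R by rewrite invr_gt0.
have [i2 I2] := ig_gauss n h2; have [i4 I4] := ig_gauss n h4.
have iA : ig (leb R n) (\1_A : 'rV[R]_n -> R).
  apply: ig_ge0; [exact: measurable_indic|by []|].
  by rewrite integral_indic// setIT.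
have IA : leb R n A = (Int (leb R n) (\1_A : 'rV[R]_n -> R))%:E.
  by rewrite -IntE// integral_indic// setIT.
rewrite IA lee_fin.
have : Int (leb R n) (fun x => expR (- 2^-1 * dotp x x)) <=
    Int (leb R n) (fun x => (\1_A x : R) + expR (- 2 * n%:R) * expR (- 4^-1 * dotp x x)).
  apply: Int_le => //; first by apply: igD => //; exact: igZ.
  move=> x; rewrite -expRD indicE; case: (boolP (x \in A)) => [_|/negP xA].
    rewrite -[leLHS]addr0 lerD ?expR_ge0// -expR0 ler_expR.
    by rewrite mulNr oppr_le0 mulr_ge0 ?dotp_ge0// ltW.
  have h : 8 * n%:R < dotp x x by rewrite ltNge; apply/negP => h; apply: xA; rewrite inE.
  rewrite add0r ler_expR; lra.
rewrite IntD//; last exact: igZ.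
rewrite IntZ// I2 I4.
have e4 : Num.sqrt (pi / 4^-1) = Num.sqrt 2 * Num.sqrt (pi / 2^-1) :> R.
  by rewrite -sqrtrM//; congr Num.sqrt; rewrite !invrK; ring.
set J := Num.sqrt (pi / 2^-1).
have e5 : expR (- 2 * n%:R) * Num.sqrt (pi / 4^-1) ^+ n = J ^+ n * (Num.sqrt 2 * expR (- 2)) ^+ n.
  by rewrite e4 (mulrC (- 2)) expRM_natl -!exprMn; congr (_ ^+ n); rewrite -/J; ring.
rewrite e5.
have J2 : 2 <= J.
  have : Num.sqrt (2 ^+ 2) <= J :> R.
    by rewrite /J ler_wsqrtr// invrK; have := @pi_ge2 R; lra.
  by rewrite sqrtr_sqr ger0_norm.
have J1 : 2 <= J ^+ n.
  by apply: (le_trans J2); rewrite -[leLHS]expr1 ler_weXn2l//; lra.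
have q1 : Num.sqrt 2 * expR (- 2) <= 2^-1 :> R.
  have s2 : Num.sqrt 2 <= 3 / 2 :> R.
    have h : 0 <= 3 / 2 :> R by lra.
    rewrite -(ler_sqr (sqrtr_ge0 2) h) sqr_sqrtr//; lra.
  have e2 : expR (- 2) <= 3^-1 :> R.
    rewrite expRN lef_pV2 ?posrE ?expR_gt0//; have := expR_ge1Dx (2 : R); lra.
  apply: (@le_trans _ _ (3 / 2 * 3^-1)); last by lra.
  by apply: ler_pM; rewrite ?sqrtr_ge0 ?expR_ge0.
have qn : (Num.sqrt 2 * expR (- 2)) ^+ n <= 2^-1 :> R.
  have q0 : 0 <= Num.sqrt 2 * expR (- 2) :> R by rewrite mulr_ge0 ?sqrtr_ge0 ?expR_ge0.
  apply: (le_trans _ q1); rewrite -[leRHS]expr1; apply: ler_wiXn2l => //.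
  by apply: (le_trans q1); lra.
have qJ : J ^+ n * (Num.sqrt 2 * expR (- 2)) ^+ n <= J ^+ n * 2^-1.
  by rewrite ler_pM2l//; lra.
lra.
Qed.

Lemma leb_affine n (S : 'M[R]_n) (b : 'rV[R]_n) (A : set 'rV[R]_n) : S \in unitmx ->
  measurable (A : set (borel R n)) ->
  measurable ([set b + u *m S | u in A] : set (borel R n)) /\
  leb R n [set b + u *m S | u in A] = (`|\det S|%:E * leb R n A)%E.
Proof.
move=> uS mA.
have BE : [set b + u *m S | u in A] = [set x | A ((x - b) *m invmx S)].
  apply/seteqP; split => [_ [u Au <-]|x Ax] /=.
    by rewrite addrAC subrr add0r mulmxK.
  by exists ((x - b) *m invmx S) => //; rewrite mulmxKV// addrCA subrr addr0.
have mB : measurable ([set b + u *m S | u in A] : set (borel R n)).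
  have := measurableT_comp (measurable_lin (invmx S)) (measurable_add (- b)) measurableT mA.
  by rewrite setTI BE.
split => //; set B := [set _ | _ in _] in mB *.
have mI (D : set (borel R n)) : measurable D -> measurable_fun setT (fun x => (\1_D x)%:E : \bar R).
  by move=> mD; apply/measurable_EFinP; exact: measurable_indic.
have -> : leb R n B = (\int[leb R n]_x (\1_B x)%:E)%E by rewrite integral_indic// setIT.
have -> : leb R n A = (\int[leb R n]_x (\1_A x)%:E)%E by rewrite integral_indic// setIT.
rewrite -(ge0_integral_translation b (mI _ mB)); last by move=> x; rewrite lee_fin.
rewrite -(jacobian_unitmx uS (f := fun x => (\1_B (x + b)%R)%:E)); last 2 first.
- exact: measurableT_comp (mI _ mB) (measurable_add b).
- by move=> x; rewrite lee_fin.
congr (_ * _)%E; apply: eq_integral => x _; rewrite !indicE; congr (_%:R%:E).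
rewrite (_ : (x *m S + b \in B) = (x \in A))//; apply/idP/idP; rewrite !inE.
  by rewrite /B BE /= addrK mulmxK.
by move=> Ax; exists x => //; rewrite addrC.
Qed.

Lemma leb_ball_gt0 n (r : R) : 0 < r -> (0 < leb R n [set x : 'rV[R]_n | (enorm x <= r)%R] < +oo)%E.
Proof.
move=> r0.
have mb k (c : R) : measurable ([set x : 'rV[R]_k | enorm x <= c] : set (borel R k)).
  by apply: measurable_compact_rV; exact: compact_ball.
apply/andP; split; last by have [_] := lcm_leb R n; apply; exact: compact_ball.
case: n => [|n].
  rewrite leb0E indicE mem_set ?lte_fin ?ltr01//= /enorm dotp0l sqrtr0; exact: ltW.
pose c : R := Num.sqrt (8 * n.+1%:R).
have c0 : 0 < c by rewrite sqrtr_gt0.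
have cE : [set x : 'rV[R]_n.+1 | dotp x x <= 8 * n.+1%:R] = [set x | enorm x <= c].
  apply/seteqP; split => x /=; rewrite enorm_sq_le ?(ltW c0)// /c sqr_sqrtr//.
have := @leb_gauss_ball n.+1 isT; rewrite cE => H.
have u : (c / r)%:M \in @unitmx R n.+1.
  by rewrite unitmxE det_scalar unitrX// unitfE gt_eqF// divr_gt0.
have [_ E] := leb_affine 0 u (mb _ r).
have imE : [set 0 + u *m (c / r)%:M | u in [set x : 'rV[R]_n.+1 | enorm x <= r]] = [set x | enorm x <= c].
  apply/seteqP; split => [_ [x /= xr <-]|x /= xc].
    rewrite add0r mul_mx_scalar enormZ gtr0_norm ?divr_gt0//.
    by rewrite mulrAC ler_pdivrMr// ler_pM2l.
  exists ((r / c) *: x) => /=.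
    by rewrite enormZ gtr0_norm ?divr_gt0// mulrAC ler_pdivrMr// ler_pM2l.
  by rewrite add0r mul_mx_scalar scalerA -[c / r]invf_div mulVf ?scale1r// gt_eqF ?divr_gt0.
rewrite imE in E; rewrite E in H.
rewrite lt_neqAle measure_ge0 andbT; apply/eqP => h; move: H; rewrite -h mule0.
by rewrite lee_fin ler10.
Qed.

End superlevel.

(** * Lower bounds for exponential moments *)

Section moments.
Variable R : realType.

Lemma law_translate n (b : 'rV[R]_n) (P : probability (borel R n) R) : lcm P ->
  exists2 Q, law_of P (fun x => x + b) Q & lcm Q.
Proof.
move=> lcP; have [Q fQ QE] := law_ofP P (measurable_add b); exists Q => //.
apply: prob_lcm => A B l cA cB l01; rewrite !QE.
have cK (K : set 'rV[R]_n) : compact K -> compact [set x | K (x + b)].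
  move=> cK; have -> : [set x | K (x + b)] = (fun x => x - b) @` K.
    apply/seteqP; split => [x Kx|_ [x Kx <-]] /=; last by rewrite subrK.
    by exists (x + b) => //; rewrite addrK.
  apply: continuous_compact cK; apply: continuous_subspaceT => x.
  by apply: (@continuousB _ _ _ (fun y : 'rV[R]_n => y) (fun=> b)); [exact: cvg_id|exact: cst_continuous].
have [lc _] := lcP; apply: le_trans (lc _ _ _ (cK _ cA) (cK _ cB) l01) _.
rewrite le_eqVlt; apply/orP; left; apply/eqP; congr (P _).
apply/seteqP; split => [_ [x Ax] [y By] <-|x [a Aa] [c Bc] e] /=.
  exists (x + b) => //; exists (y + b) => //.
  by apply/rowP => i; rewrite !mxE; ring.
exists (a - b); first by rewrite /= subrK.
exists (c - b); first by rewrite /= subrK.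
apply: (addIr b); rewrite -e; apply/rowP => i; rewrite !mxE; ring.
Qed.

(** From [e^u >= (1 + u/2)^2] for [u >= -2]; below that the quartic term makes the left side
    negative. *)
Lemma expR_lower (u : R) : 1 + u + u ^+ 2 / 4 - u ^+ 4 <= expR u.
Proof.
have [h|h] := leP (- 2) u.
  have h1 : 0 <= 1 + u / 2 by lra.
  have h2 : (1 + u / 2) ^+ 2 <= expR u.
    have -> : expR u = expR (u / 2) ^+ 2 by rewrite -expRM_natl; congr expR; lra.
    by apply: lerXn2r; rewrite ?nnegrE ?expR_ge0//; exact: expR_ge1Dx.
  apply: le_trans h2; have : 0 <= u ^+ 4 by rewrite (exprM u 2 2) sqr_ge0.
  lra.
apply: le_trans (expR_ge0 u).
have u2 : 4 <= u ^+ 2 by nra.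
have : 4 * u ^+ 2 <= u ^+ 4 by rewrite (exprM u 2 2) [leRHS]expr2 ler_wpM2r// sqr_ge0.
nra.
Qed.

Lemma expR_bernoulli (k z : R) : 1 <= k -> 1 + k * (expR z - 1) <= expR (k * z).
Proof.
move=> k1; have k0 : 0 < k by lra.
have [->|kn1] := eqVneq k 1; first by rewrite !mul1r; lra.
have k1' : 1 < k by rewrite lt_neqAle eq_sym kn1.
have l01 : 0 < k^-1 < 1 by rewrite invr_gt0 k0 invf_lt1.
have := weighted_am_gm ler01 (expR_ge0 (k * z)) l01.
rewrite powR1 mul1r mulr1 powR_expR mulKf ?gt_eqF// => h.
have : k * expR z <= k * (1 - k^-1 + k^-1 * expR (k * z)) by rewrite ler_pM2l.
by rewrite mulrDr mulrA mulrBr mulfV ?gt_eqF// mulr1 mul1r; lra.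
Qed.

(** Chosen so that at standard deviation [r0] the quartic loss [borell_const * r0^4] equals
    [r0^2 / 8], half of the quadratic gain [r0^2 / 4] in [expR_lower]. The slope [c1] is the
    resulting gain in the logarithm per unit of standard deviation. *)
Definition r0sq : R := (8 * borell_const R)^-1.
Definition r0 : R := Num.sqrt r0sq.
Definition c1 : R := ln (1 + r0sq / 8) / r0.

Lemma borell_const_ge1 : 1 <= borell_const R.
Proof. by rewrite /borell_const !exprS expr0; lra. Qed.

Lemma r0sq_gt0 : 0 < r0sq.
Proof. by rewrite /r0sq invr_gt0; have := borell_const_ge1; lra. Qed.

Lemma r0_gt0 : 0 < r0. Proof. by rewrite sqrtr_gt0 r0sq_gt0. Qed.

Lemma r0_le1 : r0 <= 1.
Proof.
rewrite -[leRHS](@sqrtr1 R) ler_wsqrtr// /r0sq invf_le1//; have := borell_const_ge1; lra.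
Qed.

Lemma c1_gt0 : 0 < c1.
Proof. by rewrite divr_gt0 ?r0_gt0// ln_gt0//; have := r0sq_gt0; lra. Qed.

Variables (n : nat) (Q : probability (borel R n) R) (v : 'rV[R]_n) (r : R).
Hypothesis lcQ : lcm Q.
Hypothesis mQ : Int Q (fun x => dotp x v) = 0.
Hypothesis vQ : Int Q (fun x => dotp x v ^+ 2) = r ^+ 2.
Hypothesis r_ge0 : 0 <= r.
Hypothesis eQ : ig Q (fun x => expR (dotp x v)).

Lemma mgf_ge1 : 1 <= Int Q (fun x => expR (dotp x v)).
Proof.
have i1 := ig_dotp v lcQ.
have : Int Q (fun x => 1 + dotp x v) <= Int Q (fun x => expR (dotp x v)).
  apply: Int_le => //; first by apply: igD => //; exact: ig_cst.
  by move=> x; exact: expR_ge1Dx.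
by rewrite IntD// ?Int_cst ?mQ ?addr0//; exact: ig_cst.
Qed.

(** Shrunk by [l = r0 / r], the variable has standard deviation [r0], and the fourth moment bound
    gives a mean of at least [1 + r0^2 / 8]. Raising to the power [k = 1 / l], pointwise by
    Bernoulli's inequality, makes the gain linear in [r]. *)
Lemma mgf_lower : r0 <= r -> expR (c1 * r) <= Int Q (fun x => expR (dotp x v)).
Proof.
move=> r0r; have r00 := r0_gt0; have r_gt0 : 0 < r by lra.
pose l := r0 / r; pose k := r / r0.
have k1 : 1 <= k by rewrite ler_pdivlMr// mul1r.
have lk : l * k = 1 by rewrite /l /k mulrA divfK ?mulfV// gt_eqF.
have l0 : 0 < l by rewrite divr_gt0.
have l1 : l <= 1 by rewrite ler_pdivrMr// mul1r.
have i1 := ig_dotp v lcQ; have i2 := ig_sq v lcQ.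
have E4 x : `|dotp x v| ^+ 4 = dotp x v ^+ 4 by rewrite (exprM _ 2 2) real_normK ?num_real// -exprM.
have i4 : ig Q (fun x => dotp x v ^+ 4) by apply: eq_ig (ig_pow lcQ v 4).
have il : ig Q (fun x => expR (l * dotp x v)).
  apply: ig_le0 (igD (ig_cst Q 1) eQ).
    by apply: measurable_expRT; apply: measurable_funM => //; exact: measurable_dotp.
  move=> x; rewrite expR_ge0 /=; have [h|h] := leP 0 (dotp x v).
    by apply: (@le_trans _ _ (expR (dotp x v))); [rewrite ler_expR ler_piMl|rewrite lerDr].
  apply: (@le_trans _ _ 1); last by rewrite lerDl expR_ge0.
  by rewrite -expR0 ler_expR pmulr_rle0// ltW.
have vpos : 0 < Int Q (fun x => dotp x v ^+ 2) by rewrite vQ exprn_gt0.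
have m4 := fourth_moment lcQ vpos; rewrite vQ in m4.
have step : 1 + r0sq / 8 <= Int Q (fun x => expR (l * dotp x v)).
  have : Int Q (fun x => ((1 + l * dotp x v) + (l ^+ 2 / 4) * dotp x v ^+ 2) - l ^+ 4 * dotp x v ^+ 4) <= Int Q (fun x => expR (l * dotp x v)).
    apply: Int_le => //.
      apply: igB; last exact: igZ.
      apply: igD; last exact: igZ.
      by apply: igD; [exact: ig_cst|exact: igZ].
    move=> x; have := expR_lower (l * dotp x v); rewrite !exprMn; lra.
  have ia : ig Q (fun x => 1 + l * dotp x v) by apply: igD; [exact: ig_cst|exact: igZ].
  have ib : ig Q (fun x => (1 + l * dotp x v) + (l ^+ 2 / 4) * dotp x v ^+ 2) by apply: igD => //; exact: igZ.
  rewrite IntB//; last exact: igZ.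
  rewrite IntD//; last exact: igZ.
  rewrite IntD//; [|exact: ig_cst|exact: igZ].
  rewrite Int_cst !IntZ// mQ vQ mulr0 addr0; apply: le_trans.
  have lr : l ^+ 2 * r ^+ 2 = r0sq.
    by rewrite -exprMn /l divfK ?gt_eqF// sqr_sqrtr// ltW// r0sq_gt0.
  have l4 : l ^+ 4 * Int Q (fun x => dotp x v ^+ 4) <= borell_const R * r0sq ^+ 2.
    apply: (@le_trans _ _ (l ^+ 4 * (borell_const R * (r ^+ 2) ^+ 2))).
      by rewrite ler_pM2l ?exprn_gt0.
    by rewrite mulrCA (exprM l 2 2) -exprMn lr.
  have bc : borell_const R * r0sq ^+ 2 = r0sq / 8.
    rewrite /r0sq; field; rewrite gt_eqF//; have := borell_const_ge1; lra.
  rewrite bc in l4; rewrite mulrAC lr; lra.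
pose d := ln (1 + r0sq / 8).
have rs := r0sq_gt0.
have ed : expR d = 1 + r0sq / 8 by rewrite /d lnK// posrE; lra.
have c1r : c1 * r = k * d by rewrite /c1 /k -/d; field; rewrite gt_eqF.
have ix : ig Q (fun x => (1 - k) + k * expR (- d) * expR (l * dotp x v)) by apply: igD; [exact: ig_cst|exact: igZ].
have : Int Q (fun x => (1 - k) + k * expR (- d) * expR (l * dotp x v)) <= Int Q (fun x => expR (- (k * d)) * expR (dotp x v)).
  apply: Int_le => //; first exact: igZ.
  move=> x.
  have e1 : k * (l * dotp x v - d) = - (k * d) + dotp x v by rewrite mulrBr mulrA (mulrC k) lk mul1r addrC.
  have e2 : expR (l * dotp x v - d) = expR (- d) * expR (l * dotp x v) by rewrite addrC expRD.
  have := expR_bernoulli (l * dotp x v - d) k1; rewrite e1 e2 expRD; apply: le_trans.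
  by rewrite le_eqVlt; apply/orP; left; apply/eqP; ring.
rewrite IntD//; [|exact: ig_cst|exact: igZ].
rewrite Int_cst !IntZ// c1r => h.
have e1 : 1 <= expR (- d) * Int Q (fun x => expR (l * dotp x v)).
  by rewrite expRN ler_pdivlMl ?expR_gt0// mulr1 ed.
have h2 : 1 <= expR (- (k * d)) * Int Q (fun x => expR (dotp x v)).
  apply: le_trans h; rewrite -mulrA.
  have : k * 1 <= k * (expR (- d) * Int Q (fun x => expR (l * dotp x v))) by rewrite ler_wpM2l//; lra.
  lra.
by move: h2; rewrite expRN ler_pdivlMl ?expR_gt0// mulr1.
Qed.

End moments.

Section signed.
Variable R : realType.

Lemma law_of_Int_signed d (T : measurableType d) n (P : probability T R) (f : T -> 'rV[R]_n) Q
    (h : 'rV[R]_n -> R) : measurable_fun setT (f : T -> borel R n) ->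
  law_of P f Q -> ig Q h -> Int Q h = Int P (fun x => h (f x)).
Proof.
move=> mf fQ ih; have ih' := ig_norm ih; have mh := ig_measurable ih.
have h0 x : 0 <= `|h x| + h x by have := ler_norm (- h x); rewrite normrN; lra.
have mh1 := ig_measurable (igD ih' ih).
have i1 : ig P (fun x => `|h (f x)| + h (f x)).
  exact/(law_of_ig mf fQ mh1 h0)/igD.
have i2 : ig P (fun x => `|h (f x)|).
  exact/(law_of_ig mf fQ (ig_measurable ih') (fun=> normr_ge0 _)).
have E1 := law_of_Int mf fQ mh1 h0.
have E2 := law_of_Int mf fQ (ig_measurable ih') (fun=> normr_ge0 _).
transitivity (Int Q (fun x => (`|h x| + h x) - `|h x|)); first by apply: eq_Int => x; ring.
rewrite IntB//; last exact: igD.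
rewrite E1 E2 -IntB//; apply: eq_Int => x; ring.
Qed.

Lemma ig_gauss_affine n (S : 'M[R]_n) (b : 'rV[R]_n) : S \in unitmx ->
  ig (leb R n) (fun x => expR (- 2^-1 * dotp (x *m S + b) (x *m S + b))).
Proof.
move=> uS; have h2 : 0 < 2^-1 :> R by rewrite invr_gt0.
have [ig2 I2] := ig_gauss n h2.
have mg : measurable_fun setT (fun x : borel R n => (expR (- 2^-1 * dotp (x : 'rV[R]_n) x))%:E).
  by apply/measurable_EFinP; exact: ig_measurable ig2.
have mg' : measurable_fun setT (fun x : borel R n => (expR (- 2^-1 * dotp ((x : 'rV[R]_n) + b) (x + b)))%:E).
  exact: measurableT_comp mg (measurable_add b).
apply: ig_ge0; [exact: measurable_expaff|by move=> x; exact: expR_ge0|].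
have d0 : 0 < `|\det S| by rewrite normr_gt0 -unitfE -unitmxE.
have g0 (x : 'rV[R]_n) : (0 <= (expR (- 2^-1 * dotp (x + b) (x + b)))%:E)%E by rewrite lee_fin expR_ge0.
have H := @jacobian_unitmx R n S uS (fun x => (expR (- 2^-1 * dotp (x + b) (x + b)))%:E) mg' g0.
have E : (\int[leb R n]_x (expR (- 2^-1 * dotp (x + b) (x + b)))%:E < +oo)%E.
  rewrite (ge0_integral_translation b mg); last by move=> x; rewrite lee_fin expR_ge0.
  by rewrite IntE// ltry.
rewrite -H in E; move: E; rewrite !ltey; apply: contra_neq => ->.
by rewrite gt0_muley// lte_fin.
Qed.

Lemma expR_add_ge2 (t : R) : 2 <= expR t + expR (- t).
Proof. by have := expR_ge1Dx t; have := expR_ge1Dx (- t); lra. Qed.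

Lemma half_le (a b : R) : 2 * a <= b + b -> a <= b.
Proof. lra. Qed.

Lemma half_le8 (a b : R) : a <= 8 * b -> 2^-1 * a <= 4 * b.
Proof. lra. Qed.

Lemma tilt_contra (a : R) : 1 <= a -> - a / 2 < 4 * a + 1 + - 6 * a -> False.
Proof. lra. Qed.

End signed.

(** * Exponential tilts in a near-maximal position *)

Section tilt.
Variables (R : realType) (m : nat) (f : 'rV[R]_m -> R) (theta : R).
Hypothesis m_gt0 : (0 < m)%N.
Hypothesis f_gt0 : forall x, 0 < f x.
Hypothesis mf : measurable_fun setT (f : borel R m -> R).
Hypothesis lf : lcf f.
Hypothesis ef : forall x, f (- x) = f x.
Hypothesis theta_gt0 : 0 < theta.
Local Notation leb := (leb R m).

Let g (x : 'rV[R]_m) := expR (- 2^-1 * dotp x x).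
Let p x := f x * g x.
Let w y x := p x * expR (dotp x y).
Let M y := Int leb (w y).
Let I := Int leb p.

Hypothesis hQ : forall Q, Q \in unitmx ->
  Int leb (fun x => f x * expR (- 2^-1 * dotp (x *m Q) (x *m Q))) <= expR 1 * `|\det Q| `^ (- theta) * I.

Let f_ge0 x : 0 <= f x. Proof. exact: ltW. Qed.
Let f_le x : f x <= f 0. Proof. exact: lcf_even_max. Qed.
Let g_gt0 x : 0 < g x. Proof. exact: expR_gt0. Qed.
Let mg : measurable_fun setT (g : borel R m -> R).
Proof. by apply: measurable_expRT; apply: measurable_funM => //; exact: measurable_dotpp. Qed.
Let w_gt0 y x : 0 < w y x. Proof. by rewrite !mulr_gt0// expR_gt0. Qed.
Let mw y : measurable_fun setT (w y : borel R m -> R).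
Proof.
apply: measurable_funM; first exact: measurable_funM.
by apply: measurable_expRT; exact: measurable_dotp.
Qed.

Let wE y x : w y x = expR (2^-1 * dotp y y) * (f x * g (x - y)).
Proof.
rewrite /w /p /g mulrCA -mulrA; congr (_ * _); rewrite -!expRD; congr expR.
by rewrite !(dotpDl, dotpDr, dotpNl, dotpNr) (dotpC y x); field.
Qed.

Let ig_fk (S : 'M[R]_m) b : S \in unitmx ->
  ig leb (fun x => f x * expR (- 2^-1 * dotp (x *m S + b) (x *m S + b))).
Proof.
move=> uS; apply: ig_le0 (igZ (f 0) (ig_gauss_affine b uS)).
  by apply: measurable_funM => //; exact: measurable_expaff.
by move=> x; rewrite mulr_ge0 ?expR_ge0//= ler_wpM2r ?expR_ge0.
Qed.

Let ig_fg b : ig leb (fun x => f x * g (x + b)).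
Proof. by apply: eq_ig (ig_fk b (unitmx1 _ _)) => x; rewrite mulmx1. Qed.

Let iw y : ig leb (w y).
Proof.
apply: eq_ig (igZ (expR (2^-1 * dotp y y)) (ig_fg (- y))) => x.
by rewrite wE.
Qed.

Let ip : ig leb p.
Proof. by apply: eq_ig (ig_fg 0) => x; rewrite addr0. Qed.

Let ball_pos z (r : R) : 0 < r -> exists B : set (borel R m),
  [/\ measurable B, (0 < leb B)%E & forall x : 'rV[R]_m, B x -> enorm (x - z) <= r].
Proof.
move=> r0; have mB : measurable ([set x : 'rV[R]_m | enorm x <= r] : set (borel R m)).
  by apply: measurable_compact_rV; exact: compact_ball.
have [mA AE] := leb_affine z (unitmx1 _ _) mB.
exists [set z + u *m 1%:M | u in [set x : 'rV[R]_m | enorm x <= r]]; split => //.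
  by rewrite AE det1 normr1 mul1e; have /andP[] := leb_ball_gt0 m r0.
by move=> _ [u /= ur <-]; rewrite mulmx1 addrAC subrr add0r.
Qed.

Let pos_Int (h : 'rV[R]_m -> R) : (forall x, 0 < h x) -> ig leb h -> 0 < Int leb h.
Proof.
move=> h0 ih; have [B [mB B0 _]] := ball_pos 0 ltr01.
by apply: (Int_gt0 mB B0) => // x; exact: ltW.
Qed.

Let I_gt0 : 0 < I. Proof. by apply: pos_Int => // x; rewrite mulr_gt0. Qed.
Let M_gt0 y : 0 < M y. Proof. exact: pos_Int. Qed.

(** [M] is even, and the exponentials of opposite tilts add up to at least 2. *)
Lemma tilt_ge y : I <= M y.
Proof.
have MN : M (- y) = M y.
  apply: EFin_inj; rewrite -(IntE (iw (- y))) -(IntE (iw y)) -(lebN (mw (- y)) (fun x => ltW (w_gt0 (- y) x))).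
  apply: eq_integral => x _; congr (_%:E).
  by rewrite /w /p /g ef !dotpNl !dotpNr !opprK.
have : Int leb (fun x => 2 * p x) <= Int leb (fun x => w y x + w (- y) x).
  apply: Int_le; [exact: igZ|exact: igD|move=> x].
  rewrite /w -mulrDr mulrC (ler_pM2l (mulr_gt0 (f_gt0 x) (g_gt0 x))) dotpNr.
  exact: expR_add_ge2.
rewrite (IntZ 2 ip) (IntD (iw y) (iw (- y))) => h.
have {}h : 2 * I <= M y + M (- y) := h.
rewrite MN in h; exact: half_le h.
Qed.

(** Completing the square turns the tilt into a translation of the Gaussian factor, and Anderson's
    inequality removes the translation. *)
Lemma tilt_le y : M y <= expR (2^-1 * dotp y y) * I.
Proof.
have -> : M y = expR (2^-1 * dotp y y) * Int leb (fun x => f x * g (x - y)).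
  by rewrite -IntZ//; apply: eq_Int => x; rewrite wE.
rewrite (ler_pM2l (expR_gt0 _)); apply: anderson => //.
- exact: lcm_leb.
- exact: lebN.
- by move=> x; exact: ltW.
- by apply: lcf_gauss; rewrite invr_ge0.
- by move=> x; rewrite /g dotpNl dotpNr opprK.
Qed.

(** Half of the slope [c1] pays for moving inside the ellipsoid, the other half remains for the
    strict gap. The slack [eps] covers directions of standard deviation below [r0], where only
    Jensen's bound is available. *)
Let cc := c1 R / 2.
Let eps := cc * r0 R.

(** Here [b] is the barycentre and [S S^T] the covariance of the law with density proportional to
    [w y]. The points of the ellipsoid of radius [cc] about [b] are subgradients of [ln M] at [y] up
    to [eps], with room to spare in directions of standard deviation above one. The determinant
    bound comes from testing [hQ] with the matrix that whitens this law. *)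
Lemma tilt_ellipsoid y : exists b (S : 'M[R]_m), [/\ S \in unitmx,
  forall u v, enorm u <= cc -> M y * expR (dotp (b + u *m S^T) v - eps) <= M (y + v),
  forall u v, enorm u <= cc -> 1 < enorm (v *m S) ->
    M y * expR (dotp (b + u *m S^T) v + eps) < M (y + v) &
  dotp y y <= 8 * m%:R -> expR (- 6 * m%:R / theta) <= `|\det S| ].
Proof.
have [P [PE lcP]] := density_law (fun x => ltW (w_gt0 y x)) (iw y) (M_gt0 y).
have lw : lcf (w y).
  apply: lcf_mul; [by move=> x; rewrite ltW// mulr_gt0|by move=> x; exact: expR_ge0| |exact: lcf_explin].
  by apply: lcf_mul => //; [move=> x; exact: ltW|apply: lcf_gauss; rewrite invr_ge0].
have {}lcP := lcP (lcm_leb R m) lw.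
have iP v : ig P (fun x => dotp x v) by exact: ig_dotp.
pose b := \row_i Int P (fun x => dotp x (delta_mx 0 i)).
have bE v : Int P (fun x => dotp x v) = dotp b v.
  transitivity (Int P (fun x => \sum_i v 0 i * dotp x (delta_mx 0 i))).
    by apply: eq_Int => x; apply: eq_bigr => i _; rewrite dotp_delta mulrC.
  rewrite Int_sum; last by move=> i; exact: igZ.
  by apply: eq_bigr => i _; rewrite IntZ// mxE mulrC.
have [Q fQ lcQ] := law_translate (- b) lcP.
have mb := @measurable_add R m (- b).
have iQ v : ig Q (fun x => dotp x v) by exact: ig_dotp.
have iQ2 v : ig Q (fun x => dotp x v ^+ 2) by exact: ig_sq.
have Q0 v : Int Q (fun x => dotp x v) = 0.
  rewrite (law_of_Int_signed mb fQ)//.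
  transitivity (Int P (fun x => dotp x v - dotp b v)).
    by apply: eq_Int => x; rewrite dotpDl dotpNl.
  by rewrite IntB//; [rewrite bE Int_cst subrr|exact: ig_cst].
have iQij i j : ig Q (fun x => (x : 'rV[R]_m) 0 i * x 0 j).
  apply: (@eq_ig _ _ _ Q (fun x : borel R m => 4^-1 * (dotp x (delta_mx 0 i + delta_mx 0 j) ^+ 2 - dotp x (delta_mx 0 i - delta_mx 0 j) ^+ 2))).
    by move=> x; rewrite !dotpDr dotpNr !dotp_delta; field.
  by apply: igZ; exact: igB.
pose A := \matrix_(i, j) Int Q (fun x => (x : 'rV[R]_m) 0 i * x 0 j).
have AE v : Int Q (fun x => dotp x v ^+ 2) = dotp (v *m A) v.
  transitivity (Int Q (fun x => \sum_i \sum_j (v 0 i * v 0 j) * ((x : 'rV[R]_m) 0 i * x 0 j))).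
    apply: eq_Int => x; rewrite expr2 /dotp big_distrlr /=.
    by apply: eq_bigr => i _; apply: eq_bigr => j _; ring.
  rewrite Int_sum; last by move=> i; apply: ig_sum => j; exact: igZ.
  rewrite /dotp; under [RHS]eq_bigr do rewrite mxE mulr_suml.
  rewrite exchange_big; apply: eq_bigr => i _; rewrite Int_sum; last by move=> j; exact: igZ.
  apply: eq_bigr => j _; rewrite IntZ// mxE; ring.
have AT : A^T = A.
  by apply/matrixP => i j; rewrite !mxE; apply: eq_Int => x; rewrite mulrC.
have Apos v : v != 0 -> 0 < dotp (v *m A) v.
  move=> v0; rewrite -AE (law_of_Int mb fQ); [|exact: measurable_dotpX|by move=> x; exact: sqr_ge0].
  have mh : measurable_fun setT (fun x : borel R m => dotp ((x : 'rV[R]_m) - b) v ^+ 2).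
    exact: measurableT_comp (measurable_dotpX v 2) mb.
  have i2 : ig P (fun x => dotp (x - b) v ^+ 2).
    exact: ((law_of_ig mb fQ (measurable_dotpX v 2) (fun x => sqr_ge0 _)).2 (iQ2 v)).
  have mhw : measurable_fun setT (fun x : borel R m => dotp ((x : 'rV[R]_m) - b) v ^+ 2 * w y x) by exact: measurable_funM.
  have hw0 x : 0 <= dotp (x - b) v ^+ 2 * w y x by rewrite mulr_ge0 ?sqr_ge0// ltW.
  have E := PE _ mh (fun x => sqr_ge0 _).
  rewrite IntE// in E.
  have i3 : ig leb (fun x => dotp (x - b) v ^+ 2 * w y x).
    apply: (ig_ge0 mhw hw0); rewrite ltey; apply/eqP => e; move: E; rewrite e gt0_muley; first by [].
    rewrite lte_fin invr_gt0; exact: M_gt0.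
  have : (Int P (fun x => dotp (x - b) v ^+ 2)) = (M y)^-1 * Int leb (fun x => dotp (x - b) v ^+ 2 * w y x).
    by apply: EFin_inj; rewrite E IntE.
  move=> ->; apply: mulr_gt0; first by rewrite invr_gt0; exact: M_gt0.
  have ev : 0 < enorm v / 2 by rewrite divr_gt0// sqrtr_gt0; exact: dotp_gt0.
  have [B [mB B0 Bz]] := ball_pos (b + v) ev.
  apply: (Int_gt0 mB B0) => // x /Bz xB; rewrite mulr_gt0// exprn_gt0//.
  have -> : dotp (x - b) v = dotp v v + dotp (x - (b + v)) v.
    by rewrite !(dotpDl, dotpNl) opprD; ring.
  have h1 := CSe (x - (b + v)) v.
  have h2 : enorm (x - (b + v)) * enorm v <= enorm v / 2 * enorm v by rewrite ler_wpM2r// enorm_ge0.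
  have h3 := ler_norm (- dotp (x - (b + v)) v); rewrite normrN in h3.
  have h4 := dotp_gt0 v0; rewrite -enorm2 expr2 in h4 *.
  lra.
have [S uS ASS] := pos_sqrt AT Apos.
have vS v : Int Q (fun x => dotp x v ^+ 2) = enorm (v *m S) ^+ 2.
  by rewrite AE ASS enorm2 mulmxA [RHS]dotp_mulmx dotpC.
have eQ v : ig Q (fun x => expR (dotp x v)) /\ Int Q (fun x => expR (dotp x v)) = expR (- dotp b v) * ((M y)^-1 * M (y + v)).
  have me : measurable_fun setT (fun x : borel R m => expR (dotp (x : 'rV[R]_m) v)).
    by apply: measurable_expRT; exact: measurable_dotp.
  apply: Int_eqE => //; rewrite fQ//.
  have me' : measurable_fun setT (fun x : borel R m => expR (dotp ((x : 'rV[R]_m) - b) v)) by exact: measurableT_comp me mb.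
  rewrite (PE (fun x => expR (dotp (x - b) v)))//.
  have E x : (expR (dotp (x - b) v) * w y x)%:E = (expR (- dotp b v) * w (y + v) x)%:E.
    rewrite /w dotpDr expRD dotpDl dotpNl addrC expRD; congr (_%:E); ring.
  under eq_integral do rewrite E.
  rewrite IntE; last exact: igZ.
  by rewrite IntZ// -EFinM mulrCA.
have Mge v : M y * expR (dotp b v) <= M (y + v).
  have [ie Ie] := eQ v; have := mgf_ge1 lcQ (Q0 v) ie; rewrite Ie.
  by rewrite expRN (ler_pdivlMl _ _ (expR_gt0 _)) mulr1 (ler_pdivlMl _ _ (M_gt0 y)).
have Mge2 v : r0 R <= enorm (v *m S) -> M y * (expR (dotp b v) * expR (c1 R * enorm (v *m S))) <= M (y + v).
  move=> h; have [ie Ie] := eQ v; have := mgf_lower lcQ (Q0 v) (vS v) ie h; rewrite Ie.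
  by rewrite expRN (ler_pdivlMl _ _ (expR_gt0 _)) (ler_pdivlMl _ _ (M_gt0 y)).
have c1p := c1_gt0 R; have r0p := r0_gt0 R; have r01 := r0_le1 R.
have cc0 : 0 < cc by rewrite divr_gt0.
have uv u v : enorm u <= cc -> dotp (b + u *m S^T) v <= dotp b v + cc * enorm (v *m S).
  move=> uc; rewrite dotpDl lerD2l dotp_mulmx trmxK.
  apply: le_trans (ler_norm _) _; apply: le_trans (CSe _ _) _.
  by rewrite ler_wpM2r// enorm_ge0.
exists b, S; split; first exact: uS.
- move=> u v uc; have h := uv u v uc; have [r0r|rr0] := leP (r0 R) (enorm (v *m S)).
    apply: le_trans (Mge2 v r0r); rewrite (ler_pM2l (M_gt0 y)) -expRD ler_expR.
    have : cc * enorm (v *m S) <= c1 R * enorm (v *m S) by rewrite ler_wpM2r ?enorm_ge0// /cc; lra.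
    have : 0 <= eps by rewrite /eps mulr_ge0// ltW.
    lra.
  apply: le_trans (Mge v); rewrite (ler_pM2l (M_gt0 y)) ler_expR.
  have : cc * enorm (v *m S) <= eps by rewrite /eps ler_pM2l// ltW.
  lra.
- move=> u v uc r1; have h := uv u v uc.
  apply: lt_le_trans (Mge2 v (ltW (le_lt_trans r01 r1))).
  rewrite (ltr_pM2l (M_gt0 y)) -expRD ltr_expR.
  have : eps < cc * enorm (v *m S) by rewrite /eps ltr_pM2l//; exact: le_lt_trans r01 r1.
  have : c1 R * enorm (v *m S) = cc * enorm (v *m S) + cc * enorm (v *m S) by rewrite /cc; field.
  lra.
(* [x *m T] has identity covariance under the centred law, so the mean of its squared norm is
   [m]. *)
move=> y8; pose T := invmx S^T.
have uT : T \in unitmx by rewrite unitmx_inv unitmx_tr.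
have TS : T^T *m S = 1%:M by rewrite /T trmx_inv trmxK mulVmx.
have xT x : dotp (x *m T) (x *m T) = \sum_i dotp x (delta_mx 0 i *m T^T) ^+ 2.
  by rewrite {1}/dotp; apply: eq_bigr => i _; rewrite -dotp_mulmx dotp_delta expr2.
have iT : ig Q (fun x => dotp (x *m T) (x *m T)).
  by apply: eq_ig (ig_sum (fun i => iQ2 (delta_mx 0 i *m T^T))) => x; rewrite xT.
have IT : Int Q (fun x => dotp (x *m T) (x *m T)) = m%:R.
  rewrite (eq_Int Q (g := fun x => \sum_i dotp x (delta_mx 0 i *m T^T) ^+ 2))//.
  rewrite Int_sum// (eq_bigr (fun=> 1)) ?sumr_const ?card_ord// => i _.
  by rewrite vS -mulmxA TS mulmx1 enorm2 dotp_delta mxE !eqxx.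
pose k x := expR (- 2^-1 * dotp (x *m T) (x *m T)).
have mk : measurable_fun setT (k : borel R m -> R).
  have := @measurable_expaff R m m T 0 (- 2^-1); apply: eq_measurable_fun => x _.
  by rewrite /k addr0.
have k0 x : 0 <= k x by exact: expR_ge0.
have ik : ig Q k.
  apply: (@ig_bounded0 _ _ _ Q _ 1) => // x; rewrite k0 -expR0 ler_expR.
  by rewrite mulNr oppr_le0 mulr_ge0 ?invr_ge0// dotp_ge0.
(* Jensen's inequality, through the tangent of the exponential at [- m / 2]. *)
have lower : expR (- m%:R / 2) <= Int Q k.
  have i1 : ig Q (fun x => expR (- m%:R / 2) * (1 + m%:R / 2) - expR (- m%:R / 2) / 2 * dotp (x *m T) (x *m T)).
    by apply: igB; [exact: ig_cst|exact: igZ].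
  apply: (@le_trans _ _ (Int Q (fun x => expR (- m%:R / 2) * (1 + m%:R / 2) - expR (- m%:R / 2) / 2 * dotp (x *m T) (x *m T)))).
    rewrite IntB; [|exact: ig_cst|exact: igZ].
    by rewrite Int_cst IntZ// IT le_eqVlt; apply/orP; left; apply/eqP; field.
  apply: Int_le => // x; rewrite /k.
  have -> : - 2^-1 * dotp (x *m T) (x *m T) = - m%:R / 2 + (m%:R / 2 - 2^-1 * dotp (x *m T) (x *m T)) by ring.
  rewrite expRD; have h := expR_ge1Dx (m%:R / 2 - 2^-1 * dotp (x *m T) (x *m T)).
  have := ler_wpM2l (expR_ge0 (- m%:R / 2)) h; apply: le_trans.
  by rewrite le_eqVlt; apply/orP; left; apply/eqP; field.
pose bT := - b *m T.
have kb x : k (x - b) = expR (- 2^-1 * dotp (x *m T + bT) (x *m T + bT)) by rewrite /k mulmxDl.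
have ifk : ig leb (fun x => f x * k x).
  by apply: eq_ig (ig_fk 0 uT) => x; rewrite addr0.
have ifkb : ig leb (fun x => f x * k (x - b)).
  by apply: eq_ig (ig_fk bT uT) => x; rewrite kb.
have and1 : Int leb (fun x => f x * k (x - b)) <= Int leb (fun x => f x * k x).
  apply: anderson => //.
  - exact: lcm_leb.
  - exact: lebN.
  - have h2 : 0 <= 2^-1 :> R by rewrite invr_ge0.
    have H := lcf_affine T 0 (lcf_gauss h2).
    by move=> a1 a2 l l01; have := H a1 a2 l l01; rewrite !addr0.
  - by move=> x; rewrite /k mulNmx dotpNl dotpNr opprK.
(* The tilt costs [e^(|y|^2/2) <= e^(4m)], Anderson's inequality recentres [k], [hQ] bounds the
   resulting mass by that of [p], and [tilt_ge] compares it with [M y]. *)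
have upper : Int Q k <= expR (4 * m%:R + 1) * `|\det S| `^ theta.
  rewrite -lee_fin -IntE// fQ//.
  have mkb : measurable_fun setT (fun x : borel R m => k ((x : 'rV[R]_m) - b)) by exact: measurableT_comp mk mb.
  rewrite (PE (fun x => k (x - b)))//.
  have ikw : ig leb (fun x => k (x - b) * w y x).
    apply: ig_le0 (iw y); first exact: measurable_funM.
    move=> x; rewrite mulr_ge0 ?(ltW (w_gt0 _ _))//= ler_piMl ?(ltW (w_gt0 _ _))//.
    by rewrite -expR0 ler_expR mulNr oppr_le0 mulr_ge0 ?invr_ge0// dotp_ge0.
  rewrite (IntE ikw) -EFinM lee_fin (ler_pdivrMl _ _ (M_gt0 y)).
  apply: (@le_trans _ _ (expR (4 * m%:R) * Int leb (fun x => f x * k x))).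
    apply: (@le_trans _ _ (expR (4 * m%:R) * Int leb (fun x => f x * k (x - b)))); last first.
      by rewrite ler_pM2l ?expR_gt0.
    rewrite -IntZ//; apply: Int_le => //; first exact: igZ.
    move=> x; rewrite wE.
    have -> : k (x - b) * (expR (2^-1 * dotp y y) * (f x * g (x - y))) = (f x * k (x - b)) * (expR (2^-1 * dotp y y) * g (x - y)) by ring.
    rewrite [leRHS]mulrC; apply: ler_wpM2l; first by rewrite mulr_ge0.
    rewrite -[leRHS]mulr1; apply: ler_pM; [exact: expR_ge0|exact: expR_ge0| |].
      by rewrite ler_expR; exact: half_le8.
    by rewrite -expR0 ler_expR mulNr oppr_le0 mulr_ge0 ?invr_ge0// dotp_ge0.
  have hT := hQ uT.
  apply: (@le_trans _ _ (expR (4 * m%:R) * (expR 1 * `|\det T| `^ (- theta) * I))).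
    by rewrite ler_pM2l ?expR_gt0.
  have dT : `|\det T| `^ (- theta) = `|\det S| `^ theta.
    rewrite /T det_inv det_tr normfV -powR_inv1// -powRrM; congr (_ `^ _); ring.
  rewrite dT expRD [X in _ <= X]mulrC; have := tilt_ge y.
  set a := _ `^ _; have a0 : 0 <= expR (4 * m%:R) * (expR 1 * a) by rewrite !mulr_ge0 ?expR_ge0 ?powR_ge0.
  by move=> h; have := ler_wpM2l a0 h; rewrite -!mulrA.
have key := le_trans lower upper.
rewrite leNgt; apply/negP => h.
have d0 : 0 <= `|\det S| by [].
have h1 : `|\det S| `^ theta < expR (- 6 * m%:R).
  have := gt0_ltr_powR theta_gt0 _ _ h; rewrite powR_expR (_ : theta * (- 6 * m%:R / theta) = - 6 * m%:R); last first.
    by field; rewrite gt_eqF.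
  by apply; rewrite nnegrE ?expR_ge0.
have h2 : expR (4 * m%:R + 1) * `|\det S| `^ theta < expR (4 * m%:R + 1) * expR (- 6 * m%:R).
  by rewrite ltr_pM2l ?expR_gt0.
have := le_lt_trans key h2; rewrite -expRD ltr_expR.
have m1 : 1 <= m%:R :> R by rewrite ler1n.
exact: tilt_contra.
Qed.

End tilt.

(** * Packing and covering by finite families *)

Section packing.
Context d (T : measurableType d) (R : realType) (mu : {measure set T -> \bar R}) (I : eqType).
Implicit Types (X : I -> set T) (s : seq I).

Definition unionl X s : set T := [set x | exists2 i, i \in s & X i x].

Fixpoint disjointl X s : Prop :=
  if s is i :: s' then (forall j, j \in s' -> X i `&` X j = set0) /\ disjointl X s' else True.

Lemma unionl_cons X i s : unionl X (i :: s) = X i `|` unionl X s.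
Proof.
apply/seteqP; split => [x [j + Xj]|x [Xi|[j js Xj]]].
- by rewrite inE => /orP[/eqP <-|js]; [left|right; exists j].
- by exists i => //; rewrite inE eqxx.
- by exists j => //; rewrite inE js orbT.
Qed.

Lemma measurable_unionl X s : (forall i, measurable (X i)) -> measurable (unionl X s).
Proof.
move=> mX; elim: s => [|i s ih]; last by rewrite unionl_cons; exact: measurableU.
by rewrite (_ : unionl X [::] = set0)//; apply/seteqP; split => x // -[].
Qed.

Lemma packing X s (a : R) : (forall i, measurable (X i)) -> disjointl X s ->
  (forall i, i \in s -> a%:E <= mu (X i))%E -> (((size s)%:R * a)%:E <= mu (unionl X s))%E.
Proof.
move=> mX; elim: s => [_ _|i s ih [ds1 ds2] ha] /=; first by rewrite mul0r measure_ge0.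
rewrite unionl_cons measureU//; last 2 first.
- exact: measurable_unionl.
- apply/seteqP; split => x // -[Xi [j js Xj]].
  by have := ds1 j js; move/seteqP => [/(_ x (conj Xi Xj))].
rewrite -addn1 natrD mulrDl mul1r addrC EFinD; apply: leeD; first by apply: ha; rewrite inE eqxx.
by apply: ih => // j js; apply: ha; rewrite inE js orbT.
Qed.

Lemma covering X s (b : R) : (forall i, measurable (X i)) ->
  (forall i, i \in s -> mu (X i) <= b%:E)%E -> (mu (unionl X s) <= ((size s)%:R * b)%:E)%E.
Proof.
move=> mX; elim: s => [_|i s ih hb] /=.
  by rewrite (_ : unionl X [::] = set0) ?measure0 ?mul0r//; apply/seteqP; split => x // -[].
rewrite unionl_cons; apply: le_trans (measureU2 _ (mX i) (measurable_unionl s mX)) _.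
rewrite -addn1 natrD mulrDl mul1r [X in (_ <= X%:E)%E]addrC EFinD; apply: leeD; first by apply: hb; rewrite inE eqxx.
by apply: ih => // j js; apply: hb; rewrite inE js orbT.
Qed.

Lemma maximal_disjoint X (Y : set I) (N : nat) :
  (forall s, (forall i, i \in s -> Y i) -> disjointl X s -> (size s <= N)%N) ->
  exists s, [/\ forall i, i \in s -> Y i, disjointl X s &
    forall j, Y j -> exists2 i, i \in s & X j `&` X i !=set0 \/ i = j].
Proof.
move=> bN; pose P k := `[< exists s, [/\ forall i, i \in s -> Y i, disjointl X s & size s = k] >].
have exP : exists k, P k by exists 0%N; apply/asboolP; exists [::].
have ubP k : P k -> (k <= N)%N by move=> /asboolP[s [sY ds <-]]; exact: bN.
have [k /asboolP[s [sY ds sk]] kmax] := ex_maxnP exP ubP.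
exists s; split => // j Yj; apply: contrapT => h.
have : P k.+1.
  apply/asboolP; exists (j :: s); split => /=; last by rewrite sk.
  - by move=> i; rewrite inE => /orP[/eqP ->|/sY].
  - split => // i is_; apply/seteqP; split => x // Xx; apply: h; exists i => //.
    by left; exists x.
by move/kmax; rewrite ltnn.
Qed.

End packing.

Section arithmetic.
Variable R : realType.

Lemma le_quad (a b : R) : a <= 8 * b -> 2^-1 * (a + a + (a + a)) <= 16 * b.
Proof. lra. Qed.

Lemma exp_contra m (e t : R) : 1 <= m%:R :> R -> e <= 1 -> t - e <= 16 * m%:R ->
  expR (2 * (11 * m%:R) - t - e) <= expR m%:R + 2 ^+ m -> False.
Proof.
move=> m1 e1 te h.
have e2 : (2 : R) ^+ m <= expR m%:R.
  rewrite -[m%:R]mulr1 expRM_natl; apply: lerXn2r; rewrite ?nnegrE ?expR_ge0//.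
  have := expR_ge1Dx (1 : R); lra.
have h2 : expR (4 * m%:R) <= 2 * expR m%:R :> R.
  apply: (@le_trans _ _ (expR (2 * (11 * m%:R) - t - e))).
    rewrite ler_expR; lra.
  by apply: le_trans h _; lra.
have h3 : expR (4 * m%:R) = expR (3 * m%:R) * expR m%:R :> R by rewrite -expRD; congr expR; ring.
rewrite h3 ler_pM2r ?expR_gt0// in h2.
have := expR_ge1Dx (3 * m%:R : R); lra.
Qed.

Lemma two_gaps (M1 M2 a e : R) : M1 * expR (a + e) < M2 -> M2 * expR (- a - e) <= M1 -> False.
Proof.
move=> /(conj (expR_gt0 (- a - e)))[h0 h1] h2.
have : M1 * expR (a + e) * expR (- a - e) < M2 * expR (- a - e) by rewrite ltr_pM2r.
move/lt_le_trans/(_ h2); rewrite -mulrA -expRD -opprD subrr expR0 mulr1 ltxx; exact: notF.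
Qed.

Lemma le_quarter2 (a : R) : 2 * (2 * (a / 4)) <= a.
Proof. lra. Qed.

Lemma final_bound (c f0 E F G J : R) : 0 < c -> 0 < f0 ->
  c <= E * (F * G * J / f0) -> f0 <= F * (E * G) / c * J.
Proof.
move=> c0 f00 h; rewrite mulrAC ler_pdivlMr// mulrC -ler_pdivlMr//.
by apply: (le_trans h); rewrite le_eqVlt; apply/orP; left; apply/eqP; ring.
Qed.

End arithmetic.

(** * Value at the origin against Gaussian mass *)

Section covering_volume.
Variables (R : realType) (m : nat) (f : 'rV[R]_m -> R) (theta : R).
Hypothesis m_gt0 : (0 < m)%N.
Hypothesis f_gt0 : forall x, 0 < f x.
Hypothesis cf : continuous f.
Hypothesis lf : lcf f.
Hypothesis ef : forall x, f (- x) = f x.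
Hypothesis theta_gt0 : 0 < theta.
Local Notation leb := (leb R m).

Let p x := f x * expR (- 2^-1 * dotp x x).
Let I := Int leb p.

Hypothesis hQ : forall Q, Q \in unitmx ->
  Int leb (fun x => f x * expR (- 2^-1 * dotp (x *m Q) (x *m Q))) <= expR 1 * `|\det Q| `^ (- theta) * I.

Let mf : measurable_fun setT (f : borel R m -> R).
Proof. exact: measurable_fun_continuous_rV. Qed.

Let M y := Int leb (fun x => p x * expR (dotp x y)).
Let cc := c1 R / 2.
Let eps := cc * r0 R.

Let lp : lcf p.
Proof.
apply: lcf_mul => //; [by move=> x; exact: ltW|].
by apply: lcf_gauss; rewrite invr_ge0.
Qed.
Let p_gt0 x : 0 < p x. Proof. by rewrite mulr_gt0// expR_gt0. Qed.
Let p0 : p 0 = f 0. Proof. by rewrite /p dotp0l mulr0 expR0 mulr1. Qed.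
Let cp : continuous p.
Proof.
move=> x; apply: (@continuousM _ _ f (fun x => expR (- 2^-1 * dotp x x))); first exact: cf.
apply: (@continuous_comp _ _ _ (fun x : 'rV[R]_m => - 2^-1 * dotp x x) expR); last exact: continuous_expR.
apply: (@continuousM _ _ (fun=> - 2^-1) (fun x : 'rV[R]_m => dotp x x)); first exact: cst_continuous.
exact: continuous_dotpp.
Qed.
Let ip : ig leb p.
Proof.
have h2 : 0 < 2^-1 :> R by rewrite invr_gt0.
apply: ig_le0 (igZ (f 0) (ig_gauss m h2).1); first exact: measurable_fun_continuous_rV.
move=> x; rewrite ltW//= ler_wpM2r ?expR_ge0//; apply: lcf_even_max => // z; exact: ltW.
Qed.
Let I_gt0 : 0 < I.
Proof.
have /andP[B0 _] := leb_ball_gt0 m (@ltr01 R).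
apply: (Int_gt0 _ B0) => //; last by move=> x; exact: ltW.
by apply: measurable_compact_rV; exact: compact_ball.
Qed.

Let eps_le1 : eps <= 1.
Proof.
rewrite /eps /cc /c1 mulrAC divfK ?gt_eqF ?r0_gt0//.
have rs := r0sq_gt0 R.
have : ln (1 + r0sq R / 8) <= r0sq R / 8.
  by rewrite -ler_expR lnK ?posrE; [exact: expR_ge1Dx|lra].
have : r0sq R <= 1 by rewrite /r0sq invf_le1; have := borell_const_ge1 R; lra.
lra.
Qed.

Let cc_gt0 : 0 < cc. Proof. by rewrite divr_gt0// c1_gt0. Qed.

(** The superlevel set of [p], dilated by [44 = 4 * 11]: a functional normalised to [11 m] at a
    point outside [K] is then at most [m / 4] on the superlevel set. *)
Let K := [set x | p 0 * expR (- 4 * m%:R) <= p (44^-1 *: x)].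

(** For [x] outside [K], separation gives [v'] with [<x,v'> = 11 m]. The gap at [v = y], against
    [M(2y) <= e^(16m) I], bounds [<x,y>] by [16 m + eps]; the gap at [v = 2v' - y] then makes
    [M(2v')] at least about [e^(6m) I]. The decay of [p] along [v'] allows only [(e^m + 2^m) I]. *)
Lemma gap_in_K y x : dotp y y <= 8 * m%:R ->
  (forall v, M y * expR (dotp x v - eps) <= M (y + v)) -> K x.
Proof.
move=> y8 gap; apply: contrapT => nKx.
have m1 : 1 <= m%:R :> R by rewrite ler1n.
have clK : closed K.
  apply: (@preimage_closed _ _ (fun x : 'rV[R]_m => p (44^-1 *: x)) [set r | p 0 * expR (- 4 * m%:R) <= r]).
    move=> z _; apply: (@continuous_comp _ _ _ (fun x : 'rV[R]_m => 44^-1 *: x) p); last exact: cp.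
    exact: scaler_continuous.
  exact: closed_ge.
have cK : convexs K.
  move=> a b l Ka Kb l01; rewrite /K /=; have /andP[l0 l1] := l01.
  have l'0 : 0 < 1 - l by rewrite subr_gt0.
  have -> : 44^-1 *: ((1 - l) *: a + l *: b) = (1 - l) *: (44^-1 *: a) + l *: (44^-1 *: b).
    by apply/rowP => i; rewrite !mxE; ring.
  apply: le_trans (lp _ _ l01).
  have t0 : 0 < p 0 * expR (- 4 * m%:R) by rewrite mulr_gt0// expR_gt0.
  apply: (@le_trans _ _ ((p 0 * expR (- 4 * m%:R)) `^ (1 - l) * (p 0 * expR (- 4 * m%:R)) `^ l)).
    rewrite -powRD ?subrK ?powRr1 ?(ltW t0)//; by rewrite oner_eq0.
  apply: ler_pM; [exact: powR_ge0|exact: powR_ge0| |].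
    apply: ge0_ler_powR; [exact: ltW|by rewrite nnegrE ltW|by rewrite nnegrE ltW|exact: Ka].
  apply: ge0_ler_powR; [exact: ltW|by rewrite nnegrE ltW|by rewrite nnegrE ltW|exact: Kb].
have K0 : K 0.
  rewrite /K /= scaler0 -[leRHS]mulr1 ler_pM2l// -[leRHS]expR0 ler_expR; lra.
have [v [a [Ka ax]]] := separation clK cK (ex_intro _ 0 K0) nKx.
have a0 : 0 <= a by have := Ka 0 K0; rewrite dotp0l.
have xv : 0 < dotp x v by exact: le_lt_trans ax.
pose v' := (11 * m%:R / dotp x v) *: v.
have c0 : 0 < 11 * m%:R / dotp x v by rewrite divr_gt0// mulr_gt0//; lra.
have xv' : dotp x v' = 11 * m%:R by rewrite /v' dotpZr divfK// gt_eqF.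
have Kv' z : p 0 * expR (- 4 * m%:R) <= p z -> dotp z v' <= m%:R / 4.
  move=> Kz; have Kz' : K (44 *: z) by rewrite /K /= scalerA mulVf ?scale1r.
  have := Ka _ Kz'; rewrite dotpZl => h.
  rewrite /v' dotpZr.
  have h1 : 44 * dotp z v <= dotp x v by lra.
  have h2 : (11 * m%:R / dotp x v) * (44 * dotp z v) <= (11 * m%:R / dotp x v) * dotp x v by rewrite ler_pM2l.
  rewrite divfK ?gt_eqF// in h2; lra.
have s0 : 0 < m%:R / 4 :> R by lra.
have [iph Iph] := Int_half (fun z => ltW (p_gt0 z)) ip.
(* While [<z,v'> <= m / 2] the exponential factor is at most [e^m]; beyond that [lcf_decay] supplies
   the exponent [-4 <z,v'>], which outweighs [2 <z,v'>]. *)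
have pe z : p z * expR (dotp z (2 *: v')) <= expR m%:R * p z + p (2^-1 *: z).
  rewrite dotpZr; have [h|h] := leP (dotp z v') (2 * (m%:R / 4)).
    rewrite mulrC; apply: ler_wpDr; first exact: ltW (p_gt0 _).
    apply: ler_wpM2r; first exact: ltW (p_gt0 _).
    by rewrite ler_expR; apply: (le_trans (ler_wpM2l (ler0n R 2) h)); rewrite le_quarter2.
  have := lcf_decay (fun z => ltW (p_gt0 z)) lp (p_gt0 0) s0 (ltW (lt_le_trans ltr01 m1)) Kv' h.
  have -> : - m%:R * (dotp z v' / (m%:R / 4)) = - 4 * dotp z v' by field; rewrite gt_eqF// ltr0n.
  move=> H; apply: (@le_trans _ _ (p (2^-1 *: z))); last by rewrite lerDr mulr_ge0 ?expR_ge0// ltW.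
  apply: le_trans (ler_wpM2r (expR_ge0 (2 * dotp z v')) H) _.
  rewrite -mulrA -expRD (ger_pMr _ (p_gt0 _)) -[leRHS]expR0 ler_expR.
  lra.
have i2 : ig leb (fun z => p z * expR (dotp z (2 *: v'))).
  apply: ig_le0 (igD (igZ (expR m%:R) ip) iph).
    apply: measurable_funM; first exact: ig_measurable ip.
    by apply: measurable_expRT; exact: measurable_dotp.
  by move=> z; rewrite mulr_ge0 ?expR_ge0 ?(ltW (p_gt0 z))//=.
have M2v : M (2 *: v') <= (expR m%:R + 2 ^+ m) * I.
  have := Int_le i2 (igD (igZ (expR m%:R) ip) iph) pe.
  by rewrite (IntD (igZ (expR m%:R) ip) iph) (IntZ _ ip) Iph -mulrDl.
have tl := tilt_le f_gt0 mf lf ef.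
have tg := tilt_ge f_gt0 mf lf ef.
have g1 := gap y; have g2 := gap (2 *: v' - y).
rewrite addrCA subrr addr0 in g2.
have Ly : I <= M y := tg y.
have L2 : M (y + y) <= expR (16 * m%:R) * I.
  apply: le_trans (tl _) _; rewrite (ler_pM2r I_gt0) ler_expR dotpDl !dotpDr; exact: le_quad.
have MyI c : M y * expR c >= I * expR c by rewrite (ler_pM2r (expR_gt0 _)).
have xy : dotp x y - eps <= 16 * m%:R.
  by have := le_trans (MyI _) (le_trans g1 L2); rewrite mulrC (ler_pM2r I_gt0) ler_expR.
have := le_trans (MyI _) (le_trans g2 M2v); rewrite mulrC (ler_pM2r I_gt0).
rewrite dotpDr dotpNr dotpZr xv'; exact: (exp_contra m1 eps_le1 xy).
Qed.

Let bB (c : R) : measurable ([set x : 'rV[R]_m | enorm x <= c] : set (borel R m)).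
Proof. by apply: measurable_compact_rV; exact: compact_ball. Qed.

Lemma leb_K : (leb K <= (44 ^+ m * expR (4 * m%:R) * I / f 0)%:E)%E.
Proof.
have t0 : 0 < p 0 * expR (- 4 * m%:R) by rewrite mulr_gt0// expR_gt0.
have V := superlevel_volume t0 (fun x => ltW (p_gt0 x)) ip.
have mK0 : measurable ([set x | p 0 * expR (- 4 * m%:R) <= p x] : set (borel R m)).
  by apply: measurable_set_le => //; exact: ig_measurable ip.
have u : 44%:M \in @unitmx R m by rewrite unitmxE det_scalar unitrX// unitfE.
have [_ E] := leb_affine 0 u mK0.
have -> : K = [set 0 + x *m 44%:M | x in [set x | p 0 * expR (- 4 * m%:R) <= p x]].
  apply/seteqP; split => [x Kx|_ [x /= Kx <-]] /=.
    by exists (44^-1 *: x) => //; rewrite add0r mul_mx_scalar scalerA mulfV ?scale1r.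
  by rewrite /K /= add0r mul_mx_scalar scalerA mulVf ?scale1r.
rewrite E det_scalar normrX ger0_norm//.
apply: (@le_trans _ _ ((44 ^+ m)%:E * ((p 0 * expR (- 4 * m%:R))^-1 * I)%:E)%E).
  by rewrite lee_wpmul2l// lee_fin exprn_ge0.
rewrite -EFinM lee_fin p0 invfM -expRN le_eqVlt; apply/orP; left; apply/eqP.
have -> : - (- 4 * m%:R) = 4 * m%:R :> R by ring.
by field; rewrite gt_eqF.
Qed.

(** [44 e^4] is the volume of the dilated level set relative to [I / f 0], per dimension;
    [12 / theta] is twice the exponent of the determinant bound, used once for the packing and once
    for the covering; [c1 / 2] is the radius of the primal ellipsoids. *)
Definition milman_const : R := 44 * expR (4 + 12 / theta) / (c1 R / 2).

(* The logarithmic Laplace transform of [p] is, around every tilt [y], pinched by an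
   ellipsoid of volume not too small. Disjoint primal ellipsoids are packed into a
   dilated level set of [p]; the polar ellipsoids then cover a ball, and comparing
   the two counts gives the bound. *)
Lemma milman_ellipsoid : f 0 <= milman_const ^+ m * I.
Proof.
have tilt := tilt_ellipsoid m_gt0 f_gt0 mf lf ef theta_gt0 hQ.
have [bS bSP] := choice tilt.
have bS' y : exists S : 'M[R]_m, [/\ S \in unitmx,
  forall u v, enorm u <= cc -> M y * expR (dotp (bS y + u *m S^T) v - eps) <= M (y + v),
  forall u v, enorm u <= cc -> 1 < enorm (v *m S) ->
    M y * expR (dotp (bS y + u *m S^T) v + eps) < M (y + v) &
  dotp y y <= 8 * m%:R -> expR (- 6 * m%:R / theta) <= `|\det S| ] by exact: bSP.
have [S SP] := choice bS'.
have uS y : S y \in unitmx by have [] := SP y.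
have uST y : (S y)^T \in unitmx by rewrite unitmx_tr.
have uSV y : invmx (S y) \in unitmx by rewrite unitmx_inv.
pose X (y : 'rV[R]_m) : set (borel R m) := [set bS y + u *m (S y)^T | u in [set u : 'rV[R]_m | enorm u <= cc]].
pose Y := [set y : 'rV[R]_m | dotp y y <= 8 * m%:R].
have mX y : measurable (X y : set (borel R m)) by have [] := leb_affine (bS y) (uST y) (bB cc).
have lX y : leb (X y) = (`|\det (S y)|%:E * leb [set u | (enorm u <= cc)%R])%E.
  by have [_] := leb_affine (bS y) (uST y) (bB cc); rewrite det_tr.
have /andP[V1 V2] := leb_ball_gt0 m (@ltr01 R).
set B1 := [set x : 'rV[R]_m | (enorm x <= 1)%R] in V1 V2.
have V1f : leb B1 \is a fin_num by rewrite ge0_fin_numE.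
pose V := fine (leb B1).
have VE : leb B1 = V%:E by rewrite /V fineK.
have V0 : 0 < V by rewrite -lte_fin -VE.
have ucc : cc%:M \in @unitmx R m by rewrite unitmxE det_scalar unitrX// unitfE gt_eqF.
have lB : leb [set u | (enorm u <= cc)%R] = (cc ^+ m * V)%:E.
  have [_ E] := leb_affine 0 ucc (bB 1).
  have -> : [set u : 'rV[R]_m | enorm u <= cc] = [set 0 + u *m cc%:M | u in B1].
    apply/seteqP; split => [u uc|_ [u /= u1 <-]] /=.
      exists (cc^-1 *: u) => /=; last by rewrite add0r mul_mx_scalar scalerA mulfV ?scale1r// gt_eqF.
      by rewrite /B1 /= enormZ gtr0_norm ?invr_gt0// ler_pdivrMl// mulr1.
    by rewrite add0r mul_mx_scalar enormZ gtr0_norm// ger_pMr.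
  by rewrite E -/B1 VE det_scalar normrX gtr0_norm// -EFinM.
pose a := expR (- 6 * m%:R / theta) * (cc ^+ m * V).
have a0 : 0 < a by rewrite mulr_gt0 ?expR_gt0// mulr_gt0// exprn_gt0.
pose W := 44 ^+ m * expR (4 * m%:R) * I / f 0.
have mK : measurable (K : set (borel R m)).
  rewrite /K; apply: measurable_set_le => //.
  have := measurableT_comp (ig_measurable ip) (@measurable_lin R m m (44^-1)%:M).
  by apply: eq_measurable_fun => x _ /=; rewrite mul_mx_scalar.
have pack s : (forall y, y \in s -> Y y) -> disjointl X s -> (size s)%:R * a <= W.
  move=> sY ds; rewrite -lee_fin.
  apply: le_trans (packing (mu := leb) mX ds _) _.
    move=> y /sY yY; suff: (a%:E <= leb (X y))%E by [].
    rewrite lX lB -EFinM lee_fin ler_pM2r ?mulr_gt0 ?exprn_gt0//.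
    by have [_ _ _] := SP y; exact.
  apply: le_trans leb_K; apply: le_measure; rewrite ?inE//.
    exact: measurable_unionl.
  move=> x [y ys [u /= uc <-]]; apply: (gap_in_K (y := y)); first exact: sY.
  by move=> v; have [_ h _ _] := SP y; exact: h.
have bN s : (forall y, y \in s -> Y y) -> disjointl X s -> (size s <= Num.trunc (W / a))%N.
  move=> sY ds; have := pack s sY ds; rewrite -ler_pdivlMr// => h.
  by rewrite -ltnS -(ltr_nat R); apply: le_lt_trans h _; exact: truncnS_gt.
have [s [sY ds smax]] := maximal_disjoint bN.
pose C (y : 'rV[R]_m) : set (borel R m) := [set y + u *m invmx (S y) | u in B1].
have mC y : measurable (C y : set (borel R m)) by have [] := leb_affine y (uSV y) (bB 1).
(* By maximality [X y] shares a point [x] with some [X y']. If [y] were outside the polar ellipsoid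
   of [y'], the strict gap from [y'] to [y] and the gap from [y] back to [y'], both taken at the
   same [x], would contradict each other. *)
have cover : Y `<=` unionl C s.
  move=> y Yy; have [y' y's h] := smax y Yy; exists y' => //.
  exists ((y - y') *m S y'); last by rewrite mulmxK// addrCA subrr addr0.
  rewrite /B1 /=; case: h => [[x [[u /= uc ux] [u' /= uc' ux']]]|->]; last first.
    by rewrite subrr mul0mx /enorm dotp0l sqrtr0.
  rewrite leNgt; apply/negP => r1.
  have [_ g1 _ _] := SP y; have [_ _ g2 _] := SP y'.
  have := g1 u (y' - y) uc; have := g2 u' (y - y') uc' r1.
  have e p1 p2 : p1 + (p2 - p1) = p2 :> 'rV[R]_m by rewrite addrC subrK.
  rewrite ux ux' !e => h2 h1.
  by rewrite -[y' - y]opprB dotpNr in h1; exact: two_gaps h2 h1.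
have : 1 <= (size s)%:R * (expR (6 * m%:R / theta) * V).
  have YV : (1%:E <= leb Y)%E := leb_gauss_ball R m_gt0.
  suff: (1%:E <= ((size s)%:R * (expR (6 * m%:R / theta) * V))%:E)%E by rewrite lee_fin.
  apply: (le_trans YV).
  have mY : measurable (Y : set (borel R m)).
    by apply: measurable_set_le => //; exact: measurable_dotpp.
  apply: (@le_trans _ _ (leb (unionl C s))).
    by apply: le_measure; rewrite ?inE//; exact: measurable_unionl.
  apply: covering => // y ys.
  have [_ E] := leb_affine y (uSV y) (bB 1).
  suff: (leb (C y) <= (expR (6 * m%:R / theta) * V)%:E)%E by [].
  rewrite /C E -/B1 VE -EFinM lee_fin ler_pM2r// det_inv normfV.
  have [_ _ _ hd] := SP y; have := hd (sY _ ys) => hd'.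
  have -> : 6 * m%:R / theta = - (- 6 * m%:R / theta) by field; rewrite gt_eqF.
  rewrite expRN lef_pV2 ?posrE ?expR_gt0//; exact: lt_le_trans (expR_gt0 _) hd'.
have := pack s sY ds; rewrite /a /W => h1 h2.
have f00 := f_gt0 0.
have cm : 0 < cc ^+ m by rewrite exprn_gt0.
(* The covering count carries [e^(6m/theta)] and the packing count its inverse, so twice the
   exponent remains when the number of ellipsoids is eliminated. *)
have E1 : expR (6 * m%:R / theta) = expR (- 6 * m%:R / theta) * expR (12 * m%:R / theta).
  by rewrite -expRD; congr expR; field; rewrite gt_eqF.
have h3 : cc ^+ m <= expR (12 * m%:R / theta) * (44 ^+ m * expR (4 * m%:R) * I / f 0).
  apply: (@le_trans _ _ (cc ^+ m * ((size s)%:R * (expR (6 * m%:R / theta) * V)))).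
    by rewrite ler_peMr// ltW.
  have := ler_wpM2l (expR_ge0 (12 * m%:R / theta)) h1; apply: le_trans.
  by rewrite E1 le_eqVlt; apply/orP; left; apply/eqP; ring.
rewrite /milman_const -/cc !exprMn exprVn -expRM_natl.
have -> : m%:R * (4 + 12 / theta) = 12 * m%:R / theta + 4 * m%:R by field; rewrite gt_eqF.
rewrite expRD; exact: (final_bound cm f00 h3).
Qed.

End covering_volume.

Section gaussian_lipschitz.
Variable R : realType.

Lemma gauss_lipschitz (a b : R) : 0 <= a -> 0 <= b -> `|expR (- a ^+ 2) - expR (- b ^+ 2)| <= 2 * `|a - b|.
Proof.
wlog ab : a b / a <= b => [hw a0 b0|a0 b0].
  have [ab|/ltW ba] := leP a b; first exact: hw.
  by rewrite distrC (distrC a); exact: hw.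
have ea1 : expR (- a ^+ 2) <= 1 by rewrite -[leRHS]expR0 ler_expR oppr_le0 sqr_ge0.
have eb0 := expR_ge0 (- b ^+ 2).
have eba : expR (- b ^+ 2) <= expR (- a ^+ 2) by rewrite ler_expR lerN2; apply: lerXn2r; rewrite ?nnegrE.
rewrite ger0_norm ?subr_ge0// ler0_norm ?subr_le0// opprB.
have [h|h] := leP 1 (b - a); first by lra.
have e1 : expR (- b ^+ 2) = expR (- a ^+ 2) * expR (- (b ^+ 2 - a ^+ 2)) by rewrite -expRD; congr expR; ring.
have e2 := expR_ge1Dx (- (b ^+ 2 - a ^+ 2)).
have e3 := ler_wpM2l (expR_ge0 (- a ^+ 2)) e2; rewrite -e1 in e3.
have e4 : expR (- a ^+ 2) * (1 + a ^+ 2) <= 1.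
  rewrite expRN ler_pdivrMl ?expR_gt0// mulr1; exact: expR_ge1Dx.
have e5 : expR (- a ^+ 2) * (2 * a) <= 1.
  apply: le_trans e4; rewrite ler_wpM2l ?expR_ge0//.
  by have := sqr_ge0 (a - 1); rewrite sqrrB; lra.
have e6 : expR (- a ^+ 2) * ((b + a) * (b - a)) <= 2 * (b - a).
  rewrite mulrA ler_wpM2r ?subr_ge0//.
  apply: (@le_trans _ _ (expR (- a ^+ 2) * (2 * a + 1))); first by rewrite ler_wpM2l ?expR_ge0//; lra.
  rewrite mulrDr mulr1; lra.
have e7 : expR (- a ^+ 2) * ((b + a) * (b - a)) = expR (- a ^+ 2) * (b ^+ 2 - a ^+ 2) by ring.
lra.
Qed.

End gaussian_lipschitz.

Lemma evenm_Int (R : realType) m (mu : {measure set (borel R m) -> \bar R}) (h : 'rV[R]_m -> R) :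
  evenm mu -> measurable_fun setT (h : borel R m -> R) -> (forall x, 0 <= h x) ->
  Int mu (fun x => h (- x)) = Int mu h.
Proof. by move=> eP mh h0; rewrite /Int /Rintegral eP. Qed.

(** * Gaussian smoothing of a law *)

Section smoothing.
Variables (R : realType) (m : nat) (P : probability (borel R m) R) (a : R).
Hypothesis a_gt0 : 0 < a.

(** Up to the factor [(pi / a)^(m/2)], the density of [X + G] with [G] an independent Gaussian
    vector of covariance [1 / (2 a)] times the identity. *)
Definition smooth (x : 'rV[R]_m) := Int P (fun z => expR (- a * dotp (z - x) (z - x))).

Lemma ig_smooth x : ig P (fun z => expR (- a * dotp (z - x) (z - x))).
Proof.
apply: (@ig_bounded0 _ _ _ P _ 1).
  exact: measurableT_comp (measurable_expN a) (measurable_add (- x)).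
by move=> z; rewrite expR_ge0 -[leRHS]expR0 ler_expR mulNr oppr_le0 mulr_ge0 ?dotp_ge0// ltW.
Qed.

Lemma smooth_gt0 x : 0 < smooth x.
Proof.
apply: (@Int_gt0 _ _ _ P _ setT) => //; last exact: ig_smooth.
- by rewrite [X in (_ < X)%E]probability_setT.
- by move=> z _; rewrite expR_gt0.
Qed.

Lemma smooth0 : smooth 0 = Zf P a.
Proof. by apply: eq_Int => z; rewrite subr0. Qed.

Lemma smooth_even : evenm P -> forall x, smooth (- x) = smooth x.
Proof.
move=> eP x; rewrite /smooth -(evenm_Int eP (ig_measurable (ig_smooth x))); last by move=> z; exact: expR_ge0.
apply: eq_Int => z; congr (expR (_ * _)).
by rewrite opprK -opprD dotpNl dotpNr opprK.
Qed.

Lemma lcf_smooth : lcm P -> lcf smooth.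
Proof.
move=> lcP; apply: (lcf_marginal (mu := P) lcP).
- by move=> x z; exact: expR_ge0.
- exact: ig_smooth.
- move=> x z x' z' l l01; apply: le_trans (lcf_gauss (ltW a_gt0) _ _ l01) _.
  have -> : (1 - l) *: (z - x) + l *: (z' - x') = (1 - l) *: z + l *: z' - ((1 - l) *: x + l *: x').
    by apply/rowP => i; rewrite !mxE; ring.
  by [].
Qed.

(** The kernel is Lipschitz in [x] with constant [2 sqrt a], uniformly in [z], so the average over
    [P] is too. *)
Lemma continuous_smooth : continuous smooth.
Proof.
have lip x y : `|smooth x - smooth y| <= 2 * Num.sqrt a * enorm (x - y).
  rewrite /smooth -IntB; [|exact: ig_smooth|exact: ig_smooth].
  apply: le_trans (le_normr_Rintegral _ (igB (ig_smooth x) (ig_smooth y))) _ => //.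
  rewrite -[leRHS](Int_cst P).
  have iB := igB (ig_smooth x) (ig_smooth y).
  apply: Int_le; [exact: ig_norm iB|exact: ig_cst|move=> z].
  have e (u : 'rV[R]_m) : - a * dotp u u = - (Num.sqrt a * enorm u) ^+ 2.
    by rewrite exprMn sqr_sqrtr ?(ltW a_gt0)// enorm2 mulNr.
  rewrite !e; apply: le_trans (gauss_lipschitz _ _) _; rewrite ?mulr_ge0 ?sqrtr_ge0//.
  rewrite -mulrBr normrM ger0_norm ?sqrtr_ge0// mulrA ler_wpM2l ?mulr_ge0 ?sqrtr_ge0//.
  rewrite ler_norml; apply/andP; split.
    have := enormD (z - x) (x - y); rewrite addrA subrK; lra.
  have := enormD (z - y) (y - x); rewrite addrA subrK -[y - x]opprB enormN; lra.
move=> x; have Fx : Filter (nbhs x) by exact: nbhs_filter.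
apply/(@cvgrPdist_le _ _ _ (nbhs x) Fx) => e e0.
have sa : 0 < 2 * Num.sqrt a by rewrite mulr_gt0// sqrtr_gt0.
have e'0 : 0 < e / (2 * Num.sqrt a) by rewrite divr_gt0.
have ce : (fun y : 'rV[R]_m => enorm (x - y)) @ x --> enorm (x - x).
  apply: (@continuous_comp _ _ _ (fun y : 'rV[R]_m => x - y) (@enorm R m)); last exact: continuous_enorm.
  by apply: (@continuousB _ _ _ (fun=> x) (fun y : 'rV[R]_m => y)); [exact: cst_continuous|exact: cvg_id].
have : \forall y \near x, enorm (x - y) < e / (2 * Num.sqrt a).
  apply: (@cvgr_lt _ _ (nbhs x) Fx _ _ ce); by rewrite subrr /enorm dotp0l sqrtr0.
apply: filterS => y h; apply: le_trans (lip x y) _.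
by rewrite mulrC -ler_pdivlMr// ltW.
Qed.

Lemma measurable_smooth : measurable_fun setT (smooth : borel R m -> R).
Proof. apply: measurable_fun_continuous_rV; exact: continuous_smooth. Qed.

Lemma measurable_gauss_kernel (phi : 'rV[R]_m -> R) : measurable_fun setT (phi : borel R m -> R) ->
  measurable_fun setT (fun z : borel R m * borel R m =>
    (expR (- a * dotp ((z.1 : 'rV[R]_m) - z.2) (z.1 - z.2 : 'rV[R]_m)) * phi z.2)%:E).
Proof.
move=> mphi; apply/measurable_EFinP; apply: measurable_funM; last exact: measurableT_comp mphi measurable_snd.
apply: measurable_expRT; apply: measurable_funM => //; apply: measurable_sum => i.
have mi : measurable_fun setT (fun z : borel R m * borel R m => ((z.1 : 'rV[R]_m) - z.2) 0 i).
  apply: (eq_measurable_fun (fun z : borel R m * borel R m => (z.1 : 'rV[R]_m) 0 i - (z.2 : 'rV[R]_m) 0 i)).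
    by move=> z _; rewrite !mxE.
  apply: measurable_funB.
    exact: measurableT_comp (measurable_fun_coord i) measurable_fst.
  exact: measurableT_comp (measurable_fun_coord i) measurable_snd.
exact: measurable_funM.
Qed.

Lemma smooth_tonelli (phi : 'rV[R]_m -> R) : measurable_fun setT (phi : borel R m -> R) ->
  (forall x, 0 <= phi x) ->
  (\int[leb R m]_x (smooth x * phi x)%:E =
   \int[P]_z \int[leb R m]_x (expR (- a * dotp (z - x) (z - x)) * phi x)%:E)%E.
Proof.
move=> mphi phi0.
pose F (z : borel R m * borel R m) := (expR (- a * dotp ((z.1 : 'rV[R]_m) - z.2) (z.1 - z.2 : 'rV[R]_m)) * phi z.2)%:E.
have mF : measurable_fun setT F by exact: measurable_gauss_kernel.
have F0 z : (0 <= F z)%E by rewrite lee_fin mulr_ge0 ?expR_ge0.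
have H := @fubini_tonelli _ _ _ _ _ P (leb R m) F mF F0.
rewrite /F /= in H; rewrite H; apply: eq_integral => x _.
have -> : (smooth x * phi x)%:E = ((phi x)%:E * (smooth x)%:E)%E by rewrite -EFinM mulrC.
rewrite /smooth -IntE; last exact: ig_smooth.
rewrite -ge0_integralZl//; try (by rewrite lee_fin); try (by move=> z _; rewrite lee_fin expR_ge0).
  by apply: eq_integral => z _; rewrite -EFinM mulrC.
by apply/measurable_EFinP; exact: ig_measurable (ig_smooth x).
Qed.

Lemma Int_smooth : ig (leb R m) smooth /\ Int (leb R m) smooth = Num.sqrt (pi / a) ^+ m.
Proof.
apply: Int_eqE; [exact: measurable_smooth|by move=> x; exact/ltW/smooth_gt0|].
have := @smooth_tonelli (fun=> 1) (measurable_cst _) (fun=> ler01).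
have -> : (\int[leb R m]_x (smooth x * 1)%:E = \int[leb R m]_x (smooth x)%:E)%E by apply: eq_integral => x _; rewrite mulr1.
move=> ->.
have [ia Ia] := ig_gauss m a_gt0.
have E (z : 'rV[R]_m) : (\int[leb R m]_x (expR (- a * dotp (z - x) (z - x)) * 1)%:E = (Num.sqrt (pi / a) ^+ m)%:E)%E.
  rewrite -Ia -IntE// -(ge0_integral_translation (- z) (f := fun x => (expR (- a * dotp x x))%:E)).
  - by apply: eq_integral => x _; rewrite mulr1 -[x - z]opprB dotpNl dotpNr opprK.
  - by apply/measurable_EFinP; exact: measurable_expN.
  - by move=> x; rewrite lee_fin expR_ge0.
under eq_integral do rewrite E.
by rewrite integral_cst// [X in (_ * X)%E]probability_setT mule1.
Qed.

End smoothing.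

(** * Existence of a regular position *)

Section position.
Variables (R : realType) (m : nat) (f : 'rV[R]_m -> R) (theta : R).
Hypothesis m_gt0 : (0 < m)%N.
Hypothesis f_gt0 : forall x, 0 < f x.
Hypothesis cf : continuous f.
Hypothesis lf : lcf f.
Hypothesis ef : forall x, f (- x) = f x.
Hypothesis fi : ig (leb R m) f.
Hypothesis theta01 : 0 < theta < 1.

Definition gmass (Q : 'M[R]_m) := Int (leb R m) (fun x => f x * expR (- 2^-1 * dotp (x *m Q) (x *m Q))).

Lemma ig_gmass (Q : 'M[R]_m) : ig (leb R m) (fun x => f x * expR (- 2^-1 * dotp (x *m Q) (x *m Q))).
Proof.
apply: (ig_le0 _ _ fi).
  apply: measurable_funM; first exact: measurable_fun_continuous_rV.
  have := @measurable_expaff R m m Q 0 (- 2^-1); apply: eq_measurable_fun => x _.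
  by rewrite addr0.
move=> x; rewrite mulr_ge0 ?expR_ge0 ?(ltW (f_gt0 x))//= ger_pMr//.
by rewrite -[leRHS]expR0 ler_expR mulNr oppr_le0 mulr_ge0 ?invr_ge0// dotp_ge0.
Qed.

Lemma gmass_le_Int Q : gmass Q <= Int (leb R m) f.
Proof.
apply: (Int_le (ig_gmass Q) fi) => x; rewrite ger_pMr//.
by rewrite -[leRHS]expR0 ler_expR mulNr oppr_le0 mulr_ge0 ?invr_ge0// dotp_ge0.
Qed.

Lemma Int_jacobian Q (h : 'rV[R]_m -> R) : Q \in unitmx -> ig (leb R m) h -> (forall x, 0 <= h x) ->
  ig (leb R m) (fun x => h (x *m Q)) /\ `|\det Q| * Int (leb R m) (fun x => h (x *m Q)) = Int (leb R m) h.
Proof.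
move=> uQ ih h0; have mh := ig_measurable ih.
have d0 : 0 < `|\det Q| by rewrite normr_gt0 -unitfE -unitmxE.
have mhQ : measurable_fun setT (fun x : borel R m => h ((x : 'rV[R]_m) *m Q)).
  exact: measurableT_comp mh (measurable_lin Q).
have mhE : measurable_fun setT (fun x : borel R m => (h x)%:E) by exact/measurable_EFinP.
have h0E (x : 'rV[R]_m) : (0 <= (h x)%:E)%E by rewrite lee_fin.
have J := jacobian_unitmx uQ mhE h0E; rewrite (IntE ih) in J.
have iQ : ig (leb R m) (fun x => h (x *m Q)).
  apply: ig_ge0 => //; rewrite ltey; apply/eqP => e; move: J; rewrite e gt0_muley; first by [].
  by rewrite lte_fin.
split => //; apply: EFin_inj; rewrite -J EFinM; congr (_ * _)%E; by rewrite -IntE.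
Qed.

Lemma gmass_le_det Q : Q \in unitmx -> `|\det Q| * gmass Q <= f 0 * Num.sqrt (2 * pi) ^+ m.
Proof.
move=> uQ; have h2 : 0 < 2^-1 :> R by rewrite invr_gt0.
have [i2 I2] := ig_gauss m h2.
have [iQ JQ] := Int_jacobian uQ i2 (fun x => expR_ge0 _).
have -> : Num.sqrt (2 * pi) ^+ m = Int (leb R m) (fun x => expR (- 2^-1 * dotp x x)).
  by rewrite I2 invrK mulrC.
rewrite -JQ mulrCA ler_wpM2l// -IntZ//.
apply: (Int_le (ig_gmass Q) (igZ _ iQ)) => x; rewrite ler_wpM2r ?expR_ge0//.
by apply: lcf_even_max => // z; exact: ltW.
Qed.

Lemma gmass_gt0 Q : 0 < gmass Q.
Proof.
have /andP[B0 _] := leb_ball_gt0 m (@ltr01 R).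
apply: (Int_gt0 _ B0 _ _ (ig_gmass Q)).
- by apply: measurable_compact_rV; exact: compact_ball.
- by move=> x; rewrite mulr_ge0 ?expR_ge0// ltW.
- by move=> x _; rewrite mulr_gt0 ?expR_gt0.
Qed.

(* A near-maximiser of [gmass Q * |det Q| ^ theta]: near-maximality is exactly the
   hypothesis of [milman_ellipsoid] after the change of variables by [Q0]. *)
Lemma regular_position : exists Q0, [/\ Q0 \in unitmx,
  forall Q, Q \in unitmx -> gmass Q * `|\det Q| `^ theta <= expR 1 * (gmass Q0 * `|\det Q0| `^ theta) &
  f 0 <= milman_const theta ^+ m * (`|\det Q0| * gmass Q0)].
Proof.
have /andP[th0 th1] := theta01.
pose A := [set gmass Q * `|\det Q| `^ theta | Q in [set Q | Q \in unitmx]].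
pose B := Int (leb R m) f + f 0 * Num.sqrt (2 * pi) ^+ m.
have f0 := f_gt0 0.
have If : 0 <= Int (leb R m) f by apply: Int_ge0 => x; exact: ltW.
have Bp : 0 <= f 0 * Num.sqrt (2 * pi) ^+ m by rewrite mulr_ge0 ?exprn_ge0 ?sqrtr_ge0// ltW.
have dpos (Q : 'M[R]_m) : Q \in unitmx -> 0 < `|\det Q| by rewrite unitmxE unitfE normr_gt0.
have AB : ubound A B.
  move=> _ [Q /= uQ <-]; have d0 := dpos Q uQ; have g0 := gmass_gt0 Q.
  (* The mass alone is bounded when the determinant is at most one, and mass times determinant is
     bounded otherwise; since [0 < theta < 1], each controls the functional on its side. *)
  have [d1|/ltW d1] := leP `|\det Q| 1.
    apply: (@le_trans _ _ (gmass Q)); last by apply: le_trans (gmass_le_Int Q) _; rewrite lerDl.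
    rewrite ler_piMr ?(ltW g0)//; have -> : 1 = 1 `^ theta :> R by rewrite powR1.
    by apply: ge0_ler_powR; rewrite ?nnegrE// ltW.
  apply: (@le_trans _ _ (`|\det Q| * gmass Q)); last by apply: le_trans (gmass_le_det uQ) _; rewrite lerDr.
  rewrite mulrC ler_pM2r//; rewrite -[leRHS]powRr1 ?(ltW d0)//.
  by apply: ler_powR => //; exact: ltW.
have A1 : A (gmass 1%:M * `|\det (1%:M : 'M[R]_m)| `^ theta) by exists 1%:M => //; exact: unitmx1.
have hs : has_sup A by split; [exists (gmass 1%:M * `|\det (1%:M : 'M[R]_m)| `^ theta)|exists B].
have s0 : 0 < sup A.
  apply: lt_le_trans (ub_le_sup _ A1); last by exists B.
  by rewrite det1 normr1 powR1 mulr1 gmass_gt0.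
have e1 : 1 < expR 1 :> R by rewrite -expR0 ltr_expR.
have e0 : 0 < expR 1 :> R by exact: expR_gt0.
(* An element above [sup A / e] is taken in place of a maximiser; this is the source of the factor
   [expR 1]. *)
have eps0 : 0 < sup A - sup A / expR 1.
  by rewrite subr_gt0 ltr_pdivrMr// ltr_pMr.
have [_ [Q0 /= uQ0 <-]] := sup_adherent eps0 hs.
rewrite opprB addrC subrK => Q0s.
have max Q : Q \in unitmx -> gmass Q * `|\det Q| `^ theta <= expR 1 * (gmass Q0 * `|\det Q0| `^ theta).
  move=> uQ; apply: (@le_trans _ _ (sup A)); first by apply: ub_le_sup; [exists B|exists Q].
  by rewrite mulrC -ler_pdivrMr// ltW.
exists Q0; split => //.
pose T := invmx Q0; have uT : T \in unitmx by rewrite unitmx_inv.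
pose f' x := f (x *m T + 0).
have f'0 x : 0 < f' x by exact: f_gt0.
have cf' : continuous f'.
  move=> x; apply: (@continuous_comp _ _ _ (fun x : 'rV[R]_m => x *m T + 0) f); last exact: cf.
  by rewrite (_ : (fun x : 'rV[R]_m => x *m T + 0) = (fun x => x *m T)); [exact: continuous_lin|apply/funext => z; rewrite addr0].
have lf' : lcf f' by exact: lcf_affine.
have ef' x : f' (- x) = f' x by rewrite /f' !addr0 mulNmx ef.
have d0 := dpos _ uQ0.
have gE Q : Int (leb R m) (fun x => f' x * expR (- 2^-1 * dotp (x *m Q) (x *m Q))) = `|\det Q0| * gmass (Q0 *m Q).
  have [iT JT] := Int_jacobian uT (ig_gmass (Q0 *m Q)) (fun x => ltW (mulr_gt0 (f_gt0 x) (expR_gt0 _))).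
  rewrite /gmass -JT mulrA /T det_inv normfV mulfV ?gt_eqF// mul1r.
  by apply: eq_Int => x; rewrite /f' addr0 mulmxA mulmxKV.
have IE : Int (leb R m) (fun x => f' x * expR (- 2^-1 * dotp x x)) = `|\det Q0| * gmass Q0.
  by have := gE 1%:M; rewrite mulmx1 => <-; apply: eq_Int => x; rewrite mulmx1.
have hQ Q : Q \in unitmx ->
  Int (leb R m) (fun x => f' x * expR (- 2^-1 * dotp (x *m Q) (x *m Q))) <=
   expR 1 * `|\det Q| `^ (- theta) * Int (leb R m) (fun x => f' x * expR (- 2^-1 * dotp x x)).
  move=> uQ; rewrite gE IE; have dQ := dpos Q uQ.
  have := max (Q0 *m Q); rewrite unitmx_mul uQ0 uQ => /(_ isT).
  rewrite det_mulmx normrM powRM// => h.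
  have pQ : 0 < `|\det Q| `^ theta by rewrite powR_gt0.
  have p0 : 0 < `|\det Q0| `^ theta by rewrite powR_gt0.
  rewrite powRN [X in _ <= X]mulrCA ler_pM2l// mulrAC ler_pdivlMr//.
  by move: h; rewrite mulrA mulrAC mulrA ler_pM2r.
have := milman_ellipsoid m_gt0 f'0 cf' lf' ef' th0 hQ.
by rewrite IE /f' mul0mx addr0.
Qed.

End position.

(** * Self-improvement of the Gaussian decay *)

Section diagonal_smoothing.
Variable R : realType.

Definition wsq n (b x : 'rV[R]_n) : R := \sum_i b 0 i * x 0 i ^+ 2.

Lemma measurable_wsq n (b : 'rV[R]_n) : measurable_fun setT (fun x : borel R n => wsq b x).
Proof.
apply: measurable_sum => i; apply: measurable_funM => //.
by apply: measurable_funX; exact: measurable_fun_coord.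
Qed.

Lemma wsq_ge0 n (b x : 'rV[R]_n) : (forall i, 0 <= b 0 i) -> 0 <= wsq b x.
Proof. by move=> b0; apply: sumr_ge0 => i _; rewrite mulr_ge0 ?sqr_ge0. Qed.

Lemma wsq_cst n (c : R) (x : 'rV[R]_n) : wsq (const_mx c) x = c * dotp x x.
Proof. by rewrite /wsq /dotp mulr_sumr; apply: eq_bigr => i _; rewrite mxE expr2. Qed.

Definition harm n (a : R) (b : 'rV[R]_n) : 'rV[R]_n := \row_i (a * b 0 i / (2 * a + b 0 i)).

Lemma harm_ge0 n a (b : 'rV[R]_n) : 0 < a -> (forall i, 0 < b 0 i) -> forall i, 0 <= harm a b 0 i.
Proof. by move=> a0 b0 i; rewrite mxE divr_ge0 ?mulr_ge0 ?addr_ge0 ?mulr_ge0 ?ltW. Qed.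

Lemma complete_square (a b z x : R) : 2 * a + b != 0 ->
  - a * ((z - x) * (z - x)) + - 2^-1 * (b * x ^+ 2) =
  - (a * b / (2 * a + b) * z ^+ 2) + - ((2 * a + b) * (x - 2 * a * z / (2 * a + b)) ^+ 2) / 2.
Proof. by move=> h; field. Qed.

(* Completing the square leaves the harmonic weight [a b / (2 a + b)] on the centre. *)
Lemma gauss_convolution n (a : R) (b z : 'rV[R]_n) : 0 < a -> (forall i, 0 < b 0 i) ->
  (\int[leb R n]_x (expR (- a * dotp (z - x) (z - x)) * expR (- 2^-1 * wsq b x))%:E =
   ((\prod_i Num.sqrt (2 * pi / (2 * a + b 0 i))) * expR (- wsq (harm a b) z))%:E)%E.
Proof.
move=> a0 b0; pose s : 'rV[R]_n := \row_i (2 * a + b 0 i).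
have s0 i : 0 < s 0 i by rewrite mxE addr_gt0 ?mulr_gt0.
pose w : 'rV[R]_n := \row_i (2 * a * z 0 i / s 0 i).
pose G (x : 'rV[R]_n) := expR (- (\sum_i s 0 i * x 0 i ^+ 2) / 2).
have [iG IG] := ig_gauss_diag s0.
have mG : measurable_fun setT (fun x : borel R n => (G x)%:E) by apply/measurable_EFinP; exact: ig_measurable iG.
have G0 x : (0 <= (G x)%:E)%E by rewrite lee_fin expR_ge0.
transitivity (\int[leb R n]_x ((expR (- wsq (harm a b) z))%:E * (G (x + - w))%:E))%E.
  apply: eq_integral => x _; rewrite -EFinM -!expRD; congr (_%:E); congr (expR _).
  rewrite /dotp /wsq -!sumrN mulr_sumr mulr_sumr -big_split /= mulr_suml -big_split /=.
  apply: eq_bigr => i _; rewrite /w /s !mxE; apply: complete_square.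
  by have := s0 i; rewrite mxE => /lt0r_neq0.
rewrite ge0_integralZl//; first last.
  exact: (measurableT_comp mG (measurable_add (- w))).
rewrite (ge0_integral_translation (- w) mG G0) IntE// IG -EFinM mulrC.
by congr (_ * _)%:E; apply: eq_bigr => i _; rewrite mxE.
Qed.

Lemma smooth_gauss_diag n (P : probability (borel R n) R) (a : R) (b : 'rV[R]_n) :
  0 < a -> (forall i, 0 < b 0 i) ->
  ig (leb R n) (fun x => smooth P a x * expR (- 2^-1 * wsq b x)) /\
  Int (leb R n) (fun x => smooth P a x * expR (- 2^-1 * wsq b x)) =
  (\prod_i Num.sqrt (2 * pi / (2 * a + b 0 i))) * Int P (fun x => expR (- wsq (harm a b) x)).
Proof.
move=> a0 b0.
have mb : measurable_fun setT (fun x : borel R n => expR (- 2^-1 * wsq b x)).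
  by apply: measurable_expRT; apply: measurable_funM => //; exact: measurable_wsq.
apply: Int_eqE.
- by apply: measurable_funM => //; exact: measurable_smooth.
- by move=> x; rewrite mulr_ge0 ?expR_ge0// ltW// smooth_gt0.
rewrite smooth_tonelli//.
under eq_integral do rewrite gauss_convolution//.
have ih : ig P (fun x => expR (- wsq (harm a b) x)).
  apply: (@ig_bounded0 _ _ _ P _ 1).
    by apply: measurable_expRT; apply: measurableT_comp => //; exact: measurable_wsq.
  move=> x; rewrite expR_ge0 -[leRHS]expR0 ler_expR oppr_le0; exact/wsq_ge0/harm_ge0.
rewrite -IntZ//; rewrite -IntE//; exact: igZ.
Qed.

End diagonal_smoothing.

Section descent_tools.
Variable R : realType.

(** Jensen's inequality with [E |X|^2 = n]. *)
Lemma Zf_lower n (P : probability (borel R n) R) a : Cm P -> 0 <= a -> expR (- (a * n%:R)) <= Zf P a.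
Proof.
move=> [lcP _ sqP] a0.
have [isq Isq] : ig P (fun x => dotp x x) /\ Int P (fun x => dotp x x) = n%:R.
  have E : (fun x : borel R n => dotp x x) = (fun x => \sum_i dotp x (delta_mx 0 i) ^+ 2).
    by apply/funext => x; apply: eq_bigr => i _; rewrite dotp_delta expr2.
  rewrite E; have i2 i : ig P (fun x => dotp x (delta_mx 0 i) ^+ 2) by exact: ig_sq.
  split; first exact: ig_sum.
  rewrite Int_sum//.
  under eq_bigr do rewrite sqP dotp_delta mxE !eqxx.
  by rewrite sumr_const card_ord.
have ih : ig P (fun x => expR (- (a * n%:R)) * ((1 + a * n%:R) + - a * dotp x x)).
  by apply: igZ; apply: igD; [exact: ig_cst|exact: igZ].
have := Int_le ih (ig_expN P a0); rewrite IntZ//; last by apply: igD; [exact: ig_cst|exact: igZ].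
rewrite IntD; [|exact: ig_cst|exact: igZ].
rewrite Int_cst IntZ// Isq mulNr addrK mulr1; apply => x.
have -> : expR (- a * dotp x x) = expR (- (a * n%:R)) * expR (a * n%:R + - a * dotp x x).
  by rewrite -expRD; congr expR; ring.
rewrite ler_wpM2l ?expR_ge0// -addrA; exact: expR_ge1Dx.
Qed.

(** The Gaussian mass of the smoothed density in the diagonal position with squared entries [b],
    divided by the total integral [(pi / a)^(n/2)]; see [smooth_omega]. *)
Definition omega n (P : probability (borel R n) R) a (b : 'rV[R]_n) : R :=
  \prod_i Num.sqrt (2 * a / (2 * a + b 0 i)) * Int P (fun x => expR (- wsq (harm a b) x)).

Section fixed_b.
Variables (n : nat) (P : probability (borel R n) R) (a : R) (b : 'rV[R]_n).
Hypothesis a_gt0 : 0 < a.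
Hypothesis b_gt0 : forall i, 0 < b 0 i.

Lemma ig_harm : ig P (fun x => expR (- wsq (harm a b) x)).
Proof.
apply: (@ig_bounded0 _ _ _ P _ 1).
  by apply: measurable_expRT; apply: measurableT_comp => //; exact: measurable_wsq.
by move=> x; rewrite expR_ge0 -[leRHS]expR0 ler_expR oppr_le0; exact/wsq_ge0/harm_ge0.
Qed.

Lemma omega_gt0 : 0 < omega P a b.
Proof.
rewrite mulr_gt0//.
  by apply: prodr_gt0 => i _; rewrite sqrtr_gt0 divr_gt0 ?addr_gt0 ?mulr_gt0.
apply: (@Int_gt0 _ _ _ P _ setT) => //; last exact: ig_harm.
- by rewrite [X in (_ < X)%E]probability_setT.
- by move=> z _; rewrite expR_gt0.
Qed.

Lemma sqrt_split (u : R) : 0 < u -> Num.sqrt (2 * pi / u) = Num.sqrt (pi / a) * Num.sqrt (2 * a / u).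
Proof.
move=> u0; rewrite -sqrtrM; last by rewrite divr_ge0 ?pi_ge0// ltW.
by congr Num.sqrt; field; rewrite !gt_eqF.
Qed.

Lemma smooth_omega :
  ig (leb R n) (fun x => smooth P a x * expR (- 2^-1 * wsq b x)) /\
  Int (leb R n) (fun x => smooth P a x * expR (- 2^-1 * wsq b x)) = Num.sqrt (pi / a) ^+ n * omega P a b.
Proof.
have [i1 ->] := smooth_gauss_diag P a_gt0 b_gt0; split => //.
rewrite /omega mulrA; congr (_ * _).
have -> : Num.sqrt (pi / a) ^+ n = \prod_(i < n) Num.sqrt (pi / a) by rewrite prodr_const card_ord.
by rewrite -big_split /=; apply: eq_bigr => i _; rewrite sqrt_split// addr_gt0 ?mulr_gt0.
Qed.

(** The smoothed density is largest at the origin, where it equals [Zf P a]; what remains is the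
    integral of the Gaussian weight. *)
Lemma omega_le_Zf : lcm P -> evenm P -> omega P a b <= \prod_i Num.sqrt (2 * a / b 0 i) * Zf P a.
Proof.
move=> lcP eP; have [i1 I1] := smooth_omega.
have [iG IG] := ig_gauss_diag b_gt0.
have p0 : 0 < Num.sqrt (pi / a) ^+ n by rewrite exprn_gt0// sqrtr_gt0 divr_gt0// pi_gt0.
rewrite -(ler_pM2l p0) -I1 mulrA.
have -> : Num.sqrt (pi / a) ^+ n * \prod_i Num.sqrt (2 * a / b 0 i) = \prod_i Num.sqrt (2 * pi / b 0 i).
  have -> : Num.sqrt (pi / a) ^+ n = \prod_(i < n) Num.sqrt (pi / a) by rewrite prodr_const card_ord.
  by rewrite -big_split /=; apply: eq_bigr => i _; rewrite sqrt_split.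
rewrite mulrC -IG -IntZ//; apply: Int_le => //; first exact: igZ.
move=> x.
have -> : expR (- 2^-1 * wsq b x) = expR (- (\sum_i b 0 i * x 0 i ^+ 2) / 2).
  by congr expR; rewrite /wsq mulNr mulrC mulNr.
rewrite ler_wpM2r ?expR_ge0// -smooth0; apply: lcf_even_max.
- by move=> z; exact/ltW/smooth_gt0.
- exact: lcf_smooth.
- exact: smooth_even.
Qed.

(** When both [b] and [2 a] are at least [lam], the harmonic weight [a b / (2 a + b)] is at least
    [lam / 4]. *)
Lemma omega_le_large (lam : R) : 0 < lam -> (forall i, lam <= b 0 i) -> lam <= 2 * a ->
  omega P a b <= Zf P (lam / 4).
Proof.
move=> l0 lb la; have l4 : 0 <= lam / 4 by rewrite divr_ge0// ltW.
have h : Int P (fun x => expR (- wsq (harm a b) x)) <= Zf P (lam / 4).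
  apply: Int_le; [exact: ig_harm|exact: ig_expN|move=> x].
  rewrite ler_expR mulNr lerN2 -wsq_cst; apply: ler_sum => i _.
  rewrite ler_wpM2r ?sqr_ge0// !mxE ler_pdivlMr; last by rewrite addr_gt0 ?mulr_gt0.
  have := ler_wpM2l (ltW (b_gt0 i)) la; have := ler_wpM2l (ltW a_gt0) (lb i); lra.
rewrite -[leRHS]mul1r; apply: ler_pM => //.
- by apply: prodr_ge0 => i _; exact: sqrtr_ge0.
- by apply: Int_ge0 => x; exact: expR_ge0.
apply: prodr_ile1 => i _; rewrite sqrtr_ge0 -[leRHS]sqrtr1 ler_sqrt//=.
rewrite ler_pdivrMr ?mul1r ?addr_gt0 ?mulr_gt0// lerDl; exact: ltW.
Qed.

End fixed_b.

Definition coord_mx m (F : {set 'I_m}) : 'M[R]_(m, #|F|) := \matrix_(j, i) (j == enum_val i)%:R.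

Lemma coord_mxE m (F : {set 'I_m}) (x : 'rV[R]_m) i : (x *m coord_mx F) 0 i = x 0 (enum_val i).
Proof.
rewrite mxE (bigD1 (enum_val i))//= mxE eqxx mulr1 big1 ?addr0// => j ji.
by rewrite mxE (negbTE ji) mulr0.
Qed.

Lemma coord_mx_orth m (F : {set 'I_m}) : (coord_mx F)^T *m coord_mx F = 1%:M.
Proof.
apply/matrixP => i j; rewrite !mxE (bigD1 (enum_val i))//= !mxE eqxx mul1r big1 ?addr0.
  by rewrite (inj_eq enum_val_inj).
by move=> l li; rewrite !mxE (negbTE li) mul0r.
Qed.

Lemma sum_coord_mx m (F : {set 'I_m}) (g : 'I_m -> R) :
  \sum_(i < #|F|) g (enum_val i) = \sum_(i in F) g i.
Proof. by rewrite [RHS]big_enum_val. Qed.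

(** Discarding coordinates can only increase [omega]: each one contributes a square root below one
    and a nonnegative term in the exponent. *)
Lemma omega_marginal m (P : probability (borel R m) R) a (b : 'rV[R]_m) (F : {set 'I_m}) :
  Cm P -> 0 < a -> (forall i, 0 < b 0 i) -> exists2 Q : probability (borel R #|F|) R, Cm Q &
  omega P a b <= omega Q a (b *m coord_mx F).
Proof.
move=> CP a0 b0; have [Q PQ CQ] := Cm_lin (coord_mx_orth F) CP; exists Q => //.
have b0' i : 0 < (b *m coord_mx F) 0 i by rewrite coord_mxE.
have e (z : 'rV[R]_m) : wsq (harm a (b *m coord_mx F)) (z *m coord_mx F) = \sum_(i in F) harm a b 0 i * z 0 i ^+ 2.
  rewrite -(sum_coord_mx F (fun i => harm a b 0 i * z 0 i ^+ 2)).
  by apply: eq_bigr => i _; rewrite coord_mxE; congr (_ * _); rewrite [LHS]mxE [RHS]mxE coord_mxE.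
rewrite /omega (law_of_Int _ PQ); first last.
- by move=> x; exact: expR_ge0.
- by apply: measurable_expRT; apply: measurableT_comp => //; exact: measurable_wsq.
- exact: measurable_lin.
have s1 i : Num.sqrt (2 * a / (2 * a + b 0 i)) <= 1.
  rewrite -[leRHS]sqrtr1 ler_sqrt//.
  by rewrite ler_pdivrMr ?mul1r ?addr_gt0 ?mulr_gt0// lerDl ltW.
apply: ler_pM.
- by apply: prodr_ge0 => i _; exact: sqrtr_ge0.
- by apply: Int_ge0 => x; exact: expR_ge0.
- under [leRHS]eq_bigr do rewrite coord_mxE.
  rewrite -(big_enum_val (fun i => Num.sqrt (2 * a / (2 * a + b 0 i)))) /=.
  rewrite (bigID (mem F))/= -[leRHS]mulr1 ler_pM//.
  + by apply: prodr_ge0 => i _; exact: sqrtr_ge0.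
  + by apply: prodr_ge0 => i _; exact: sqrtr_ge0.
  by apply: prodr_ile1 => i _; rewrite sqrtr_ge0 s1.
apply: Int_le; first exact: ig_harm.
  apply: (law_of_ig (h := fun y => expR (- wsq (harm a (b *m coord_mx F)) y)) (measurable_lin _) PQ _ _).2; last exact: ig_harm.
  - by apply: measurable_expRT; apply: measurableT_comp => //; exact: measurable_wsq.
  by move=> x; exact: expR_ge0.
move=> x; rewrite ler_expR lerN2 e /wsq [leRHS](bigID (mem F))/= lerDl.
by apply: sumr_ge0 => i _; rewrite mulr_ge0 ?sqr_ge0// harm_ge0.
Qed.

End descent_tools.

Section step_arithmetic.
Variable R : realType.

(** Here [M] is the dimension, [K] the number of large eigenvalues, [w = ln omega] and
    [d = ln |det Q|]. The volume bound with the two estimates over the large and the small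
    eigenvalues gives [M < 2 K]. Then the decay makes [w] at most about [- M b l / 4], while
    comparison with the identity needs [w + (b/16) d >= - M - 1]. Since [d <= 2 M (l + 2)], the
    exponent [b / 16] returns only about [M b l / 8], half of the deficit. *)
Lemma step_arith (M K l w d dF c h b : R) : 1 <= M -> 0 <= K <= M -> 0 <= c -> 0 <= h -> 0 < b <= 1 ->
  M * (l - 2^-1) < M * c + d + w ->
  w <= K * l - dF -> d - dF <= (M - K) * l / 2 ->
  w + d <= M * l ->
  w <= K * (h - b / 2 * (l - 2)) ->
  - M <= 1 + w + b / 16 * d ->
  4 * (c + 2^-1) + 4 * (h + 6) / b < l -> False.
Proof.
move=> M1 /andP[K0 KM] c0 h0 /andP[b0 b1] Hi Ha1 Ha2 Hb Hc Hii Hl.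
have hb : 0 < 4 * (h + 6) / b by rewrite divr_gt0//; lra.
have lc : 4 * (c + 2^-1) < l by lra.
have lh : 4 * (h + 6) < b * l by rewrite [b * l]mulrC -ltr_pdivrMr//; lra.
have l0 : 0 < l by lra.
have KM2 : M < 2 * K.
  rewrite ltNge; apply/negP => h2.
  have h3 : (M - K) * l / 2 < M * (c + 2^-1) by lra.
  have h4 : M / 2 * l <= (M - K) * l by rewrite ler_wpM2r ?(ltW l0)//; lra.
  have h5 : M * (4 * (c + 2^-1)) < M * l by rewrite ltr_pM2l//; lra.
  lra.
have dle : d <= 2 * (M * (l + 2)).
  have [d0|d0] := leP d 0; first by apply: (le_trans d0); rewrite mulr_ge0// mulr_ge0//; lra.
  have : b / 16 * d <= d / 2 by rewrite mulrC ler_wpM2l ?(ltW d0)//; lra.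
  lra.
have bd : b / 16 * d <= b / 16 * (2 * (M * (l + 2))) by rewrite ler_wpM2l//; lra.
have neg : h - b / 2 * (l - 2) <= 0 by lra.
have h6 : K * (h - b / 2 * (l - 2)) <= M / 2 * (h - b / 2 * (l - 2)) by rewrite ler_wnM2r//; lra.
have h9 : 0 < M * (b * l / 8 - h / 2 - 2 - 3 / 4 * b) by rewrite mulr_gt0//; lra.
lra.
Qed.

Lemma level_gt (c h b l : R) : 0 <= c -> 0 <= h -> 0 < b -> b <= 1 ->
  4 * (c + 2^-1) + 4 * (h + 6) / b < l -> 26 < l.
Proof.
move=> c0 h0 b0 b1; have : 24 <= 4 * (h + 6) / b by rewrite ler_pdivlMr//; lra.
lra.
Qed.

Lemma base_arith (l n x y : R) : 0 <= l -> x <= y -> y < n -> 0 <= l + n / 2 - 2^-1 * x.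
Proof. lra. Qed.

Lemma ln4_le2 : ln 4 <= 2 :> R.
Proof.
rewrite -ler_expR lnK ?posrE//.
have := expR_ge1Dx (1 : R) => h.
have -> : 2 = 1 + 1 :> R by [].
rewrite expRD; have : 2 * 2 <= expR 1 * expR 1 :> R by apply: ler_pM => //; lra.
lra.
Qed.

Lemma ln_sqrt (x : R) : 0 < x -> ln (Num.sqrt x) = 2^-1 * ln x.
Proof.
move=> x0; have h : ln (Num.sqrt x ^+ 2) = ln x by rewrite sqr_sqrtr// ltW.
by rewrite -h lnXn ?sqrtr_gt0// -mulr_natl; field.
Qed.

Lemma ln_prod (I : finType) (F : I -> R) : (forall i, 0 < F i) -> ln (\prod_i F i) = \sum_i ln (F i).
Proof.
move=> F0; suff [] : 0 < \prod_i F i /\ ln (\prod_i F i) = \sum_i ln (F i) by [].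
elim/big_rec2: _ => [|i y1 y2 _ [y0 <-]]; first by rewrite ln1.
by split; [rewrite mulr_gt0|rewrite lnM ?posrE].
Qed.

Lemma log_ratio (m : nat) (a mc dt w l c : R) : 0 < a -> 0 < mc -> 0 < dt -> 0 < w ->
  ln (mc * Num.sqrt (2 * pi)) <= c ->
  expR (m%:R * (l - 2^-1 - 2^-1 * ln (2 * a))) < mc ^+ m * (dt * (Num.sqrt (pi / a) ^+ m * w)) ->
  m%:R * (l - 2^-1) < m%:R * c + ln dt + ln w.
Proof.
move=> a0 mc0 dt0 w0 hc.
have p0 := @pi_gt0 R.
have s0 : 0 < Num.sqrt (pi / a) by rewrite sqrtr_gt0 divr_gt0.
have s2 : 0 < Num.sqrt (2 * pi) :> R by rewrite sqrtr_gt0 mulr_gt0.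
have p1 : 0 < Num.sqrt (pi / a) ^+ m * w by rewrite mulr_gt0// exprn_gt0.
have p2 : 0 < dt * (Num.sqrt (pi / a) ^+ m * w) by rewrite mulr_gt0.
have p3 : 0 < mc ^+ m by rewrite exprn_gt0.
have p4 : 0 < mc ^+ m * (dt * (Num.sqrt (pi / a) ^+ m * w)) by rewrite mulr_gt0.
have e : ln (mc ^+ m * (dt * (Num.sqrt (pi / a) ^+ m * w))) =
    m%:R * ln mc + (ln dt + (m%:R * (2^-1 * (ln pi - ln a)) + ln w)).
  have lX (x : R) : 0 < x -> ln (x ^+ m) = m%:R * ln x by move=> x0; rewrite lnXn// mulr_natl.
  rewrite lnM ?posrE// lX// lnM ?posrE// lnM ?posrE ?exprn_gt0// lX//.
  by rewrite ln_sqrt ?divr_gt0// ln_div ?posrE.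
rewrite -ltr_ln ?posrE ?expR_gt0// expRK e lnM ?posrE//.
move: hc; rewrite lnM ?posrE// ln_sqrt ?mulr_gt0// lnM ?posrE//.
move=> /(ler_wpM2l (ler0n R m)); lra.
Qed.

End step_arithmetic.

Lemma milman_const_gt0 (R : realType) (t : R) : 0 < milman_const t.
Proof.
apply: divr_gt0; first by rewrite mulr_gt0// expR_gt0.
by rewrite divr_gt0// c1_gt0.
Qed.

Lemma dotpE (R : realType) n (y z : 'rV[R]_n) : dotp y z = (y *m z^T) 0 0.
Proof. by rewrite mulmx_tr_dotp mxE mulr1n. Qed.

Lemma dotp_spectral (R : realType) m (Q U : 'M[R]_m) (b : 'rV[R]_m) : Q *m Q^T = U^T *m diag_mx b *m U ->
  forall x, dotp (x *m Q) (x *m Q) = wsq b (x *m U^T).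
Proof.
move=> QE x; transitivity (dotp (x *m U^T *m diag_mx b) (x *m U^T)).
  by rewrite !dotpE !trmx_mul trmxK !mulmxA -(mulmxA x) QE !mulmxA.
by apply: eq_bigr => i _; rewrite mul_mx_diag [in LHS]mxE; ring.
Qed.

(** * Lowering the level of the decay *)

Section descent.
Variables (R : realType) (beta h : R).
Hypothesis beta01 : 0 < beta <= 1.
Hypothesis h_ge0 : 0 <= h.
Hypothesis decay : forall m (P : probability (borel R m) R) (a : R), Cm P -> 2 <= a ->
  Zf P a <= expR (m%:R * (h - beta / 2 * ln a)).

Definition descent_c : R := `|ln (milman_const (beta / 16 : R) * Num.sqrt (2 * pi))|.
(** The threshold of [step_arith]: the first summand makes the large eigenvalues the majority, the
    second lets the decay on them win. *)
Definition descent_level : R := 4 * (descent_c + 2^-1) + 4 * (h + 6) / beta.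

(** The level [l] is applied to the marginal on [F], which is why it has to hold in all dimensions.
    It serves both for the large eigenvalues and for the full index set. *)
Lemma omega_log1 m (P : probability (borel R m) R) (a l : R) (b : 'rV[R]_m) (F : {set 'I_m}) :
  Cm P -> 0 < a -> (forall i, 0 < b 0 i) ->
  (forall k (Q : probability (borel R k) R), Cm Q -> Zf Q a <= expR (k%:R * (l - 2^-1 * ln (2 * a)))) ->
  ln (omega P a b) <= #|F|%:R * l - 2^-1 * \sum_(i in F) ln (b 0 i).
Proof.
move=> CP a0 b0 hl; have [Q CQ oQ] := omega_marginal F CP a0 b0.
have b0' i : 0 < (b *m coord_mx R F) 0 i by rewrite coord_mxE.
have [lcQ eQ _] := CQ.
have o1 := omega_le_Zf a0 b0' lcQ eQ.
rewrite -ler_expR lnK ?posrE ?omega_gt0//.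
apply: (le_trans oQ); apply: (le_trans o1).
have pp : 0 < \prod_i Num.sqrt (2 * a / (b *m coord_mx R F) 0 i).
  by apply: prodr_gt0 => i _; rewrite sqrtr_gt0 divr_gt0// mulr_gt0.
apply: (@le_trans _ _ (\prod_i Num.sqrt (2 * a / (b *m coord_mx R F) 0 i) * expR (#|F|%:R * (l - 2^-1 * ln (2 * a))))).
  by rewrite ler_pM2l// hl.
rewrite -[X in X * _]lnK ?posrE// -expRD ler_expR.
rewrite ln_prod; last by move=> i; rewrite sqrtr_gt0 divr_gt0// mulr_gt0.
under eq_bigr => i _ do rewrite coord_mxE ln_sqrt ?ln_div ?posrE ?divr_gt0 ?mulr_gt0//.
rewrite (sum_coord_mx F (fun i => 2^-1 * (ln (2 * a) - ln (b 0 i)))).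
rewrite -mulr_sumr big_split /= sumr_const sumrN -mulr_natl.
by rewrite le_eqVlt; apply/orP; left; apply/eqP; ring.
Qed.

(** The decay is used at the parameter [e^l / 4], which is at least 2 because [8 <= e^l]; the shift
    from [l] to [l - 2] absorbs [ln 4]. *)
Lemma omega_log2 m (P : probability (borel R m) R) (a l : R) (b : 'rV[R]_m) (F : {set 'I_m}) :
  Cm P -> 0 < a -> (forall i, 0 < b 0 i) -> (forall i, i \in F -> expR l <= b 0 i) ->
  expR l <= 2 * a -> 8 <= expR l ->
  ln (omega P a b) <= #|F|%:R * (h - beta / 2 * (l - 2)).
Proof.
move=> CP a0 b0 bl la l8; have [Q CQ oQ] := omega_marginal F CP a0 b0.
have b0' i : 0 < (b *m coord_mx R F) 0 i by rewrite coord_mxE.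
have bl' i : expR l <= (b *m coord_mx R F) 0 i by rewrite coord_mxE; apply: bl; exact: enum_valP.
have o1 := omega_le_large Q a0 b0' (expR_gt0 l) bl' la.
rewrite -ler_expR lnK ?posrE ?omega_gt0//.
apply: (le_trans oQ); apply: (le_trans o1).
have h2 : 2 <= expR l / 4 by lra.
apply: (le_trans (decay CQ h2)); rewrite ler_expR ler_wpM2l// lerD2l lerN2.
rewrite ler_wpM2l ?divr_ge0//; first by have /andP[/ltW] := beta01.
rewrite ln_div ?posrE ?expR_gt0// expRK; have := ln4_le2 R; lra.
Qed.

(** The reference value for the identity position: the square roots contribute at least [e^(-1/2)]
    per coordinate, and the effective parameter [a / (2 a + 1)] is at most one half, so Jensen gives
    the other [e^(-m/2)]. *)
Lemma omega1_ge m (P : probability (borel R m) R) (a : R) : Cm P -> 2^-1 <= a ->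
  expR (- m%:R) <= omega P a (const_mx 1).
Proof.
move=> CP a1; have a0 : 0 < a by apply: lt_le_trans a1; rewrite invr_gt0.
have a21 : 0 < 2 * a + 1 by rewrite addr_gt0// mulr_gt0.
have -> : omega P a (const_mx 1) = Num.sqrt (2 * a / (2 * a + 1)) ^+ m * Zf P (a / (2 * a + 1)).
  rewrite /omega; congr (_ * _).
    by under eq_bigr do rewrite mxE; rewrite prodr_const card_ord.
  apply: eq_Int => x; congr expR; rewrite mulNr -wsq_cst; congr (- wsq _ _).
  by apply/rowP => i; rewrite !mxE mulr1.
have -> : - m%:R = m%:R * - 2^-1 + - (2^-1 * m%:R) :> R by field.
rewrite expRD expRM_natl; apply: ler_pM; [by rewrite exprn_ge0 ?expR_ge0|exact: expR_ge0| |].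
  apply: lerXn2r; rewrite ?nnegrE ?expR_ge0 ?sqrtr_ge0//.
  rewrite -(@ler_pXn2r _ 2) ?nnegrE ?expR_ge0 ?sqrtr_ge0// sqr_sqrtr; last by rewrite divr_ge0 ?mulr_ge0 ?ltW.
  rewrite -expRM_natl (_ : 2 * - 2^-1 = - 1); last by field.
  rewrite expRN ler_pdivlMr// mulrC ler_pdivrMr ?expR_gt0//.
  have := ler_wpM2l (ltW (mulr_gt0 (@ltr0n R 2) a0)) (expR_ge1Dx (1 : R)); lra.
apply: (le_trans (Zf_lower CP _)); first by rewrite invr_ge0.
apply: Zf_ge; rewrite divr_ge0 ?(ltW a0) ?(ltW a21)//= ler_pdivrMr//; lra.
Qed.

(* In a regular position with eigenvalues [b], let [F] be the set of large eigenvalues.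
   If [F] has at most half of the indices, the volume bound already controls the level;
   otherwise the decay hypothesis applied to the marginal on [F] contradicts the
   near-maximality of the position against the identity. *)
Lemma descent_step (A l : R) : 1 <= A -> descent_level < l ->
  (forall m (P : probability (borel R m) R) a, Cm P -> 2^-1 <= a <= A ->
     Zf P a <= expR (m%:R * (l - 2^-1 * ln (2 * a)))) ->
  forall m (P : probability (borel R m) R) a, Cm P -> 2^-1 <= a <= A ->
     Zf P a <= expR (m%:R * (l - 2^-1 - 2^-1 * ln (2 * a))).
Proof.
move=> A1 ll hyp m P a CP /andP[a1 aA].
have a0 : 0 < a by apply: lt_le_trans a1; rewrite invr_gt0.
rewrite leNgt; apply/negP => big.
have Z1 := Zf_le1 P (ltW a0).
have [m0|m_gt0] := posnP m.
  by move: (lt_le_trans big Z1); subst m; rewrite mul0r expR0 ltxx.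
have m1 : 1 <= m%:R :> R by rewrite ler1n.
have c0 : 0 <= descent_c by exact: normr_ge0.
have /andP[be0 be1] := beta01; have be01 := beta01.
have lb : 26 < l.
  exact: level_gt c0 h_ge0 be0 be1 ll.
have l8 : 8 <= expR l by have := expR_ge1Dx l; lra.
(* As [Z <= 1], a violation of the improved level needs a negative exponent, so
   [2 l - 1 < ln (2 a)]. In particular [a] is large, although the statement starts at one half. *)
have la : expR l <= 2 * a.
  have : expR (m%:R * (l - 2^-1 - 2^-1 * ln (2 * a))) < expR 0 by rewrite expR0; exact: lt_le_trans big Z1.
  rewrite ltr_expR pmulr_rlt0; last by lra.
  move=> h1; have h2 : l <= ln (2 * a) by lra.
  by move: h2; rewrite -ler_expR lnK// posrE mulr_gt0.
have [lcP eP sqP] := CP.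
have th01 : 0 < beta / 16 < 1 by apply/andP; split; lra.
have [iS IS] := Int_smooth P a0.
have [Q [uQ Qmax Qf]] := regular_position m_gt0 (@smooth_gt0 R m P a a0) (@continuous_smooth R m P a a0)
  (lcf_smooth a0 lcP) (smooth_even a0 eP) iS th01.
have [U [b [UU QE b0]]] : exists U (b : 'rV[R]_m), [/\ U *m U^T = 1%:M,
    Q *m Q^T = U^T *m diag_mx b *m U & forall i, 0 < b 0 i].
  apply: spectral_pos; first by rewrite trmx_mul trmxK.
  move=> x x0.
  have -> : dotp (x *m (Q *m Q^T)) x = dotp (x *m Q) (x *m Q).
    by rewrite !dotpE trmx_mul !mulmxA.
  rewrite dotp_gt0//; apply: contra x0 => /eqP e.
  by rewrite -(mulmxK uQ x) e mul0mx.
have UtU := orthogonal_tr UU.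
have UT1 : (U^T)^T *m U^T = 1%:M by rewrite trmxK.
(* Rotating the law by [U^T] makes the position diagonal; the rotated law is again in the class. *)
have [P' PP' CP'] := Cm_lin UT1 CP.
have lo : forall c0 : 'rV[R]_m, (forall i, 0 < c0 0 i) -> 0 < omega P' a c0.
  by move=> c0' ?; exact: omega_gt0.
have rot := dotp_spectral QE.
have gm : gmass (smooth P a) Q = Num.sqrt (pi / a) ^+ m * omega P' a b.
  have [_ <-] := smooth_omega P' a0 b0.
  have i1 := (smooth_omega P' a0 b0).1.
  apply: EFin_inj; rewrite -(IntE i1) -(IntE (ig_gmass (@smooth_gt0 _ _ P _ a0) (@continuous_smooth _ _ P _ a0) iS Q)).
  have mb : measurable_fun setT (fun x : borel R m => expR (- 2^-1 * wsq b x)).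
    by apply: measurable_expRT; apply: measurable_funM => //; exact: measurable_wsq.
  have mQ : measurable_fun setT (fun x : borel R m => expR (- 2^-1 * dotp ((x : 'rV[R]_m) *m Q) (x *m Q))).
    by have := @measurable_expaff R m m Q 0 (- 2^-1); apply: eq_measurable_fun => x _; rewrite addr0.
  rewrite (smooth_tonelli P a0 mQ (fun x => expR_ge0 _)) (smooth_tonelli P' a0 mb (fun x => expR_ge0 _)).
  have G z := gauss_convolution z a0 b0.
  under [RHS]eq_integral do rewrite G.
  pose g z := \prod_i Num.sqrt (2 * pi / (2 * a + b 0 i)) * expR (- wsq (harm a b) z).
  rewrite -/g (PP' g); first last.
  - by move=> x; rewrite mulr_ge0 ?expR_ge0// prodr_ge0// => i _; exact: sqrtr_ge0.
  - apply: measurable_funM => //; apply: measurable_expRT; apply: measurableT_comp => //; exact: measurable_wsq.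
  apply: eq_integral => z _; rewrite /g -G.
  have UT2 : U^T *m (U^T)^T = 1%:M by rewrite trmxK.
  have uU : U^T \in unitmx by apply: (mulmx1_unit UtU).1.
  pose k (y : 'rV[R]_m) := (expR (- a * dotp (z *m U^T - y) (z *m U^T - y)) * expR (- 2^-1 * wsq b y))%:E.
  have mk : measurable_fun setT (k : borel R m -> \bar R).
    apply/measurable_EFinP; apply: measurable_funM => //.
    have := measurableT_comp (measurable_expN a) (measurable_add (- (z *m U^T))).
    by apply: eq_measurable_fun => y _ /=; rewrite -[z *m U^T - y]opprB dotpNl dotpNr opprK.
  have k0 y : (0 <= k y)%E by rewrite lee_fin mulr_ge0 ?expR_ge0.
  have := jacobian_unitmx uU mk k0.
  have -> : `|\det U^T| = 1.
    have := congr1 determinant UU; rewrite det_mulmx !det_tr det1 -expr2 => /(congr1 Num.norm).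
    by rewrite normrX normr1 => /eqP; rewrite pexpr_eq1// => /eqP.
  rewrite mul1e => <-; apply: eq_integral => x _; rewrite /k -mulmxBl (dotp_orth _ _ UT2).
  by rewrite rot.
have gm1 : gmass (smooth P a) 1%:M = Num.sqrt (pi / a) ^+ m * omega P a (const_mx 1).
  have o0 i : 0 < (const_mx 1 : 'rV[R]_m) 0 i by rewrite mxE.
  have [_ <-] := smooth_omega P a0 o0.
  by apply: eq_Int => x; rewrite mulmx1 wsq_cst mul1r.
have dQ : ln `|\det Q| = 2^-1 * \sum_i ln (b 0 i).
  have dd : 0 < `|\det Q| by move: uQ; rewrite unitmxE unitfE normr_gt0.
  have : `|\det Q| ^+ 2 = \prod_i b 0 i.
    have := congr1 determinant QE; rewrite !det_mulmx !det_tr det_diag -normrX expr2 => ->.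
    have := congr1 determinant UU; rewrite det_mulmx det_tr det1 => u1.
    by rewrite mulrAC u1 mul1r ger0_norm//; apply: prodr_ge0 => i _; exact: ltW.
  by move/(congr1 (@ln R)); rewrite lnXn// ln_prod// => <-; rewrite -mulr_natl; field.
pose F := [set i | expR l <= b 0 i]%SET.
pose d := 2^-1 * \sum_i ln (b 0 i).
pose dF := 2^-1 * \sum_(i in F) ln (b 0 i).
have hyp' k (Q' : probability (borel R k) R) : Cm Q' -> Zf Q' a <= expR (k%:R * (l - 2^-1 * ln (2 * a))).
  by move=> CQ'; apply: hyp => //; rewrite a1.
have KM : 0 <= (#|F|%:R : R) <= m%:R.
  by rewrite ler0n ler_nat -[X in (_ <= X)%N](card_ord m) max_card.
have Ha1 := omega_log1 (P := P') F CP' a0 b0 hyp'.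
have Hb := omega_log1 (P := P') [set: 'I_m]%SET CP' a0 b0 hyp'.
rewrite cardsT card_ord (eq_bigl xpredT) in Hb; last by move=> i; rewrite inE.
have bF i : i \in F -> expR l <= b 0 i by rewrite inE.
have Hc := omega_log2 (P := P') CP' a0 b0 bF la l8.
have d0 : 0 < `|\det Q| by move: uQ; rewrite unitmxE unitfE normr_gt0.
have pa0 : 0 < Num.sqrt (pi / a) ^+ m by rewrite exprn_gt0// sqrtr_gt0 divr_gt0// pi_gt0.
apply: (@step_arith R m%:R #|F|%:R l (ln (omega P' a b)) d dF descent_c h beta m1 KM c0 h_ge0 be01 _ Ha1 _ _ Hc _ ll).
- have := lt_le_trans big; move: Qf; rewrite smooth0 => Qf /(_ _ Qf).
  rewrite gm => lt.
  rewrite /d -dQ; apply: (@log_ratio R m a (milman_const (beta / 16))) => //; [exact: milman_const_gt0|exact: lo|exact: ler_norm].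
- rewrite /d /dF -mulrBr (bigID (mem F))/= [X in _ * (X - _)]addrC addrK.
  rewrite mulrC ler_pM2r ?invr_gt0//.
  apply: (@le_trans _ _ (\sum_(i in ~: F) l)); last first.
    have cF : m%:R = #|F|%:R + #|(~: F)%SET|%:R :> R by rewrite -natrD cardsC card_ord.
    by rewrite sumr_const -[l *+ _]mulr_natl cF addrAC subrr add0r.
  rewrite [leRHS](eq_bigl (fun i => i \notin F)); last by move=> i; rewrite inE.
  apply: ler_sum => i; rewrite inE -ltNge => /ltW.
  by rewrite -[X in _ -> _ <= X]expRK ler_ln ?posrE ?expR_gt0.
- by rewrite -lerBrDr.
- have := Qmax 1%:M (unitmx1 _ _); rewrite gm gm1 det1 normr1 powR1 mulr1.
  have -> : expR 1 * (Num.sqrt (pi / a) ^+ m * omega P' a b * `|\det Q| `^ (beta / 16)) =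
    Num.sqrt (pi / a) ^+ m * (expR 1 * omega P' a b * `|\det Q| `^ (beta / 16)) by ring.
  rewrite ler_pM2l// => h1.
  have := le_trans (omega1_ge CP a1) h1.
  have w0 := lo b b0; have e0 : 0 < expR 1 * omega P' a b by rewrite mulr_gt0// expR_gt0.
  have D0 : 0 < `|\det Q| `^ (beta / 16) by rewrite powR_gt0.
  rewrite -ler_ln ?posrE ?expR_gt0//; last by rewrite mulr_gt0.
  by rewrite expRK lnM ?posrE// lnM ?posrE ?expR_gt0// expRK ln_powR dQ.
Qed.

(** The level falls by one half for all laws, dimensions and parameters up to [A] simultaneously.
    Bounding the parameters by [A] provides a first level; the final one does not depend on [A]. *)
Lemma descent m (P : probability (borel R m) R) a : Cm P -> 2^-1 <= a ->
  Zf P a <= expR (m%:R * (descent_level - 2^-1 * ln (2 * a))).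
Proof.
move=> CP a1; pose A := Num.max 1 a.
have A1 : 1 <= A by rewrite le_max lexx.
have l00 : 0 <= descent_level.
  have /andP[be0 _] := beta01.
  apply: addr_ge0; first by rewrite mulr_ge0// addr_ge0// normr_ge0.
  by rewrite divr_ge0// ?(ltW be0)// mulr_ge0// addr_ge0.
have key N : (forall m (P : probability (borel R m) R) a, Cm P -> 2^-1 <= a <= A ->
     Zf P a <= expR (m%:R * (descent_level + N%:R / 2 - 2^-1 * ln (2 * a)))) ->
  forall m (P : probability (borel R m) R) a, Cm P -> 2^-1 <= a <= A ->
     Zf P a <= expR (m%:R * (descent_level - 2^-1 * ln (2 * a))).
  elim: N => [|N ih]; first by rewrite mul0r addr0.
  move/(@descent_step A _ A1) => h1; apply: ih.
  have l1 : descent_level < descent_level + N.+1%:R / 2 by rewrite ltrDl divr_gt0.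
  have -> : descent_level + N%:R / 2 = descent_level + N.+1%:R / 2 - 2^-1 by rewrite -natr1; field.
  exact: h1.
(* At this level the right side is at least one for every [a' <= A], so [Z <= 1] starts the
   induction. *)
apply: (key (Num.trunc (ln (2 * A))).+1) => //; last by rewrite a1 le_max lexx orbT.
move: A A1 {key} => A A1 m' P' a' CP' /andP[a1' aA].
have a0 : 0 < a' by apply: lt_le_trans a1'; rewrite invr_gt0.
apply: (le_trans (Zf_le1 P' (ltW a0))); rewrite -[leLHS]expR0 ler_expR mulr_ge0//.
have : ln (2 * a') <= ln (2 * A) by rewrite ler_ln ?posrE ?mulr_gt0 ?ler_pM2l// (lt_le_trans ltr01).
by move=> h1; exact: base_arith l00 h1 (truncnS_gt _).
Qed.

End descent.

(** * Centroid bodies *)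

Section power_inequalities.
Variable R : realType.

Lemma pow_tangent n (a b : R) : 0 <= a -> 0 <= b -> a ^+ n.+1 + n.+1%:R * a ^+ n * (b - a) <= b ^+ n.+1.
Proof.
move=> a0 b0; elim: n => [|n ih]; first by rewrite expr0 !expr1; lra.
have h := ler_wpM2l b0 ih.
rewrite [leRHS]exprS; apply: le_trans h; rewrite -subr_ge0.
have -> : b * (a ^+ n.+1 + n.+1%:R * a ^+ n * (b - a)) - (a ^+ n.+2 + n.+2%:R * a ^+ n.+1 * (b - a)) =
   n.+1%:R * a ^+ n * (b - a) ^+ 2.
  by rewrite -!natr1 !exprS; ring.
by rewrite mulr_ge0 ?sqr_ge0// mulr_ge0// exprn_ge0.
Qed.

Lemma pow_young n (a b : R) : 0 <= a -> 0 <= b -> n.+1%:R * (a ^+ n * b) <= n%:R * a ^+ n.+1 + b ^+ n.+1.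
Proof.
move=> a0 b0; have := pow_tangent n a0 b0.
have -> : n%:R * a ^+ n.+1 = n.+1%:R * a ^+ n * a - a ^+ n.+1 by rewrite -natr1 exprS; ring.
lra.
Qed.

Lemma pow_mean n (a b : R) : 0 <= a -> 0 <= b -> 2 * ((a + b) / 2) ^+ n <= a ^+ n + b ^+ n.
Proof.
case: n => [|n] a0 b0; first by rewrite !expr0; lra.
have c0 : 0 <= (a + b) / 2 by rewrite divr_ge0// addr_ge0.
have := pow_tangent n c0 a0; have := pow_tangent n c0 b0.
set c := (a + b) / 2; set k := _ * c ^+ n => h1 h2.
have : k * (b - c) + k * (a - c) = 0 by rewrite -mulrDr /c; field.
lra.
Qed.

Lemma pow_sym n (p q : R) : 2 * `|p| ^+ n <= `|p + q| ^+ n + `|p - q| ^+ n.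
Proof.
apply: le_trans (pow_mean n (normr_ge0 (p + q)) (normr_ge0 (p - q))).
rewrite ler_pM2l//; apply: lerXn2r; rewrite ?nnegrE ?normr_ge0 ?divr_ge0 ?addr_ge0 ?normr_ge0//.
rewrite ler_pdivlMr//; have := ler_normD (p + q) (p - q).
have -> : p + q + (p - q) = p * 2 by ring.
by rewrite normrM (ger0_norm (ler0n R 2)).
Qed.

Lemma pow_add n (p q : R) : `|p + q| ^+ n <= 2 ^+ n * (`|p| ^+ n + `|q| ^+ n).
Proof.
apply: (@le_trans _ _ ((2 * Num.max `|p| `|q|) ^+ n)).
  apply: lerXn2r; rewrite ?nnegrE ?mulr_ge0 ?le_max ?normr_ge0//.
  apply: le_trans (ler_normD _ _) _.
  have h1 : `|p| <= Num.max `|p| `|q| by rewrite le_max lexx.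
  have h2 : `|q| <= Num.max `|p| `|q| by rewrite le_max lexx orbT.
  lra.
rewrite exprMn ler_wpM2l ?exprn_ge0//; have [h|h] := leP `|p| `|q|.
  by rewrite lerDr exprn_ge0.
by rewrite lerDl exprn_ge0.
Qed.

(** Bernoulli's inequality for the power [(n + 2) / 2] of [t^2], proved by induction so as to stay
    with integer exponents. *)
Lemma pow_sq n (t : R) : 0 <= t -> 1 + n.+2%:R / 2 * (t ^+ 2 - 1) <= t ^+ n.+2.
Proof.
move=> t0; elim: n => [|n ih]; first by lra.
have h : t * (1 + n.+2%:R / 2 * (t ^+ 2 - 1)) <= t ^+ n.+3 by rewrite [leRHS]exprS ler_wpM2l.
apply: le_trans h; rewrite -subr_ge0.
have -> : t * (1 + n.+2%:R / 2 * (t ^+ 2 - 1)) - (1 + n.+3%:R / 2 * (t ^+ 2 - 1)) =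
   2^-1 * (t - 1) ^+ 2 * (n.+2%:R * t + n.+1%:R) by rewrite -!natr1; field.
apply: mulr_ge0; first by rewrite mulr_ge0 ?sqr_ge0// invr_ge0.
by rewrite addr_ge0// mulr_ge0.
Qed.

Lemma root_le n (x y : R) : 0 <= x -> 0 <= y -> y <= x ^+ n.+1 -> y `^ n.+1%:R^-1 <= x.
Proof.
move=> x0 y0 h; have -> : x = (x ^+ n.+1) `^ n.+1%:R^-1 by rewrite -powR_mulrn// -powRrM mulfV ?powRr1.
by apply: ge0_ler_powR; rewrite ?nnegrE ?exprn_ge0 ?invr_ge0.
Qed.

Lemma le_root n (x y : R) : 0 <= x -> 0 <= y -> x ^+ n.+1 <= y -> x <= y `^ n.+1%:R^-1.
Proof.
move=> x0 y0 h; have -> : x = (x ^+ n.+1) `^ n.+1%:R^-1 by rewrite -powR_mulrn// -powRrM mulfV ?powRr1.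
by apply: ge0_ler_powR; rewrite ?nnegrE ?exprn_ge0 ?invr_ge0.
Qed.

Lemma sq_le_bound (u a b : R) : 0 <= a -> 0 <= b -> u <= a -> - u <= b -> u * u <= (a + b) ^+ 2.
Proof.
move=> a0 b0 ua ub; rewrite -expr2 -[u ^+ 2]ger0_norm ?sqr_ge0// normrX.
apply: lerXn2r; rewrite ?nnegrE ?addr_ge0//.
by rewrite ler_norml; apply/andP; split; lra.
Qed.

End power_inequalities.

Section centroid.
Variables (R : realType) (n : nat) (nu : probability (borel R n.+1) R).
Hypothesis lc : lcm nu.

Definition mom (y : 'rV[R]_n.+1) : R := Int nu (fun x => `|dotp x y| ^+ n.+1).
Definition hcb (y : 'rV[R]_n.+1) : R := mom y `^ n.+1%:R^-1.
(** The intersection of the half-spaces prescribed by the support function. It is explicit, unlike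
    the body selected by [get]; [centroid_bodyE] identifies them. *)
Definition cbody : set 'rV[R]_n.+1 := [set x | forall y, dotp x y <= hcb y].

Lemma ig_mom y : ig nu (fun x => `|dotp x y| ^+ n.+1).
Proof. exact: ig_pow. Qed.

Lemma mom_ge0 y : 0 <= mom y.
Proof. by apply: Int_ge0 => x; rewrite exprn_ge0. Qed.

Lemma hcb_ge0 y : 0 <= hcb y. Proof. exact: powR_ge0. Qed.

Lemma hcbX y : hcb y ^+ n.+1 = mom y.
Proof. by rewrite -powR_mulrn ?powR_ge0// -powRrM mulVf ?powRr1 ?mom_ge0. Qed.

Lemma Lnorm_hcb y : ('N[nu]_(n.+1%:R)%:E [(fun x => (dotp x y)%:E)] = (hcb y)%:E)%E.
Proof.
rewrite unlock /Lnorm.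
under eq_integral do rewrite /= powR_mulrn//.
by rewrite (IntE (ig_mom y)) poweR_EFin.
Qed.

(** [sgn u |u|^n], up to a factor the derivative of [|u|^(n+1)]; the sign is written with an
    indicator for measurability. *)
Let sgp (u : R) : R := `|u| ^+ n * (2 * \1_[set t : R | 0 <= t] u - 1).

Let sgpM u : sgp u * u = `|u| ^+ n.+1.
Proof.
rewrite /sgp indicE exprSr -mulrA; congr (_ * _).
have [u0|u0] := leP 0 u.
  by rewrite mem_set//= ger0_norm// mulr1 (_ : 2 - 1 = 1) ?mul1r//; ring.
rewrite memNset/=; last by apply/negP; rewrite -ltNge.
by rewrite ltr0_norm// mulr0 sub0r mulN1r.
Qed.

Let sgp_norm u : `|sgp u| = `|u| ^+ n.
Proof.
rewrite /sgp normrM normrX normr_id indicE; case: (_ \in _) => /=.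
  by rewrite (_ : 2 * 1 - 1 = 1) ?normr1 ?mulr1//; ring.
by rewrite (_ : 2 * 0 - 1 = - 1) ?normrN ?normr1 ?mulr1//; ring.
Qed.

Let msgp : measurable_fun setT sgp.
Proof.
apply: measurable_funM.
  by apply: measurable_funX; exact: normr_measurable.
apply: measurable_funB => //; apply: measurable_funM => //.
apply: measurable_indic.
by rewrite (_ : [set t : R | 0 <= t] = `[0, +oo[%classic); [exact: measurable_itv|apply/seteqP; split => t; rewrite /= in_itv/= andbT].
Qed.

Let ig_cross y z : ig nu (fun x => sgp (dotp x y) * dotp x z).
Proof.
apply: (ig_le _ _ (igD (igZ n.+1%:R (ig_mom y)) (ig_mom z))).
  apply: measurable_funM; last exact: measurable_dotp.
  exact: measurableT_comp msgp (measurable_dotp y).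
move=> x; rewrite normrM sgp_norm.
have := pow_young n (normr_ge0 (dotp x y)) (normr_ge0 (dotp x z)).
have p1 : 0 <= `|dotp x y| ^+ n * `|dotp x z| by rewrite mulr_ge0 ?exprn_ge0.
have p2 : 0 <= `|dotp x y| ^+ n.+1 by rewrite exprn_ge0.
rewrite -!natr1 => h; apply: (@le_trans _ _ ((n%:R + 1) * (`|dotp x y| ^+ n * `|dotp x z|))).
  by rewrite ler_peMl// lerDr.
apply: (le_trans h); rewrite lerD2r ler_wpM2r// lerDl; exact: ler01.
Qed.

(** Hoelder's inequality, obtained from Young's after normalising by [hcb y] and by some
    [s > hcb z]; the strict inequality avoids division by zero when [hcb z] vanishes. *)
Let cross_le y z : 0 < mom y -> Int nu (fun x => sgp (dotp x y) * dotp x z) <= hcb y ^+ n * hcb z.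
Proof.
move=> y0; have A0 : 0 < hcb y by rewrite powR_gt0.
have An : 0 < hcb y ^+ n by rewrite exprn_gt0.
suff H s : hcb z < s -> Int nu (fun x => sgp (dotp x y) * dotp x z) / hcb y ^+ n <= s.
  have h : Int nu (fun x => sgp (dotp x y) * dotp x z) / hcb y ^+ n <= hcb z.
    by apply/ler_addgt0Pr => e e0; apply: H; rewrite ltrDl.
  by move: h; rewrite (ler_pdivrMr _ _ An) mulrC.
move=> zs; have s0 : 0 < s by exact: le_lt_trans (hcb_ge0 z) zs.
have k0 : 0 < n.+1%:R :> R by [].
have ic := ig_cross y z; have iy := ig_mom y; have iz := ig_mom z.
have := Int_le (igZ (n.+1%:R / (hcb y ^+ n * s)) ic) (igD (igZ (n%:R / hcb y ^+ n.+1) iy) (igZ (s ^+ n.+1)^-1 iz)).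
rewrite (IntD (igZ (n%:R / hcb y ^+ n.+1) iy) (igZ (s ^+ n.+1)^-1 iz)) (IntZ _ ic) (IntZ _ iy) (IntZ _ iz).
rewrite -/(mom y) -/(mom z) -!hcbX divfK ?gt_eqF ?exprn_gt0// => H.
have : n.+1%:R / (hcb y ^+ n * s) * Int nu (fun x => sgp (dotp x y) * dotp x z) <= n%:R + 1.
  apply: le_trans (H _) _; last first.
    rewrite lerD2l mulrC ler_pdivrMr ?exprn_gt0// mul1r; apply: lerXn2r; rewrite ?nnegrE ?hcb_ge0 ?ltW//.
  move=> x; have a0 : 0 <= `|dotp x y| / hcb y by rewrite divr_ge0// ltW.
  have b0 : 0 <= `|dotp x z| / s by rewrite divr_ge0// ltW.
  have := pow_young n a0 b0.
  rewrite !expr_div_n => Y.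
  apply: le_trans (le_trans _ Y) _; last by rewrite mulrA [X in _ + X <= _]mulrC mulrAC.
  have -> : n.+1%:R * (`|dotp x y| ^+ n / hcb y ^+ n * (`|dotp x z| / s)) =
     n.+1%:R / (hcb y ^+ n * s) * (`|dotp x y| ^+ n * `|dotp x z|) by field; rewrite !gt_eqF.
  rewrite ler_wpM2l//; first by rewrite divr_ge0// mulr_ge0// ltW.
  by rewrite -sgp_norm -normrM ler_norm.
rewrite natr1 -mulrA ger_pMr// mulrC ler_pdivrMr ?mulr_gt0// mul1r => h.
by rewrite ler_pdivrMr// mulrC.
Qed.

(* The point of the centroid body at which the support function is attained is
   [E (sgn <X,y> |<X,y>|^n X)], normalised; Young's inequality puts it in the body. *)
Lemma touching y : exists2 x, cbody x & dotp x y = hcb y.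
Proof.
have [y0|y0] := eqVneq (mom y) 0.
  by exists 0; [move=> z; rewrite dotp0l hcb_ge0|rewrite dotp0l /hcb y0 powR0// invr_eq0 pnatr_eq0].
have {}y0 : 0 < mom y by rewrite lt_neqAle eq_sym y0 mom_ge0.
have A0 : 0 < hcb y by rewrite powR_gt0.
have An : 0 < hcb y ^+ n by rewrite exprn_gt0.
pose x : 'rV[R]_n.+1 := \row_i (Int nu (fun x => sgp (dotp x y) * dotp x (delta_mx 0 i)) / hcb y ^+ n).
have E z : dotp x z = Int nu (fun x => sgp (dotp x y) * dotp x z) / hcb y ^+ n.
  transitivity (\sum_i Int nu (fun u => z 0 i * (sgp (dotp u y) * dotp u (delta_mx 0 i))) / hcb y ^+ n).
    apply: eq_bigr => i _; rewrite [x 0 i]mxE (IntZ (z 0 i) (ig_cross y _)).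
    by rewrite mulrC mulrA.
  rewrite -mulr_suml -Int_sum; last by move=> i; exact: igZ.
  congr (_ / _); apply: eq_Int => u; rewrite [dotp u z]/dotp mulr_sumr.
  by apply: eq_bigr => i _; rewrite dotp_delta mulrCA [z 0 i * _]mulrC.
exists x => [z|]; first by rewrite E ler_pdivrMr// mulrC; exact: cross_le.
rewrite E; apply: (@mulIf _ (hcb y ^+ n)); first by rewrite gt_eqF.
rewrite divfK ?gt_eqF// -exprS hcbX; apply: eq_Int => u; exact: sgpM.
Qed.

Lemma convexs_cbody : convexs cbody.
Proof.
move=> x x' l cx cx' /andP[l0 l1] y; rewrite dotpDl !dotpZl.
have -> : hcb y = (1 - l) * hcb y + l * hcb y by ring.
by apply: lerD; rewrite ler_pM2l ?subr_gt0.
Qed.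

Lemma closed_cbody : closed cbody.
Proof.
have -> : cbody = \bigcap_y [set x | dotp x y <= hcb y].
  by apply/seteqP; split => [x cx y _|x cx y]; [exact: cx|exact: (cx y I)].
apply: closed_bigI => y _.
apply: (@preimage_closed _ _ (fun x : 'rV[R]_n.+1 => dotp x y) [set r | r <= hcb y]); last exact: closed_le.
move=> x _; exact: continuous_dotp.
Qed.

Lemma compact_cbody : compact cbody.
Proof.
apply: (@compact_enorm R n.+1 _ (Num.sqrt (\sum_i (hcb (delta_mx 0 i) + hcb (- delta_mx 0 i)) ^+ 2))).
  exact: closed_cbody.
move=> x cx; rewrite /enorm ler_sqrt; last by apply: sumr_ge0 => i _; exact: sqr_ge0.
apply: ler_sum => i _.
have h1 := cx (delta_mx 0 i); have h2 := cx (- delta_mx 0 i).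
rewrite dotpNr in h2; rewrite dotp_delta in h1 h2.
exact: sq_le_bound (hcb_ge0 _) (hcb_ge0 _) h1 h2.
Qed.

Lemma support_cbody y : support_function cbody y = hcb y.
Proof.
have [x cx xy] := touching y.
apply/eqP; rewrite eq_le; apply/andP; split.
  by apply: ge_sup; [exists (dotp x y); exists x|move=> _ [z cz <-]; exact: cz].
rewrite -xy; apply: ub_le_sup; [exists (hcb y) => _ [z cz <-]; exact: cz|by exists x].
Qed.

(** [touching] shows that [cbody] has the required support function, so the choice is made from a
    nonempty class; separation shows that this class has only one member. *)
Lemma centroid_bodyE : centroid_body n.+1%:R nu = cbody.
Proof.
pose D := [set K : set 'rV[R]_n.+1 | convex_body K /\ forall y,
    ((support_function K y)%:E = 'N[nu]_(n.+1%:R)%:E [(fun x => (dotp x y)%:E)])%E].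
have Dc : D cbody.
  split=> [|y]; last by rewrite Lnorm_hcb support_cbody.
  split; [by exists 0 => y; rewrite dotp0l hcb_ge0|exact: compact_cbody|].
  apply/convex_setW => x y; rewrite !inE => cx cy k k0 k1.
  have := convexs_cbody cx cy (l := 1 - k%:num); rewrite subr_gt0 k1 ltrBlDr ltrDl k0 subKr => /(_ isT).
  by move=> h; apply/mem_set; exact: h.
have [[K0 cK vK] sK] := getPex (ex_intro _ _ Dc : exists K, D K).
rewrite -/(centroid_body n.+1%:R nu) in K0 cK vK sK.
set K := centroid_body _ _ in K0 cK vK sK *.
have sK' y : support_function K y = hcb y by apply: EFin_inj; rewrite sK Lnorm_hcb.
have ubK y : has_ubound [set dotp x y | x in K].
  have [c [c0 Kc]] := compact_enorm_bounded cK; exists (c * enorm y) => _ [z Kz <-].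
  by apply: (le_trans (ler_norm _)); apply: (le_trans (CSe z y)); rewrite ler_wpM2r ?enorm_ge0// Kc.
apply/seteqP; split => [x Kx y|x cx].
  by rewrite -sK'; apply: ub_le_sup => //; exists x.
apply: contrapT => nKx.
have clK : closed K by apply: compact_closed => //; exact: norm_hausdorff.
have vK' : convexs K.
  move=> u v l Ku Kv /andP[l0 l1].
  have := vK v u (Itv01 (ltW l0) (ltW l1)); rewrite !inE => /(_ Kv Ku).
  by rewrite /conv /= addrC.
have [v [a [Ka ax]]] := separation clK vK' K0 nKx.
have := lt_le_trans ax (cx v); rewrite -sK' ltNge => /negP; apply.
by apply: ge_sup => [|_ [z Kz <-]]; [have [z Kz] := K0; exists (dotp z v); exists z|exact: Ka].
Qed.

End centroid.

(** * Lower bounds for the moments of isotropic laws *)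

Section moment_lower.
Variable R : realType.

(** Needed in dimension one, where the exponent 1 lies below 2. Splitting at [s] gives
    [E u^2 <= s E|u| + s^(-2) E u^4]; with [s^2 = 2 borell_const |v|^2] the last term is half of
    [|v|^2], and [E|u| >= |v|^2 / (2 s)] remains. *)
Definition mom_const : R := (2 * Num.sqrt (2 * borell_const R))^-1.

Lemma mom_const_gt0 : 0 < mom_const.
Proof. by rewrite invr_gt0 mulr_gt0// sqrtr_gt0; have := borell_const_ge1 R; lra. Qed.

Lemma mom_const_le1 : mom_const <= 1.
Proof.
have b1 := borell_const_ge1 R.
have : 1 <= Num.sqrt (2 * borell_const R) by rewrite -[leLHS]sqrtr1 ler_sqrt; lra.
by move=> h; rewrite invf_le1; lra.
Qed.

Lemma mom_lower1 (nu : probability (borel R 1) R) v : lcm nu ->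
  (forall v, Int nu (fun x => dotp x v ^+ 2) = dotp v v) -> mom_const * enorm v <= mom nu v.
Proof.
move=> lc iso; have [->|v0] := eqVneq v 0.
  by rewrite /enorm dotp0l sqrtr0 mulr0 mom_ge0.
have vv := dotp_gt0 v0; have V0 : 0 < enorm v by rewrite sqrtr_gt0.
have B1 := borell_const_ge1 R; have B0 : 0 < borell_const R by lra.
pose s := Num.sqrt (2 * borell_const R) * enorm v.
have sB : 0 < Num.sqrt (2 * borell_const R) by rewrite sqrtr_gt0 mulr_gt0.
have s0 : 0 < s by rewrite mulr_gt0.
have s2 : s ^+ 2 = 2 * borell_const R * dotp v v by rewrite exprMn sqr_sqrtr ?enorm2// mulr_ge0// ltW.
have i2 := ig_sq v lc; have i1 := ig_mom lc v.
have i4 : ig nu (fun x => dotp x v ^+ 4).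
  apply: (eq_ig _ (ig_pow lc v 4)) => x; by rewrite -normrX ger0_norm// (exprM _ 2 2) sqr_ge0.
have V2 : 0 < Int nu (fun x => dotp x v ^+ 2) by rewrite iso.
have F := fourth_moment lc V2; rewrite iso in F.
have := Int_le i2 (igD (igZ s i1) (igZ (s ^+ 2)^-1 i4)).
rewrite (IntD (igZ s i1) (igZ (s ^+ 2)^-1 i4)) (IntZ _ i1) (IntZ _ i4) iso -/(mom nu v) => H.
have {}H : dotp v v <= s * mom nu v + dotp v v / 2.
  apply: le_trans (H _) _; last first.
    rewrite lerD2l; apply: (le_trans (ler_wpM2l _ F)); first by rewrite invr_ge0 sqr_ge0.
    by rewrite s2 le_eqVlt; apply/orP; left; apply/eqP; field; rewrite !gt_eqF.
  move=> x; rewrite expr1; set u := dotp x v.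
  have [h|/ltW h] := leP `|u| s.
    rewrite ler_wpDr//; first by rewrite mulr_ge0 ?invr_ge0 ?sqr_ge0// (exprM _ 2 2) sqr_ge0.
    by rewrite -[u ^+ 2]ger0_norm ?sqr_ge0// normrX expr2 ler_wpM2r.
  rewrite ler_wpDl//; first by rewrite mulr_ge0// ltW.
  rewrite mulrC ler_pdivlMr ?exprn_gt0// (exprM _ 2 2) [leRHS]expr2 ler_wpM2l ?sqr_ge0//.
  by rewrite -[u ^+ 2]ger0_norm ?sqr_ge0// normrX; apply: lerXn2r; rewrite ?nnegrE// ltW.
have h1 : enorm v * enorm v <= s * mom nu v * 2 by rewrite -expr2 enorm2; lra.
have h2 : enorm v <= Num.sqrt (2 * borell_const R) * mom nu v * 2.
  rewrite -(ler_pM2l V0); apply: (le_trans h1); rewrite /s le_eqVlt; apply/orP; left; apply/eqP; ring.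
by rewrite /mom_const mulrC ler_pdivrMr ?mulr_gt0//; apply: (le_trans h2); rewrite le_eqVlt; apply/orP; left; apply/eqP; ring.
Qed.

(** For exponents at least 2 the moment dominates the second one; [pow_sq] is the tangent form of
    this monotonicity, integrated with [E <x,v>^2 = |v|^2]. *)
Lemma mom_lower2 n (nu : probability (borel R n.+2) R) v : lcm nu ->
  (forall v, Int nu (fun x => dotp x v ^+ 2) = dotp v v) -> enorm v ^+ n.+2 <= mom nu v.
Proof.
move=> lc iso; have [->|v0] := eqVneq v 0.
  by rewrite /enorm dotp0l sqrtr0 expr0n mom_ge0.
have vv := dotp_gt0 v0; have V0 : 0 < enorm v by rewrite sqrtr_gt0.
have i2 := ig_sq v lc; have im := ig_mom lc v.
have Vn : 0 < enorm v ^+ n.+2 by rewrite exprn_gt0.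
pose c : R := n.+2%:R / 2.
have := Int_le (igD (ig_cst nu (1 - c)) (igZ (c / dotp v v) i2)) (igZ (enorm v ^+ n.+2)^-1 im).
rewrite (IntD (ig_cst nu (1 - c)) (igZ (c / dotp v v) i2)) Int_cst (IntZ _ i2) (IntZ _ im) iso.
rewrite divfK ?gt_eqF// subrK -/(mom nu v) => H.
rewrite -[leLHS]mulr1 -ler_pdivlMl//; apply: H => x.
have t0 : 0 <= `|dotp x v| / enorm v by rewrite divr_ge0// ltW.
have := pow_sq n t0; rewrite !expr_div_n enorm2 -normrX ger0_norm ?sqr_ge0// [leRHS]mulrC; apply: le_trans.
by rewrite -/c le_eqVlt; apply/orP; left; apply/eqP; field; rewrite gt_eqF.
Qed.

Lemma mom_lower n (nu : probability (borel R n.+1) R) v : lcm nu ->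
  (forall v, Int nu (fun x => dotp x v ^+ 2) = dotp v v) -> (mom_const * enorm v) ^+ n.+1 <= mom nu v.
Proof.
case: n nu v => [|n] nu v lc iso; first by rewrite expr1; exact: mom_lower1.
apply: le_trans (mom_lower2 v lc iso); apply: lerXn2r; rewrite ?nnegrE ?mulr_ge0 ?enorm_ge0 ?(ltW mom_const_gt0)//.
by rewrite ler_piMl ?enorm_ge0// mom_const_le1.
Qed.

End moment_lower.

Section scalar_bounds.
Variable R : realType.

Lemma le_expR (r : R) : r <= expR r.
Proof. by have := expR_ge1Dx r; lra. Qed.

Lemma cosh_ge (p q w : R) : p + q = 2 * w -> 2 * expR w <= expR p + expR q.
Proof.
move=> h; have e1 : expR p = expR w * expR (p - w) by rewrite -expRD; congr expR; ring.
have e2 : expR q = expR w * expR (- (p - w)) by rewrite -expRD; congr expR; lra.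
rewrite e1 e2 -mulrDr mulrC ler_wpM2l ?expR_ge0//.
have := expR_ge1Dx (p - w); have := expR_ge1Dx (- (p - w)); lra.
Qed.

Lemma decay_power n (u s : R) : 0 < s -> 0 <= u ->
  u ^+ n * expR (- n%:R * (u / s)) <= (2 * s) ^+ n.
Proof.
move=> s0 u0; rewrite mulNr expRN expRM_natl ler_pdivrMr ?exprn_gt0 ?expR_gt0// -exprMn.
apply: lerXn2r; rewrite ?nnegrE ?mulr_ge0 ?expR_ge0 ?(ltW s0)//.
have := le_expR (u / s); rewrite ler_pdivrMr// => h.
by apply: (le_trans h); rewrite mulrC ler_wpM2r ?expR_ge0//; lra.
Qed.

Lemma half_power_bound n : 1 + 2 ^+ n.+1 <= 4 ^+ n.+1 :> R.
Proof.
elim: n => [|n ih]; first by rewrite !expr1; lra.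
rewrite [2 ^+ _]exprS [leRHS]exprS; have : 0 < (2 : R) ^+ n.+1 by rewrite exprn_gt0.
lra.
Qed.

Lemma ereal_double (I : \bar R) (c : R) : (0 <= I)%E -> ((c + c)%:E <= I + I)%E -> (c%:E <= I)%E.
Proof. case: I => [i| |] //=; rewrite ?leey// -EFinD !lee_fin; lra. Qed.

Lemma Int_add_half n (f : 'rV[R]_n -> R) (c : R) : (forall x, 0 <= f x) -> ig (leb R n) f ->
  ig (leb R n) (fun x => c * (f x + f (2^-1 *: x))) /\
  Int (leb R n) (fun x => c * (f x + f (2^-1 *: x))) = c * (Int (leb R n) f + 2 ^+ n * Int (leb R n) f).
Proof.
move=> f0 fi; have [ih Ih] := Int_half f0 fi.
by split; [apply: igZ; exact: igD|rewrite (IntZ _ (igD fi ih)) (IntD fi ih) Ih].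
Qed.

Lemma convexs_superlevel n (f : 'rV[R]_n -> R) (t : R) : 0 < t -> lcf f -> (forall x, 0 <= f x) ->
  convexs [set x | t <= f x].
Proof.
move=> t0 lf f0 x y l Lx Ly l01; have /andP[l0 l1] := l01.
rewrite /=; apply: (le_trans _ (lf _ _ _ l01)).
have -> : t = t `^ (1 - l) * t `^ l.
  by rewrite -powRD ?subrK ?powRr1 ?(ltW t0)// oner_eq0.
have mono u z : 0 < u -> t <= z -> t `^ u <= z `^ u.
  move=> u0 tz; apply: ge0_ler_powR => //; [exact: ltW|by rewrite nnegrE ltW|].
  by rewrite nnegrE (le_trans (ltW t0)).
by apply: ler_pM; rewrite ?powR_ge0// mono// subr_gt0.
Qed.

End scalar_bounds.

(** * Moments and level sets of the smoothed density *)

Section smooth_moments.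
Variables (R : realType) (n : nat) (P : probability (borel R n) R) (a : R).
Hypothesis a_gt0 : 0 < a.
Hypothesis eP : evenm P.
Hypothesis lcP : lcm P.
Local Notation g := (smooth P a).

(** Averaging over [x] and [-x] leaves a hyperbolic cosine, which is at least one. *)
Lemma smooth_ge x : expR (- a * dotp x x) * Zf P a <= g x.
Proof.
have i0 := ig_expN P (ltW a_gt0); have i1 := ig_smooth P a_gt0 x; have i2 := ig_smooth P a_gt0 (- x).
have := Int_le (igZ (2 * expR (- a * dotp x x)) i0) (igD i1 i2).
rewrite (IntZ _ i0) (IntD i1 i2) -/(smooth P a x) -/(smooth P a (- x)) smooth_even// => h.
have : 2 * expR (- a * dotp x x) * Zf P a <= g x + g x; last by lra.
apply: h => z; rewrite -mulrA -expRD; apply: cosh_ge.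
by rewrite opprK !(dotpDl, dotpDr, dotpNl, dotpNr) (dotpC x z); ring.
Qed.

(** Symmetric noise cannot lower a convex moment: the contributions of [u] and [-u] are paired by
    [pow_sym]. *)
Lemma gauss_mean z v k :
  ((`|dotp z v| ^+ k * Num.sqrt (pi / a) ^+ n)%:E <=
   \int[leb R n]_x (expR (- a * dotp (z - x) (z - x)) * `|dotp x v| ^+ k)%:E)%E.
Proof.
pose h (u : 'rV[R]_n) := expR (- a * dotp u u) * `|dotp (u + z) v| ^+ k.
have mh : measurable_fun setT (h : borel R n -> R).
  apply: measurable_funM; first exact: measurable_expN.
  apply: measurable_funX; apply: measurableT_comp; first exact: normr_measurable.
  exact: (measurableT_comp (measurable_dotp v) (measurable_add z)).
have h0 u : 0 <= h u by rewrite mulr_ge0 ?expR_ge0 ?exprn_ge0.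
have -> : (\int[leb R n]_x (expR (- a * dotp (z - x) (z - x)) * `|dotp x v| ^+ k)%:E = \int[leb R n]_x (h x)%:E)%E.
  rewrite -(ge0_integral_translation (- z) (f := fun x => (h x)%:E)).
  - by apply: eq_integral => x _; rewrite /h subrK -[z - x]opprB dotpNl dotpNr opprK.
  - exact/measurable_EFinP.
  - by move=> u; rewrite lee_fin.
have [ia Ia] := ig_gauss n a_gt0.
apply: ereal_double; first by apply: integral_ge0 => u _; rewrite lee_fin.
rewrite -{2}(lebN mh h0) -ge0_integralD//; try (by move=> u _; rewrite lee_fin); try exact/measurable_EFinP;
  try (by apply/measurable_EFinP; exact: measurable_oppr_rV).
have -> : `|dotp z v| ^+ k * Num.sqrt (pi / a) ^+ n + `|dotp z v| ^+ k * Num.sqrt (pi / a) ^+ n =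
    2 * `|dotp z v| ^+ k * Num.sqrt (pi / a) ^+ n by ring.
rewrite -Ia -(IntZ _ ia) -(IntE (igZ _ ia)).
apply: ge0_le_integral => //.
- by apply/measurable_EFinP; exact: ig_measurable (igZ _ ia).
- by apply: emeasurable_funD; apply/measurable_EFinP => //; exact: measurable_oppr_rV.
- move=> u _; rewrite -EFinD lee_fin.
  have e1 : dotp (u + z) v = dotp z v + dotp u v by rewrite dotpDl addrC.
  have e2 : dotp (- u + z) v = dotp z v - dotp u v by rewrite dotpDl dotpNl addrC.
  have e3 : dotp (- u) (- u) = dotp u u by rewrite dotpNl dotpNr opprK.
  rewrite /h e1 e2 e3 -mulrDr [leLHS]mulrC; apply: ler_wpM2l; [exact: expR_ge0|exact: pow_sym].
Qed.

Lemma mom_smooth v k : ig (leb R n) (fun x => g x * `|dotp x v| ^+ k) ->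
  Int P (fun x => `|dotp x v| ^+ k) * Num.sqrt (pi / a) ^+ n <= Int (leb R n) (fun x => g x * `|dotp x v| ^+ k).
Proof.
move=> ig1; have ip := ig_pow lcP v k.
have mv : measurable_fun setT (fun x : borel R n => `|dotp x v| ^+ k) by exact: ig_measurable ip.
rewrite -lee_fin -(IntE ig1) smooth_tonelli//.
rewrite mulrC -IntZ// -(IntE (igZ _ ip)).
apply: ge0_le_integral => //.
- by apply/measurable_EFinP; exact: ig_measurable (igZ _ ip).
- apply: (@measurable_fun_fubini_tonelli_F _ _ _ _ _ (leb R n) _ (measurable_gauss_kernel a mv)).
  by move=> z; rewrite lee_fin mulr_ge0 ?expR_ge0 ?exprn_ge0.
- by move=> z _; rewrite mulrC; exact: gauss_mean.
Qed.

Definition level : set 'rV[R]_n := [set x | g 0 * expR (- 4 * n%:R) <= g x].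

(** Up to [2 s] the power is bounded directly; beyond it [lcf_decay] with [k = n] compensates the
    power and leaves [(2 s)^n] times the density at [x / 2]. The two integrals give
    [(2 s)^n (1 + 2^n) <= (8 s)^n]. *)
Lemma mom_level v s : (0 < n)%N -> 0 < s -> (forall x, level x -> dotp x v <= s) ->
  Int P (fun x => `|dotp x v| ^+ n) <= (8 * s) ^+ n.
Proof.
move=> n0 s0 Ls; have [iS IS] := Int_smooth P a_gt0.
have g0 x : 0 <= g x by apply/ltW/smooth_gt0.
have pw x : g x * `|dotp x v| ^+ n <= (2 * s) ^+ n * (g x + g (2^-1 *: x)).
  have [h|h] := leP `|dotp x v| (2 * s).
    rewrite mulrC; apply: ler_pM; rewrite ?exprn_ge0//; last by rewrite lerDl.
    by apply: lerXn2r; rewrite ?nnegrE ?mulr_ge0// ltW.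
  have dec : g x <= g (2^-1 *: x) * expR (- n%:R * (`|dotp x v| / s)).
    have D w : 2 * s < dotp w v -> g w <= g (2^-1 *: w) * expR (- n%:R * (dotp w v / s)).
      by apply: lcf_decay => //; [exact: lcf_smooth|exact: smooth_gt0].
    move: h; have [xv|xv] := ger0P (dotp x v); first by move=> h; exact: D.
    move=> h; have := D (- x); rewrite dotpNl scalerN !smooth_even//; exact.
  have := ler_wpM2r (exprn_ge0 n (normr_ge0 (dotp x v))) dec => /le_trans; apply.
  rewrite -mulrA mulrC; apply: ler_pM; rewrite ?mulr_ge0 ?exprn_ge0 ?expR_ge0//; last by rewrite lerDr.
  by rewrite mulrC; exact: decay_power.
have i1 : ig (leb R n) (fun x => g x * `|dotp x v| ^+ n).
  have [i2 _] := Int_add_half ((2 * s) ^+ n) g0 iS.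
  apply: (ig_le0 _ _ i2).
    apply: measurable_funM; first exact: measurable_smooth.
    by apply: measurable_funX; apply: measurableT_comp; [exact: normr_measurable|exact: measurable_dotp].
  by move=> x; rewrite mulr_ge0 ?exprn_ge0//=.
have E : Int (leb R n) (fun x => (2 * s) ^+ n * (g x + g (2^-1 *: x))) =
    (2 * s) ^+ n * (Num.sqrt (pi / a) ^+ n + 2 ^+ n * Num.sqrt (pi / a) ^+ n).
  by have [_ ->] := Int_add_half ((2 * s) ^+ n) g0 iS; rewrite IS.
have [i2 _] := Int_add_half ((2 * s) ^+ n) g0 iS.
have h := Int_le i1 i2 pw; rewrite E in h.
have p0 : 0 < Num.sqrt (pi / a) ^+ n by rewrite exprn_gt0// sqrtr_gt0 divr_gt0// pi_gt0.
have := le_trans (mom_smooth i1) h.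
rewrite -[X in _ * (X + _)]mul1r -mulrDl mulrA ler_pM2r// => /le_trans; apply.
have -> : 8 * s = (2 * s) * 4 by ring.
rewrite [leRHS]exprMn ler_wpM2l ?exprn_ge0 ?mulr_ge0 ?(ltW s0)//.
by move: n0; case: (n) => // n' _; exact: half_power_bound.
Qed.

(** By [smooth_ge] the level set contains the ball of radius [2 sqrt (n / a)], since
    [e^(-a |x|^2) >= e^(-4n)] there. Noise at the smoothing scale can therefore be measured against
    the level set. *)
Lemma level_dir v : v != 0 -> exists x, level x /\ dotp x v = 2 * Num.sqrt (n%:R / a) * enorm v.
Proof.
move=> v0; have V0 : 0 < enorm v by rewrite sqrtr_gt0 dotp_gt0.
pose c := 2 * Num.sqrt (n%:R / a) / enorm v.
exists (c *: v); split; last by rewrite dotpZl -enorm2 /c; field; rewrite gt_eqF.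
rewrite /level /= mulrC smooth0; apply: le_trans (smooth_ge _).
rewrite dotpZl dotpZr -enorm2 (_ : - a * _ = - 4 * n%:R)//.
have : Num.sqrt (n%:R / a) ^+ 2 = n%:R / a by rewrite sqr_sqrtr// divr_ge0// ltW.
rewrite /c; move: (Num.sqrt _) => r r2.
have -> : - a * (2 * r / enorm v * (2 * r / enorm v * enorm v ^+ 2)) = - a * (4 * r ^+ 2) by field; rewrite gt_eqF.
by rewrite r2; field; rewrite gt_eqF.
Qed.

Lemma level0 : level 0.
Proof.
rewrite /level /= -[leRHS]mulr1; apply: ler_wpM2l; first exact/ltW/smooth_gt0.
by rewrite -[leRHS]expR0 ler_expR mulNr oppr_le0 mulr_ge0.
Qed.

Lemma closed_level : closed level.
Proof.
apply: (@preimage_closed _ _ g [set r | g 0 * expR (- 4 * n%:R) <= r]); last exact: closed_ge.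
by move=> x _; exact: continuous_smooth.
Qed.

Lemma convexs_level : convexs level.
Proof.
apply: (convexs_superlevel (f := g)); [|by apply: lcf_smooth|by move=> x; exact/ltW/smooth_gt0].
by rewrite mulr_gt0 ?expR_gt0// smooth_gt0.
Qed.

Lemma leb_level : (leb R n level <= ((expR 4 * Num.sqrt (pi / a)) ^+ n / Zf P a)%:E)%E.
Proof.
have t0 : 0 < g 0 * expR (- 4 * n%:R) by rewrite mulr_gt0 ?expR_gt0 ?smooth_gt0.
have [iS IS] := Int_smooth P a_gt0.
have := superlevel_volume t0 (fun x => ltW (smooth_gt0 P a_gt0 x)) iS.
move/le_trans; apply; rewrite lee_fin IS smooth0 invfM -expRN.
have -> : - (- 4 * n%:R) = n%:R * 4 :> R by ring.
by rewrite expRM_natl exprMn le_eqVlt; apply/orP; left; apply/eqP; ring.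
Qed.

End smooth_moments.

Lemma exprD_le (R : realType) k (x y : R) : 0 <= x -> 0 <= y -> x ^+ k.+1 + y ^+ k.+1 <= (x + y) ^+ k.+1.
Proof.
move=> x0 y0; elim: k => [|k ih]; first by rewrite !expr1.
rewrite ![_ ^+ k.+2]exprS; apply: le_trans (ler_wpM2l (addr_ge0 x0 y0) ih).
have p1 : 0 <= x * y ^+ k.+1 by rewrite mulr_ge0// exprn_ge0.
have p2 : 0 <= y * x ^+ k.+1 by rewrite mulr_ge0// exprn_ge0.
rewrite mulrDl !mulrDr; lra.
Qed.

Section centroid_volume.
Variables (R : realType) (n l : nat) (P Q : probability (borel R n.+1) R) (a cg : R).
Variables (S : 'M[R]_n.+1) (W : 'M[R]_(n.+1, l)).
Hypothesis a_gt0 : 0 < a.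
Hypothesis cg_ge0 : 0 <= cg.
Hypothesis lcP : lcm P.
Hypothesis eP : evenm P.
Hypothesis uS : S \in unitmx.
Hypothesis dS : `|\det S| <= 1.
Hypothesis hW : forall y, Num.sqrt a * enorm (y *m W) <= 2 * enorm (y *m S).
Hypothesis hQ : forall y, mom Q y <= 2 ^+ n.+1 * (mom P (y *m S) + (cg * Num.sqrt n.+1%:R * enorm (y *m W)) ^+ n.+1).

Let C3 := 2 * (8 + cg).

Let C3_gt0 : 0 < C3. Proof. by rewrite mulr_gt0// ltr_wpDr. Qed.

Let hcb_le s y : 0 < s -> (forall x, level P a x -> dotp x (y *m S) <= s) -> hcb Q y <= C3 * s.
Proof.
move=> s0 Ls.
(* The level set reaches [2 sqrt ((n + 1) / a) |y S|] in the direction of [y S], which bounds [s]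
   from below, and [hW] puts [|y W|] under that scale. *)
have noise : Num.sqrt n.+1%:R * enorm (y *m W) <= s.
  have [v0|v0] := eqVneq (y *m S) 0.
    have e0 : enorm (0 : 'rV[R]_n.+1) = 0 by rewrite /enorm dotp0l sqrtr0.
    have := hW y; rewrite v0 e0 mulr0 pmulr_rle0 ?sqrtr_gt0// => h.
    have -> : enorm (y *m W) = 0 by apply/eqP; rewrite eq_le h enorm_ge0.
    by rewrite mulr0 ltW.
  have [x [Lx xv]] := level_dir a_gt0 eP v0.
  have := Ls x Lx; rewrite xv sqrtrM// sqrtrV ?(ltW a_gt0)//; apply: le_trans.
  have sa : 0 < Num.sqrt a by rewrite sqrtr_gt0.
  have -> : 2 * (Num.sqrt n.+1%:R / Num.sqrt a) * enorm (y *m S) = Num.sqrt n.+1%:R * (2 * enorm (y *m S) / Num.sqrt a).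
    by field; rewrite gt_eqF.
  by rewrite ler_wpM2l ?sqrtr_ge0// ler_pdivlMr// mulrC hW.
have m1 : mom P (y *m S) <= (8 * s) ^+ n.+1 by exact: (mom_level a_gt0 eP lcP (ltn0Sn n) s0 Ls).
have m2 : (cg * Num.sqrt n.+1%:R * enorm (y *m W)) ^+ n.+1 <= (cg * s) ^+ n.+1.
  apply: lerXn2r; rewrite ?nnegrE ?mulr_ge0 ?sqrtr_ge0 ?enorm_ge0 ?(ltW s0)//.
  by rewrite -mulrA ler_wpM2l.
apply: root_le; [by rewrite mulr_ge0// ltW|exact: mom_ge0|].
apply: (le_trans (hQ y)).
have -> : (C3 * s) ^+ n.+1 = 2 ^+ n.+1 * (8 * s + cg * s) ^+ n.+1.
  by rewrite -exprMn; congr (_ ^+ _); rewrite /C3; ring.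
apply: ler_wpM2l; first exact: exprn_ge0.
by apply: (le_trans (lerD m1 m2)); apply: exprD_le; rewrite mulr_ge0//; exact: ltW.
Qed.

(* The dual norm of [Q] in direction [y] is at most a multiple of the support function of
   the level set of the smoothed density at [y *m S], because the noise coming from [W]
   is no larger than the Gaussian scale of the smoothing. *)
Lemma centroid_volume :
  (leb R n.+1 (cbody Q) <= ((2 * (8 + cg) * expR 4 * Num.sqrt (pi / a)) ^+ n.+1 / Zf P a)%:E)%E.
Proof.
have uST : C3 *: S^T \in unitmx by rewrite unitmxZ ?unitfE ?gt_eqF// unitmx_tr.
have mL : measurable (level P a : set (borel R n.+1)).
  by apply: measurable_closed_rV; exact: closed_level.
have [mI E] := leb_affine 0 uST mL.
have sub : cbody Q `<=` [set 0 + u *m (C3 *: S^T) | u in level P a].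
  move=> x cx; pose x' := x *m invmx (C3 *: S^T).
  exists x'; last by rewrite add0r mulmxKV.
  apply: contrapT => nLx.
  have [v [al [La ax]]] := separation (closed_level (P := P) a_gt0) (convexs_level a_gt0 lcP) (ex_intro _ 0 (level0 P a_gt0)) nLx.
  have a0 : 0 <= al by have := La 0 (level0 P a_gt0); rewrite dotp0l.
  pose s := (al + dotp x' v) / 2.
  have s0 : 0 < s by rewrite divr_gt0// ltr_wpDl// (le_lt_trans a0).
  have as_ : al <= s by rewrite /s; lra.
  have sx : s < dotp x' v by rewrite /s; lra.
  pose y := v *m invmx S.
  have yS : y *m S = v by rewrite mulmxKV.
  have h := @hcb_le s y s0; rewrite yS in h.
  have {}h := h (fun z Lz => le_trans (La z Lz) as_).
  have := le_trans (cx y) h; apply/negP; rewrite -ltNge.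
  have -> : x = x' *m (C3 *: S^T) by rewrite mulmxKV.
  rewrite -scalemxAr dotpZl ltr_pM2l//.
  have -> : dotp (x' *m S^T) y = dotp x' v by rewrite dotp_mulmx trmxK yS.
  exact: sx.
have mc : measurable (cbody Q : set (borel R n.+1)).
  by apply: measurable_compact_rV; exact: compact_cbody.
apply: (@le_trans _ _ (leb R n.+1 [set 0 + u *m (C3 *: S^T) | u in level P a])).
  by apply: le_measure; rewrite ?inE.
rewrite E detZ det_tr normrM normrX gtr0_norm//.
apply: (@le_trans _ _ ((C3 ^+ n.+1)%:E * ((expR 4 * Num.sqrt (pi / a)) ^+ n.+1 / Zf P a)%:E)%E).
  apply: lee_pmul => //.
  - by rewrite lee_fin mulr_ge0// exprn_ge0// ltW.
  - by rewrite lee_fin ger_pMr// exprn_gt0.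
  - exact: leb_level.
by rewrite -EFinM lee_fin -/C3 -mulrA [in leRHS]exprMn mulrA.
Qed.

End centroid_volume.

(** * Subspaces and marginals *)

Section grassmannian.
Variable R : realType.

(** The basis is selected by [get]; existence through [gram_schmidt] rules out the default value. *)
Lemma orthonormal_basisP n (F : {vspace 'rV[R]_n}) : orthonormal_basis_of (orthonormal_basis F).
Proof.
apply: (@getPex _ (@orthonormal_basis_of R n F)).
have /gram_schmidt[Y [sY oY tY]] : free (vbasis F) by exact: basis_free (vbasisP F).
have sF : size Y = \dim F by rewrite sY size_tuple.
have spY : <<Y>>%VS = F.
  by have := tY (size Y); rewrite take_size sY take_size => ->; exact: span_basis (vbasisP F).
exists (tcast sF (in_tuple Y)); split.
  rewrite basisEdim /= val_tcast spY subvv /=.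
  by rewrite sF.
by move=> i j; rewrite !(tnth_nth 0) val_tcast oY ?sF.
Qed.

Definition deltas n : seq 'rV[R]_n := [seq delta_mx 0 i | i <- enum 'I_n].

Lemma size_deltas n : size (deltas n) = n.
Proof. by rewrite size_map size_enum_ord. Qed.

Definition coord_space n k : {vspace 'rV[R]_n} := <<take k (deltas n)>>%VS.

Lemma nth_deltas n (i : nat) (ni : (i < n)%N) :
  (deltas n)`_i = delta_mx 0 (Ordinal ni) :> 'rV[R]_n.
Proof.
rewrite /deltas (nth_map (Ordinal ni)) ?size_enum_ord//; congr (delta_mx _ _).
by apply: val_inj; rewrite /= nth_enum_ord.
Qed.

Lemma dim_coord_space n k : (k <= n)%N -> \dim (coord_space n k) = k.
Proof.
move=> kn.
have sk : size (take k (deltas n)) = k.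
  by rewrite size_takel// size_deltas.
have fr : free (take k (deltas n)).
  apply: orthonormal_free => i j; rewrite sk => ik jk.
  rewrite !nth_take// (nth_deltas (leq_trans ik kn)) (nth_deltas (leq_trans jk kn)) dotp_delta mxE /=.
  by rewrite eq_sym.
by rewrite -[RHS]sk; apply/eqP; rewrite -[_ == _]/(free _) fr.
Qed.

(** A basis of [F] followed by one of a complement is orthonormalised into the rows of [U]; as
    [gram_schmidt] keeps the spans of prefixes, the first coordinates are sent onto [F]. *)
Lemma grass_transport n (F : {vspace 'rV[R]_n}) :
  exists2 U : 'M[R]_n, U *m U^T = 1%:M & (linfun (mulmxr U) @: coord_space n (\dim F))%VS = F.
Proof.
pose X := vbasis F ++ vbasis (F^C)%VS.
have sX : size X = n.
  rewrite size_cat !size_tuple dimv_compl subnKC; first by rewrite dimvf /dim /= mul1n.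
  exact/dimvS/subvf.
have fX : free X.
  rewrite cat_free !(basis_free (vbasisP _)) !(span_basis (vbasisP _)) /=.
  by apply/directv_addP; exact: capv_compl.
have [Y [sY oY tY]] := gram_schmidt fX; rewrite sX in sY.
pose U : 'M[R]_n := \matrix_i Y`_i.
have UE i (ni : (i < n)%N) : delta_mx 0 (Ordinal ni) *m U = Y`_i by rewrite -rowE rowK.
exists U.
  apply/matrixP => i j; rewrite !mxE.
  transitivity (dotp (Y`_i) (Y`_j)); first by apply: eq_bigr => q _; rewrite !mxE.
  by rewrite oY ?sY.
rewrite limg_span map_take.
have -> : [seq linfun (mulmxr U) i | i <- deltas n] = Y.
  apply: (@eq_from_nth _ 0); first by rewrite size_map size_deltas sY.
  move=> i; rewrite size_map size_deltas => ni.
  by rewrite (nth_map 0) ?size_deltas// (nth_deltas ni) lfunE /= UE.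
rewrite tY take_size_cat ?size_tuple//; exact: span_basis (vbasisP F).
Qed.

Lemma op_norm_ub n (U : 'M[R]_n) : U *m U^T = 1%:M ->
  has_ubound [set enorm (x *m (1%:M - U)) | x in [set x : 'rV[R]_n | enorm x <= 1]].
Proof.
move=> UU; exists 2 => _ [z /= z1 <-]; rewrite mulmxBr mulmx1.
apply: (le_trans (enormD _ _)); rewrite enormN {2}/enorm (dotp_orth _ _ UU) -/(enorm z).
by rewrite (_ : 2 = 1 + 1)// lerD.
Qed.

Lemma op_normP n (U : 'M[R]_n) (x : 'rV[R]_n) : U *m U^T = 1%:M -> enorm (x - x *m U) <= op_norm (1%:M - U) * enorm x.
Proof.
move=> UU; have [->|x0] := eqVneq x 0.
  by rewrite mul0mx subr0 /enorm dotp0l sqrtr0 mulr0.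
have V0 : 0 < enorm x by rewrite sqrtr_gt0 dotp_gt0.
rewrite -ler_pdivrMr//.
have e1 : enorm ((enorm x)^-1 *: x) = 1 by rewrite enormZ gtr0_norm ?invr_gt0// mulVf// gt_eqF.
have -> : enorm (x - x *m U) / enorm x = enorm (((enorm x)^-1 *: x) *m (1%:M - U)).
  by rewrite mulmxBr mulmx1 -scalemxAl -scalerBr enormZ gtr0_norm ?invr_gt0// mulrC.
apply: ub_le_sup; last by exists ((enorm x)^-1 *: x) => //=; rewrite e1.
exact: op_norm_ub.
Qed.

(* [grass_dist] is the infimum of a set that is nonempty by [grass_transport]; without
   that the value [inf set0 = 0] would carry no information. *)
Lemma grass_close k l (F : {vspace 'rV[R]_(k + l)}) (eps : R) : \dim F = k ->
  grass_dist (coord_space (k + l) k) F < eps ->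
  forall v, v \in F -> enorm (rsubmx v) <= eps * enorm v.
Proof.
move=> dF dist v vF.
have e0 p : enorm (0 : 'rV[R]_p) = 0 by rewrite /enorm dotp0l sqrtr0.
have op0 (U : 'M[R]_(k + l)) : U *m U^T = 1%:M -> 0 <= op_norm (1%:M - U).
  move=> UU; apply: ub_le_sup; first exact: op_norm_ub.
  by exists 0; rewrite /= ?mul0mx e0.
have [U0 UU0 F0] := grass_transport F; rewrite dF in F0.
have hi : has_inf [set op_norm (1%:M - U) | U in
        [set U | orthogonal_group U /\ (linfun (mulmxr U) @: coord_space (k + l) k)%VS = F]].
  split; first by exists (op_norm (1%:M - U0)); exists U0.
  by exists 0 => _ [U [UU _] <-]; exact: op0.
have [|_ [U [UU FU] <-] Ueps] := inf_adherent (_ : 0 < eps - grass_dist (coord_space (k + l) k) F) hi.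
  by rewrite subr_gt0.
have {}Ueps : op_norm (1%:M - U) < eps by move: Ueps; rewrite /grass_dist [X in _ < X]addrC subrK.
move: vF; rewrite -FU => /memv_imgP[e eE ->]; rewrite lfunE /=.
have re : rsubmx e = 0.
  pose f := linfun (mulmxr (col_mx 0 1%:M : 'M[R]_(k + l, l))) : 'Hom('rV[R]_(k + l), 'rV[R]_l).
  have : (coord_space (k + l) k <= lker f)%VS.
    apply/span_subvP => w /(nthP 0)[i]; rewrite size_takel ?size_deltas ?leq_addr// => ik <-.
    rewrite nth_take// (nth_deltas (ltn_addr l ik)) memv_ker lfunE /=.
    apply/eqP/rowP => j; rewrite -rowE !mxE; case: fintype.splitP => [j' _|j' /= e']; first by rewrite mxE.
    by move: ik; rewrite e' ltnNge leq_addr.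
  move/subvP/(_ e eE); rewrite memv_ker lfunE /= => /eqP.
  by rewrite -[e]hsubmxK mul_row_col mulmx0 mulmx1 add0r row_mxKr.
have -> : rsubmx (e *m U) = - rsubmx (e - e *m U).
  by rewrite linearB /= re sub0r opprK.
rewrite enormN.
have : enorm (rsubmx (e - e *m U)) <= enorm (e - e *m U).
  rewrite /enorm ler_sqrt ?dotp_ge0// -[e - e *m U in leRHS]hsubmxK dotp_row_mx lerDr; exact: dotp_ge0.
move/le_trans; apply; apply: (le_trans (op_normP _ UU)).
have -> : enorm (e *m U) = enorm e by rewrite /enorm (dotp_orth _ _ UU).
by rewrite ler_wpM2r ?enorm_ge0// ltW.
Qed.

Definition frame n (F : {vspace 'rV[R]_n}) : 'M[R]_(\dim F, n) := \matrix_i tnth (orthonormal_basis F) i.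

Lemma frame_orth n (F : {vspace 'rV[R]_n}) : frame F *m (frame F)^T = 1%:M.
Proof.
have [_ o] := orthonormal_basisP F.
apply/matrixP => i j; rewrite !mxE -o.
by apply: eq_bigr => q _; rewrite !mxE.
Qed.

Lemma frame_mem n (F : {vspace 'rV[R]_n}) y : y *m frame F \in F.
Proof.
have [bF _] := orthonormal_basisP F.
rewrite mulmx_sum_row; apply: memv_suml => i _.
by apply: memvZ; rewrite rowK; exact: basis_mem bF (mem_tnth _ _).
Qed.

Lemma proj_coordsE n (F : {vspace 'rV[R]_n}) (x : 'rV[R]_n) : proj_coords F x = x *m (frame F)^T.
Proof.
have [_ o] := orthonormal_basisP F.
have E z i : (z *m (frame F)^T) 0 i = dotp z (tnth (orthonormal_basis F) i).
  by rewrite mxE; apply: eq_bigr => q _; rewrite !mxE.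
have ds (I : finType) (f : I -> 'rV[R]_n) w : dotp (\sum_i f i) w = \sum_i dotp (f i) w.
  by elim/big_rec2: _ => [|i y1 y2 _ <-]; rewrite ?dotp0l ?dotpDl.
apply/rowP => i; rewrite E mxE /orth_proj ds (bigD1 i)//= dotpZl o eqxx mulr1 big1 ?addr0// => j ji.
by rewrite dotpZl o (negbTE ji) mulr0.
Qed.

End grassmannian.

Lemma sqrt_ge2 (R : realType) (a : R) : 2 <= a -> 2 <= Num.sqrt (2 * a).
Proof.
move=> a2; have e : Num.sqrt (2 ^+ 2) = 2 :> R by rewrite sqrtr_sqr ger0_norm.
by rewrite -[leLHS]e ler_sqrt; lra.
Qed.

(** * Isotropic constants of marginals *)

Section isotropic_const.
Variables (R : realType) (n : nat) (Q : probability (borel R n.+1) R).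
Hypothesis lcQ : lcm Q.
Hypothesis sqQ : forall v, Int Q (fun x => dotp x v ^+ 2) = dotp v v.

Lemma isotropic_constantE : isotropic_constant Q = fine (leb R n.+1 (cbody Q)) `^ (- n.+1%:R^-1).
Proof. by rewrite /isotropic_constant centroid_bodyE// volumeE. Qed.

Lemma measurable_cbody : measurable (cbody Q : set (borel R n.+1)).
Proof. by apply: measurable_compact_rV; exact: compact_cbody. Qed.

(** The body contains a ball of radius [mom_const]. With zero volume the negative power would take
    the value 0 and the isotropic constant would carry no information. *)
Lemma leb_cbody_gt0 : (0 < leb R n.+1 (cbody Q))%E.
Proof.
have /andP[B0 _] := leb_ball_gt0 n.+1 (mom_const_gt0 R).
apply: (lt_le_trans B0); apply: le_measure; rewrite ?inE//.
- by apply: measurable_compact_rV; exact: compact_ball.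
- exact: measurable_cbody.
move=> x /= xc y; apply: (le_trans (ler_norm _)); apply: (le_trans (CSe x y)).
apply: (@le_trans _ _ (mom_const R * enorm y)); first by rewrite ler_wpM2r ?enorm_ge0.
apply: le_root; [by rewrite mulr_ge0 ?enorm_ge0// ltW// mom_const_gt0|exact: mom_ge0|exact: mom_lower].
Qed.

Lemma isotropic_constant_volume (V : R) : 0 <= V -> (leb R n.+1 (cbody Q) <= V%:E)%E ->
  forall c, isotropic_constant Q < c -> 1 <= V * c ^+ n.+1.
Proof.
move=> V0 QV c; rewrite isotropic_constantE.
have L0 := leb_cbody_gt0.
have Lf : leb R n.+1 (cbody Q) \is a fin_num by rewrite ge0_fin_numE// (le_lt_trans QV)// ltry.
rewrite -(fineK Lf) lte_fin in L0; rewrite -(fineK Lf) lee_fin in QV.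
move: L0 QV; set v := fine _ => v0 vV vc.
have r0 : 0 < v `^ (- n.+1%:R^-1) by rewrite powR_gt0.
have c0 : 0 < c by exact: lt_trans vc.
have e : (v `^ (- n.+1%:R^-1)) ^+ n.+1 = v^-1.
  by rewrite -powR_mulrn ?powR_ge0// -powRrM mulNr mulVf// powRN powRr1// ltW.
have h : v^-1 <= c ^+ n.+1 by rewrite -e; apply: lerXn2r; rewrite ?nnegrE ?ltW.
apply: (@le_trans _ _ (v * v^-1)); first by rewrite mulfV// gt_eqF.
by apply: ler_pM => //; [exact: ltW|rewrite invr_ge0 ltW].
Qed.

End isotropic_const.

Section near_coordinate_marginal.
Variables (R : realType) (n l d : nat) (a cg c : R).
Variables (P : probability (borel R n.+1) R) (G : probability (borel R l) R).
Variables (nu : probability (borel R (n.+1 + l)) R) (Q : probability (borel R d) R) (B : 'M[R]_(d, n.+1 + l)).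
Hypothesis a_ge2 : 2 <= a.
Hypothesis cg_ge0 : 0 <= cg.
Hypothesis CP : Cm P.
Hypothesis Cnu : Cm nu.
Hypothesis lcG : lcm G.
Hypothesis noise : forall w, Int G (fun x => `|dotp x w| ^+ n.+1) <= (cg * Num.sqrt n.+1%:R * enorm w) ^+ n.+1.
Hypothesis nuE : forall h : 'rV[R]_(n.+1 + l) -> \bar R, measurable_fun setT (h : borel R (n.+1 + l) -> \bar R) ->
  (forall x, 0 <= h x)%E -> (\int[nu]_x h x = \int[P]_x \int[G]_y h (row_mx x y))%E.
Hypothesis BB : B *m B^T = 1%:M.
Hypothesis hB : forall y, enorm (rsubmx (y *m B)) <= (Num.sqrt (2 * a))^-1 * enorm (y *m B).
Hypothesis lawQ : law_of nu (fun x => x *m B^T) Q.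
Hypothesis lcQ : lcm Q.
Hypothesis Qc : isotropic_constant Q < c.

(** In the frame [B = (S, W)] of the subspace the marginal is the law of [X S^T + G W^T]. Closeness
    to the coordinate space makes [W] small, hence [S] invertible and the noise no larger than the
    smoothing scale, so [centroid_volume] applies. The dimension [d] is a variable because that of a
    subspace equals [n + 1] only by a proof. *)
Lemma near_coordinate_marginal : d = n.+1 ->
  Zf P a <= (2 * (8 + cg) * expR 4 * Num.sqrt (pi / a) * c) ^+ n.+1.
Proof.
move=> dn; subst d.
have a0 : 0 < a by exact: lt_le_trans a_ge2.
have [lcP eP sqP] := CP; have [lcnu enu sqnu] := Cnu.
pose S := lsubmx B; pose W := rsubmx B.
have yB (y : 'rV[R]_n.+1) : y *m B = row_mx (y *m S) (y *m W) by rewrite -[B in LHS]hsubmxK mul_mx_row.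
have nB (y : 'rV[R]_n.+1) : enorm (y *m B) = enorm y by rewrite /enorm (dotp_orth _ _ BB).
have sq y : dotp y y = dotp (y *m S) (y *m S) + dotp (y *m W) (y *m W).
  by rewrite -(dotp_orth y y BB) yB dotp_row_mx.
have hW' y : enorm (y *m W) <= (Num.sqrt (2 * a))^-1 * enorm y.
  by have := hB y; rewrite nB yB row_mxKr.
have s2 : 2 <= Num.sqrt (2 * a).
  exact: sqrt_ge2.
have s20 : 0 < Num.sqrt (2 * a) by exact: lt_le_trans s2.
have hWh y : enorm (y *m W) <= 2^-1 * enorm y.
  apply: (le_trans (hW' y)); rewrite ler_wpM2r ?enorm_ge0// lef_pV2 ?posrE//.
have hS y : enorm y <= 2 * enorm (y *m S).
  have w2 : dotp (y *m W) (y *m W) <= 4^-1 * dotp y y.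
    rewrite -!enorm2; have := hWh y => h; have := ler_pM (enorm_ge0 _) (enorm_ge0 _) h h.
    rewrite -!expr2 exprMn; lra.
  rewrite -(@ler_pXn2r _ 2) ?nnegrE ?mulr_ge0 ?enorm_ge0// exprMn !enorm2.
  have := sq y; have := dotp_ge0 (y *m S); lra.
have S1 y : enorm (y *m S) <= enorm y.
  by rewrite /enorm ler_sqrt ?dotp_ge0// [leRHS]sq lerDl dotp_ge0.
have uS : S \in unitmx.
  rewrite -row_free_unit; apply: inj_row_free => y yS0.
  apply/eqP; apply: contraT => y0; have := hS y; rewrite yS0.
  have -> : enorm (0 : 'rV[R]_n.+1) = 0 by rewrite /enorm dotp0l sqrtr0.
  by rewrite mulr0 leNgt sqrtr_gt0 dotp_gt0.
have mball : measurable ([set x : 'rV[R]_n.+1 | enorm x <= 1] : set (borel R n.+1)).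
  by apply: measurable_compact_rV; exact: compact_ball.
(* [S] is a contraction, so it maps the unit ball into itself and cannot increase volume. *)
have dS : `|\det S| <= 1.
  have [mI E] := leb_affine 0 uS mball.
  have /andP[B0 B1] := leb_ball_gt0 n.+1 (@ltr01 R).
  have : (leb R n.+1 [set (0 + u *m S)%R | u in [set x : 'rV[R]_n.+1 | (enorm x <= 1)%R]] <=
     leb R n.+1 [set x : 'rV[R]_n.+1 | (enorm x <= 1)%R])%E.
    apply: le_measure; rewrite ?inE// => _ [u /= u1 <-] /=.
    by rewrite add0r; exact: le_trans (S1 u) u1.
  rewrite E -[X in (_ <= X)%E]mul1e lee_pmul2r// ge0_fin_numE//.
have hW y : Num.sqrt a * enorm (y *m W) <= 2 * enorm (y *m S).
  apply: le_trans (hS y); apply: (le_trans (ler_wpM2l (sqrtr_ge0 a) (hW' y))).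
  rewrite mulrA ler_piMl ?enorm_ge0// ler_pdivrMr// mul1r ler_sqrt ?mulr_ge0 ?(ltW a0)//.
  by rewrite ler_peMl ?(ltW a0)// ler1n.
have mQ (h : 'rV[R]_n.+1 -> R) : measurable_fun setT (h : borel R n.+1 -> R) -> (forall x, 0 <= h x) ->
    Int Q h = Int nu (fun x => h (x *m B^T)).
  by move=> mh h0; apply: (law_of_Int (measurable_lin _) lawQ).
have mabs p (y : 'rV[R]_p) k : measurable_fun setT (fun x : borel R p => `|dotp x y| ^+ k).
  by apply: measurable_funX; apply: measurableT_comp; [exact: normr_measurable|exact: measurable_dotp].
have sqQ v : Int Q (fun x => dotp x v ^+ 2) = dotp v v.
  rewrite mQ; [|exact: measurable_dotpX|by move=> x; exact: sqr_ge0].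
  under eq_Int do rewrite dotp_mulmx trmxK.
  by rewrite sqnu (dotp_orth _ _ BB).
have hQ y : mom Q y <= 2 ^+ n.+1 * (mom P (y *m S) + (cg * Num.sqrt n.+1%:R * enorm (y *m W)) ^+ n.+1).
  have -> : mom Q y = Int nu (fun x => `|dotp x (y *m B)| ^+ n.+1).
    rewrite /mom mQ; [|exact: mabs|by move=> x; exact: exprn_ge0].
    by apply: eq_Int => x; rewrite dotp_mulmx trmxK.
  rewrite -lee_fin -IntE; last exact: ig_pow.
  rewrite (nuE (h := fun x => (`|dotp x (y *m B)| ^+ n.+1)%:E)); last 2 first.
  - by apply/measurable_EFinP; exact: mabs.
  - by move=> x; rewrite lee_fin exprn_ge0.
  have iP := ig_pow lcP (y *m S) n.+1; have iG := ig_pow lcG (y *m W) n.+1.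
  pose b := (cg * Num.sqrt n.+1%:R * enorm (y *m W)) ^+ n.+1.
  have i2 : ig P (fun x => 2 ^+ n.+1 * (`|dotp x (y *m S)| ^+ n.+1 + b)).
    by apply: igZ; apply: igD => //; exact: ig_cst.
  have -> : 2 ^+ n.+1 * (mom P (y *m S) + b) = Int P (fun x => 2 ^+ n.+1 * (`|dotp x (y *m S)| ^+ n.+1 + b)).
    rewrite IntZ; last by apply: igD => //; exact: ig_cst.
    by rewrite (IntD iP (ig_cst P b)) Int_cst.
  rewrite -(IntE i2).
  have inner x : (\int[G]_z (`|dotp (row_mx x z) (y *m B)| ^+ n.+1)%:E <= (2 ^+ n.+1 * (`|dotp x (y *m S)| ^+ n.+1 + b))%:E)%E.
    have iz : ig G (fun z => `|dotp (row_mx x z) (y *m B)| ^+ n.+1).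
      apply: (ig_le0 _ _ (igZ (2 ^+ n.+1) (igD (ig_cst G (`|dotp x (y *m S)| ^+ n.+1)) iG))).
        have -> : (fun z : borel R l => `|dotp (row_mx x z) (y *m B)| ^+ n.+1) = (fun z : borel R l => `|dotp x (y *m S) + dotp z (y *m W)| ^+ n.+1).
          by apply/funext => z; rewrite yB dotp_row_mx.
        apply: measurable_funX; apply: measurableT_comp; first exact: normr_measurable.
        by apply: measurable_funD => //; exact: measurable_dotp.
      by move=> z; rewrite exprn_ge0//= yB dotp_row_mx pow_add.
    rewrite (IntE iz) lee_fin.
    apply: le_trans (Int_le iz (igZ (2 ^+ n.+1) (igD (ig_cst G (`|dotp x (y *m S)| ^+ n.+1)) iG)) _) _.
      by move=> z; rewrite yB dotp_row_mx pow_add.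
    rewrite IntZ; last by apply: igD => //; exact: ig_cst.
    rewrite (IntD (ig_cst G _) iG) Int_cst ler_wpM2l ?exprn_ge0// lerD2l; exact: noise.
  apply: ge0_le_integral => //.
  - by move=> x _; apply: integral_ge0 => z _; rewrite lee_fin exprn_ge0.
  - pose F (z : borel R n.+1 * borel R l) := (`|dotp (row_mx (z.1 : 'rV[R]_n.+1) (z.2 : 'rV[R]_l)) (y *m B)| ^+ n.+1)%:E.
    apply: (@measurable_fun_fubini_tonelli_F _ _ _ _ _ G F).
      apply/measurable_EFinP; have := measurableT_comp (mabs _ (y *m B) n.+1) (@measurable_rowp R n.+1 l).
      by apply: eq_measurable_fun.
    by move=> z; rewrite lee_fin exprn_ge0.
  - by apply/measurable_EFinP; exact: ig_measurable i2.
have V := centroid_volume a0 cg_ge0 lcP eP uS dS hW hQ.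
have Z0 := Zf_gt0 P (ltW a0).
have c8 : 0 <= 2 * (8 + cg) * expR 4 * Num.sqrt (pi / a).
  by rewrite !mulr_ge0 ?expR_ge0 ?sqrtr_ge0 ?addr_ge0.
have := isotropic_constant_volume lcQ sqQ _ V Qc.
rewrite divr_ge0 ?exprn_ge0 ?(ltW Z0)// => /(_ isT).
by rewrite mulrAC -exprMn ler_pdivlMr// mul1r.
Qed.

End near_coordinate_marginal.

(** * Weak decay from the marginal hypothesis *)

Section decay.
Variable R : realType.

Definition marginal_property (K n : nat) (alpha C : R) :=
  forall mu : probability (borel R n) R, isotropic_log_concave mu ->
  forall eps : R, 0 < eps < 1 ->
  forall E : {vspace 'rV[R]_n}, grassmannian K E ->
  exists F : {vspace 'rV[R]_n},
    [/\ grassmannian K F, grass_dist E F < eps &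
        isotropic_constant (marginal F mu) < C / eps `^ alpha].

Lemma marginal_law n (F : {vspace 'rV[R]_n}) (mu : probability (borel R n) R) :
  law_of mu (fun x => x *m (frame F)^T) (marginal F mu).
Proof.
move=> h mh h0; rewrite /marginal ge0_integral_distribution//.
- by apply: eq_integral => x _ /=; rewrite proj_coordsE.
- exact/measurable_EFinP.
Qed.

Lemma marginal_lcm n (F : {vspace 'rV[R]_n}) (mu : probability (borel R n) R) : lcm mu -> lcm (marginal F mu).
Proof.
move=> lc; apply: prob_lcm; apply: (@slc_pushforward_lin _ _ _ (frame F)^T mu) => //.
  by apply: (@le_lt_trans _ _ 1%E); [exact: probability_le1|rewrite ltry].
move=> A mA; rewrite /marginal /distribution /pushforward.
by congr (mu _); apply/seteqP; split => x /=; rewrite proj_coordsE.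
Qed.

(** The hypothesis is applied with [eps = (2 a)^(-1/2)] at the coordinate space; [2 <= a] keeps
    [eps] below one. *)
Lemma decay_dim (cg : R) K l alpha C : 0 < cg ->
  (forall j, exists2 Q : probability (borel R j) R, Cm Q &
    forall w k, (0 < k)%N -> Int Q (fun x => `|dotp x w| ^+ k) <= (cg * Num.sqrt k%:R * enorm w) ^+ k) ->
  (0 < K)%N -> marginal_property K (K + l) alpha C ->
  forall (P : probability (borel R K) R) a, Cm P -> 2 <= a ->
  Zf P a <= (2 * (8 + cg) * expR 4 * Num.sqrt (pi / a) * (C / ((Num.sqrt (2 * a))^-1 `^ alpha))) ^+ K.
Proof.
case: K => // n cg0 gm _ hyp P a CP a2.
have a0 : 0 < a by exact: lt_le_trans a2.
have [G CG noise] := gm l; have [nu [Cnu nuE _]] := Cm_prod CP CG.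
have [lcG _ _] := CG; have [lcnu _ _] := Cnu.
have s2 := sqrt_ge2 a2; have s0 : 0 < Num.sqrt (2 * a) by exact: lt_le_trans s2.
have eps01 : 0 < (Num.sqrt (2 * a))^-1 < 1.
  by rewrite invr_gt0 s0 invf_lt1//; apply: (lt_le_trans _ s2); rewrite ltr1n.
have [F [dF dist iso]] := hyp nu (Cm_isotropic Cnu) _ eps01 (coord_space R (n.+1 + l) n.+1) (dim_coord_space R (leq_addr l n.+1)).
have hB y : enorm (rsubmx (y *m frame F)) <= (Num.sqrt (2 * a))^-1 * enorm (y *m frame F).
  by apply: (grass_close dF dist); exact: frame_mem.
have noise' w : Int G (fun x => `|dotp x w| ^+ n.+1) <= (cg * Num.sqrt n.+1%:R * enorm w) ^+ n.+1.
  exact: noise.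
exact: (near_coordinate_marginal a2 (ltW cg0) CP Cnu lcG noise' nuE (frame_orth F) hB (@marginal_law _ F nu) (@marginal_lcm _ F nu lcnu) iso dF).
Qed.

End decay.

Section decay_all.
Variables (R : realType) (alpha C : R) (k : nat -> nat).
Hypothesis alpha01 : 0 < alpha < 1.
Hypothesis C_gt0 : 0 < C.
Hypothesis k_lt : forall n, (2 <= n)%N -> (0 < k n < n)%N.
Hypothesis k_oo : k @ \oo --> \oo.
Hypothesis hyp : forall n, (2 <= n)%N -> marginal_property (k n) n alpha C.

(** Of the dimensions [k n] it is known only that they tend to infinity, so one of them is divided
    by [m]: the quotient counts the copies of [P] and the remainder is left for a Gaussian
    factor. *)
Lemma large_dim (N0 m : nat) : (0 < m)%N -> exists N r l,
  [/\ (N0 <= N)%N, (r < m)%N, (0 < N * m + r)%N & marginal_property (N * m + r) (N * m + r + l) alpha C].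
Proof.
move=> m0; have [M _ HM] := (cvgnyPge k).1 k_oo (N0 * m)%N.
pose n := maxn M 2; have n2 : (2 <= n)%N by rewrite leq_maxr.
have kn : (N0 * m <= k n)%N by apply: HM; rewrite /= leq_maxl.
have /andP[k0 kln] := k_lt n2.
have [N [r [rm NN E1]]] : exists N r, [/\ (r < m)%N, (N0 <= N)%N & (N * m + r)%N = k n].
  by exists (k n %/ m)%N, (k n %% m)%N; rewrite ltn_mod leq_divRL// -divn_eq.
have [l E2] : exists l, (N * m + r + l)%N = n by exists (n - k n)%N; rewrite E1 subnKC// ltnW.
exists N, r, l; split => //; first by rewrite E1.
by rewrite E2 E1; exact: hyp.
Qed.

(* The marginal hypothesis is applied to [N] independent copies of [P] and a Gaussian
   factor; the [N]-th root removes the loss as [N] grows. *)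
Lemma decay : exists2 h, 0 <= h & forall m (P : probability (borel R m) R) a, Cm P -> 2 <= a ->
  Zf P a <= expR (m%:R * (h - (1 - alpha) / 2 * ln a)).
Proof.
have [cg [cg0 gm]] := gauss_moment R.
pose M := 2 * (8 + cg) * expR 4 * Num.sqrt (2 * pi) * C.
have p0 := @pi_gt0 R; have /andP[al0 al1] := alpha01.
have M0 : 0 < M.
  by rewrite !mulr_gt0 ?expR_gt0 ?sqrtr_gt0 ?mulr_gt0// addr_gt0.
exists `|ln M| => [|m P a CP a2]; first exact: normr_ge0.
have a0 : 0 < a by exact: lt_le_trans a2.
have a20 : 0 < 2 * a by rewrite mulr_gt0.
pose B := ln M - (1 - alpha) / 2 * ln (2 * a).
have BE : 2 * (8 + cg) * expR 4 * Num.sqrt (pi / a) * (C / ((Num.sqrt (2 * a))^-1 `^ alpha)) = expR B.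
  have s0 : 0 < Num.sqrt (2 * a) by rewrite sqrtr_gt0.
  have e1 : Num.sqrt (pi / a) = Num.sqrt (2 * pi) / Num.sqrt (2 * a).
    rewrite -sqrtrV ?(ltW a20)// -sqrtrM ?mulr_ge0 ?(ltW p0)//; congr Num.sqrt; field.
    by rewrite gt_eqF.
  have e2 : ((Num.sqrt (2 * a))^-1 `^ alpha)^-1 = expR (alpha / 2 * ln (2 * a)).
    rewrite -powRN -[LHS]lnK ?posrE ?powR_gt0 ?invr_gt0// ln_powR lnV ?posrE// ln_sqrt//.
    by congr expR; field.
  have e3 : (Num.sqrt (2 * a))^-1 = expR (- 2^-1 * ln (2 * a)).
    by rewrite -[LHS]lnK ?posrE ?invr_gt0// lnV ?posrE// ln_sqrt// mulNr.
  rewrite e1 e2 e3 [RHS](_ : _ = M * (expR (- 2^-1 * ln (2 * a)) * expR (alpha / 2 * ln (2 * a)))); first by rewrite /M; ring.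
  by rewrite -[M in RHS]lnK ?posrE// -!expRD; congr expR; rewrite /B; field.
have lnle : ln a <= ln (2 * a) by rewrite ler_ln ?posrE// ler_peMl ?(ltW a0)// ler1n.
apply: (@le_trans _ _ (expR (m%:R * B))); last first.
  rewrite ler_expR ler_wpM2l// /B lerB ?ler_norm// ler_wpM2l// divr_ge0// subr_ge0 ltW//.
have [m0|m_gt0] := posnP m; first by subst m; rewrite mul0r expR0; exact: Zf_le1 (ltW a0).
have Z0 := Zf_gt0 P (ltW a0).
rewrite -[leLHS]lnK ?posrE// ler_expR leNgt; apply/negP => big.
pose del := ln (Zf P a) - m%:R * B; have d0 : 0 < del by rewrite subr_gt0.
(* Bounds the loss from the [r < m] Gaussian coordinates, uniformly in [N]; an excess [del] per copy
   overtakes it once [N] exceeds [X / del]. *)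
pose X := a * m%:R + m%:R * `|B|.
have [N [r [l [N0N rm Nr mp]]]] := large_dim (Num.trunc (X / del)).+1 m_gt0.
have [G CG _] := gm r.
have [PN CPN ZPN] := Cm_power N CP.
have [P' [CP' _ ZP']] := Cm_prod CPN CG.
have := decay_dim cg0 gm Nr mp CP' a2; rewrite BE ZP' ?(ltW a0)// ZPN ?(ltW a0)// -expRM_natl.
have GZ := Zf_lower CG (ltW a0).
have ZN0 : 0 < Zf P a ^+ N by rewrite exprn_gt0.
move=> H; have {H} := le_trans (ler_wpM2l (ltW ZN0) GZ) H.
rewrite -[Zf P a]lnK ?posrE// -expRM_natl -expRD ler_expR natrD natrM => H.
have XN : X < N%:R * del.
  rewrite -ltr_pdivrMr//; apply: (lt_le_trans (truncnS_gt _)); by rewrite ler_nat.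
have rB : r%:R * B <= m%:R * `|B|.
  apply: (@le_trans _ _ (r%:R * `|B|)); first by rewrite ler_wpM2l// ler_norm.
  by rewrite ler_wpM2r// ler_nat ltnW.
have ra : a * r%:R <= a * m%:R by rewrite ler_pM2l// ler_nat ltnW.
move: XN; rewrite /X /del mulrBr => XN.
have : N%:R * ln (Zf P a) <= N%:R * (m%:R * B) + r%:R * B + a * r%:R by lra.
lra.
Qed.

End decay_all.

(** * Volume of the centroid body *)

Opaque smooth.
Section volume_tools.
Variable R : realType.

Lemma Int_indic n (A : set 'rV[R]_n) : measurable (A : set (borel R n)) -> (leb R n A < +oo)%E ->
  ig (leb R n) (fun x => \1_A x) /\ leb R n A = (Int (leb R n) (fun x => \1_A x))%:E.
Proof.
move=> mA fA.
have fin : leb R n A \is a fin_num by rewrite ge0_fin_numE.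
have [i1 I1] : ig (leb R n) (fun x => \1_A x) /\ Int (leb R n) (fun x => \1_A x) = fine (leb R n A).
  apply: Int_eqE.
  - exact: (@measurable_indic _ (borel R n) R setT A mA).
  - by move=> x; rewrite indicE.
  by rewrite (@integral_indic _ (borel R n) R (leb R n) setT _ A)// setIT fineK.
by split => //; rewrite I1 fineK.
Qed.

Lemma neg_half n : expR (- 2 * n.+1%:R) * 2 ^+ n.+1 <= 2^-1 :> R.
Proof.
have e4 : 4 <= expR 2 :> R.
  have -> : 2 = 1 + 1 :> R by []. rewrite expRD.
  have h := expR_ge1Dx (1 : R); have : 2 * 2 <= expR 1 * expR 1 :> R by apply: ler_pM => //; lra.
  lra.
rewrite (_ : - 2 * n.+1%:R = n.+1%:R * - 2 :> R); last by ring.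
rewrite expRM_natl -exprMn expRN.
have h0 : 0 <= (expR 2)^-1 * 2 :> R by rewrite mulr_ge0 ?invr_ge0 ?expR_ge0.
have h1 : (expR 2)^-1 * 2 <= 2^-1 :> R by rewrite ler_pdivrMl ?expR_gt0//; lra.
have h2 : ((expR 2)^-1 * 2) ^+ n <= 1 :> R by apply: exprn_ile1 => //; lra.
rewrite exprS; apply: le_trans (ler_wpM2l h0 h2) _; lra.
Qed.

(** Half of the Gaussian exponent absorbs the power, because [t e^(-t^2/4) <= 1]. *)
Lemma gauss_power n (u v : 'rV[R]_n.+1) :
  expR (- (n.+1%:R / 2) * dotp u u) * `|dotp u v| ^+ n.+1 <= enorm v ^+ n.+1 * expR (- (n.+1%:R / 4) * dotp u u).
Proof.
have -> : expR (- (n.+1%:R / 2) * dotp u u) = expR (- (n.+1%:R / 4) * dotp u u) * expR (- (dotp u u / 4)) ^+ n.+1.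
  by rewrite -expRM_natl -expRD; congr expR; field.
rewrite -mulrA mulrC -exprMn ler_wpM2r ?expR_ge0//.
apply: lerXn2r; rewrite ?nnegrE ?mulr_ge0 ?expR_ge0 ?enorm_ge0//.
apply: le_trans (ler_wpM2l (expR_ge0 _) (CSe u v)) _.
rewrite mulrA ler_piMl ?enorm_ge0// expRN ler_pdivrMl ?expR_gt0// mulr1 -enorm2.
have := expR_ge1Dx (enorm u ^+ 2 / 4); have := sqr_ge0 (enorm u / 2 - 1); lra.
Qed.

Lemma square_decay (p q r e : R) : 0 < p -> 0 < r -> 0 <= e -> p <= q * e ^+ 2 -> p * q <= r ^+ 2 -> p <= e * r.
Proof.
move=> p0 r0 e0 h m; have er : 0 <= e * r by rewrite mulr_ge0// ltW.
rewrite -(@ler_pXn2r _ 2)// ?nnegrE ?(ltW p0)//.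
apply: (@le_trans _ _ (e ^+ 2 * (p * q))).
  by rewrite expr2 mulrCA ler_wpM2l ?(ltW p0)// mulrC.
by rewrite exprMn ler_wpM2l ?sqr_ge0.
Qed.

Lemma mass_arith (u e p q I : R) : 0 <= u -> e * p <= 2^-1 -> u <= q * I + e * (p * u) -> u <= 2 * q * I.
Proof. by move=> u0 /(ler_wpM2r u0) h; rewrite mulrA; lra. Qed.

Lemma moment_arith (p h e q S I J : R) : 0 <= p -> 0 <= h -> 0 <= e -> 0 <= q ->
  S <= 2 * q * J -> J <= 2 * I -> p * h * e * (S / 4) <= p * (q * e) * (h * I).
Proof.
move=> p0 h0 e0 q0 SJ JI; have -> : p * (q * e) * (h * I) = p * h * e * (q * I) by ring.
rewrite ler_wpM2l ?mulr_ge0//.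
by have := ler_wpM2l q0 JI; lra.
Qed.

Lemma leb_fin_sub n (A B : set 'rV[R]_n) : measurable (A : set (borel R n)) -> measurable (B : set (borel R n)) ->
  A `<=` B -> (leb R n B < +oo)%E -> (leb R n A < +oo)%E.
Proof. by move=> mA mB AB; apply: le_lt_trans; apply: le_measure; rewrite ?inE. Qed.

Lemma pow_le_norm k (s u : R) : 0 <= s -> s <= u -> s ^+ k <= `|u| ^+ k.
Proof. by move=> s0 su; apply: lerXn2r; rewrite ?nnegrE// (le_trans su)// ler_norm. Qed.

End volume_tools.

Section lower_volume.
Variables (R : realType) (n : nat) (Q : probability (borel R n.+1) R).
Hypothesis CQ : Cm Q.
Local Notation N := (n.+1%:R : R).
Local Notation a := (n.+1%:R / 2 : R).
Local Notation g := (smooth Q a).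
Local Notation K := (level Q a).
Local Notation leb := (leb R n.+1).

Let a_gt0 : 0 < a. Proof. by rewrite divr_gt0. Qed.
Let lcQ : lcm Q. Proof. by have [] := CQ. Qed.
Let eQ : evenm Q. Proof. by have [] := CQ. Qed.
Let g_gt0 x : 0 < g x. Proof. exact: smooth_gt0. Qed.
Let g_max x : g x <= g 0.
Proof. by apply: lcf_even_max => [z||z]; [exact: ltW|exact: lcf_smooth|exact: smooth_even]. Qed.
Let mK : measurable (K : set (borel R n.+1)).
Proof. by apply: measurable_closed_rV; exact: closed_level. Qed.
Let Kfin : (leb K < +oo)%E.
Proof. by apply: (le_lt_trans (leb_level Q a_gt0)); rewrite ltry. Qed.

(** Off the level set [g x <= e^(-4N) g 0], and the midpoint inequality converts this into
    [g x <= e^(-2N) g(x/2)]. *)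
Let gK x : g x <= g 0 * \1_K x + expR (- 2 * N) * g (2^-1 *: x).
Proof.
rewrite indicE; have [Kx|nKx] := pselect (K x).
  rewrite mem_set// mulr1; apply: ler_wpDr; last exact: g_max.
  by apply: mulr_ge0; [exact: expR_ge0|exact: ltW (g_gt0 _)].
rewrite memNset// mulr0 add0r.
have {nKx}h : g x <= g 0 * expR (- 4 * N) by rewrite leNgt; apply/negP => h; apply: nKx; exact: ltW.
have m := lcf_mid x 0 (fun z => ltW (g_gt0 z)) (lcf_smooth a_gt0 lcQ); rewrite addr0 in m.
have e : expR (- 4 * N) = expR (- 2 * N) ^+ 2 by rewrite -expRM_natl; congr expR; ring.
rewrite e in h; exact: square_decay (g_gt0 x) (g_gt0 _) (expR_ge0 _) h m.
Qed.

(** In [gK] the outer part integrates to [e^(-2N) 2^N <= 1/2] of the total, so at least half of the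
    mass sits on the level set, where the density is at most [g 0]. *)
Lemma level_mass : Num.sqrt (pi / a) ^+ n.+1 <= 2 * g 0 * Int leb (fun x => \1_K x).
Proof.
have [iS IS] := Int_smooth Q a_gt0.
have [iK _] := Int_indic mK Kfin.
have [ih Ih] := Int_half (fun z => ltW (g_gt0 z)) iS.
have iK' := igZ (g 0) iK; have ih' := igZ (expR (- 2 * N)) ih.
have h := Int_le iS (igD iK' ih') gK.
have E := etrans (IntD iK' ih') (congr2 +%R (IntZ (g 0) iK) (etrans (IntZ (expR (- 2 * N)) ih) (congr1 ( *%R _) Ih))).
have h' := eq_ind _ (fun r => Int leb g <= r) h _ E.
rewrite -IS; exact: mass_arith (Int_ge0 leb (fun x => ltW (g_gt0 x))) (neg_half R n) h'.
Qed.

Lemma level_half (y : 'rV[R]_n.+1) :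
  (leb K <= leb (K `&` [set z | (0 <= dotp z y)%R]) + leb (K `&` [set z | (0 <= dotp z y)%R]))%E.
Proof.
set A : set (borel R n.+1) := K `&` [set z | 0 <= dotp z y].
have mA : measurable A.
  apply: measurableI => //; apply: measurable_set_le => //; exact: measurable_dotp.
have u1 : (-1)%:M \in @unitmx R n.+1 by rewrite unitmxE det_scalar unitrX// unitrN unitr1.
have [mN E] := leb_affine 0 u1 mA.
have {}E : leb [set 0 + u *m (-1)%:M | u in A] = leb A.
  by rewrite E det_scalar normrX normrN normr1 expr1n mul1e.
rewrite -[X in (_ <= _ + X)%E]E.
apply: le_trans (measureU2 leb mA mN); apply: le_measure; rewrite ?inE//; first exact: measurableU.
move=> z Kz; have [h|h] := leP 0 (dotp z y); first by left.
right; exists (- z); last by rewrite add0r mul_mx_scalar scaleN1r opprK.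
split; last by rewrite /= dotpNl oppr_ge0 ltW.
by rewrite /level /= smooth_even.
Qed.

(* The half of the level set on the side of [y], shrunk towards [x0], has enough mass. *)
Lemma level_moment (x0 y : 'rV[R]_n.+1) : K x0 -> 0 < dotp x0 y ->
  ig leb (fun x => g x * `|dotp x y| ^+ n.+1) ->
  (dotp x0 y / 4) ^+ n.+1 * expR (- 4 * N) * (Num.sqrt (pi / a) ^+ n.+1 / 4) <=
  Int leb (fun x => g x * `|dotp x y| ^+ n.+1).
Proof.
move=> Kx0 t0 ik; set t := dotp x0 y in t0 *.
pose A : set (borel R n.+1) := K `&` [set z | 0 <= dotp z y].
have mA : measurable A.
  apply: measurableI => //; apply: measurable_set_le => //; exact: measurable_dotp.
have u2 : (2^-1)%:M \in @unitmx R n.+1 by rewrite unitmxE det_scalar unitrX// unitfE invr_eq0.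
have [mB EB] := leb_affine (2^-1 *: x0) u2 mA.
move: mB EB; set B := [set _ | _ in A] => mB EB.
have Bin x : B x -> K x /\ t / 2 <= dotp x y.
  move=> [z [Kz zy] <-]; rewrite mul_mx_scalar; split.
    have l01 : 0 < (2^-1 : R) < 1 by rewrite invr_gt0 invf_lt1// ltr0n ltr1n.
    have := convexs_level a_gt0 lcQ Kx0 Kz l01.
    by rewrite (_ : 1 - 2^-1 = 2^-1)//; field.
  rewrite dotpDl !dotpZl -/t mulrC lerDl mulr_ge0// invr_ge0//.
have Bfin : (leb B < +oo)%E.
  exact: leb_fin_sub mB mK (fun x Bx => (Bin x Bx).1) Kfin.
have [iB LB] := Int_indic mB Bfin; have [iK LK] := Int_indic mK Kfin.
have Afin : (leb A < +oo)%E.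
  exact: leb_fin_sub mA mK (@subIsetl _ _ _) Kfin.
have [iA LA] := Int_indic mA Afin.
have KA : Int leb (fun x => \1_K x) <= 2 * Int leb (fun x => \1_A x).
  have := level_half y; rewrite -/A LA LK -EFinD lee_fin; lra.
have BA : Int leb (fun x => \1_B x) = 2^-1 ^+ n.+1 * Int leb (fun x => \1_A x).
  by apply: EFin_inj; rewrite -LB EFinM -LA EB det_scalar normrX ger0_norm ?invr_ge0.
pose c := (t / 2) ^+ n.+1 * (g 0 * expR (- 4 * N)).
have t2 : 0 <= t / 2 by rewrite divr_ge0// ltW.
have c0 : 0 <= c := mulr_ge0 (exprn_ge0 _ t2) (mulr_ge0 (ltW (g_gt0 0)) (expR_ge0 _)).
have := Int_le (igZ c iB) ik; rewrite (IntZ c iB) => h.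
have {h} : c * Int leb (fun x => \1_B x) <= Int leb (fun x => g x * `|dotp x y| ^+ n.+1).
  apply: h => x; rewrite indicE; have [Bx|nBx] := pselect (B x); last first.
    rewrite memNset// mulr0; exact: mulr_ge0 (ltW (g_gt0 x)) (exprn_ge0 _ (normr_ge0 _)).
  rewrite mem_set// mulr1 /c mulrC; have [Kx tx] := Bin x Bx.
  apply: (ler_pM (mulr_ge0 (ltW (g_gt0 0)) (expR_ge0 _)) (exprn_ge0 _ t2) Kx).
  exact: pow_le_norm t2 tx.
apply: le_trans; rewrite BA /c.
have M := level_mass; have I0 : 0 <= Int leb (fun x => \1_A x) by apply: Int_ge0 => x; rewrite indicE.
have e : (t / 4) ^+ n.+1 = (t / 2) ^+ n.+1 * 2^-1 ^+ n.+1 by rewrite -exprMn; congr (_ ^+ _); field.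
have t40 : 0 <= t / 4 by rewrite divr_ge0// ltW.
move: M KA; rewrite e.
exact: (moment_arith (exprn_ge0 _ t2) (exprn_ge0 _ _) (expR_ge0 _) (ltW (g_gt0 0))).
Qed.

(** At [a = N / 2] the noise has standard deviation about [N^(-1/2)] in each direction, so its
    moment of order [N] in direction [y] is at most [(2 |y|)^N]: smoothing at this scale costs only
    a constant factor per dimension. *)
Lemma smooth_moment_upper (y : 'rV[R]_n.+1) :
  ig leb (fun x => g x * `|dotp x y| ^+ n.+1) /\
  Int leb (fun x => g x * `|dotp x y| ^+ n.+1) <=
    2 ^+ n.+1 * (mom Q y + (2 * enorm y) ^+ n.+1) * Num.sqrt (pi / a) ^+ n.+1.
Proof.
pose G := Num.sqrt (pi / a) ^+ n.+1.
have mabs : measurable_fun setT (fun x : borel R n.+1 => `|dotp x y| ^+ n.+1).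
  by apply: measurable_funX; apply: measurableT_comp; [exact: normr_measurable|exact: measurable_dotp].
pose b := (2 * enorm y) ^+ n.+1.
have b0 : 0 <= b by rewrite exprn_ge0// mulr_ge0// enorm_ge0.
have G0 : 0 <= G by rewrite exprn_ge0 ?sqrtr_ge0.
have iQ := ig_pow lcQ y n.+1.
have i2 : ig Q (fun z => (2 ^+ n.+1 * G) * (`|dotp z y| ^+ n.+1 + b)) by apply: igZ; apply: igD => //; exact: ig_cst.
have I2 : Int Q (fun z => (2 ^+ n.+1 * G) * (`|dotp z y| ^+ n.+1 + b)) = 2 ^+ n.+1 * (mom Q y + b) * G.
  rewrite (IntZ _ (igD iQ (ig_cst Q b))) (IntD iQ (ig_cst Q b)) Int_cst -/(mom Q y); ring.
have [ia Ia] := ig_gauss n.+1 a_gt0.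
have a4 : 0 < N / 4 by rewrite divr_gt0.
have [i4 I4] := ig_gauss n.+1 a4.
have inner z : (\int[leb]_x (expR (- a * dotp (z - x) (z - x)) * `|dotp x y| ^+ n.+1)%:E <=
    ((2 ^+ n.+1 * G) * (`|dotp z y| ^+ n.+1 + b))%:E)%E.
  pose h (u : 'rV[R]_n.+1) := expR (- a * dotp u u) * `|dotp (u + z) y| ^+ n.+1.
  have mh : measurable_fun setT (h : borel R n.+1 -> R).
    apply: measurable_funM; first exact: measurable_expN.
    apply: measurable_funX; apply: measurableT_comp; first exact: normr_measurable.
    exact: (measurableT_comp (measurable_dotp y) (measurable_add z)).
  have h0 u : 0 <= h u by rewrite mulr_ge0 ?expR_ge0 ?exprn_ge0.
  have -> : (\int[leb]_x (expR (- a * dotp (z - x) (z - x)) * `|dotp x y| ^+ n.+1)%:E = \int[leb]_x (h x)%:E)%E.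
    rewrite -(ge0_integral_translation (- z) (f := fun x => (h x)%:E)).
    - by apply: eq_integral => x _; rewrite /h subrK -[z - x]opprB dotpNl dotpNr opprK.
    - exact/measurable_EFinP.
    - by move=> u; rewrite lee_fin.
  have ib : ig leb (fun u => 2 ^+ n.+1 * (`|dotp z y| ^+ n.+1 * expR (- a * dotp u u) + enorm y ^+ n.+1 * expR (- (N / 4) * dotp u u))).
    by apply: igZ; apply: igD; exact: igZ.
  have hb u : h u <= 2 ^+ n.+1 * (`|dotp z y| ^+ n.+1 * expR (- a * dotp u u) + enorm y ^+ n.+1 * expR (- (N / 4) * dotp u u)).
    rewrite /h dotpDl; apply: le_trans (ler_wpM2l (expR_ge0 _) (pow_add n.+1 _ _)) _.
    rewrite mulrCA; apply: ler_wpM2l; first exact: exprn_ge0.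
    rewrite mulrDr addrC; apply: lerD; [by rewrite mulrC|exact: gauss_power].
  have ih : ig leb h by apply: (ig_le0 _ _ ib) => // u; rewrite h0 hb.
  rewrite (IntE ih) lee_fin; apply: (le_trans (Int_le ih ib hb)).
  rewrite (IntZ _ (igD (igZ _ ia) (igZ _ i4))) (IntD (igZ _ ia) (igZ _ i4)) (IntZ _ ia) (IntZ _ i4) Ia I4 -/G.
  have -> : Num.sqrt (pi / (N / 4)) ^+ n.+1 = Num.sqrt 2 ^+ n.+1 * G.
    rewrite -exprMn -sqrtrM//; congr (Num.sqrt _ ^+ _); field.
    by rewrite nat1r pnatr_eq0.
  rewrite -mulrA; apply: ler_wpM2l; first exact: exprn_ge0.
  rewrite mulrDr; apply: lerD; first by rewrite mulrC.
  rewrite [leRHS]mulrC mulrA; apply: ler_wpM2r => //.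
  rewrite -exprMn /b; apply: lerXn2r; rewrite ?nnegrE ?mulr_ge0 ?sqrtr_ge0 ?enorm_ge0//.
  rewrite mulrC; apply: ler_wpM2r; first exact: enorm_ge0.
  have e : Num.sqrt (2 ^+ 2) = 2 :> R by rewrite sqrtr_sqr ger0_norm.
  by rewrite -[leRHS]e ler_sqrt; lra.
have fin : (\int[leb]_x (g x * `|dotp x y| ^+ n.+1)%:E <= (2 ^+ n.+1 * (mom Q y + b) * G)%:E)%E.
  rewrite smooth_tonelli// -I2 -(IntE i2).
  apply: ge0_le_integral => //.
  - by move=> z _; apply: integral_ge0 => x _; rewrite lee_fin mulr_ge0 ?expR_ge0 ?exprn_ge0.
  - apply: (@measurable_fun_fubini_tonelli_F _ _ _ _ _ leb _ (measurable_gauss_kernel a mabs)).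
    by move=> z; rewrite lee_fin mulr_ge0 ?expR_ge0 ?exprn_ge0.
  - by apply/measurable_EFinP; exact: ig_measurable i2.
have ig1 : ig leb (fun x => g x * `|dotp x y| ^+ n.+1).
  apply: ig_ge0.
  - apply: measurable_funM; [exact: measurable_smooth|exact: mabs].
  - move=> x; exact: mulr_ge0 (ltW (g_gt0 x)) (exprn_ge0 _ (normr_ge0 _)).
  by apply: (le_lt_trans fin); rewrite ltry.
by split => //; rewrite -lee_fin -(IntE ig1).
Qed.

End lower_volume.

(** * From Gaussian decay to the isotropic constant *)

Section conclusion.
Variable R : realType.

(** [e^(-4)] is the height of the level set; 16 comes from the shrinking factor 4 in [level_moment]
    and from its prefactor 1/4; 8 collects [2^(n+1)] from splitting off the noise and
    [2^(n+2) <= 4^(n+1)] from symmetrisation; [1 + 2 / mom_const] compares the noise with the moment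
    itself. *)
Definition support_const : R := expR (- 4) / 16 / (8 * (1 + 2 / mom_const R)).

Lemma support_const_gt0 : 0 < support_const.
Proof.
have c0 := mom_const_gt0 R; rewrite !divr_gt0 ?expR_gt0//.
by rewrite mulr_gt0// addr_gt0// divr_gt0.
Qed.

Lemma support_arith n (t w MQ Mm : R) : 0 <= t -> 0 <= w -> 0 <= Mm ->
  (t / 4) ^+ n.+1 * expR (- 4 * n.+1%:R) / 4 <= 2 ^+ n.+1 * (MQ + (2 * w) ^+ n.+1) ->
  (mom_const R * w) ^+ n.+1 <= MQ -> MQ <= 2 ^+ n.+2 * Mm ->
  (support_const * t) ^+ n.+1 <= Mm.
Proof.
move=> t0 w0 M0 h1 h2 h3; have c0 := mom_const_gt0 R.
pose q := 2 / mom_const R; have q0 : 0 < q by rewrite divr_gt0.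
have MQ0 : 0 <= MQ by apply: le_trans h2; rewrite exprn_ge0// mulr_ge0// ltW.
have h4 : (2 * w) ^+ n.+1 <= q ^+ n.+1 * MQ.
  have -> : 2 * w = q * (mom_const R * w) by rewrite /q; field; rewrite gt_eqF.
  by rewrite exprMn ler_wpM2l// exprn_ge0// ltW.
have h5 : MQ + (2 * w) ^+ n.+1 <= (1 + q) ^+ n.+1 * MQ.
  have := exprD_le n (@ler01 R) (ltW q0); rewrite expr1n => /(ler_wpM2r MQ0); lra.
have h6 : 2 ^+ n.+2 <= 4 ^+ n.+1 :> R.
  rewrite exprS (_ : 4 = 2 * 2 :> R); last by ring.
  by rewrite [leRHS]exprMn ler_wpM2r ?exprn_ge0// exprS ler_peMr// exprn_ege1// ler1n.
pose D := 8 * (1 + q); have D0 : 0 < D by rewrite mulr_gt0// addr_gt0.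
have h7 : 2 ^+ n.+1 * (MQ + (2 * w) ^+ n.+1) <= D ^+ n.+1 * Mm.
  have p2 : 0 <= 2 ^+ n.+1 :> R by rewrite exprn_ge0.
  have q1 : 0 <= (1 + q) ^+ n.+1 by rewrite exprn_ge0// addr_ge0// ltW.
  apply: (le_trans (ler_wpM2l p2 h5)).
  apply: (@le_trans _ _ (2 ^+ n.+1 * ((1 + q) ^+ n.+1 * (4 ^+ n.+1 * Mm)))).
    apply: (ler_wpM2l p2); apply: (ler_wpM2l q1).
    exact: le_trans h3 (ler_wpM2r M0 h6).
  rewrite !mulrA -!exprMn (_ : 2 * (1 + q) * 4 = D)//; rewrite /D; ring.
have -> : support_const * t = (t * expR (- 4) / 16) / D by rewrite /support_const -/q -/D; field; rewrite gt_eqF.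
rewrite [leLHS]expr_div_n ler_pdivrMr ?exprn_gt0// [leRHS]mulrC; apply: le_trans h7; apply: le_trans h1.
have -> : t * expR (- 4) / 16 = (t / 4 * expR (- 4)) * 4^-1 by field.
rewrite exprMn [X in X * _ <= _]exprMn (_ : - 4 * n.+1%:R = n.+1%:R * - 4 :> R); last by ring.
rewrite expRM_natl ler_wpM2l//; last by rewrite exprS ler_piMr ?invr_ge0// exprn_ile1 ?invr_ge0// invf_le1// ler1n.
by rewrite mulr_ge0 ?exprn_ge0 ?expR_ge0// divr_ge0.
Qed.

(** Support functions are compared: a point of the level set far in direction [y] forces a large
    moment of the smoothed density, hence of [Q], hence of [mu]. *)
Lemma level_sub_cbody n (mu Q : probability (borel R n.+1) R) : lcm mu -> Cm Q ->
  (forall v q, Int Q (fun x => `|dotp x v| ^+ q) <= 2 ^+ q.+1 * Int mu (fun x => `|dotp x v| ^+ q)) ->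
  forall x, level Q (n.+1%:R / 2) x -> cbody mu (support_const *: x).
Proof.
move=> lcmu CQ Qmu x Kx y; have [lcQ _ sqQ] := CQ.
have c0 := support_const_gt0; rewrite dotpZl.
have [t0|t0] := leP (dotp x y) 0.
  by apply: (@le_trans _ _ 0); [rewrite mulr_ge0_le0// ltW|exact: hcb_ge0].
apply: le_root; [by rewrite mulr_ge0 ?(ltW c0)// ltW|exact: mom_ge0|].
have [ik up] := smooth_moment_upper CQ y.
have lo := le_trans (level_moment CQ Kx t0 ik) up.
have G0 : 0 < Num.sqrt (pi / (n.+1%:R / 2)) ^+ n.+1 :> R.
  by rewrite exprn_gt0// sqrtr_gt0 divr_gt0 ?pi_gt0// divr_gt0.
apply: (support_arith (ltW t0) (enorm_ge0 y) (mom_ge0 mu y) _ (mom_lower y lcQ sqQ) (Qmu y n.+1)).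
rewrite -(ler_pM2r G0); apply: (le_trans _ lo).
by rewrite le_eqVlt; apply/orP; left; apply/eqP; ring.
Qed.

Definition volume_const (L : R) : R := support_const * (Num.sqrt (2 * pi) * expR (- L) / 2).

Lemma volume_const_gt0 L : 0 < volume_const L.
Proof.
by rewrite mulr_gt0 ?support_const_gt0// divr_gt0// mulr_gt0 ?expR_gt0// sqrtr_gt0 mulr_gt0// pi_gt0.
Qed.

(** With [a = (n + 1) / 2] both the total mass and the bound on [Zf] carry the factor
    [(n + 1)^(-1/2)] per dimension; it cancels, leaving a lower bound that is a pure power. *)
Lemma level_lower n (Q : probability (borel R n.+1) R) (L : R) : Cm Q ->
  Zf Q (n.+1%:R / 2) <= expR (n.+1%:R * (L - 2^-1 * ln (2 * (n.+1%:R / 2)))) ->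
  (Num.sqrt (2 * pi) * expR (- L) / 2) ^+ n.+1 <= Int (leb R n.+1) (fun x => \1_(level Q (n.+1%:R / 2)) x).
Proof.
move=> CQ hL; have := level_mass CQ; set I := Int _ _.
have N0 : 0 < n.+1%:R :> R by [].
have e2 : 2 * (n.+1%:R / 2) = n.+1%:R :> R by field.
rewrite e2 in hL.
rewrite smooth0 => h.
have I0 : 0 <= I by apply: Int_ge0 => x; rewrite indicE.
pose r := expR (- 2^-1 * ln n.+1%:R) : R; have r0 : 0 < r by exact: expR_gt0.
have Gr : Num.sqrt (pi / (n.+1%:R / 2)) = Num.sqrt (2 * pi) * r :> R.
  have -> : r = Num.sqrt (n.+1%:R^-1).
    by rewrite -[RHS]lnK ?posrE ?sqrtr_gt0 ?invr_gt0// ln_sqrt ?invr_gt0// lnV ?posrE// mulrN /r mulNr.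
  rewrite -sqrtrM ?mulr_ge0 ?pi_ge0//; congr Num.sqrt; field.
  by rewrite nat1r pnatr_eq0.
have Zr : expR (n.+1%:R * (L - 2^-1 * ln n.+1%:R)) = (expR L * r) ^+ n.+1.
  by rewrite expRM_natl /r -expRD mulNr.
rewrite Zr in hL; rewrite Gr in h.
have h' : (Num.sqrt (2 * pi) * r) ^+ n.+1 <= 2 * (expR L * r) ^+ n.+1 * I.
  by apply: (le_trans h); rewrite ler_wpM2r// ler_wpM2l.
rewrite !exprMn in h'.
have rn : 0 < r ^+ n.+1 by rewrite exprn_gt0.
have {}h' : Num.sqrt (2 * pi) ^+ n.+1 <= 2 * expR L ^+ n.+1 * I.
  by rewrite -(ler_pM2r rn); apply: (le_trans h'); rewrite le_eqVlt; apply/orP; left; apply/eqP; ring.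
rewrite expRN [leLHS]expr_div_n expr_div_n ler_pdivrMr ?exprn_gt0// ler_pdivrMr ?exprn_gt0 ?expR_gt0//.
apply: (le_trans h').
have : 2 <= 2 ^+ n.+1 :> R by rewrite exprS ler_peMr// exprn_ege1// ler1n.
have p0 : 0 <= expR L ^+ n.+1 * I by rewrite mulr_ge0 ?exprn_ge0 ?expR_ge0.
move=> /(ler_wpM2r p0); rewrite mulrA => /le_trans; apply.
by rewrite le_eqVlt; apply/orP; left; apply/eqP; ring.
Qed.

Lemma isotropic_constant_le n (mu : probability (borel R n.+1) R) (L : R) : isotropic_log_concave mu ->
  (forall Q : probability (borel R n.+1) R, Cm Q ->
    Zf Q (n.+1%:R / 2) <= expR (n.+1%:R * (L - 2^-1 * ln (2 * (n.+1%:R / 2))))) ->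
  isotropic_constant mu <= (volume_const L)^-1.
Proof.
move=> iso hL; have [Q CQ Qmu] := symmetrization iso.
have lcmu : lcm mu by apply: prob_lcm; case: iso.
have c0 := support_const_gt0; have V0 := volume_const_gt0 L.
have [lcQ _ _] := CQ.
have a0 : 0 < n.+1%:R / 2 :> R by rewrite divr_gt0.
have mK : measurable (level Q (n.+1%:R / 2) : set (borel R n.+1)).
  by apply: measurable_closed_rV; exact: closed_level.
have Kf : (leb R n.+1 (level Q (n.+1%:R / 2)) < +oo)%E.
  by apply: (le_lt_trans (leb_level Q a0)); rewrite ltry.
have [_ LK] := Int_indic mK Kf.
have uc : support_const%:M \in @unitmx R n.+1 by rewrite unitmxE det_scalar unitrX// unitfE gt_eqF.
have [mI E] := leb_affine 0 uc mK.
have cC : compact (cbody mu) by exact: compact_cbody.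
have Cf : leb R n.+1 (cbody mu) \is a fin_num by rewrite ge0_fin_numE// (lcm_leb R n.+1).2.
have low : volume_const L ^+ n.+1 <= fine (leb R n.+1 (cbody mu)).
  rewrite -lee_fin fineK//.
  apply: (@le_trans _ _ (leb R n.+1 [set 0 + u *m support_const%:M | u in level Q (n.+1%:R / 2)])); last first.
    apply: le_measure; rewrite ?inE//; first exact: measurable_compact_rV.
    by move=> _ [u Ku <-]; rewrite add0r mul_mx_scalar; exact: (level_sub_cbody lcmu CQ Qmu).
  rewrite E LK det_scalar normrX gtr0_norm// -EFinM lee_fin /volume_const exprMn ler_wpM2l//.
    by rewrite exprn_ge0// ltW.
  exact: level_lower (hL Q CQ).
rewrite isotropic_constantE// powRN lef_pV2 ?posrE//.
  by apply: le_root => //; [exact: ltW|exact: le_trans (exprn_ge0 _ (ltW V0)) low].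
by rewrite powR_gt0// (lt_le_trans _ low)// exprn_gt0.
Qed.

End conclusion.

Theorem proposition4p1 (R : realType) :
  (exists (alpha C : R) (k : nat -> nat),
    [/\ 0 < alpha < 1,
        0 < C,
        (forall n, (2 <= n)%N -> (0 < k n < n)%N),
        k @ \oo --> \oo &
        forall n, (2 <= n)%N ->
        forall mu : probability (borel R n) R, isotropic_log_concave mu ->
        forall eps : R, 0 < eps < 1 ->
        forall E : {vspace 'rV[R]_n}, grassmannian (k n) E ->
        exists F : {vspace 'rV[R]_n},
          [/\ grassmannian (k n) F,
              grass_dist E F < eps &
              isotropic_constant (marginal F mu) < C / eps `^ alpha]]) ->
  exists C' : R,
    0 < C' /\
    forall n, (1 <= n)%N ->
    forall mu : probability (borel R n) R, isotropic_log_concave mu ->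
      isotropic_constant mu < C'.
Proof.
move=> [alpha [C [k [al01 C0 kl koo hyp]]]].
have [h h0 dec] := decay al01 C0 kl koo hyp.
have /andP[al0 al1] := al01.
have b01 : 0 < 1 - alpha <= 1 by rewrite subr_gt0 al1 gerBl ltW.
pose L := descent_level (1 - alpha) h.
(* The factor 2 makes the final inequality strict. *)
have V0 := volume_const_gt0 L; exists (2 * (volume_const L)^-1); split; first by rewrite mulr_gt0// invr_gt0.
case=> // n _ mu iso; apply: (@le_lt_trans _ _ (volume_const L)^-1).
  (* The parameter is half the dimension, so dimension one requires the decay from [a = 1/2] on, the
     starting point of [descent]. *)
  apply: isotropic_constant_le iso _ => Q CQ; apply: (descent b01 h0 dec CQ).
  by rewrite ler_pdivlMr// mulVf// ler1n.
by rewrite ltr_pMl ?invr_gt0// ltr1n.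
Qed.
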